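(* Let $F$ be an $\mathcal F_T$-measurable real random variable such that $E[e^{p'F^+}]<\infty$ for every $p'\ge1$ and $F^-\le k$ for some constant $k>0$, and let the portfolio constraint set be a closed convex cone $\mathcal C^c\subset\mathbb R^d$ with $0\in\mathcal C^c$. Suppose moreover that the constrained BSDE $$C_t^\infty(F)=F+\int_t^TdA_u^\infty(F)-\int_t^T(H_u^\infty(F))^{tr}\theta_udu-\int_t^T(H_u^\infty(F))^{tr}dB_u,\quad t\in[0,T],$$ $$\text{subject to } H_u^\infty(F)\in\sigma_u^{tr}\mathcal C^c\ \text{ for a.e. }u\in[0,T],$$ admits at least one solution $(\overline C^\infty(F),\overline H^\infty(F),\overline A^\infty(F))\in\mathcal S^2\times M^2\times\mathcal S^2$ with $\overline A^\infty(F)$ an increasing process. Then the utility indifference prices satisfy $$\lim_{\alpha\to\infty}C_0^\alpha(F)=C_0^\infty(F),$$ where $(C^\infty(F),H^\infty(F),A^\infty(F))$ is the minimal solution of this constrained BSDE, i.e. for every solution $(\overline C^\infty(F),\overline H^\infty(F),\overline A^\infty(F))$ one has $C_t^\infty(F)\le\overline C_t^\infty(F)$, $\mathbb P$-a.s., for $t\in[0,T]$.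
   Context: Fix $T>0$ and integers $1\le d\le m$. $B$ is a standard $m$-dimensional Brownian motion on a complete probability space $(\Omega,\mathcal F,\mathbb P)$ with augmented natural filtration $(\mathcal F_t)$; predictability is with respect to this filtration, $E$ is expectation under $\mathbb P$, and $A^{tr}$ is the transpose of $A$. The processes $b$ ($\mathbb R^d$-valued) and $\sigma$ ($\mathbb R^{d\times m}$-valued) are predictable and bounded, $\sigma_t\sigma_t^{tr}$ is invertible, and $\theta_t=\sigma_t^{tr}(\sigma_t\sigma_t^{tr})^{-1}b_t$ is bounded. $\mathrm{dist}_K$ is the Euclidean distance to $K\subset\mathbb R^m$; $\sigma_t^{tr}\mathcal C^c=\{\sigma_t^{tr}\pi:\pi\in\mathcal C^c\}$. $y^+=\max\{y,0\}$, $y^-=\max\{-y,0\}$. $\mathcal S^2$ is the space of real adapted càdlàg processes with $E[\sup_{t\le T}|Y_t|^2]<\infty$; $M^2$ is the space of $\mathbb R^m$-valued predictable processes with $E[\int_0^T|Z_s|^2ds]<\infty$. For each risk aversion parameter $\alpha>0$ put, for $(t,z)\in[0,T]\times\mathbb R^m$, $$f^\alpha(t,z)=\frac{\alpha}{2}\mathrm{dist}^2_{\sigma_t^{tr}\mathcal C^c}\left(z+\frac1\alpha\theta_t\right)-z^{tr}\theta_t-\frac1{2\alpha}|\theta_t|^2 .$$ For $G\in\{F,0\}$, $(Y^\alpha(G),Z^\alpha(G))$ denotes the unique solution of $Y_t=G+\int_t^Tf^\alpha(s,Z_s)ds-\int_t^TZ_s^{tr}dB_s$ (predictable, $Y$ continuous)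 such that, for every $p'\ge1$, $E[\sup_{t\le T}e^{p'\alpha Y_t^+}]<\infty$ and $E[(\int_0^T|Z_s|^2ds)^{p'/2}]<\infty$, and $Y^-$ is bounded. Utility indifference price: for $\alpha>0$, $C_0^\alpha(F)$ is the solution of $$\sup_{\pi\in\mathcal A}E\left[-e^{-\alpha(x+C_0^\alpha(F)+\int_0^T\pi_u^{tr}\sigma_u(dB_u+\theta_udu)-F)}\right]=\sup_{\pi\in\mathcal A'}E\left[-e^{-\alpha(x+\int_0^T\pi_u^{tr}\sigma_u(dB_u+\theta_udu))}\right],$$ where both $\mathcal A$ and $\mathcal A'$ consist of predictable $\mathbb R^d$-valued $\pi$ with $\int_0^T|\sigma_t^{tr}\pi_t|^2dt<\infty$ and $\pi_t\in\mathcal C^c$ a.s.; in $\mathcal A$ (the paper's $\mathcal A_D^{cone}$) one requires that $\{e^{-\alpha(X_\tau^\pi-Y_\tau^\alpha(F))}:\tau\text{ stopping time}\le T\}$ is uniformly integrable, where $X_t^\pi$ is the wealth, and in $\mathcal A'$ that $X^\pi$ is a martingale under $\mathbb Q^\theta$, $d\mathbb Q^\theta/d\mathbb P=\mathcal E_T(-\int_0^\cdot\theta_t^{tr}dB_t)$. Equivalently, $C_0^\alpha(F)=Y_0^\alpha(F)-Y_0^\alpha(0)$. *)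

(* Defs.v *)
From HB Require Import structures.
From mathcomp Require Import all_boot all_order all_algebra.
From mathcomp Require Import all_classical all_reals all_analysis.

Set Implicit Arguments.
Unset Strict Implicit.
Unset Printing Implicit Defensive.

Import Order.TTheory GRing.Theory Num.Theory.
Import numFieldNormedType.Exports.

Local Open Scope classical_set_scope.
Local Open Scope ring_scope.

(* The library norm on matrices is the sup norm, hence [enorm]. *)

Definition vdot (R : realType) (n : nat) (u v : 'cV[R]_n) : R :=
  (u^T *m v) ord0 ord0.

Definition enorm (R : realType) (n : nat) (u : 'cV[R]_n) : R :=
  Num.sqrt (vdot u u).

Definition edistance (R : realType) (n : nat) (K : set 'cV[R]_n)
    (z : 'cV[R]_n) : R :=
  inf [set enorm (z - k) | k in K].

Definition pos_part (R : realType) (y : R) : R := Num.max y 0.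
Definition neg_part (R : realType) (y : R) : R := Num.max (- y) 0.

Definition cone (R : realType) (n : nat) (C : set 'cV[R]_n) : Prop :=
  forall (l : R) x, 0 < l -> C x -> C (l *: x).

(* A process is a function of time (of which only [0, T] matters) and of
   w : Om. A filtration is a family of sigma-algebras on Om, given as sets of
   subsets of Om. *)

Definition meas_wrt d0 (Om : measurableType d0) (R : realType)
    (G : set (set Om)) (f : Om -> R) : Prop :=
  forall U : set R, measurable U -> G (f @^-1` U).

Definition adapted d0 (Om : measurableType d0) (R : realType)
    (Fil : R -> set (set Om)) (T : R) (X : R -> Om -> R) : Prop :=
  forall t, t \in `[0, T] -> meas_wrt (Fil t) (X t).

(* The predictable sigma-algebra on [0, T] x Om. *)
Definition predictable_sigma d0 (Om : measurableType d0) (R : realType)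
    (Fil : R -> set (set Om)) (T : R) : set (set (R * Om)) :=
  <<s [set p | p.1 \in `[0, T]],
      [set D | exists2 A, Fil 0 A & D = [set 0] `*` A] `|`
      [set D | exists s t A, [/\ 0 <= s, s < t, t <= T, Fil s A &
                                 D = `]s, t] `*` A]] >>.

(* Componentwise predictability of a matrix- (or vector-) valued process. *)
Definition predictable_mx d0 (Om : measurableType d0) (R : realType)
    (Fil : R -> set (set Om)) (T : R) (p q : nat)
    (H : R -> Om -> 'M[R]_(p, q)) : Prop :=
  forall i j (U : set R), measurable U ->
    predictable_sigma Fil T
      [set tw | tw.1 \in `[0, T] /\ U (H tw.1 tw.2 i j)].

Definition predictable d0 (Om : measurableType d0) (R : realType)
    (Fil : R -> set (set Om)) (T : R) (Y : R -> Om -> R) : Prop :=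
  predictable_mx Fil T (fun t w => (Y t w)%:M : 'M[R]_1).

Definition stopping_time d0 (Om : measurableType d0) (R : realType)
    (Fil : R -> set (set Om)) (T : R) (tau : Om -> R) : Prop :=
  (forall w, tau w \in `[0, T]) /\
  (forall t, t \in `[0, T] -> Fil t [set w | tau w <= t]).

Definition unif_integrable d0 (Om : measurableType d0) (R : realType)
    (P : probability Om R) (S : set (Om -> R)) : Prop :=
  forall e : R, 0 < e -> exists c : R, forall f, S f ->
    (\int[P]_(w in [set w | (c <= `|f w|)%R]) (`|f w|)%:E <= e%:E)%E.

Definition martingale d0 (Om : measurableType d0) (R : realType)
    (Q : probability Om R) (Fil : R -> set (set Om)) (T : R)
    (X : R -> Om -> R) : Prop :=
  [/\ adapted Fil T X,
      forall t, t \in `[0, T] -> Q.-integrable setT (EFin \o X t) &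
      forall s t A, 0 <= s -> s <= t -> t <= T -> Fil s A ->
        (\int[Q]_(w in A) (X t w)%:E = \int[Q]_(w in A) (X s w)%:E)%E].

(* "P-a.s., for a.e. t in [0, T]" *)
Definition as_ae d0 (Om : measurableType d0) (R : realType)
    (P : probability Om R) (T : R) (S : R -> Om -> Prop) : Prop :=
  {ae P, forall w, {ae lebesgue_measure, forall t : R, t \in `[0, T] -> S t w}}.

(* "P-a.s., for all t in [0, T]" *)
Definition as_all d0 (Om : measurableType d0) (R : realType)
    (P : probability Om R) (T : R) (S : R -> Om -> Prop) : Prop :=
  {ae P, forall w, forall t : R, t \in `[0, T] -> S t w}.

Definition natural_filtration d0 (Om : measurableType d0) (R : realType)
    (m : nat) (B : R -> Om -> 'cV[R]_m) (t : R) : set (set Om) :=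
  <<s [set A | exists s (i : 'I_m) (U : set R),
         [/\ s \in `[0, t], measurable U &
             A = [set w | U (B s w i ord0)]] ] >>.

Definition augmented_filtration d0 (Om : measurableType d0) (R : realType)
    (P : probability Om R) (m : nat) (B : R -> Om -> 'cV[R]_m) (t : R) :
    set (set Om) :=
  <<s natural_filtration B t `|` P.-negligible >>.

Definition incr_event (Om : Type) (R : realType) (m : nat)
    (B : R -> Om -> 'cV[R]_m) (s t : R) (U : 'I_m -> set R) : set Om :=
  [set w | forall i, U i ((B t w - B s w) i ord0)].

Definition brownian_motion d0 (Om : measurableType d0) (R : realType)
    (P : probability Om R) (T : R) (m : nat) (B : R -> Om -> 'cV[R]_m) : Prop :=
  [/\ forall t (i : 'I_m), t \in `[0, T] ->
        measurable_fun setT (fun w => B t w i ord0),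
      {ae P, forall w, B 0 w = 0},
      {ae P, forall w (i : 'I_m),
        {within `[0, T], continuous (fun t => B t w i ord0)}},
      (* increments are independent of the past *)
      forall (s t : R) G (U : 'I_m -> set R),
        0 <= s -> s < t -> t <= T -> natural_filtration B s G ->
        (forall i, measurable (U i)) ->
        P (G `&` incr_event B s t U) =
        (P G * P (incr_event B s t U))%E &
      (* and have law N(0, (t - s) I_m); the second argument of [normal_prob]
         is the standard deviation *)
      forall (s t : R) (U : 'I_m -> set R),
        0 <= s -> s < t -> t <= T -> (forall i, measurable (U i)) ->
        P (incr_event B s t U) =
        (\prod_(i < m) normal_prob 0 (Num.sqrt (t - s)) (U i))%E].

(* The simple integrand sum_j coef_j 1_{]node_j, node_(j+1)]}. *)
Record simple_integrand (Om : Type) (R : realType) (m : nat) := SimpleIntegrand {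
  nstep : nat;
  node : nat -> R;
  coef : nat -> Om -> 'cV[R]_m }.

Definition simple_wf d0 (Om : measurableType d0) (R : realType) (m : nat)
    (Fil : R -> set (set Om)) (T : R) (S : simple_integrand Om R m) : Prop :=
  [/\ forall j, (j <= nstep S)%N -> node S j \in `[0, T],
      forall j, (j < nstep S)%N -> node S j <= node S j.+1,
      forall j i, (j < nstep S)%N ->
        meas_wrt (Fil (node S j)) (fun w => coef S j w i ord0) &
      exists K, forall j w, (j < nstep S)%N -> enorm (coef S j w) <= K].

Definition simple_val (Om : Type) (R : realType) (m : nat)
    (S : simple_integrand Om R m) (s : R) (w : Om) : 'cV[R]_m :=
  \sum_(j < nstep S)
     (if node S j < s <= node S j.+1 then coef S j w else 0).

Definition simple_integral (Om : Type) (R : realType) (m : nat)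
    (B : R -> Om -> 'cV[R]_m) (S : simple_integrand Om R m) (t : R) (w : Om) : R :=
  \sum_(j < nstep S)
     vdot (coef S j w)
       (B (Num.min t (node S j.+1)) w - B (Num.min t (node S j)) w).

Definition cvg0_in_probability d0 (Om : measurableType d0) (R : realType)
    (P : probability Om R) (X : nat -> Om -> \bar R) : Prop :=
  forall e : R, 0 < e ->
    P [set w | (e%:E < X n w)%E] @[n --> \oo] --> 0%E.

Definition sq_norm_integral d0 (Om : measurableType d0) (R : realType) (T : R)
    (m : nat) (H : R -> Om -> 'cV[R]_m) (w : Om) : \bar R :=
  (\int[lebesgue_measure]_(s in `[0%R, T]) (enorm (H s w) ^+ 2)%:E)%E.

(* [ito_integral P T B H I]: the process I is (a version of) the Ito integral
   int_0^. H_s^tr dB_s, for H predictable with int_0^T |H_s|^2 ds < oo a.s.,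
   i.e. the limit, uniform on [0, T] in probability, of the integrals of simple
   integrands approximating H in L^2([0, T], ds) in probability. *)
Definition ito_integral d0 (Om : measurableType d0) (R : realType)
    (P : probability Om R) (T : R) (m : nat) (B : R -> Om -> 'cV[R]_m)
    (H : R -> Om -> 'cV[R]_m) (I : R -> Om -> R) : Prop :=
  let Fil := augmented_filtration P B in
  [/\ predictable_mx Fil T H,
      {ae P, forall w, (sq_norm_integral T H w < +oo)%E},
      adapted Fil T I,
      {ae P, forall w, {within `[0, T], continuous (I ^~ w)}} &
      exists S : nat -> simple_integrand Om R m,
        [/\ forall n, simple_wf Fil T (S n),
            cvg0_in_probability P (fun n =>
              sq_norm_integral T (fun s w => simple_val (S n) s w - H s w)) &
            cvg0_in_probability P (fun n w =>
              ereal_sup [set (`|simple_integral B (S n) t w - I t w|)%:E |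
                          t in `[0, T]])]].

Definition cadlag (R : realType) (T : R) (y : R -> R) : Prop :=
  (forall t, 0 <= t -> t < T -> y s @[s --> t^'+] --> y t) /\
  (forall t, 0 < t -> t <= T -> cvg (y s @[s --> t^'-])).

Definition S2 d0 (Om : measurableType d0) (R : realType)
    (P : probability Om R) (T : R) (Fil : R -> set (set Om))
    (Y : R -> Om -> R) : Prop :=
  [/\ adapted Fil T Y,
      {ae P, forall w, cadlag T (Y ^~ w)} &
      (\int[P]_w ereal_sup [set (`|Y t w| ^+ 2)%:E | t in `[0%R, T]] < +oo)%E].

Definition M2 d0 (Om : measurableType d0) (R : realType)
    (P : probability Om R) (T : R) (Fil : R -> set (set Om)) (m : nat)
    (Z : R -> Om -> 'cV[R]_m) : Prop :=
  predictable_mx Fil T Z /\ (\int[P]_w sq_norm_integral T Z w < +oo)%E.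

Definition market_price_of_risk (Om : Type) (R : realType) (d m : nat)
    (b : R -> Om -> 'cV[R]_d) (sigma : R -> Om -> 'M[R]_(d, m))
    (t : R) (w : Om) : 'cV[R]_m :=
  (sigma t w)^T *m invmx (sigma t w *m (sigma t w)^T) *m b t w.

(* The set sigma_t^tr C. *)
Definition constraint_image (Om : Type) (R : realType) (d m : nat)
    (sigma : R -> Om -> 'M[R]_(d, m)) (C : set 'cV[R]_d) (t : R) (w : Om) :
    set 'cV[R]_m :=
  [set (sigma t w)^T *m p | p in C].

Definition generator (Om : Type) (R : realType) (d m : nat)
    (b : R -> Om -> 'cV[R]_d) (sigma : R -> Om -> 'M[R]_(d, m))
    (C : set 'cV[R]_d) (alpha : R) (t : R) (w : Om) (z : 'cV[R]_m) : R :=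
  let theta := market_price_of_risk b sigma t w in
  alpha / 2 *
    edistance (constraint_image sigma C t w) (z + alpha^-1 *: theta) ^+ 2
  - vdot z theta - (2 * alpha)^-1 * enorm theta ^+ 2.

(* (Y, Z) solves
   Y_t = G + int_t^T f^alpha(s, Z_s) ds - int_t^T Z_s^tr dB_s
   and has the integrability that makes the solution unique. *)
Definition exp_bsde d0 (Om : measurableType d0) (R : realType)
    (P : probability Om R) (T : R) (d m : nat) (B : R -> Om -> 'cV[R]_m)
    (b : R -> Om -> 'cV[R]_d) (sigma : R -> Om -> 'M[R]_(d, m))
    (C : set 'cV[R]_d) (alpha : R) (G : Om -> R)
    (Y : R -> Om -> R) (Z : R -> Om -> 'cV[R]_m) : Prop :=
  let Fil := augmented_filtration P B in
  [/\ [/\ predictable Fil T Y, predictable_mx Fil T Z &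
          {ae P, forall w, {within `[0, T], continuous (Y ^~ w)}}],
      exists2 I, ito_integral P T B Z I &
        as_all P T (fun t w => Y t w =
          G w
          + \int[lebesgue_measure]_(s in `[t, T])
              generator b sigma C alpha s w (Z s w)
          - (I T w - I t w)),
      forall p : R, 1 <= p ->
        (\int[P]_w ereal_sup
           [set (expR (p * alpha * pos_part (Y t w)))%:E | t in `[0%R, T]]
         < +oo)%E,
      forall p : R, 1 <= p ->
        (\int[P]_w ((sq_norm_integral T Z w) `^ (p / 2)) < +oo)%E &
      exists K : R, as_all P T (fun t w => neg_part (Y t w) <= K)].

(* The density of Q is the stochastic exponential
   E_T(- int theta^tr dB) = exp(- int_0^T theta^tr dB - 1/2 int_0^T |theta|^2 dt). *)
Definition girsanov_measure d0 (Om : measurableType d0) (R : realType)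
    (P : probability Om R) (T : R) (m : nat) (B : R -> Om -> 'cV[R]_m)
    (theta : R -> Om -> 'cV[R]_m) (Q : probability Om R) : Prop :=
  exists2 N, ito_integral P T B theta N &
    forall A, measurable A ->
      Q A = (\int[P]_(w in A)
        (expR (- N T w - 2^-1 *
           (\int[lebesgue_measure]_(t in `[0, T]) (enorm (theta t w) ^+ 2))%R))%:E)%E.

(* pi is a predictable C-valued strategy with int_0^T |sigma^tr pi|^2 dt < oo
   and X_t = x + int_0^t pi_u^tr sigma_u (dB_u + theta_u du) is its wealth. *)
Definition constrained_strategy d0 (Om : measurableType d0) (R : realType)
    (P : probability Om R) (T : R) (d m : nat) (B : R -> Om -> 'cV[R]_m)
    (b : R -> Om -> 'cV[R]_d) (sigma : R -> Om -> 'M[R]_(d, m))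
    (C : set 'cV[R]_d) (x : R) (pi : R -> Om -> 'cV[R]_d)
    (X : R -> Om -> R) : Prop :=
  let Fil := augmented_filtration P B in
  let theta := market_price_of_risk b sigma in
  let H := fun t w => (sigma t w)^T *m pi t w in
  [/\ predictable_mx Fil T pi,
      {ae P, forall w, (sq_norm_integral T H w < +oo)%E},
      as_ae P T (fun t w => C (pi t w)) &
      exists2 I, ito_integral P T B H I &
        as_all P T (fun t w => X t w =
          x + I t w
          + \int[lebesgue_measure]_(u in `[0, t]) vdot (H u w) (theta u w))].

(* The class A; Y stands for Y^alpha(F). *)
Definition admissible_UI d0 (Om : measurableType d0) (R : realType)
    (P : probability Om R) (T : R) (d m : nat) (B : R -> Om -> 'cV[R]_m)
    (b : R -> Om -> 'cV[R]_d) (sigma : R -> Om -> 'M[R]_(d, m))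
    (C : set 'cV[R]_d) (alpha : R) (Y : R -> Om -> R) (x : R)
    (pi : R -> Om -> 'cV[R]_d) (X : R -> Om -> R) : Prop :=
  constrained_strategy P T B b sigma C x pi X /\
  unif_integrable P
    [set (fun w => expR (- alpha * (X (tau w) w - Y (tau w) w))) |
       tau in stopping_time (augmented_filtration P B) T].

(* The class A'. *)
Definition admissible_mart d0 (Om : measurableType d0) (R : realType)
    (P Q : probability Om R) (T : R) (d m : nat) (B : R -> Om -> 'cV[R]_m)
    (b : R -> Om -> 'cV[R]_d) (sigma : R -> Om -> 'M[R]_(d, m))
    (C : set 'cV[R]_d) (x : R)
    (pi : R -> Om -> 'cV[R]_d) (X : R -> Om -> R) : Prop :=
  constrained_strategy P T B b sigma C x pi X /\
  martingale Q (augmented_filtration P B) T X.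

(* Values in [-oo, 0]. *)
Definition exp_utility d0 (Om : measurableType d0) (R : realType)
    (P : probability Om R) (alpha : R) (V : Om -> R) : \bar R :=
  (\int[P]_w (- expR (- alpha * V w))%:E)%E.

(* c is the utility indifference price C_0^alpha(F) at initial wealth x. *)
Definition indifference_price d0 (Om : measurableType d0) (R : realType)
    (P Q : probability Om R) (T : R) (d m : nat) (B : R -> Om -> 'cV[R]_m)
    (b : R -> Om -> 'cV[R]_d) (sigma : R -> Om -> 'M[R]_(d, m))
    (C : set 'cV[R]_d) (alpha : R) (F : Om -> R) (Y : R -> Om -> R)
    (x c : R) : Prop :=
  ereal_sup [set u | exists pi X,
    admissible_UI P T B b sigma C alpha Y (x + c) pi X /\
    u = exp_utility P alpha (fun w => X T w - F w)] =
  ereal_sup [set u | exists pi X,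
    admissible_mart P Q T B b sigma C x pi X /\
    u = exp_utility P alpha (X T)].

(* For A cadlag and increasing, int_t^T dA_u = A_T - A_t. *)
Definition constrained_bsde d0 (Om : measurableType d0) (R : realType)
    (P : probability Om R) (T : R) (d m : nat) (B : R -> Om -> 'cV[R]_m)
    (b : R -> Om -> 'cV[R]_d) (sigma : R -> Om -> 'M[R]_(d, m))
    (C : set 'cV[R]_d) (F : Om -> R)
    (Y : R -> Om -> R) (H : R -> Om -> 'cV[R]_m) (A : R -> Om -> R) : Prop :=
  let Fil := augmented_filtration P B in
  let theta := market_price_of_risk b sigma in
  [/\ [/\ S2 P T Fil Y, M2 P T Fil H & S2 P T Fil A],
      {ae P, forall w (s t : R), 0 <= s -> s <= t -> t <= T -> A s w <= A t w},
      exists2 I, ito_integral P T B H I &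
        as_all P T (fun t w => Y t w =
          F w + (A T w - A t w)
          - \int[lebesgue_measure]_(u in `[t, T]) vdot (H u w) (theta u w)
          - (I T w - I t w)) &
      as_ae P T (fun t w => constraint_image sigma C t w (H t w))].

Definition minimal_constrained_bsde d0 (Om : measurableType d0) (R : realType)
    (P : probability Om R) (T : R) (d m : nat) (B : R -> Om -> 'cV[R]_m)
    (b : R -> Om -> 'cV[R]_d) (sigma : R -> Om -> 'M[R]_(d, m))
    (C : set 'cV[R]_d) (F : Om -> R)
    (Y : R -> Om -> R) (H : R -> Om -> 'cV[R]_m) (A : R -> Om -> R) : Prop :=
  constrained_bsde P T B b sigma C F Y H A /\
  forall Y' H' A', constrained_bsde P T B b sigma C F Y' H' A' ->
    forall t, t \in `[0, T] -> {ae P, forall w, Y t w <= Y' t w}.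

(* Main.v *)
Require Import Defs.
From HB Require Import structures.
From mathcomp Require Import all_boot all_order all_algebra.
From mathcomp Require Import all_classical all_reals all_analysis.
From mathcomp Require Import measurable_realfun.
From mathcomp Require Import ring lra.

Set Implicit Arguments.
Unset Strict Implicit.
Unset Printing Implicit Defensive.

Import Order.TTheory GRing.Theory Num.Theory.
Import numFieldNormedType.Exports.

Local Open Scope classical_set_scope.
Local Open Scope ring_scope.

(** The key estimate is a lower bound: if [D] dominates [int h dB - 1/2 int |h|^2]
    and [exp D] is uniformly integrable along stopping times, then
    [E (exp D_T) >= 1]. It is obtained by stopping the exponentials of simple
    integrands on a grid, without the Ito formula. With [D = alpha (Y^alpha - X)]
    for the wealth [X] of a constrained strategy it bounds [Y^alpha] by every
    superhedging portfolio, bounds the expected utilities (whence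
    [Y^alpha_0 <= C^alpha_0]), and yields the energy estimates.

    The generator penalises by [alpha] the squared distance of [Z^alpha] to the
    constraints, and [E int |Z^alpha|^2] stays bounded. Near-minimisers of the
    energy, in decreasing midpoint-closed classes of almost superhedging triples,
    converge strongly to an integrand which meets the constraints and superhedges
    from [sup_n Y^(alpha_n)_0]: this is the minimal solution. Conversely the
    portfolio of a solution superhedges [F], and Jensen's inequality against the
    measure [Q] gives [C^alpha_0 <= C_0 + K^2 T / alpha], [K] a bound of [|theta|]. *)

(** * Euclidean norm and distance *)

(** Fatou's lemma, which carries identities from simple integrands to general ones, yields only [<=]
    for exponential expectations; the reverse inequality needs uniform integrability. Hence the
    stopping: before the exponential passes a level c it is bounded, passing has probability at most
    1/c, and on a grid of r^2 steps the overshoot costs about r^2 2^(-r), by r-th moments of the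
    increments.

    Monotonicity of Y^alpha in alpha is never established. The minimal value is the supremum over a
    sequence, and comparison against the lower limit of the selected triples identifies this
    supremum with their limit. The last step is by contradiction: prices below C_0 - e along some
    alpha_n would produce a solution starting at or below C_0 - e, which minimality excludes.

    The supremum is controlled at each fixed time, up to a null set depending on that time. So the
    increasing process is read on countably many times and made right-continuous; at a fixed time
    this changes nothing almost surely, because a supremum of continuous processes is lower
    semicontinuous. *)

Section euclidean.
Context (R : realType).
Implicit Types (n : nat).

Lemma vdotE n (u v : 'cV[R]_n) : vdot u v = \sum_i u i ord0 * v i ord0.
Proof. by rewrite /vdot mxE; apply: eq_bigr => i _; rewrite mxE. Qed.

Lemma vdotC n (u v : 'cV[R]_n) : vdot u v = vdot v u.
Proof. by rewrite !vdotE; apply: eq_bigr => i _; rewrite mulrC. Qed.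

Lemma vdotDl n (u v x : 'cV[R]_n) : vdot (u + v) x = vdot u x + vdot v x.
Proof. by rewrite !vdotE -big_split; apply: eq_bigr => i _; rewrite mxE mulrDl. Qed.

Lemma vdotDr n (u v x : 'cV[R]_n) : vdot x (u + v) = vdot x u + vdot x v.
Proof. by rewrite vdotC vdotDl !(vdotC _ x). Qed.

Lemma vdotZl n a (u x : 'cV[R]_n) : vdot (a *: u) x = a * vdot u x.
Proof. by rewrite !vdotE mulr_sumr; apply: eq_bigr => i _; rewrite mxE mulrA. Qed.

Lemma vdotZr n a (u x : 'cV[R]_n) : vdot x (a *: u) = a * vdot x u.
Proof. by rewrite vdotC vdotZl vdotC. Qed.

Lemma vdotNl n (u x : 'cV[R]_n) : vdot (- u) x = - vdot u x.
Proof. by rewrite -scaleN1r vdotZl mulN1r. Qed.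

Lemma vdotNr n (u x : 'cV[R]_n) : vdot x (- u) = - vdot x u.
Proof. by rewrite vdotC vdotNl vdotC. Qed.

Lemma vdotBr n (u v x : 'cV[R]_n) : vdot x (u - v) = vdot x u - vdot x v.
Proof. by rewrite vdotDr vdotNr. Qed.

Lemma vdot0l n (x : 'cV[R]_n) : vdot 0 x = 0.
Proof. by rewrite -(scale0r (0 : 'cV[R]_n)) vdotZl mul0r. Qed.

Lemma vdot0r n (x : 'cV[R]_n) : vdot x 0 = 0.
Proof. by rewrite vdotC vdot0l. Qed.

Lemma vdot_suml n (I : Type) (r : seq I) (F : I -> 'cV[R]_n) x :
  vdot (\sum_(i <- r) F i) x = \sum_(i <- r) vdot (F i) x.
Proof.
elim: r => [|a r IH]; first by rewrite !big_nil vdot0l.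
by rewrite !big_cons vdotDl IH.
Qed.

Lemma vdot_sumr n (I : Type) (r : seq I) (F : I -> 'cV[R]_n) x :
  vdot x (\sum_(i <- r) F i) = \sum_(i <- r) vdot x (F i).
Proof. by rewrite vdotC vdot_suml; apply: eq_bigr => i _; rewrite vdotC. Qed.

Lemma vdot_ge0 n (u : 'cV[R]_n) : 0 <= vdot u u.
Proof. by rewrite vdotE sumr_ge0// => i _; rewrite -expr2 sqr_ge0. Qed.

Lemma vdot_eq0 n (u : 'cV[R]_n) : vdot u u = 0 -> u = 0.
Proof.
move=> u0; apply/matrixP => i j; rewrite ord1 mxE; apply/eqP.
move: u0; rewrite vdotE => /eqP; rewrite psumr_eq0; last by move=> k _; rewrite -expr2 sqr_ge0.
by move=> /allP/(_ i (mem_index_enum i)); rewrite -expr2 sqrf_eq0.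
Qed.

Lemma enorm_ge0 n (u : 'cV[R]_n) : 0 <= enorm u.
Proof. exact: sqrtr_ge0. Qed.

Lemma sqr_enorm n (u : 'cV[R]_n) : enorm u ^+ 2 = vdot u u.
Proof. by rewrite sqr_sqrtr// vdot_ge0. Qed.

(** Expand the nonnegative squares of [e *: u + v] and [e *: u - v] and divide by [e]. The free
    weight gives Cauchy-Schwarz, and later the splitting of quadratic terms with a small
    constant. *)
Lemma vdot_weighted_le n (e : R) (u v : 'cV[R]_n) : 0 < e ->
  `|vdot u v| <= 2^-1 * (e * vdot u u + e^-1 * vdot v v).
Proof.
move=> e0; have ev : e * e^-1 = 1 by rewrite divff ?gt_eqF.
have := vdot_ge0 (e *: u - v); have := vdot_ge0 (e *: u + v).
rewrite !(vdotDl, vdotDr, vdotNl, vdotNr, vdotZl, vdotZr) (vdotC v u).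
set uu := vdot u u; set vv := vdot v v; set uv := vdot u v => h1 h2.
have ei : 0 < e^-1 by rewrite invr_gt0.
have g1 := mulr_ge0 (ltW ei) h1; have g2 := mulr_ge0 (ltW ei) h2.
have E1 : e^-1 * (e * (e * uu + uv) + (e * uv + vv)) =
  (e * e^-1) * (e * uu) + (e * e^-1) * uv *+ 2 + e^-1 * vv by ring.
have E2 : e^-1 * (e * (e * uu - uv) - (e * uv - vv)) =
  (e * e^-1) * (e * uu) - (e * e^-1) * uv *+ 2 + e^-1 * vv by ring.
rewrite E1 ev !mul1r in g1; rewrite E2 ev !mul1r in g2.
by rewrite ler_norml; apply/andP; split; lra.
Qed.

Lemma cauchy_schwarz n (u v : 'cV[R]_n) : `|vdot u v| <= enorm u * enorm v.
Proof.
have [u0|u0] := eqVneq (vdot u u) 0.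
  by rewrite (vdot_eq0 u0) vdot0l normr0 mulr_ge0 ?enorm_ge0.
have [v0|v0] := eqVneq (vdot v v) 0.
  by rewrite (vdot_eq0 v0) vdot0r normr0 mulr_ge0 ?enorm_ge0.
have up : 0 < enorm u by rewrite sqrtr_gt0 lt_neqAle eq_sym u0 vdot_ge0.
have vp : 0 < enorm v by rewrite sqrtr_gt0 lt_neqAle eq_sym v0 vdot_ge0.
(* The weight [enorm v / enorm u] balances the two terms, each of which becomes half of the product
   of the norms. *)
apply: (le_trans (vdot_weighted_le u v (divr_gt0 vp up))).
rewrite -!sqr_enorm le_eqVlt; apply/orP; left; apply/eqP.
by field; rewrite !gt_eqF.
Qed.

Lemma enormD n (u v : 'cV[R]_n) : enorm (u + v) <= enorm u + enorm v.
Proof.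
rewrite -(@ler_pXn2r _ 2) ?nnegrE ?enorm_ge0 ?addr_ge0 ?enorm_ge0// sqr_enorm.
rewrite vdotDl !vdotDr (vdotC v u).
have := cauchy_schwarz u v; have := ler_norm (vdot u v).
have := sqr_enorm u; have := sqr_enorm v; nra.
Qed.

Lemma enormZ n a (u : 'cV[R]_n) : enorm (a *: u) = `|a| * enorm u.
Proof.
by rewrite /enorm vdotZl vdotZr mulrA -expr2 sqrtrM ?sqr_ge0// sqrtr_sqr.
Qed.

Lemma enormN n (u : 'cV[R]_n) : enorm (- u) = enorm u.
Proof. by rewrite -scaleN1r enormZ normrN1 mul1r. Qed.

Lemma enorm0 n : enorm (0 : 'cV[R]_n) = 0.
Proof. by rewrite /enorm vdot0l sqrtr0. Qed.

Lemma vdotDsq_le n (u v : 'cV[R]_n) :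
  vdot (u + v) (u + v) <= 2 * vdot u u + 2 * vdot v v.
Proof.
have := vdot_ge0 (u - v); rewrite !(vdotDl, vdotDr, vdotNl, vdotNr) (vdotC v u).
by move=> h; lra.
Qed.

Section distance.
Variables (n : nat) (K : set 'cV[R]_n).
Hypothesis K0 : K !=set0.

Let has_lb z : has_lbound [set enorm (z - k) | k in K].
Proof. by exists 0 => _ [k _ <-]; exact: enorm_ge0. Qed.

Let nonempty z : [set enorm (z - k) | k in K] !=set0.
Proof. by have [k Kk] := K0; exists (enorm (z - k)), k. Qed.

Lemma edistance_le z k : K k -> edistance K z <= enorm (z - k).
Proof. by move=> Kk; apply: ge_inf => //; exists k. Qed.

Lemma edistance_ge0 z : 0 <= edistance K z.
Proof. by apply: lb_le_inf => // _ [k _ <-]; exact: enorm_ge0. Qed.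

Lemma edistance_adherent z e : 0 < e -> exists2 k, K k & enorm (z - k) < edistance K z + e.
Proof.
by move=> e0; have [_ [k Kk <-] h] := inf_adherent e0 (conj (nonempty z) (has_lb z)); exists k.
Qed.

Lemma edistance_lip z z' : edistance K z <= edistance K z' + enorm (z - z').
Proof.
apply/ler_addgt0Pr => e e0; have [k Kk hk] := edistance_adherent z' e0.
apply: (le_trans (edistance_le z Kk)).
have -> : z - k = (z' - k) + (z - z') by apply/matrixP => i j; rewrite !mxE; ring.
by apply: (le_trans (enormD _ _)); lra.
Qed.

Hypothesis Kmid : forall x y, K x -> K y -> K (2^-1 *: (x + y)).

(** The midpoint of two near-best points of [K] lies in [K]. Closure under midpoints is the form of
    convexity that the selection of near-minimisers uses. *)
Lemma edistance_mid z z' :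
  edistance K (2^-1 *: (z + z')) <= 2^-1 * (edistance K z + edistance K z').
Proof.
apply/ler_addgt0Pr => e e0.
have [k Kk hk] := edistance_adherent z e0.
have [k' Kk' hk'] := edistance_adherent z' e0.
apply: (le_trans (edistance_le _ (Kmid Kk Kk'))).
rewrite -scalerBr opprD addrACA enormZ gtr0_norm//.
by have := enormD (z - k) (z' - k'); lra.
Qed.

End distance.
End euclidean.

(** * Gaussian exponentials *)

Section ge0_density.
Local Open Scope ereal_scope.
Context d (X : measurableType d) (R : realType).
Variables (mu nu : {measure set X -> \bar R}) (g : X -> R).
Hypothesis mg : measurable_fun setT g.
Hypothesis g0 : forall x, (0 <= g x)%R.
Hypothesis nuE : forall A, measurable A -> nu A = \int[mu]_(x in A) (g x)%:E.

Import HBNNSimple.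

(** The density is known only through the values of [nu] on sets, so the formula is proved for
    simple functions and carried over by monotone convergence. It serves both the Gaussian density
    and the density of [Q]. *)
Lemma ge0_integral_density (f : X -> \bar R) :
  measurable_fun setT f -> (forall x, 0 <= f x) ->
  \int[nu]_x f x = \int[mu]_x (f x * (g x)%:E).
Proof.
move=> mf f0.
have mD : measurable [set: X] by [].
pose f_ := nnsfun_approx mD mf.
transitivity (limn (fun n => \int[nu]_x (f_ n x)%:E)).
  rewrite -monotone_convergence//.
  - apply: eq_integral => y _; apply/esym/cvg_lim => //.
    exact: cvg_nnsfun_approx.
  - by move=> n; exact/measurable_EFinP/measurable_funP.
  - by move=> n y _; rewrite lee_fin.
  - by move=> y _ m n mn; rewrite lee_fin; exact/lefP/nd_nnsfun_approx.
rewrite [X in limn X](_ : _ = (fun n => \int[mu]_x (f_ n x * g x)%:E)); last first.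
  apply/funext => n.
  have mfn r : measurable (f_ n @^-1` [set r]) by exact: measurable_funPTI.
  transitivity (\sum_(k \in range (f_ n))
      \int[mu]_x (k * \1_(f_ n @^-1` [set k]) x * g x)%:E).
    under eq_integral do rewrite fimfunE -fsumEFin//.
    rewrite ge0_integral_fsum//; last 2 first.
    - by move=> y; exact/measurable_EFinP/measurable_funM.
    - by move=> y x _; rewrite nnfun_muleindic_ge0.
    apply: eq_fsbigr => r; rewrite inE => -[x _ <-].
    have fn0 : (0 <= f_ n x)%R by [].
    rewrite integralZl_indic_nnsfun// integral_indic// setIT nuE//.
    under [RHS]eq_integral do rewrite -mulrA EFinM.
    rewrite ge0_integralZl_EFin//; last 2 first.
    - by move=> y _; rewrite lee_fin mulr_ge0.
    - by apply/measurable_EFinP/measurable_funM => //; exact: measurable_indic.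
    congr *%E; rewrite integral_mkcond; apply: eq_integral => y _.
    rewrite patchE indicE; case: ifPn => _; by rewrite ?mul1r ?mul0r.
  rewrite -ge0_integral_fsum//.
  - apply: eq_integral => x _; rewrite fsumEFin// (fimfunE (f_ n)).
    by rewrite mulr_fsuml.
  - move=> r; apply/measurable_EFinP; apply: measurable_funM => //.
    by apply: measurable_funM => //; exact: measurable_indic.
  - by move=> r x _; rewrite EFinM mule_ge0 ?lee_fin// -lee_fin EFinM nnfun_muleindic_ge0.
rewrite -monotone_convergence//.
- apply: eq_integral => x _; apply/cvg_lim => //.
  under eq_fun do rewrite EFinM.
  apply: cvgeZr => //; exact: cvg_nnsfun_approx.
- by move=> n; apply/measurable_EFinP/measurable_funM => //.
- by move=> n x _; rewrite lee_fin mulr_ge0.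
- move=> x _ m n mn; rewrite lee_fin ler_wpM2r//.
  exact/lefP/nd_nnsfun_approx.
Qed.

End ge0_density.

(** Completing the square: the integrand times the centred density is the normal density with mean
    [a * s ^+ 2], of total mass 1. *)
Lemma normal_mgf (R : realType) (a s : R) : s != 0 ->
  (\int[normal_prob 0 s]_y (expR (a * y - 2^-1 * a ^+ 2 * s ^+ 2))%:E = 1)%E.
Proof.
move=> s0.
rewrite (@ge0_integral_density _ _ _ lebesgue_measure _ (normal_pdf 0 s))//=.
- rewrite -[RHS](integral_normal_pdf (a * s ^+ 2) s); apply: eq_integral => y _.
  rewrite -EFinM !normal_pdfE//; congr EFin.
  rewrite mulrCA /normal_fun -expRD; congr (_ * expR _).
  by field.
- exact: measurable_normal_pdf.
- by move=> x; exact: normal_pdf_ge0.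
- apply/measurable_EFinP; apply: measurableT_comp => //.
  by apply: measurable_funB => //; exact: mulrl_measurable.
Qed.

Section gauss_step.
Context (R : realType) (d0 : measure_display) (Om : measurableType d0)
  (P : probability Om R).
Variables (gen : set (set Om)) (gen_meas : <<s gen >> `<=` measurable).
Variables (beta : Om -> R) (mbeta : measurable_fun setT beta) (s : R).
Hypothesis s0 : s != 0.
Hypothesis indep : forall A (U : set R), <<s gen >> A -> measurable U ->
  P (A `&` beta @^-1` U) = (P A * normal_prob 0 s U)%E.

(** Independence makes the joint law of the past and of [beta] a product measure; Tonelli applies
    and the inner integral is [normal_mgf] with the past frozen. Typing [W] and [xi] on the
    generated sigma-algebra encodes that they depend on the past only. *)
Lemma gauss_step (W xi : g_sigma_algebraType gen -> R) :
  measurable_fun setT W -> measurable_fun setT xi -> (forall w, 0 <= W w) ->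
  (\int[P]_w (W w * expR (xi w * beta w - 2^-1 * xi w ^+ 2 * s ^+ 2))%:E =
   \int[P]_w (W w)%:E)%E.
Proof.
move=> mW mxi W0.
pose Om' : measurableType _ := g_sigma_algebraType gen.
pose i : Om -> Om' := fun w => w.
have mi : measurable_fun setT i.
  by move=> _ A mA; rewrite setTI; exact: gen_meas.
pose ii : {mfun Om >-> Om'} := HB.pack i (isMeasurableFun.Build _ _ _ _ _ mi).
pose j : Om -> Om' * measurableTypeR R := fun w => (w, beta w).
have mj : measurable_fun setT j by exact: measurable_fun_pair.
pose jj : {mfun Om >-> (Om' * measurableTypeR R)%type} :=
  HB.pack j (isMeasurableFun.Build _ _ _ _ _ mj).
pose f (z : Om' * measurableTypeR R) : \bar R :=
  (W z.1 * expR (xi z.1 * z.2 - 2^-1 * xi z.1 ^+ 2 * s ^+ 2))%:E.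
have mW1 : measurable_fun setT (fun z : Om' * measurableTypeR R => W z.1).
  by apply: (measurableT_comp mW); exact: measurable_fst.
have mx1 : measurable_fun setT (fun z : Om' * measurableTypeR R => xi z.1).
  by apply: (measurableT_comp mxi); exact: measurable_fst.
have mf : measurable_fun setT f.
  apply/measurable_EFinP; apply: measurable_funM => //.
  apply: measurableT_comp => //; apply: measurable_funB.
    by apply: measurable_funM => //; exact: measurable_snd.
  apply: measurable_funM => //; apply: measurable_funM => //.
  exact: measurable_funX.
have f0 z : (0 <= f z)%E by rewrite lee_fin mulr_ge0 ?expR_ge0.
transitivity (\int[distribution P jj]_z f z)%E.
  by rewrite ge0_integral_distribution.
transitivity (\int[(distribution P ii \x normal_prob 0 s)%E]_z f z)%E.
  apply: eq_measure_integral.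
  move=> A mA _; symmetry.
  apply: product_measure_unique => // A1 A2 mA1 mA2.
rewrite fubini_tonelli1//.
transitivity (\int[distribution P ii]_w (W w)%:E)%E.
  apply: eq_integral => w _; rewrite /fubini_F /f /=.
  under eq_integral do rewrite EFinM.
  rewrite ge0_integralZl_EFin//.
  - by rewrite normal_mgf// mule1.
  - apply/measurable_EFinP; apply: measurableT_comp => //.
    by apply: measurable_funB => //; exact: mulrl_measurable.
rewrite ge0_integral_distribution//.
exact/measurable_EFinP.
Qed.

End gauss_step.

Lemma exists_natr_gt (R : realType) (x : R) : exists n : nat, x < n%:R.
Proof.
exists (Num.Def.archi_bound `|x|).
by rewrite (le_lt_trans (ler_norm x))// archi_boundP.
Qed.

Lemma exists_invS_lt (R : realType) (e : R) : 0 < e -> exists n : nat, n.+1%:R^-1 < e.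
Proof.
move=> e0; have [n hn] := exists_natr_gt e^-1; exists n.
rewrite invf_plt ?posrE// (lt_le_trans hn)// ler_nat; exact: leqnSn.
Qed.

Lemma ae_not_false (R : realType) d0 (Om : measurableType d0) (P : probability Om R) :
  ~ {ae P, forall w : Om, False}.
Proof.
move=> h; have h2 : P.-negligible [set: Om] by apply: negligibleS h => w _ /=.
have E : P setT = 0%E := measure_negligible measurableT h2.
by move: E; rewrite probability_setT => /eqP; rewrite onee_eq0.
Qed.

(** * The augmented filtration *)

Section complete_probability.
Context (R : realType) (d0 : measure_display) (Om : measurableType d0)
  (P : probability Om R) (hPc : measure_is_complete P).

Lemma measurable_ae_eq (f g : Om -> R) : measurable_fun setT f ->
  {ae P, forall w, f w = g w} -> measurable_fun setT g.
Proof.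
move=> mf fg; apply/measurable_EFinP.
apply: (ae_measurable_fun hPc (f := EFin \o f)); last exact/measurable_EFinP.
by apply: filterS fg => w + _ /=; move=> ->.
Qed.

Lemma measurable_ae_iff (A B : set Om) : measurable A ->
  {ae P, forall w, A w <-> B w} -> measurable B.
Proof.
move=> mA h; apply/(measurable_indicP R).
apply: (measurable_ae_eq (f := \1_A)); first exact: measurable_indic.
apply: filterS h => w h; rewrite !indicE; congr (_ %:R); congr nat_of_bool.
by apply/idP/idP; rewrite !inE => ?; apply/h.
Qed.

Lemma probability_ae_iff (A B : set Om) : measurable A ->
  {ae P, forall w, A w <-> B w} -> P A = P B.
Proof.
move=> mA h; have mB := measurable_ae_iff mA h.
rewrite -[in LHS](setIT A) -[in RHS](setIT B) -!(integral_indic P measurableT)//.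
apply: ge0_ae_eq_integral => //.
- by apply/measurable_EFinP; exact: measurable_indic.
- by apply/measurable_EFinP; exact: measurable_indic.
apply: filterS h => w h _; rewrite /= !indicE; congr (_ %:R%:E).
by congr nat_of_bool; apply/idP/idP; rewrite !inE => ?; apply/h.
Qed.

End complete_probability.

Lemma meas_wrt_gE d0 (Om : measurableType d0) (R : realType)
    (gen : set (set Om)) (f : Om -> R) :
  meas_wrt <<s gen >> f <->
  measurable_fun [set: g_sigma_algebraType gen] (f : g_sigma_algebraType gen -> R).
Proof.
split=> h; first by move=> _ U mU; rewrite setTI; exact: h.
by move=> U mU; have := h measurableT U mU; rewrite setTI.
Qed.

Section filtration.
Context (R : realType) (d0 : measure_display) (Om : measurableType d0)
  (P : probability Om R) (hPc : measure_is_complete P) (T : R) (hT : 0 < T)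
  (m : nat) (B : R -> Om -> 'cV[R]_m) (hB : brownian_motion P T B).
Local Notation Fil := (augmented_filtration P B).
Local Notation FT t :=
  (g_sigma_algebraType (natural_filtration B t `|` P.-negligible)).

Lemma meas_wrtP t (f : Om -> R) :
  meas_wrt (Fil t) f <-> measurable_fun [set: FT t] (f : FT t -> R).
Proof. exact: meas_wrt_gE. Qed.

Lemma natural_measurable t : t <= T -> natural_filtration B t `<=` measurable.
Proof.
move=> tT; apply: smallest_sub; first exact: sigma_algebra_measurable.
move=> _ [s [i [U [+ mU ->]]]]; rewrite in_itv/= => /andP[s0 st].
case: hB => hm _ _ _ _; rewrite -[X in measurable X]setTI.
by apply: hm => //; rewrite in_itv/= s0 (le_trans st).
Qed.

Lemma Fil_measurable t : t <= T -> Fil t `<=` measurable.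
Proof.
move=> tT; apply: smallest_sub; first exact: sigma_algebra_measurable.
by move=> A [|]; [exact: natural_measurable|exact: hPc].
Qed.

Lemma natural_mono s t : s <= t -> natural_filtration B s `<=` natural_filtration B t.
Proof.
move=> st; apply: sub_sigma_algebra2 => _ [u [i [U [us mU ->]]]].
exists u, i, U; split=> //; move: us; rewrite !in_itv/= => /andP[-> us].
exact: le_trans us st.
Qed.

Lemma Fil_mono s t : s <= t -> Fil s `<=` Fil t.
Proof.
move=> st; apply: sub_sigma_algebra2; apply: setSU; exact: natural_mono.
Qed.

Lemma Fil_negligible t : P.-negligible `<=` Fil t.
Proof. by move=> A nA; apply: sub_sigma_algebra; right. Qed.

Lemma meas_wrt_mono s t (f : Om -> R) :
  s <= t -> meas_wrt (Fil s) f -> meas_wrt (Fil t) f.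
Proof. by move=> st mf U mU; exact: (Fil_mono st (mf _ mU)). Qed.

Lemma meas_wrt_measurable t (f : Om -> R) :
  t <= T -> meas_wrt (Fil t) f -> measurable_fun setT f.
Proof.
move=> tT mf _ U mU; rewrite setTI; exact: (Fil_measurable tT (mf _ mU)).
Qed.

(** [A'] is obtained from [A] by removing and adding null sets, and the augmented filtration
    contains them all. *)
Lemma Fil_ae_iff t (A A' : set Om) : Fil t A ->
  {ae P, forall w, A w <-> A' w} -> Fil t A'.
Proof.
move=> FA h.
have -> : A' = (A `\` (A `\` A')) `|` (A' `\` A).
  apply/seteqP; split=> w /=; first by case: (pselect (A w)); tauto.
  by case: (pselect (A' w)); tauto.
have n1 : Fil t (A `\` A').
  by apply: Fil_negligible; apply: negligibleS h => w [Aw A'w] /= [] /(_ Aw).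
have n2 : Fil t (A' `\` A).
  by apply: Fil_negligible; apply: negligibleS h => w [Aw A'w] /= [] _ /(_ Aw).
apply: (@measurableU _ (FT t)) => //.
exact: (@measurableD _ (FT t)).
Qed.

Lemma meas_wrt_ae t (f g : Om -> R) : meas_wrt (Fil t) f ->
  {ae P, forall w, f w = g w} -> meas_wrt (Fil t) g.
Proof.
move=> mf fg U mU; apply: (Fil_ae_iff (mf _ mU)).
by apply: filterS fg => w /= ->.
Qed.

Lemma B0_as0 (i : 'I_m) : {ae P, forall w, B 0 w i ord0 = 0}.
Proof. by case: hB => _ h _ _ _; apply: filterS h => w ->; rewrite mxE. Qed.

(** Negligible and co-negligible sets together form a sigma-algebra, and it contains the generators
    because [B 0] is almost surely 0. *)
Lemma Fil0_trivial (A : set Om) : Fil 0 A ->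
  P.-negligible A \/ P.-negligible (~` A).
Proof.
move: A; apply: smallest_sub.
  split=> /=.
  - by left; exact: negligible_set0.
  - by move=> A [|] h; rewrite setTD; [right; rewrite setCK|left].
  - move=> A hA.
    have [[n hn]|/forallNP hn] := pselect (exists n, P.-negligible (~` A n)).
      right; apply: negligibleS hn; apply: subsetC; exact: bigcup_sup.
    left; apply: negligible_bigcup => n.
    by have [//|/hn] := hA n.
move=> A [|]; last by left.
move: A; apply: smallest_sub.
  split=> /=.
  - by left; exact: negligible_set0.
  - by move=> A [|] h; rewrite setTD; [right; rewrite setCK|left].
  - move=> A hA.
    have [[n hn]|/forallNP hn] := pselect (exists n, P.-negligible (~` A n)).
      right; apply: negligibleS hn; apply: subsetC; exact: bigcup_sup.
    left; apply: negligible_bigcup => n.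
    by have [//|/hn] := hA n.
move=> _ [s [i [U [+ mU ->]]]]; rewrite in_itv/= -eq_le => /eqP <-.
(* Only the time 0 is available, so the event is almost sure or negligible according to whether 0
   lies in [U]. *)
have [U0|U0] := pselect (U 0); [right|left].
  by apply: negligibleS (B0_as0 i) => w /= h; apply: contra_not h => ->.
by apply: negligibleS (B0_as0 i) => w /= h; apply: contra_not U0 => <-.
Qed.

(** By the dichotomy each level is almost surely exceeded or almost surely not. The constant is the
    supremum of the exceeded levels, finite because [f] is real-valued. This makes the initial
    values of all the equations deterministic. *)
Lemma Fil0_const (f : Om -> R) : meas_wrt (Fil 0) f ->
  exists c, {ae P, forall w, f w = c}.
Proof.
move=> mf.
have dich (r : R) : {ae P, forall w, f w <= r} \/ {ae P, forall w, r < f w}.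
  have mU : measurable [set x : R | x <= r].
    by rewrite (_ : [set _ | _] = `]-oo, r]%classic)//; apply/seteqP; split=> x /=; rewrite in_itv.
  have [h|h] := Fil0_trivial (mf _ mU); [right|left] => //.
  by apply: negligibleS h => w /= /negP; rewrite -leNgt.
pose S := [set r : R | {ae P, forall w, r < f w}].
have S0 : S !=set0.
  apply: contrapT => /set0P/negP; rewrite negbK => /eqP S0; apply: (@ae_not_false _ _ _ P).
  have : {ae P, forall w n, f w <= - n%:R}.
    apply/ae_foralln => n; have [//|h] := dich (- n%:R).
    by have : S (- n%:R) by []; rewrite S0.
  apply: filterS => w h.
  have [n hn] := exists_natr_gt (- f w).
  by have := h n; rewrite lerNr leNgt hn.
have ubS : has_ubound S.
  apply: contrapT => nub; apply: (@ae_not_false _ _ _ P).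
  have : {ae P, forall w n, n%:R < f w}.
    apply/ae_foralln => n; have [h|//] := dich n%:R; exfalso.
    apply: nub; exists n%:R => r rS; rewrite leNgt; apply/negP => nr.
    apply: (@ae_not_false _ _ _ P); apply: filterS2 h rS => w h1 h2.
    by have := lt_trans (le_lt_trans h1 nr) h2; rewrite ltxx.
  apply: filterS => w h.
  have [n hn] := exists_natr_gt (f w).
  by have := lt_trans (h n) hn; rewrite ltxx.
exists (sup S).
have h1 : {ae P, forall w n, sup S - n.+1%:R^-1 <= f w}.
  apply/ae_foralln => n.
  have [r rS /ltW hr] : exists2 r, S r & sup S - n.+1%:R^-1 < r.
    by apply: sup_gt => //; rewrite ltrBlDr ltrDl.
  by apply: filterS rS => w /ltW; apply: le_trans.
have h2 : {ae P, forall w n, f w <= sup S + n.+1%:R^-1}.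
  apply/ae_foralln => n; have [//|h] := dich (sup S + n.+1%:R^-1).
  have /(ub_le_sup ubS) : S (sup S + n.+1%:R^-1) by [].
  by rewrite gerDl leNgt invr_gt0 ltr0n.
apply: filterS2 h1 h2 => w h1 h2; apply/eqP; rewrite eq_le; apply/andP; split.
  apply/ler_addgt0Pr => e e0; have [n hn] := exists_invS_lt e0.
  by apply: (le_trans (h2 n)); rewrite lerD2l ltW.
apply/ler_addgt0Pr => e e0; have [n hn] := exists_invS_lt e0.
by rewrite -lerBlDr; apply: le_trans (h1 n); rewrite lerD2l lerN2 ltW.
Qed.

Lemma measurable_B t (i : 'I_m) : t \in `[0, T] ->
  measurable_fun setT (fun w => B t w i ord0).
Proof. by case: hB => h _ _ _ _; exact: h. Qed.

Lemma adapted_B t s (i : 'I_m) : 0 <= s -> s <= t -> t <= T ->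
  meas_wrt (Fil t) (fun w => B s w i ord0).
Proof.
move=> s0 st tT U mU; apply: sub_sigma_algebra; left.
apply: sub_sigma_algebra; exists s, i, U; split=> //.
by rewrite in_itv/= s0 st.
Qed.

(** [brownian_motion] states independence from the natural past only; this replaces an augmented
    event by a natural one up to a null set. Events with such a substitute form a sigma-algebra. *)
Lemma Fil_natural t A : t <= T -> Fil t A ->
  exists2 A', natural_filtration B t A' & {ae P, forall w, A w <-> A' w}.
Proof.
move=> tT; move: A; apply: smallest_sub.
  split=> /=.
  - exists set0; first exact: sigma_algebra0.
    exact: aeW.
  - move=> A [A' nA' h]; exists (setT `\` A').
      exact: sigma_algebraCD.
    by apply: filterS h => w h /=; split=> -[_ ?]; split=> // /h.
  - move=> A hA.
    have /choice[A' hA'] : forall n, exists A', natural_filtration B t A' /\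
        {ae P, forall w, A n w <-> A' w}.
      by move=> n; have [A' ? ?] := hA n; exists A'.
    exists (\bigcup_n A' n); first by apply: sigma_algebra_bigcup => n; case: (hA' n).
    have : {ae P, forall w n, A n w <-> A' n w}.
      by apply/ae_foralln => n; case: (hA' n).
    by apply: filterS => w h; split => -[n _ An]; exists n => //; exact/h.
move=> A [nA|nA]; first by exists A => //; exact: aeW.
exists set0; first exact: sigma_algebra0.
by apply: negligibleS nA => w /= h; apply: contrapT => nAw; apply: h; split.
Qed.

Lemma indep_incr s t G (U : 'I_m -> set R) :
  0 <= s -> s < t -> t <= T -> Fil s G -> (forall i, measurable (U i)) ->
  P (G `&` incr_event B s t U) =
  (P G * \prod_(i < m) normal_prob 0 (Num.sqrt (t - s)) (U i))%E.
Proof.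
move=> s0 st tT FG mU; have sT := le_trans (ltW st) tT.
have [G' nG' GG'] := Fil_natural sT FG.
have mI : measurable (incr_event B s t U).
  rewrite (_ : incr_event _ _ _ _ = \bigcap_(i in [set: 'I_m])
      [set w | U i ((B t w - B s w) i ord0)]); last first.
    by apply/seteqP; split=> w /= h i; [move=> _|]; exact: h.
  apply: fin_bigcap_measurable => // i _.
  rewrite -[X in measurable X]setTI; under eq_fun do rewrite mxE mxE.
  apply: (measurable_funB (measurable_B _ _) (measurable_B _ _)) => //.
    by rewrite in_itv/= tT (le_trans s0 (ltW st)).
  by rewrite in_itv/= s0 sT.
rewrite (probability_ae_iff hPc (A := G `&` _) (B := G' `&` incr_event B s t U)); last 2 first.
- apply: measurableI => //; exact: Fil_measurable FG.
- by apply: filterS GG' => w h /=; rewrite h.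
rewrite (probability_ae_iff hPc (A := G) (B := G')) //; last exact: Fil_measurable FG.
case: hB => _ _ _ h1 h2; rewrite h1// h2//.
Qed.

(** * One Brownian increment, coordinate by coordinate *)

Section one_step.
Variables (s t : R) (s0 : 0 <= s) (st : s < t) (tT : t <= T).
Let dB (i : 'I_m) (w : Om) : R := (B t w - B s w) i ord0.
(** Stable under intersections, this family generates the information of [Fil s] together with the
    first [k] coordinates of the increment, so that coordinates can be integrated out one at a
    time. *)
Let gen (k : nat) : set (set Om) :=
  [set A | exists G (U : 'I_m -> set R), [/\ Fil s G, forall i, measurable (U i) &
     A = G `&` [set w | forall i : 'I_m, (i < k)%N -> U i (dB i w)]]].

Let sqrt_gt0 : Num.sqrt (t - s) != 0.
Proof. by rewrite gt_eqF// sqrtr_gt0 subr_gt0. Qed.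

Let mdB i : measurable_fun setT (dB i).
Proof.
rewrite /dB; under eq_fun do rewrite mxE mxE.
apply: (measurable_funB (measurable_B _ _) (measurable_B _ _)) => //.
  by rewrite in_itv/= tT (le_trans s0 (ltW st)).
by rewrite in_itv/= s0 (le_trans (ltW st) tT).
Qed.

Let gen_measurable k : <<s gen k >> `<=` measurable.
Proof.
apply: smallest_sub; first exact: sigma_algebra_measurable.
move=> _ [G [U [FG mU ->]]]; apply: measurableI.
  exact: (Fil_measurable (le_trans (ltW st) tT) FG).
rewrite (_ : [set w | _] = \bigcap_(i in [set i : 'I_m | (i < k)%N])
    (dB i @^-1` U i)); last first.
  by apply/seteqP; split=> w /= h i; exact: h.
apply: fin_bigcap_measurable => // i _.
by rewrite -[X in measurable X]setTI; exact: mdB.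
Qed.

Let gen_Fil k : Fil s `<=` <<s gen k >>.
Proof.
move=> A FA; apply: sub_sigma_algebra; exists A, (fun=> setT); split=> //.
by apply/seteqP; split=> w //= [].
Qed.

Let gen_dB k (i : 'I_m) : (i < k)%N -> meas_wrt <<s gen k >> (dB i).
Proof.
move=> ik U mU; apply: sub_sigma_algebra.
exists setT, (fun j => if j == i then U else setT); split=> //.
- exact: (@measurableT _ (FT s)).
- by move=> j; case: ifP.
apply/seteqP; split=> w /=.
  by move=> h; split=> // j _; case: eqP => // ->.
by move=> [_ /(_ i ik)]; rewrite eqxx.
Qed.

(** A Dynkin argument: on generators the formula is [indep_incr] applied to boxes, and both sides
    respect complements and disjoint unions. *)
Let gen_indep (k : 'I_m) A (U : set R) : <<s gen k >> A -> measurable U ->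
  P (A `&` dB k @^-1` U) = (P A * normal_prob 0 (Num.sqrt (t - s)) U)%E.
Proof.
move=> gA mU; move: A gA.
have mk A : <<s gen k >> A -> measurable (A `&` dB k @^-1` U).
  move=> /gen_measurable mA; apply: measurableI => //.
  by rewrite -[X in measurable X]setTI; exact: mdB.
have fN : normal_prob 0 (Num.sqrt (t - s)) U \is a fin_num by exact: fin_num_measure.
have H1 (G : set Om) (V : 'I_m -> set R) : Fil s G -> (forall i, measurable (V i)) ->
    P ((G `&` [set w | forall i : 'I_m, (i < k)%N -> V i (dB i w)]) `&` dB k @^-1` U) =
    (P (G `&` [set w | forall i : 'I_m, (i < k)%N -> V i (dB i w)]) *
     normal_prob 0 (Num.sqrt (t - s)) U)%E.
  move=> FG mV.
  (* [V1] leaves the coordinates from [k] on free and [V2] adds the constraint [U] at coordinate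
     [k]. Both describe increment events, whose product formulas differ by exactly one factor. *)
  pose V1 (i : 'I_m) := if (i < k)%N then V i else setT.
  pose V2 (i : 'I_m) := if i == k then U else V1 i.
  have mV1 i : measurable (V1 i) by rewrite /V1; case: ifP.
  have mV2 i : measurable (V2 i) by rewrite /V2; case: ifP.
  have -> : [set w | forall i : 'I_m, (i < k)%N -> V i (dB i w)] = incr_event B s t V1.
    apply/seteqP; split=> w h i; rewrite /V1; first by case: ifP => // ik; exact: h.
    by move=> ik; have := h i; rewrite /V1 ik.
  have -> : G `&` incr_event B s t V1 `&` dB k @^-1` U = G `&` incr_event B s t V2.
    rewrite -setIA; congr (_ `&` _); apply/seteqP; split=> w /=.
      by move=> [h hU] i; rewrite /V2; case: eqP => [->//|_]; exact: h.
    move=> h; split; last by have := h k; rewrite /V2 eqxx.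
    by move=> i; have := h i; rewrite /V2; case: eqP => [->|//]; rewrite /V1 ltnn.
  rewrite !indep_incr// -muleA; congr *%E.
  rewrite (bigD1 k)//= [in RHS](bigD1 k)//= {1}/V2 eqxx {1}/V1 ltnn probability_setT mul1e.
  rewrite muleC; congr *%E; apply: eq_bigr => i ik; by rewrite /V2 (negbTE ik).
apply: (@dynkin_induction _ (g_sigma_algebraType (gen k)) (gen k)) => //.
- move=> _ _ [G [V [FG mV ->]]] [G' [V' [FG' mV' ->]]].
  exists (G `&` G'), (fun i => V i `&` V' i); split.
  + exact: (@measurableI _ (FT s)).
  + by move=> i; exact: measurableI.
  + apply/seteqP; split=> w /=; first by move=> [[? h] [? h']]; split=> // i ik; split; [exact: h|exact: h'].
    by move=> [[? ?] h]; split; split=> // i ik; case: (h i ik).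
- have := H1 setT (fun=> setT) (@measurableT _ (FT s)) (fun=> measurableT).
  by rewrite (_ : [set w | _] = setT) ?setIT//; apply/seteqP; split.
- by move=> _ [G [V [FG mV ->]]]; exact: H1.
- move=> S mS hS.
  have mS' := gen_measurable mS.
  have -> : ~` S `&` dB k @^-1` U = (dB k @^-1` U) `\` S by rewrite setIC.
  have := H1 setT (fun=> setT) (@measurableT _ (FT s)) (fun=> measurableT).
  rewrite (_ : [set w | _] = setT); last by apply/seteqP; split.
  rewrite ?setIT ?setTI// probability_setT mul1e => HU.
  have mdU : measurable (dB k @^-1` U) by rewrite -[X in measurable X]setTI; exact: mdB.
  rewrite measureD//=.
  rewrite setIC hS HU probability_setC// muleBl//; first by rewrite mul1e.
  by rewrite ltey_eq fin_num_measure.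
- move=> F mF tF hF.
  rewrite setI_bigcupl measure_bigcup//; last 2 first.
  + by move=> n _; apply: mk; exact: mF.
  + by apply: trivIset_setIr.
  rewrite measure_bigcup//; last by move=> n _; exact: gen_measurable (mF n).
  rewrite -(fineK fN) muleC -nneseriesZl//.
  under [in RHS]eq_eseriesr do rewrite muleC.
  by apply: eq_eseriesr => n _; rewrite (fineK fN); exact: hF.
Qed.

(** The exponent is a sum over coordinates. Each coordinate of the increment is independent of
    [Fil s] and of the previous coordinates, so [gauss_step] removes the last one and induction does
    the rest. *)
Lemma one_step (W : Om -> R) (xi : Om -> 'cV[R]_m) :
  meas_wrt (Fil s) W -> (forall w, 0 <= W w) ->
  (forall i, meas_wrt (Fil s) (fun w => xi w i ord0)) ->
  (\int[P]_w (W w * expR (vdot (xi w) (B t w - B s w) -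
     2^-1 * vdot (xi w) (xi w) * (t - s)))%:E = \int[P]_w (W w)%:E)%E.
Proof.
move=> mW W0 mxi.
pose E (k : nat) (w : Om) : R := W w * expR (\sum_(i < m | (i < k)%N)
  (xi w i ord0 * dB i w - 2^-1 * xi w i ord0 ^+ 2 * (t - s))).
have mE k : meas_wrt <<s gen k >> (E k).
  apply/meas_wrt_gE; apply: measurable_funM.
    by apply/meas_wrt_gE => U mU; exact: gen_Fil (mW _ mU).
  apply: measurableT_comp => //.
  under eq_fun do rewrite big_mkcond.
  suff h (i : 'I_m) : measurable_fun [set: g_sigma_algebraType (gen k)]
      (fun w => if (i < k)%N then
      xi w i ord0 * dB i w - 2^-1 * xi w i ord0 ^+ 2 * (t - s) else 0).
    exact: (measurable_sum _ h).
  have [ik|_] := boolP (i < k)%N; last exact: measurable_cst.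
  have mx : measurable_fun [set: g_sigma_algebraType (gen k)] (fun w => xi w i ord0).
    by apply/meas_wrt_gE => U mU; exact: gen_Fil (mxi i _ mU).
  apply: measurable_funB; first by apply: measurable_funM => //; apply/meas_wrt_gE; exact: gen_dB.
  by do 2!apply: measurable_funM => //; exact: measurable_funX.
have E0 k w : 0 <= E k w by rewrite mulr_ge0 ?expR_ge0.
have step k : (k <= m)%N -> (\int[P]_w (E k w)%:E = \int[P]_w (W w)%:E)%E.
  elim: k => [_|k IH km].
    apply: eq_integral => w _; rewrite /E big_pred0 ?expR0 ?mulr1//.
  have <- := IH (ltnW km).
  pose ko := Ordinal km.
  have mEk : measurable_fun [set: g_sigma_algebraType (gen k)] (E k).
    by apply/meas_wrt_gE; exact: mE.
  have mxk : measurable_fun [set: g_sigma_algebraType (gen k)] (fun w => xi w ko ord0).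
    by apply/meas_wrt_gE => U mU; exact: gen_Fil (mxi ko _ mU).
  have <- := gauss_step (@gen_measurable k) (@mdB ko) sqrt_gt0 (@gen_indep ko) mEk mxk (E0 k).
  apply: eq_integral => w _; congr EFin.
  rewrite /E -mulrA -expRD; congr (_ * expR _).
  rewrite (bigD1 ko)//= addrC sqr_sqrtr ?subr_ge0 ?ltW//; congr (_ + _).
  apply: eq_bigl => i; rewrite ltnS -val_eqE/= [RHS]ltn_neqAle andbC//.
have <- := step m (leqnn m); apply: eq_integral => w _; congr (EFin (_ * expR _)).
rewrite /vdot !mxE mulr_sumr mulr_suml -sumrB.
rewrite [RHS](eq_bigl xpredT); last by move=> i; rewrite ltn_ord.
by apply: eq_bigr => i _; rewrite !mxE -expr2 /dB !mxE.
Qed.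

End one_step.

End filtration.

(** * Exponentials of simple integrals *)

Section simple_integrands.
Context (R : realType) (d0 : measure_display) (Om : measurableType d0)
  (P : probability Om R) (hPc : measure_is_complete P) (T : R) (hT : 0 < T)
  (m : nat) (B : R -> Om -> 'cV[R]_m) (hB : brownian_motion P T B).
Local Notation Fil := (augmented_filtration P B).
Local Notation FT t :=
  (g_sigma_algebraType (natural_filtration B t `|` P.-negligible)).

(** For [s <= t] this is the projection of the time [x] onto the interval from [s] to [t];
    differences of clamped nodes are the lengths of the parts of the steps inside that interval. *)
Definition clamp (s t x : R) : R := Num.max s (Num.min t x).

Definition simple_quad (S : simple_integrand Om R m) (s t : R) (w : Om) : R :=
  \sum_(j < nstep S) vdot (coef S j w) (coef S j w) *
    (clamp s t (node S j.+1) - clamp s t (node S j)).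

Lemma clamp_ge s t x : s <= clamp s t x.
Proof. by rewrite /clamp le_max lexx. Qed.

Lemma clamp_le s t x : s <= t -> clamp s t x <= t.
Proof. by move=> st; rewrite /clamp ge_max st ge_min lexx. Qed.

Lemma clamp_mono s t x y : x <= y -> clamp s t x <= clamp s t y.
Proof.
move=> xy; rewrite /clamp ge_max le_max lexx/= le_max; apply/orP; right.
by rewrite le_min ge_min lexx/= ge_min xy orbT.
Qed.

(** A step that really meets the interval has its clamped left end at or after its node, so its
    coefficient is known there. Steps collapsed to a point fall outside this lemma and contribute
    the factor 1. *)
Lemma clamp_lt_ge s t x y : s <= t -> x <= y -> clamp s t x < clamp s t y ->
  x <= clamp s t x.
Proof.
move=> st xy; rewrite /clamp.
case/orP: (le_total t x) => [tx|xt]; last by rewrite (min_r xt) le_max lexx orbT.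
by rewrite (min_l (le_trans tx xy)) (min_l tx) ltxx.
Qed.

Lemma clampE (f : R -> 'cV[R]_m) s t x : s <= t ->
  f (Num.min t x) - f (Num.min s x) = f (clamp s t x) - f s.
Proof.
move=> st; rewrite /clamp; case/orP: (le_total x s) => [xs|sx].
  by rewrite (min_r (le_trans xs st)) (min_r xs) max_l// !subrr.
by rewrite (min_l sx) max_r// le_min st.
Qed.

Lemma simple_integralB S s t w : s <= t ->
  simple_integral B S t w - simple_integral B S s w =
  \sum_(j < nstep S) vdot (coef S j w)
    (B (clamp s t (node S j.+1)) w - B (clamp s t (node S j)) w).
Proof.
move=> st; rewrite /simple_integral -sumrB; apply: eq_bigr => j _.
rewrite -vdotBr; congr (vdot _ _).
have h x := clampE (fun u => B u w) x st.
move: (h (node S j.+1)) (h (node S j)).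
set b1 := B _ w; set b2 := B _ w; set b3 := B _ w; set b0 := B s w.
set b4 := B _ w; set b5 := B _ w; set b6 := B _ w => h1 h2.
apply/eqP; rewrite -subr_eq0; apply/eqP.
have -> : b1 - b4 - (b2 - b5) - (b3 - b6) =
  ((b1 - b2) - (b3 - b0)) - ((b4 - b5) - (b6 - b0)).
  by apply/matrixP => i k; rewrite !mxE; ring.
by rewrite h1 h2 !subrr.
Qed.

Section wf.
Variables (S : simple_integrand Om R m) (wfS : simple_wf Fil T S).

(** The exponential factorises over the clamped steps. [one_step] removes the last factor each time,
    the product of the previous ones serving as the weight. *)
Lemma simple_exp_integral s t (W : Om -> R) : 0 <= s -> s <= t -> t <= T ->
  meas_wrt (Fil s) W -> (forall w, 0 <= W w) ->
  (\int[P]_w (W w * expR (simple_integral B S t w - simple_integral B S s w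
     - 2^-1 * simple_quad S s t w))%:E = \int[P]_w (W w)%:E)%E.
Proof.
move=> s0 st tT mW W0.
pose a j := clamp s t (node S j).
pose e (j : nat) w := vdot (coef S j w) (B (a j.+1) w - B (a j) w)
  - 2^-1 * vdot (coef S j w) (coef S j w) * (a j.+1 - a j).
pose E (k : nat) (w : Om) : R := W w * expR (\sum_(j < k) e j w).
have E0 k w : 0 <= E k w by rewrite mulr_ge0 ?expR_ge0.
case: (wfS) => nodeT nodeS mcoef _.
have as_ j : s <= a j by exact: clamp_ge.
have at_ j : a j <= t by exact: clamp_le.
have aS j : (j < nstep S)%N -> a j <= a j.+1 by move=> jn; apply: clamp_mono; exact: nodeS.
have ES k : a k = a k.+1 -> E k.+1 = E k.
  move=> aE; apply/funext => w; rewrite /E big_ord_recr/= {2}/e aE !subrr.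
  by rewrite vdot0r mulr0 subr0 addr0.
have ESr k : E k.+1 = (fun w => E k w * expR (e k w)).
  by apply/funext => w; rewrite /E big_ord_recr/= expRD mulrA.
have mc k : (k < nstep S)%N -> a k < a k.+1 ->
    forall i, meas_wrt (Fil (a k)) (fun w => coef S k w i ord0).
  move=> kn ak i; apply: meas_wrt_mono; last exact: (mcoef k i kn).
  exact: (clamp_lt_ge st (nodeS k kn) ak).
have mE k : (k <= nstep S)%N -> meas_wrt (Fil (a k)) (E k).
  elim: k => [_|k IH kn].
    rewrite /E; under eq_fun do rewrite big_ord0 expR0 mulr1.
    exact: (meas_wrt_mono (as_ 0%N) mW).
  have := aS k kn; rewrite le_eqVlt => /orP[/eqP aE|ak].
    by rewrite ES// -aE; apply: IH; exact: ltnW.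
  rewrite ESr.
  apply/meas_wrtP; apply: measurable_funM.
    by apply/meas_wrtP; apply: (meas_wrt_mono (ltW ak)); apply: IH; exact: ltnW.
  apply: measurableT_comp => //; rewrite /e; under eq_fun do rewrite !vdotE.
  have mci i : measurable_fun [set: FT (a k.+1)] (fun w => coef S k w i ord0).
    by apply/meas_wrtP; apply: (meas_wrt_mono (ltW ak)); exact: mc.
  apply: measurable_funB.
    apply: measurable_sum => i; apply: measurable_funM => //.
    under eq_fun do rewrite !mxE.
    apply: measurable_funB; apply/meas_wrtP.
      by apply: adapted_B => //; exact: (le_trans s0).
    by apply: adapted_B => //; [exact: (le_trans s0)|exact: ltW].
  apply: measurable_funM => //; apply: measurable_funM => //.
  by apply: measurable_sum => i; exact: measurable_funM.
have step k : (k <= nstep S)%N -> (\int[P]_w (E k w)%:E = \int[P]_w (W w)%:E)%E.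
  elim: k => [_|k IH kn].
    by apply: eq_integral => w _; rewrite /E big_ord0 expR0 mulr1.
  have <- := IH (ltnW kn).
  have := aS k kn; rewrite le_eqVlt => /orP[/eqP aE|ak]; first by rewrite ES.
  have <- := one_step hPc hB (le_trans s0 (as_ k)) ak (le_trans (at_ _) tT)
    (mE k (ltnW kn)) (E0 k) (mc k kn ak).
  by rewrite ESr.
have <- := step (nstep S) (leqnn _).
apply: eq_integral => w _; congr (EFin (_ * expR _)).
rewrite simple_integralB// /simple_quad mulr_sumr -sumrB.
by apply: eq_bigr => j _; rewrite /e mulrA.
Qed.

End wf.
End simple_integrands.

(** * Predictable processes *)

Section predictable_processes.
Context (R : realType) (d0 : measure_display) (Om : measurableType d0)
  (P : probability Om R) (hPc : measure_is_complete P) (T : R) (hT : 0 < T)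
  (m : nat) (B : R -> Om -> 'cV[R]_m) (hB : brownian_motion P T B).
Local Notation Fil := (augmented_filtration P B).
Local Notation FT t :=
  (g_sigma_algebraType (natural_filtration B t `|` P.-negligible)).
Local Notation mu := (@lebesgue_measure R).

Definition predictable_gen : set (set (R * Om)) :=
  [set D | exists2 A, Fil 0 A & D = [set 0] `*` A] `|`
  [set D | exists s t A, [/\ 0 <= s, s < t, t <= T, Fil s A &
                                 D = `]s, t] `*` A]].

Let D0 : set (R * Om) := [set p | p.1 \in `[0, T]].

Let D0_gen : <<s predictable_gen >> D0.
Proof.
have FT0 : Fil 0 [set: Om] by exact: (@measurableT _ (FT 0)).
have -> : D0 = ([set 0] `*` setT) `|` (`]0, T] `*` setT).
  apply/seteqP; split=> -[t w]; rewrite /D0/= !in_itv/=.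
    move=> /andP[]; rewrite le_eqVlt => /orP[/eqP <-|->] tT; first by left.
    by right.
  by move=> [[-> _]|[/andP[/ltW -> ->]]]; rewrite ?lexx ?(ltW hT).
apply: (@measurableU _ (g_sigma_algebraType predictable_gen)); apply: sub_sigma_algebra.
  by left; exists setT.
by right; exists 0, T, setT; split.
Qed.

(** [predictable_sigma] is relative to the strip of times in [[0, T]]. On subsets of the strip it
    agrees with the plain generated sigma-algebra, so predictability becomes ordinary measurability
    of a function. *)
Lemma predictable_sigmaE A : A `<=` D0 ->
  predictable_sigma Fil T A <-> <<s predictable_gen >> A.
Proof.
move=> AD; split.
  move: A {AD}; apply: smallest_sub; last exact: sub_sigma_algebra.
  split.
  - exact: sigma_algebra0.
  - by move=> A gA; exact: (@measurableD _ (g_sigma_algebraType predictable_gen) _ _ D0_gen gA).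
  - exact: sigma_algebra_bigcup.
have D0D : predictable_sigma Fil T D0.
  by rewrite -[X in predictable_sigma _ _ X]setD0; apply: sigma_algebraCD; exact: sigma_algebra0.
suff h : <<s predictable_gen >> `<=` [set A | predictable_sigma Fil T (A `&` D0)].
  by move=> /h /=; rewrite (setIidl AD).
apply: smallest_sub.
  split=> /=.
  - by rewrite set0I; exact: sigma_algebra0.
  - move=> A' gA.
    have -> : ([set: R * Om] `\` A') `&` D0 = D0 `\` (A' `&` D0).
      by apply/seteqP; split=> x /=; tauto.
    exact: sigma_algebraCD.
  - move=> F hF; rewrite setI_bigcupl; exact: sigma_algebra_bigcup.
move=> A' gA /=; rewrite (setIidl (A := A')); first exact: sub_sigma_algebra.
move: gA => [[A1 _ ->]|[s [t [A1 [s0 st tT _ ->]]]]] -[u w] /= [];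
    rewrite /D0/=.
  by move=> -> _; rewrite in_itv/= lexx ltW.
by rewrite !in_itv/= => /andP[su ut] _; rewrite (le_trans s0 (ltW su)) (le_trans ut).
Qed.

Definition pmeas (f : R -> Om -> R) :=
  measurable_fun (D0 : set (g_sigma_algebraType predictable_gen))
    (fun tw : g_sigma_algebraType predictable_gen => f tw.1 tw.2).

Lemma predictable_mxP p q (H : R -> Om -> 'M[R]_(p, q)) :
  predictable_mx Fil T H <-> forall i j, pmeas (fun t w => H t w i j).
Proof.
have E i j U : [set tw : R * Om | tw.1 \in `[0, T] /\ U (H tw.1 tw.2 i j)] =
  D0 `&` (fun tw => H tw.1 tw.2 i j) @^-1` U by [].
split=> h i j.
  move=> _ U mU; apply/predictable_sigmaE; first by apply: subIsetl.
  by rewrite -E; exact: h.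
move=> U mU; apply/predictable_sigmaE; first by move=> ? [].
by apply: (h i j).
Qed.

Lemma predictable_pmeas (Y : R -> Om -> R) : predictable Fil T Y <-> pmeas Y.
Proof.
rewrite /predictable predictable_mxP; split=> [/(_ 0 0)|h i j].
  by under [X in pmeas X]eq_fun do under eq_fun do rewrite mxE eqxx mulr1n.
by under [X in pmeas X]eq_fun do under eq_fun do rewrite !ord1 mxE eqxx mulr1n.
Qed.

(** Predictable processes are progressively measurable: cut at time [r], a generating rectangle
    based on [Fil s] is empty if [r < s], and otherwise lies in the product of the Borel sets with
    [Fil r]. *)
Lemma pmeas_joint r f : 0 <= r -> r <= T -> pmeas f ->
  measurable_fun (`[0, r] `*` setT : set (measurableTypeR R * FT r)%type)
    (fun tw => f tw.1 tw.2).
Proof.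
move=> r0 rT mf.
have mD : measurable (`[0, r] `*` setT : set (measurableTypeR R * FT r)%type).
  by apply: measurableX.
pose G := [set A : set (R * Om) | measurable ((`[0, r] `*` setT) `&` A : set (measurableTypeR R * FT r)%type)].
suff h : <<s predictable_gen >> `<=` G.
  move=> _ U mU; have := h _ (mf D0_gen U mU); rewrite /G/=.
  rewrite setIA (setIidl (A := _ `*` _))//.
  by move=> [t w]; rewrite /D0/= !in_itv/= => -[/andP[-> /le_trans ->]].
apply: smallest_sub.
  split.
  - by rewrite /G/= setI0.
  - move=> A gA; rewrite /G/= setTD.
    rewrite (_ : _ `&` ~` A = (`[0, r] `*` setT) `\` ((`[0, r] `*` setT) `&` A)).
      exact: measurableD.
    by apply/seteqP; split=> x /=; tauto.
  - by move=> F hF; rewrite /G/= setI_bigcupr; apply: bigcup_measurable => k _; exact: hF.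
move=> _ [[A FA ->]|[s [t [A [s0 st tT FA ->]]]]]; rewrite /G/= -setXI setTI.
  apply: measurableX; first by apply: measurableI => //.
  exact: (Fil_mono r0 FA).
have [sr|rs] := leP s r.
  apply: measurableX; first by apply: measurableI.
  exact: (Fil_mono sr FA).
rewrite (_ : _ `&` _ = set0) ?set0X//; apply/seteqP; split=> // x /=.
by rewrite !in_itv/= => -[/andP[_ xr] /andP[sx _]]; move: (lt_trans (le_lt_trans xr rs) sx); rewrite ltxx.
Qed.

Lemma pmeas_section f w : pmeas f -> measurable_fun `[0, T] (f ^~ w).
Proof.
move=> /(pmeas_joint (ltW hT) (lexx T)) mf.
have h : measurable_fun `[0, T]%classic
    (fun t : measurableTypeR R => (t, w) : measurableTypeR R * FT T).
  by apply: measurable_funTS; exact: pair2_measurable.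
have mD : measurable (`[0, T] `*` setT : set (measurableTypeR R * FT T)%type).
  by apply: measurableX.
apply: (measurable_comp mD _ mf h).
by move=> _ [t /= tT <-].
Qed.

(** Tonelli on the product of time with [Fil r], made available by progressive measurability; the
    time integral is therefore known already at time [r]. *)
Lemma measurable_ge0_time_integral (g : R -> Om -> R) a b r :
  (forall t w, 0 <= g t w) -> 0 <= a -> b <= r -> 0 <= r -> r <= T -> pmeas g ->
  measurable_fun [set: FT r] (fun w => \int[mu]_(s in `[a, b]) (g s w)%:E)%E.
Proof.
move=> g0 a0 br r0 rT mg.
have mg' := pmeas_joint r0 rT mg.
have mD : measurable (`[0, r] `*` setT : set (measurableTypeR R * FT r)%type).
  by apply: measurableX.
have sub : (`[a, b] `*` setT : set (measurableTypeR R * FT r)%type) `<=` `[0, r] `*` setT.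
  move=> [t w] /= []; rewrite !in_itv/= => /andP[at_ tb] _.
  by rewrite (le_trans a0 at_) (le_trans tb).
have mD' : measurable (`[a, b] `*` setT : set (measurableTypeR R * FT r)%type).
  by apply: measurableX.
pose h (tw : measurableTypeR R * FT r) : \bar R :=
  ((fun tw => (g tw.1 tw.2)%:E) \_ (`[a, b] `*` setT)) tw.
have mh : measurable_fun setT h.
  apply/(measurable_restrictT _ mD').
  by apply/measurable_EFinP; exact: measurable_funS mg'.
have h0 z : (0 <= h z)%E by rewrite /h patchE; case: ifP => // _; rewrite lee_fin.
have := measurable_fun_fubini_tonelli_G (m1 := mu) h mh h0.
apply: eq_measurable_fun => w _; rewrite /fubini_G/= [RHS]integral_mkcond.
apply: eq_integral => t _; rewrite /h !patchE.
by congr (if _ then _ else _); apply/idP/idP; rewrite !inE/=; [case|].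
Qed.

Lemma meas_wrt_time_integral (g : R -> Om -> R) a b r :
  0 <= a -> b <= r -> 0 <= r -> r <= T -> pmeas g ->
  meas_wrt (Fil r) (fun w => \int[mu]_(s in `[a, b]) g s w).
Proof.
move=> a0 br r0 rT mg; apply/meas_wrtP; rewrite /Rintegral.
apply: (measurableT_comp (fine_measurable measurableT)).
under eq_fun do rewrite integralE.
apply: emeasurable_funB.
  rewrite (_ : (fun w => _) = fun w => \int[mu]_(s in `[a, b]) (Num.max (g s w) 0)%:E)%E.
    apply: measurable_ge0_time_integral => //; first by move=> t w; rewrite le_max lexx orbT.
    by apply: measurable_maxr.
  by apply/funext => w; apply: eq_integral => t _; rewrite funeposE/= EFin_max.
rewrite (_ : (fun w => _) = fun w => \int[mu]_(s in `[a, b]) (Num.max (- g s w) 0)%:E)%E.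
  apply: measurable_ge0_time_integral => //; first by move=> t w; rewrite le_max lexx orbT.
  by apply: measurable_maxr => //; exact: measurable_funN.
by apply/funext => w; apply: eq_integral => t _; rewrite funenegE/= EFin_max.
Qed.

End predictable_processes.

(** * Convergence in probability and almost sure subsequences *)

Section almost_sure_subsequences.
Context (R : realType) (d0 : measure_display) (Om : measurableType d0)
  (P : probability Om R).

(** Powers of one half, in the shape of the summability lemma [epsilon_trick0]. The fast choices of
    indices below are made at this rate. *)
Definition rate (n : nat) : R := 1 / (2 ^ n.+1)%:R.

Lemma rate_gt0 n : 0 < rate n.
Proof. by rewrite /rate divr_gt0// ltr0n expn_gt0. Qed.

Lemma rate_le_invS n : rate n <= n.+1%:R^-1.
Proof.
rewrite /rate div1r lef_pV2 ?posrE ?ltr0n ?expn_gt0// ler_nat.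
exact: ltnW (ltn_expl _ _).
Qed.

Lemma rate_small e : 0 < e -> exists n0, forall n, (n0 <= n)%N -> rate n <= e.
Proof.
move=> e0; have [n0 h] := exists_invS_lt e0; exists n0 => n nn0.
apply: (le_trans (rate_le_invS n)); apply: le_trans (ltW h).
by rewrite lef_pV2 ?posrE ?ltr0n// ler_nat ltnS.
Qed.

Lemma borel_cantelli (A : nat -> set Om) : (forall n, measurable (A n)) ->
  (forall n, (P (A n) <= (rate n)%:E)%E) ->
  {ae P, forall w, exists N, forall n, (N <= n)%N -> ~ A n w}.
Proof.
move=> mA PA.
have h : P (lim_sup_set A) = 0%E.
  apply: lim_sup_set_cvg0 => //; apply: (@le_lt_trans _ _ 1%:E); last exact: ltry.
  by apply: le_trans (epsilon_trick0 xpredT ler01); apply: lee_nneseries => *;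
    [exact: measure_ge0|exact: PA].
exists (lim_sup_set A); split=> //.
  by apply: bigcap_measurableType => n _; apply: bigcup_measurable.
move=> w /= hw n _ /=; apply: contrapT => hn; apply: hw; exists n => k nk Ak.
by apply: hn; exists k.
Qed.

Definition eventually_small (x : nat -> \bar R) :=
  forall e : R, 0 < e -> exists n0, forall n, (n0 <= n)%N -> (x n <= e%:E)%E.

Lemma cvg0_in_probability_pick (X X' : nat -> Om -> \bar R) (e d : R) :
  cvg0_in_probability P X -> cvg0_in_probability P X' -> 0 < e -> 0 < d ->
  exists k, (P [set w | (e%:E < X k w)%E] < d%:E)%E /\
            (P [set w | (e%:E < X' k w)%E] < d%:E)%E.
Proof.
move=> cX cX' e0 d1.
have ev (Y : nat -> Om -> \bar R) : cvg0_in_probability P Y ->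
    \forall n \near \oo, (P [set w | (e%:E < Y n w)%E] < d%:E)%E.
  move=> cY; apply: (cY e e0 [set x | (x < d%:E)%E]).
  apply: open_nbhs_nbhs; split; first exact: open_ereal_lt_ereal.
  by rewrite /= lte_fin.
near \oo => k; exists k; split; near: k; exact: ev.
Unshelve. all: by end_near. Qed.

(** At rank [n] choose an index at which each sequence exceeds [rate n] with probability below
    [rate n / 2]; Borel-Cantelli then controls both along the same subsequence. *)
Lemma prob_to_as (X X' : nat -> Om -> \bar R) :
  (forall n, measurable_fun setT (X n)) -> (forall n, measurable_fun setT (X' n)) ->
  cvg0_in_probability P X -> cvg0_in_probability P X' ->
  exists phi : nat -> nat, {ae P, forall w, eventually_small (fun n => X (phi n) w) /\
     eventually_small (fun n => X' (phi n) w)}.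
Proof.
move=> mX mX' cX cX'.
have half n : 0 < rate n / 2 by rewrite divr_gt0// rate_gt0.
have /choice[phi hphi] : forall n, exists k,
    (P [set w | ((rate n)%:E < X k w)%E] < (rate n / 2)%:E)%E /\
    (P [set w | ((rate n)%:E < X' k w)%E] < (rate n / 2)%:E)%E.
  by move=> n; exact: cvg0_in_probability_pick (rate_gt0 n) (half n).
exists phi.
pose A n := [set w | ((rate n)%:E < X (phi n) w)%E] `|` [set w | ((rate n)%:E < X' (phi n) w)%E].
have mS (f : Om -> \bar R) (c : \bar R) : measurable_fun setT f -> measurable [set w | (c < f w)%E].
  by move=> mf; rewrite -[X in measurable X]setTI; exact: emeasurable_fun_o_infty.
have mA n : measurable (A n) by apply: measurableU; exact: mS.
have : {ae P, forall w, exists N, forall n, (N <= n)%N -> ~ A n w}.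
  apply: borel_cantelli => // n.
  apply: (le_trans (measureU2 _ _ _)); [exact: mS|exact: mS|].
  rewrite [rate n in leRHS]splitr EFinD; case: (hphi n) => h1 h2.
  by apply: leeD; exact: ltW.
apply: filterS => w [N hN].
have h (Y : nat -> Om -> \bar R) :
    (forall n, (N <= n)%N -> (Y (phi n) w <= (rate n)%:E)%E) ->
    eventually_small (fun n => Y (phi n) w).
  move=> hY e e0; have [n0 hn0] := rate_small e0; exists (maxn N n0) => n.
  rewrite geq_max => /andP[Nn nn0]; apply: (le_trans (hY n Nn)).
  by rewrite lee_fin hn0.
by split; apply: h => n Nn; rewrite leNgt; apply/negP => hX; apply: (hN n Nn);
  [left|right].
Unshelve. all: by end_near.
Qed.

(** Dominated convergence for the indicators of the exceedance events. *)
Lemma as_to_prob (X : nat -> Om -> \bar R) :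
  (forall n, measurable_fun setT (X n)) ->
  {ae P, forall w, eventually_small (fun n => X n w)} ->
  cvg0_in_probability P X.
Proof.
move=> mX h e e0.
pose A n := [set w | (e%:E < X n w)%E].
have mA n : measurable (A n).
  by rewrite -[X in measurable X]setTI; exact: emeasurable_fun_o_infty.
have E n : P (A n) = (\int[P]_w (\1_(A n) w)%:E)%E by rewrite integral_indic// setIT.
suff : (\int[P]_w (\1_(A n) w)%:E)%E @[n --> \oo] --> (\int[P]_w cst 0%E w)%E.
  by rewrite integral0; under eq_fun do rewrite -E.
have := @dominated_convergence _ _ _ P setT measurableT (fun n w => (\1_(A n) w)%:E)
  (cst 0%E) (cst 1%E).
case=> //.
- by move=> n; apply/measurable_EFinP; exact: measurable_indic.
- apply: filterS h => w /(_ e e0)[n0 hn0] _.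
  apply: cvg_near_cst; exists n0 => // n /= nn0.
  rewrite indicE memNset//= /A/= => hX; have := hn0 n nn0.
  by rewrite leNgt hX.
- exact: finite_measure_integrable_cst.
- apply: aeW => w n _; rewrite /= indicE normr_nat lee_fin.
  by case: (_ \in _).
Qed.

End almost_sure_subsequences.

(** * Ito integrals *)

Section time_grid.
Context (R : realType) (T : R) (hT : 0 < T).

(** A countable dense set of times containing 0 and [T]: the rationals projected onto [[0, T]], with
    [T] at codes that represent no rational. Statements that hold almost surely at each time are
    gathered along it. *)
Definition tq (n : nat) : R :=
  if (unpickle n : option rat) is Some r then clamp 0 T (ratr r) else T.

Lemma tq_ge0 n : 0 <= tq n.
Proof. by rewrite /tq; case: unpickle => [r|]; [exact: clamp_ge|exact: ltW]. Qed.

Lemma tq_le n : tq n <= T.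
Proof. by rewrite /tq; case: unpickle => [r|//]; apply: clamp_le; exact: ltW. Qed.

Lemma tq_in n : tq n \in `[0, T].
Proof. by rewrite in_itv/= tq_ge0 tq_le. Qed.

Lemma tq_right t e : 0 <= t -> t < T -> 0 < e -> exists n, t < tq n < t + e.
Proof.
move=> t0 tT e0; have : t < Num.min T (t + e) by rewrite lt_min tT ltrDl.
move=> /rat_in_itvoo[r]; rewrite in_itv/= lt_min => /andP[tr /andP[rT re]].
exists (pickle r); rewrite /tq pickleK /clamp min_r ?(ltW rT)// max_r ?tr//.
by rewrite (le_trans t0)// ltW.
Qed.

Lemma tq_T : exists n, tq n = T.
Proof.
have : T < T + 1 by rewrite ltrDl.
move=> /rat_in_itvoo[r]; rewrite in_itv/= => /andP[Tr _].
by exists (pickle r); rewrite /tq pickleK /clamp min_l ?(ltW Tr)// max_r// ltW.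
Qed.

Lemma tq_0 : exists n, tq n = 0.
Proof.
by exists (pickle (0 : rat)); rewrite /tq pickleK /clamp rmorph0 min_r ?maxxx// ltW.
Qed.

Definition right_cont (f : R -> R) :=
  forall t, 0 <= t -> t < T -> f s @[s --> t^'+] --> f t.

Lemma right_cont_le f c : right_cont f -> (forall n, f (tq n) <= c) ->
  forall t, 0 <= t -> t <= T -> f t <= c.
Proof.
move=> rf fc t t0; rewrite le_eqVlt => /orP[/eqP ->|tT].
  by have [n <-] := tq_T.
rewrite leNgt; apply/negP => cf.
have : \forall s \near t^'+, c < f s by apply: (cvgr_gt (f t)) => //; exact: rf.
move=> [e /= e0 he]; have [n /andP[tn ne]] := tq_right t0 tT e0.
have := he (tq n); rewrite /= distrC gtr0_norm ?subr_gt0// ltrBlDl.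
by move=> /(_ ne tn); rewrite ltNge fc.
Qed.

Lemma continuous_right_cont f : {within `[0, T], continuous f} -> right_cont f.
Proof.
move=> /(continuous_within_itvP _ hT)[f1 f2 _] t t0 tT.
have [->//|tn0] := eqVneq t 0.
apply: cvg_at_right_filter; apply: f1.
by rewrite in_itv/= tT lt_neqAle eq_sym tn0 t0.
Qed.

Lemma right_cont_min f x : 0 <= x -> x <= T -> right_cont f ->
  right_cont (fun t => f (Num.min t x)).
Proof.
move=> x0 xT rf t t0 tT; have [tx|xt] := ltP t x.
  apply: cvg_trans (rf t t0 tT); apply: near_eq_cvg; near=> s.
  by rewrite min_l//; near: s; exact: nbhs_right_le.
apply: cvg_near_cst; near=> s; apply/eqP; rewrite min_r// (le_trans xt)//.
Unshelve. all: by end_near.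
Qed.

Lemma right_contD f g : right_cont f -> right_cont g -> right_cont (fun t => f t + g t).
Proof. by move=> rf rg t t0 tT; apply: cvgD; [exact: rf|exact: rg]. Qed.

Lemma right_contN f : right_cont f -> right_cont (fun t => - f t).
Proof. by move=> rf t t0 tT; apply: cvgN; exact: rf. Qed.

Lemma right_contB f g : right_cont f -> right_cont g -> right_cont (fun t => f t - g t).
Proof. by move=> rf rg; apply: right_contD => //; exact: right_contN. Qed.

Lemma right_cont_norm f : right_cont f -> right_cont (fun t => `|f t|).
Proof. by move=> rf t t0 tT; apply: cvg_norm; exact: rf. Qed.

Lemma right_contZ c f : right_cont f -> right_cont (fun t => c * f t).
Proof. by move=> rf t t0 tT; apply: cvgM; [exact: cvg_cst|exact: rf]. Qed.

Lemma right_cont_cst c : right_cont (fun=> c).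
Proof. by move=> t t0 tT; exact: cvg_cst. Qed.

Lemma right_cont_sum (I : Type) (r : seq I) (f : I -> R -> R) :
  (forall i, right_cont (f i)) -> right_cont (fun t => \sum_(i <- r) f i t).
Proof.
move=> rf; elim: r => [|a r IH].
  by under [X in right_cont X]eq_fun do rewrite big_nil; exact: right_cont_cst.
by under [X in right_cont X]eq_fun do rewrite big_cons; exact: right_contD.
Qed.

(** By right continuity the supremum over all times agrees almost surely with the countable one
    along [tq], which is measurable; completeness of [P] transfers measurability. *)
Lemma measurable_sup_norm d0 (Om : measurableType d0) (P : probability Om R)
    (D : R -> Om -> R) : measure_is_complete P ->
  (forall t, t \in `[0, T] -> measurable_fun setT (D t)) ->
  {ae P, forall w, right_cont (D ^~ w)} ->
  measurable_fun setT (fun w => ereal_sup [set (`|D t w|)%:E | t in `[0, T]]).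
Proof.
move=> hPc mD rD.
apply: (ae_measurable_fun hPc (f := fun w => ereal_sup (range (fun n => (`|D (tq n) w|)%:E)))).
  apply: filterS rD => w rw _; apply/eqP; rewrite eq_le; apply/andP; split.
    by apply: ereal_sup_le => _ [n _ <-]; exists (tq n) => //; exact: tq_in.
  apply: ge_ereal_sup => _ [t tT <-].
  case E : (ereal_sup _) => [c||]; last 2 first.
  - by rewrite leey.
  - have : ((`|D (tq 0) w|)%:E <= ereal_sup (range (fun n => (`|D (tq n) w|)%:E)))%E.
      by apply: ereal_sup_ubound; exists 0%N.
    by rewrite E leeNy_eq.
  rewrite lee_fin; move: tT; rewrite /= in_itv/= => /andP[t0 tT].
  apply: (right_cont_le (right_cont_norm rw)) => // n.
  by rewrite -lee_fin -E; apply: ereal_sup_ubound; exists n.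
have := @measurable_fun_esups _ _ _ setT (fun n w => (`|D (tq n) w|)%:E) _ 0%N.
rewrite /esups/=.
under eq_fun do rewrite /sdrop/=.
rewrite (_ : [set n | (0 <= n)%N] = setT); last by apply/seteqP; split.
apply=> n; apply/measurable_EFinP; apply: measurableT_comp => //.
by apply: mD; exact: tq_in.
Qed.

End time_grid.

(** * Predictable calculus and pathwise approximation of Ito integrals *)

Section ito.
Context (R : realType) (d0 : measure_display) (Om : measurableType d0)
  (P : probability Om R) (hPc : measure_is_complete P) (T : R) (hT : 0 < T)
  (m : nat) (B : R -> Om -> 'cV[R]_m) (hB : brownian_motion P T B).
Local Notation Fil := (augmented_filtration P B).
Local Notation FT t :=
  (g_sigma_algebraType (natural_filtration B t `|` P.-negligible)).
Local Notation mu := (@lebesgue_measure R).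
Local Notation pm := (pmeas P T B).
Local Notation D0 := ([set p | p.1 \in `[0, T]] : set (g_sigma_algebraType (predictable_gen P T B))).

Lemma FT_measurable_fun d' (X : measurableType d') t (f : Om -> X) : t <= T ->
  measurable_fun [set: FT t] (f : FT t -> X) -> measurable_fun [set: Om] f.
Proof.
move=> tT mf _ U mU; rewrite setTI; apply: (Fil_measurable hPc hB tT).
by have := mf measurableT U mU; rewrite setTI.
Qed.

Lemma measurable_D0 : measurable D0.
Proof.
have FT0 : Fil 0 [set: Om] by exact: (@measurableT _ (FT 0)).
have -> : D0 = ([set 0] `*` setT) `|` (`]0, T] `*` setT).
  apply/seteqP; split=> -[t w]; rewrite /= !in_itv/=.
    move=> /andP[]; rewrite le_eqVlt => /orP[/eqP <-|->] tT; first by left.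
    by right.
  by move=> [[-> _]|[/andP[/ltW -> ->]]]; rewrite ?lexx ?(ltW hT).
apply: measurableU; apply: sub_sigma_algebra.
  by left; exists setT.
by right; exists 0, T, setT; split.
Qed.
Local Hint Resolve measurable_D0 : core.

Lemma eq_pmeas f g : (forall t w, f t w = g t w) -> pm f -> pm g.
Proof. by move=> fg; rewrite (_ : g = f)//; apply/funext => t; apply/funext => w. Qed.

Lemma pmeasD f g : pm f -> pm g -> pm (fun t w => f t w + g t w).
Proof. exact: measurable_funD. Qed.

Lemma pmeasB f g : pm f -> pm g -> pm (fun t w => f t w - g t w).
Proof. exact: measurable_funB. Qed.

Lemma pmeasM f g : pm f -> pm g -> pm (fun t w => f t w * g t w).
Proof. exact: measurable_funM. Qed.

Lemma pmeas_cst c : pm (fun t w => c).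
Proof. exact: measurable_cst. Qed.

Lemma pmeas_sum (I : Type) (r : seq I) (f : I -> R -> Om -> R) :
  (forall i, pm (f i)) -> pm (fun t w => \sum_(i <- r) f i t w).
Proof. by move=> mf; apply: measurable_sum. Qed.

Lemma pmeas_prod (I : Type) (r : seq I) (f : I -> R -> Om -> R) :
  (forall i, pm (f i)) -> pm (fun t w => \prod_(i <- r) f i t w).
Proof.
move=> mf; elim: r => [|a r IH].
  by apply: (eq_pmeas (f := fun _ _ => 1)) (pmeas_cst 1) => t w; rewrite big_nil.
by apply: (eq_pmeas (f := fun t w => f a t w * \prod_(i <- r) f i t w)) (pmeasM (mf a) IH) => t w;
  rewrite big_cons.
Qed.

Lemma pmeas_comp (g : R -> R) f : measurable_fun setT g -> pm f -> pm (fun t w => g (f t w)).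
Proof. by move=> mg mf; exact: (measurableT_comp mg mf). Qed.

Lemma pmeas_vdot n (u v : R -> Om -> 'cV[R]_n) :
  predictable_mx Fil T u -> predictable_mx Fil T v ->
  pm (fun t w => vdot (u t w) (v t w)).
Proof.
move=> /(predictable_mxP _ hT) mu_ /(predictable_mxP _ hT) mv.
apply: (eq_pmeas (f := fun t w => \sum_i u t w i ord0 * v t w i ord0)).
  by move=> t w; rewrite vdotE.
by apply: pmeas_sum => i; exact: pmeasM.
Qed.

Lemma predictable_mxD p q (u v : R -> Om -> 'M[R]_(p, q)) :
  predictable_mx Fil T u -> predictable_mx Fil T v ->
  predictable_mx Fil T (fun t w => u t w + v t w).
Proof.
move=> /(predictable_mxP _ hT) mu_ /(predictable_mxP _ hT) mv; apply/(predictable_mxP _ hT) => i j.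
apply: (eq_pmeas (f := fun t w => u t w i j + v t w i j)) => [t w|].
  by rewrite mxE.
exact: pmeasD.
Qed.

Lemma predictable_mxZ p q c (u : R -> Om -> 'M[R]_(p, q)) :
  predictable_mx Fil T u -> predictable_mx Fil T (fun t w => c *: u t w).
Proof.
move=> /(predictable_mxP _ hT) mu_; apply/(predictable_mxP _ hT) => i j.
apply: (eq_pmeas (f := fun t w => c * u t w i j)) => [t w|].
  by rewrite mxE.
by apply: pmeasM => //; exact: pmeas_cst.
Qed.

Lemma predictable_mxN p q (u : R -> Om -> 'M[R]_(p, q)) :
  predictable_mx Fil T u -> predictable_mx Fil T (fun t w => - u t w).
Proof.
move=> /(predictable_mxP _ hT) mu_; apply/(predictable_mxP _ hT) => i j.
apply: (eq_pmeas (f := fun t w => -1 * u t w i j)) => [t w|].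
  by rewrite mxE mulN1r.
by apply: pmeasM => //; exact: pmeas_cst.
Qed.

Lemma predictable_mxM p q r (u : R -> Om -> 'M[R]_(p, q)) (v : R -> Om -> 'M[R]_(q, r)) :
  predictable_mx Fil T u -> predictable_mx Fil T v ->
  predictable_mx Fil T (fun t w => u t w *m v t w).
Proof.
move=> /(predictable_mxP _ hT) mu_ /(predictable_mxP _ hT) mv; apply/(predictable_mxP _ hT) => i j.
apply: (eq_pmeas (f := fun t w => \sum_k u t w i k * v t w k j)) => [t w|].
  by rewrite mxE.
by apply: pmeas_sum => k; exact: pmeasM.
Qed.

Lemma predictable_mx_tr p q (u : R -> Om -> 'M[R]_(p, q)) :
  predictable_mx Fil T u -> predictable_mx Fil T (fun t w => (u t w)^T).
Proof.
move=> /(predictable_mxP _ hT) mu_; apply/(predictable_mxP _ hT) => i j.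
by apply: (eq_pmeas (f := fun t w => u t w j i)) (mu_ j i) => t w; rewrite mxE.
Qed.

Lemma predictable_mx0 p q : predictable_mx Fil T (fun t w => 0 : 'M[R]_(p, q)).
Proof.
apply/(predictable_mxP _ hT) => i j.
by apply: (eq_pmeas (f := fun _ _ => 0)) (pmeas_cst 0) => t w; rewrite mxE.
Qed.

Lemma pmeas_rect (a b : R) (c : Om -> R) : 0 <= a -> b <= T -> meas_wrt (Fil a) c ->
  pm (fun t w => if a < t <= b then c w else 0).
Proof.
move=> a0 bT mc.
have rect A : Fil a A -> measurable ((`]a, b] `*` A) : set (g_sigma_algebraType (predictable_gen P T B))).
  move=> FA; have [ab|ba] := ltP a b.
    by apply: sub_sigma_algebra; right; exists a, b, A; split.
  rewrite (_ : _ `*` _ = set0)//; apply/seteqP; split=> // -[x w] /=.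
  by rewrite in_itv/= => -[/andP[ax xb] _]; have := lt_le_trans ax (le_trans xb ba); rewrite ltxx.
move=> _ U mU.
have FAT : Fil a [set: Om] by exact: (@measurableT _ (FT a)).
(* Values inside the rectangle and the default 0 outside it are treated separately; the complement
   of the rectangle counts exactly when 0 lies in [U]. *)
rewrite (_ : _ `&` _ = (`]a, b] `*` (c @^-1` U)) `|`
    (if 0 \in U then D0 `\` (`]a, b] `*` setT) else set0)).
  apply: measurableU; first by apply: rect; exact: mc.
  by case: ifP => // _; apply: measurableD => //; exact: rect.
apply/seteqP; split=> -[t w] /=; rewrite !in_itv/=.
  move=> [tT]; case: ifPn => [tab Uc|tab U0]; first by left.
  right; rewrite mem_set//=; split; first by rewrite in_itv.
  by rewrite in_itv/= => -[tab' _]; rewrite tab' in tab.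
case=> [[tab Uc]|].
  rewrite tab; split=> //; move: tab => /andP[at_ tb].
  by rewrite (le_trans a0 (ltW at_)) (le_trans tb).
case: ifPn; rewrite ?inE//= => U0 [tT h]; split=> //.
by rewrite ifN//; apply/negP => tab; apply: h.
Qed.

Lemma predictable_simple (S : simple_integrand Om R m) : simple_wf Fil T S -> predictable_mx Fil T (simple_val S).
Proof.
case=> nT nS mc _; apply/(predictable_mxP _ hT) => i j.
apply: (eq_pmeas (f := fun t w => \sum_(k < nstep S)
    (if node S k < t <= node S k.+1 then coef S k w i ord0 else 0))) => [t w|].
  rewrite /simple_val summxE; apply: eq_bigr => k _.
  by rewrite (ord1 j); case: ifP => // _; rewrite mxE.
apply: pmeas_sum => k; apply: pmeas_rect; last exact: mc.
- by have := nT k (ltnW (ltn_ord k)); rewrite in_itv/= => /andP[].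
- by have := nT k.+1 (ltn_ord k); rewrite in_itv/= => /andP[].
Qed.

Lemma sq_norm_integralE n (h : R -> Om -> 'cV[R]_n) w : sq_norm_integral T h w =
  (\int[mu]_(s in `[0%R, T]) (vdot (h s w) (h s w))%:E)%E.
Proof. by apply: eq_integral => s _; rewrite sqr_enorm. Qed.

Lemma measurable_sq n (h : R -> Om -> 'cV[R]_n) : predictable_mx Fil T h ->
  measurable_fun setT (sq_norm_integral T h).
Proof.
move=> ph; rewrite (_ : sq_norm_integral T h = fun w =>
    (\int[mu]_(s in `[0%R, T]) (vdot (h s w) (h s w))%:E)%E); last first.
  by apply/funext => w; exact: sq_norm_integralE.
apply: (FT_measurable_fun (lexx T)).
apply: (measurable_ge0_time_integral hT (g := fun s w => vdot (h s w) (h s w))) => //.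
- by move=> t w; exact: vdot_ge0.
- exact: ltW.
- exact: pmeas_vdot.
Qed.

Lemma vdot_section n (u v : R -> Om -> 'cV[R]_n) w :
  predictable_mx Fil T u -> predictable_mx Fil T v ->
  measurable_fun `[0, T] (fun t => vdot (u t w) (v t w)).
Proof. by move=> pu pv; apply: (pmeas_section hT w (pmeas_vdot pu pv)). Qed.

Lemma right_cont_simple S w : simple_wf Fil T S ->
  (forall i, right_cont T (fun t => B t w i ord0)) -> right_cont T (simple_integral B S ^~ w).
Proof.
case=> nT nS mc _ rB; apply: right_cont_sum => j.
under [X in right_cont _ X]eq_fun do rewrite vdotE.
apply: right_cont_sum => i; apply: right_contZ.
under [X in right_cont _ X]eq_fun do rewrite !mxE.
have nn k : (k <= nstep S)%N -> 0 <= node S k /\ node S k <= T.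
  by move=> /nT; rewrite in_itv/= => /andP.
have [a1 a2] := nn j (ltnW (ltn_ord j)); have [b1 b2] := nn j.+1 (ltn_ord j).
apply: right_contB.
  exact: (@right_cont_min _ _ (fun t => B t w i ord0)).
exact: (@right_cont_min _ _ (fun t => B t w i ord0)).
Qed.

Lemma B_right_cont : {ae P, forall w, forall i, right_cont T (fun t => B t w i ord0)}.
Proof.
case: hB => _ _ h _ _; apply: filterS h => w h i.
exact: (continuous_right_cont hT (h i)).
Qed.

Lemma adapted_simple_integral S t : simple_wf Fil T S -> 0 <= t -> t <= T ->
  meas_wrt (Fil t) (simple_integral B S t).
Proof.
case=> nT nS mc _ t0 tT; apply/meas_wrtP; apply: measurable_sum => j.
have [n0 _] : 0 <= node S j /\ node S j <= T.
  by have := nT j (ltnW (ltn_ord j)); rewrite in_itv/= => /andP.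
have [nt|tn] := leP (node S j) t; last first.
  rewrite (_ : (fun _ => _) = cst 0); first exact: measurable_cst.
  apply/funext => w /=; rewrite min_l ?subrr ?vdot0r//.
  by rewrite (le_trans (ltW tn))// nS.
under eq_fun do rewrite vdotE; apply: measurable_sum => i; apply: measurable_funM.
  by apply/meas_wrtP; exact: (meas_wrt_mono nt (mc j i (ltn_ord j))).
under eq_fun do rewrite !mxE.
apply: measurable_funB; apply/meas_wrtP; apply: adapted_B => //.
- by rewrite le_min t0 (le_trans n0)// nS.
- by rewrite ge_min lexx.
Qed.

(** Pathwise form of the two convergences in probability of [ito_integral]. It follows from them
    along a subsequence and implies them, and algebraic operations on integrals are carried out on
    it. *)
Definition ito_approx (S : nat -> simple_integrand Om R m) (h : R -> Om -> 'cV[R]_m)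
    (I : R -> Om -> R) (w : Om) : Prop :=
  forall e : R, 0 < e -> exists n0, forall n, (n0 <= n)%N ->
    (sq_norm_integral T (fun s w => (simple_val (S n) s w - h s w)%R) w <= e%:E)%E /\
    forall t, 0 <= t -> t <= T -> `|simple_integral B (S n) t w - I t w| <= e.

Lemma measurable_sup_simple S I : simple_wf Fil T S -> adapted Fil T I ->
  {ae P, forall w, right_cont T (I ^~ w)} ->
  measurable_fun setT (fun w => ereal_sup [set (`|simple_integral B S t w - I t w|)%:E |
                          t in `[0, T]]).
Proof.
move=> wfS aI rI; apply: (measurable_sup_norm hT (D := fun t w => simple_integral B S t w - I t w) hPc).
  move=> t tT; move: (tT); rewrite in_itv/= => /andP[t0 t1].
  apply: measurable_funB; apply: (meas_wrt_measurable hPc hB t1).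
    exact: adapted_simple_integral.
  exact: aI.
apply: filterS2 rI B_right_cont => w rI rB.
by apply: right_contB => //; exact: right_cont_simple.
Qed.

Lemma ito_integral_approx h I : ito_integral P T B h I ->
  exists2 S, forall n, simple_wf Fil T (S n) & {ae P, forall w, ito_approx S h I w}.
Proof.
case=> ph _ aI cI [S [wfS c1 c2]].
have rI : {ae P, forall w, right_cont T (I ^~ w)}.
  by apply: filterS cI => w /(continuous_right_cont hT).
have m1 n : measurable_fun setT (sq_norm_integral T (fun s w => (simple_val (S n) s w - h s w)%R)).
  apply: measurable_sq; apply: predictable_mxD; first exact: predictable_simple.
  exact: predictable_mxN.
have m2 n := measurable_sup_simple (wfS n) aI rI.
have [phi hphi] := prob_to_as m1 m2 c1 c2.
exists (S \o phi) => [n|]; first exact: wfS.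
apply: filterS hphi => w [e1 e2] e e0.
have [n1 h1] := e1 e e0; have [n2 h2] := e2 e e0.
exists (maxn n1 n2) => n; rewrite geq_max => /andP[/h1 h1n /h2 h2n]; split=> // t t0 tT.
rewrite -lee_fin; apply: le_trans h2n; apply: ereal_sup_ubound.
by exists t => //=; rewrite in_itv/= t0.
Qed.

Lemma approx_ito_integral h I S : predictable_mx Fil T h ->
  {ae P, forall w, (sq_norm_integral T h w < +oo)%E} -> adapted Fil T I ->
  {ae P, forall w, {within `[0, T], continuous (I ^~ w)}} ->
  (forall n, simple_wf Fil T (S n)) -> {ae P, forall w, ito_approx S h I w} ->
  ito_integral P T B h I.
Proof.
move=> ph fh aI cI wfS hS; split=> //; exists S; split=> //.
- apply: as_to_prob.
    move=> n; apply: measurable_sq; apply: predictable_mxD; first exact: predictable_simple.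
    exact: predictable_mxN.
  apply: filterS hS => w hS e e0; have [n0 h0] := hS e e0; exists n0 => n nn0.
  by have [] := h0 n nn0.
- have rI : {ae P, forall w, right_cont T (I ^~ w)}.
    by apply: filterS cI => w /(continuous_right_cont hT).
  apply: as_to_prob; first by move=> n; exact: measurable_sup_simple.
  apply: filterS hS => w hS e e0; have [n0 h0] := hS e e0; exists n0 => n nn0.
  have [_ h1] := h0 n nn0; apply: ge_ereal_sup => _ [t + <-].
  by rewrite /= in_itv/= lee_fin => /andP[t0 tT]; exact: h1.
Qed.

End ito.

(** * Refinement and linear combinations of simple integrands *)

Section simple_calculus.
Context (R : realType) (d0 : measure_display) (Om : measurableType d0)
  (P : probability Om R) (T : R) (m : nat) (B : R -> Om -> 'cV[R]_m).
Local Notation Fil := (augmented_filtration P B).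
Local Notation mu := (@lebesgue_measure R).
Implicit Types S : simple_integrand Om R m.

Lemma steps_mono (u : nat -> R) n : (forall i, (i < n)%N -> u i <= u i.+1) ->
  forall i j, (i <= j)%N -> (j <= n)%N -> u i <= u j.
Proof.
move=> hu i j; elim: j => [|j IH]; first by rewrite leqn0 => /eqP ->.
rewrite leq_eqVlt => /orP[/eqP -> //|]; rewrite ltnS => ij jn.
exact: (le_trans (IH ij (ltnW jn)) (hu j jn)).
Qed.

Lemma sum_partition (V : nmodType) (u : nat -> R) n (s : R) (X : V) :
  (forall i, (i < n)%N -> u i <= u i.+1) ->
  \sum_(i < n) (if u i < s <= u i.+1 then X else 0) =
  if u 0%N < s <= u n then X else 0.
Proof.
elim: n => [|n IH] hu.
  by rewrite big_ord0; case: ifP => // /andP[/lt_le_trans h /h]; rewrite ltxx.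
rewrite big_ord_recr/= IH; last by move=> i ni; apply: hu; exact: ltnW.
have u0n : u 0%N <= u n by apply: (steps_mono hu).
have := hu n (ltnSn n) => un.
case/orP: (le_total s (u n)) => [s1|]; last rewrite le_eqVlt => /orP[/eqP <-|s1].
- by rewrite (ltNge (u n)) s1/= addr0 (le_trans s1 un).
- by rewrite lexx ltxx un/= addr0.
- by rewrite (leNgt s) s1 andbF add0r (le_lt_trans u0n s1).
Qed.

(** The steps are disjoint, so at each time at most one term is present and cross products vanish;
    the clamped nodes measure the time spent in each step. *)
Lemma simple_quadE S s t w : (forall j, (j < nstep S)%N -> node S j <= node S j.+1) ->
  s <= t ->
  (\int[mu]_(u in `[s, t]) (vdot (simple_val S u w) (simple_val S u w))%:E =
  (simple_quad S s t w)%:E)%E.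
Proof.
move=> hS st.
have E u : vdot (simple_val S u w) (simple_val S u w) =
    \sum_(j < nstep S) (if node S j < u <= node S j.+1 then vdot (coef S j w) (coef S j w) else 0).
  rewrite /simple_val; move: (nstep S) hS; elim=> [|k IH] hk.
    by rewrite !big_ord0 vdot0l.
  rewrite !big_ord_recr/= -IH; last by move=> j jk; apply: hk; exact: ltnW.
  case: ifPn => [/andP[ku _]|_]; last by rewrite !addr0.
  rewrite big1 ?add0r ?vdot0l ?add0r// => j _.
  rewrite ifN//; apply/negP => /andP[_ uj]; move: ku; rewrite ltNge => /negP; apply.
  by apply: (le_trans uj); apply: (steps_mono hk).
under eq_integral do rewrite E -sumEFin.
have mI (D : set R) (a b c : R) : measurable_fun D (fun u : R => (if a < u <= b then c else 0)).
  apply: measurable_funTS.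
  rewrite (_ : (fun _ => _) = fun u => c * \1_(`]a, b] : set R) u).
    by apply: measurable_funM => //; exact: measurable_indic.
  apply/funext => u; rewrite indicE; case: ifPn => h.
    by rewrite mem_set ?mulr1//= in_itv.
  by rewrite memNset ?mulr0//= in_itv/=; exact/negP.
rewrite ge0_integral_sum//; last 2 first.
- by move=> j; apply/measurable_EFinP; exact: mI.
- by move=> j u _; case: ifP => // _; rewrite lee_fin vdot_ge0.
rewrite /simple_quad -sumEFin; apply: eq_bigr => j _.
set a := node S j; set b := node S j.+1; set c := vdot _ _.
have ab : a <= b := hS j (ltn_ord j).
have cab : clamp s t a <= clamp s t b by exact: clamp_mono.
transitivity (\int[mu]_(u in `]s, t]) (c * \1_(`]clamp s t a, clamp s t b] : set R) u)%:E)%E.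
  rewrite -integral_itv_obnd_cbnd; last by apply/measurable_EFinP; exact: mI.
  apply: eq_integral => u; rewrite inE/= in_itv/= => /andP[su ut]; congr EFin.
  rewrite indicE; suff -> : (u \in (`]clamp s t a, clamp s t b]%classic : set R)) = (a < u <= b).
    by case: ifP; rewrite ?mulr1 ?mulr0.
  rewrite /clamp; apply/idP/idP; rewrite inE/= in_itv/= gt_max le_max gt_min le_min su ut.
    by rewrite [t < u]ltNge ut (leNgt u s) su/=.
  by rewrite [t < u]ltNge ut (leNgt u s) su/=.
under eq_integral do rewrite EFinM.
rewrite ge0_integralZl_EFin//; last 2 first.
- by apply/measurable_EFinP; exact: measurable_indic.
- exact: vdot_ge0.
rewrite integral_indic//= [in RHS]EFinM; congr (_ * _)%E; rewrite setIidl.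
  rewrite lebesgue_measure_itv/= lte_fin; case: ltP => // h.
  have /eqP <- : clamp s t a == clamp s t b by rewrite eq_le cab.
  by rewrite subrr.
move=> x /=; rewrite !in_itv/= => /andP[x1 x2].
by rewrite (le_lt_trans (clamp_ge s t a) x1) (le_trans x2)// clamp_le.
Qed.

Section refinement.
Variables (S : simple_integrand Om R m) (wfS : simple_wf Fil T S).
Variables (u : nat -> R) (n : nat).
Hypothesis uT : forall j, (j <= n)%N -> u j \in `[0, T].
Hypothesis uS : forall i, (i < n)%N -> u i <= u i.+1.
Hypothesis unode : forall j, (j <= nstep S)%N -> exists2 i, (i <= n)%N & node S j = u i.

(** On a step of the finer grid the integrand is constant and equal to its value at the right end,
    the steps being open on the left. Collapsed steps receive 0, because measurability at their node
    could fail otherwise. *)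
Definition refine : simple_integrand Om R m := SimpleIntegrand n u
  (fun i w => if u i < u i.+1 then simple_val S (u i.+1) w else 0).

Let node_lt j i : (j <= nstep S)%N -> (i < n)%N -> node S j < u i.+1 -> node S j <= u i.
Proof.
move=> /unode[k kn ->] ni h; apply: (steps_mono uS); last exact: ltnW.
rewrite -ltnS ltnNge; apply/negP => ik.
by have := steps_mono uS ik kn; rewrite leNgt h.
Qed.

Let lt_node j i s : (j <= nstep S)%N -> (i < n)%N -> u i < s -> s <= node S j ->
  u i.+1 <= node S j.
Proof.
move=> /unode[k kn ->] ni h1 h2; apply: (steps_mono uS) => //.
rewrite ltnNge; apply/negP => ik.
have := steps_mono uS ik (ltnW ni); rewrite leNgt => /negP; apply.
exact: lt_le_trans h1 h2.
Qed.

Let node_in j : (j <= nstep S)%N -> u 0%N <= node S j <= u n.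
Proof.
by move=> /unode[k kn ->]; rewrite (steps_mono uS (leq0n k) kn) (steps_mono uS kn).
Qed.

Lemma refine_val s w : simple_val refine s w = simple_val S s w.
Proof.
have e1 i : (i < n)%N -> u i < s -> s <= u i.+1 -> simple_val S (u i.+1) w = simple_val S s w.
  move=> ni h1 h2; apply: eq_bigr => j _; congr (if _ then _ else _).
  congr (_ && _); apply/idP/idP => h.
  - exact: le_lt_trans (node_lt (ltnW (ltn_ord j)) ni h) h1.
  - exact: lt_le_trans h h2.
  - exact: le_trans h2 h.
  - exact: lt_node (ltn_ord j) ni h1 h.
rewrite /refine {1}/simple_val/=.
rewrite (eq_bigr (fun i : 'I_n => if u i < s <= u i.+1 then simple_val S s w else 0)).
  rewrite sum_partition//; case: ifPn => // h.
  rewrite /simple_val big1// => j _; rewrite ifN//; apply/negP => /andP[h1 h2].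
  move/negP: h; apply.
  have /andP[a1 _] := node_in (ltnW (ltn_ord j)); have /andP[_ a2] := node_in (ltn_ord j).
  by rewrite (le_lt_trans a1 h1) (le_trans h2 a2).
move=> i _; case: ifP => // /andP[h1 h2].
by rewrite (lt_le_trans h1 h2); exact: e1.
Qed.

Lemma refine_integral t w : simple_integral B refine t w = simple_integral B S t w.
Proof.
case: wfS => nT nS mc _.
pose b x := B (Num.min t x) w.
rewrite /simple_integral/=.
transitivity (\sum_(i < n) \sum_(j < nstep S) vdot (coef S j w)
    (b (clamp (node S j) (node S j.+1) (u i.+1)) - b (clamp (node S j) (node S j.+1) (u i)))).
  apply: eq_bigr => i _.
  have cl j : (j < nstep S)%N ->
      b (clamp (node S j) (node S j.+1) (u i.+1)) - b (clamp (node S j) (node S j.+1) (u i)) =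
      if node S j < u i.+1 <= node S j.+1 then b (u i.+1) - b (u i) else 0.
    move=> jn; have jj := nS j jn; have uu := uS (ltn_ord i).
    have [h1|h1] := ltP (node S j) (u i.+1); last first.
      rewrite /clamp (min_r (le_trans h1 jj)) (min_r (le_trans (le_trans uu h1) jj)).
      by rewrite !max_l ?subrr// (le_trans uu h1).
    have ui := node_lt (ltnW jn) (ltn_ord i) h1.
    have [h2|h2] := leP (u i.+1) (node S j.+1).
      rewrite /clamp (min_r h2) (min_r (le_trans uu h2)) max_r ?max_r// ltW//.
    have ui2 := node_lt jn (ltn_ord i) h2.
    by rewrite /clamp (min_l (ltW h2)) (min_l ui2) subrr.
  rewrite (eq_bigr (fun j : 'I_(nstep S) => if node S j < u i.+1 <= node S j.+1 then
     vdot (coef S j w) (b (u i.+1) - b (u i)) else 0)); last first.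
    by move=> j _; rewrite cl//; case: ifP => // _; rewrite vdot0r.
  have := uS (ltn_ord i); rewrite le_eqVlt => /orP[/eqP ui|ui].
    rewrite -ui ltxx vdot0l big1// => j _.
    by case: ifP => // _; rewrite subrr vdot0r.
  rewrite ui; rewrite /simple_val.
  rewrite vdot_suml.
  by apply: eq_bigr => j _; case: ifP => // _; rewrite vdot0l.
rewrite exchange_big; apply: eq_bigr => j _.
pose c i := clamp (node S j) (node S j.+1) (u i).
rewrite -vdot_sumr.
congr (vdot _ _).
rewrite -(big_mkord xpredT (fun i => b (c i.+1) - b (c i))) telescope_sumr//.
have jj := nS j (ltn_ord j).
have /andP[a1 a1'] := node_in (ltnW (ltn_ord j)); have /andP[a2' a2] := node_in (ltn_ord j).
by rewrite /c /clamp (min_l a2) (max_r jj) (min_r (le_trans a1 jj)) (max_l a1).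
Qed.

Lemma refine_wf : simple_wf Fil T refine.
Proof.
case: wfS => nT nS mc [K hK]; split=> //=.
- move=> i k ni; have [ui|_] := boolP (u i < u i.+1); last first.
    by rewrite mxE; apply/meas_wrt_gE; exact: measurable_cst.
  apply/meas_wrt_gE.
  rewrite (_ : (fun _ => _) = (fun w => \sum_(j < nstep S)
     (if node S j < u i.+1 <= node S j.+1 then coef S j w k ord0 else 0))); last first.
    apply/funext => w; rewrite /simple_val summxE; apply: eq_bigr => j _.
    by case: ifP => // _; rewrite mxE.
  apply: (@measurable_sum _ (g_sigma_algebraType (natural_filtration B (u i) `|` P.-negligible))) => j.
  have [/andP[h1 _]|_] := boolP (node S j < u i.+1 <= node S j.+1); last exact: measurable_cst.
  apply/meas_wrt_gE.
  exact: (meas_wrt_mono (node_lt (ltnW (ltn_ord j)) ni h1) (mc j k (ltn_ord j))).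
- exists (\sum_(j < nstep S) `|K|) => i w ni.
  have K0 : 0 <= \sum_(j < nstep S) `|K| by apply: sumr_ge0.
  case: ifPn => [ui|_]; last by rewrite enorm0.
  rewrite /simple_val; elim/big_ind2 : _ => [|x a y c h1 h2|j _].
  + by rewrite enorm0.
  + by apply: (le_trans (enormD _ _)); exact: lerD.
  + case: ifP => _; last by rewrite enorm0.
    by apply: (le_trans (hK j w (ltn_ord j))); exact: ler_norm.
Qed.

End refinement.

Lemma simple_lincomb S S' (a a' : R) : simple_wf Fil T S -> simple_wf Fil T S' ->
  exists2 S2, simple_wf Fil T S2 &
    (forall s w, simple_val S2 s w = a *: simple_val S s w + a' *: simple_val S' s w) /\
    (forall t w, simple_integral B S2 t w =
       a * simple_integral B S t w + a' * simple_integral B S' t w).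
Proof.
move=> wS wS'.
(* Sorting the union of the two lists of nodes gives a common refinement, on which coefficients can
   be added. *)
pose l0 := [seq node S j | j <- iota 0 (nstep S).+1] ++ [seq node S' j | j <- iota 0 (nstep S').+1].
pose l := sort <=%R l0.
pose n := (size l).-1; pose u i := nth 0 l i.
have l0' : (0 < size l)%N by rewrite size_sort /l0 size_cat !size_map !size_iota.
have sl : size l = n.+1 by rewrite prednK.
have uS i : (i < n)%N -> u i <= u i.+1.
  move=> ni; apply: (sorted_leq_nth le_trans le_refl) => //.
  - by apply: sort_sorted; exact: le_total.
  - by rewrite inE sl ltnW// ltnS.
  - by rewrite inE sl ltnS.
have mem x : x \in l -> exists2 i, (i <= n)%N & x = u i.
  by move=> /(nthP 0)[i]; rewrite sl ltnS => ni <-; exists i.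
have uT i : (i <= n)%N -> u i \in `[0, T].
  move=> ni; have : u i \in l by apply: mem_nth; rewrite sl ltnS.
  rewrite mem_sort mem_cat => /orP[] /mapP[j]; rewrite mem_iota add0n ltnS => /= jn ->.
    by case: wS => h _ _ _; exact: h.
  by case: wS' => h _ _ _; exact: h.
have n1 j : (j <= nstep S)%N -> exists2 i, (i <= n)%N & node S j = u i.
  move=> jn; apply: mem; rewrite mem_sort mem_cat; apply/orP; left.
  by apply: map_f; rewrite mem_iota add0n ltnS.
have n2 j : (j <= nstep S')%N -> exists2 i, (i <= n)%N & node S' j = u i.
  move=> jn; apply: mem; rewrite mem_sort mem_cat; apply/orP; right.
  by apply: map_f; rewrite mem_iota add0n ltnS.
have [r1 r2 r3 [K rK]] := refine_wf wS uT uS n1.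
have [r1' r2' r3' [K' rK']] := refine_wf wS' uT uS n2.
exists (SimpleIntegrand n u (fun i w => a *: coef (refine S u n) i w + a' *: coef (refine S' u n) i w)).
  split=> //.
    move=> j i /= jn; apply/meas_wrt_gE; under eq_fun do rewrite !mxE.
    apply: measurable_funD; apply: measurable_funM => //; apply/meas_wrt_gE.
      exact: (r3 j i jn).
    exact: (r3' j i jn).
  exists (`|a| * K + `|a'| * K') => j w jn /=.
  apply: (le_trans (enormD _ _)); rewrite !enormZ; apply: lerD; apply: ler_wpM2l => //.
    exact: (rK j w jn).
  exact: (rK' j w jn).
split.
  move=> s w; rewrite -(refine_val uS n1 s w) -(refine_val uS n2 s w) /simple_val/=.
  rewrite !scaler_sumr -big_split; apply: eq_bigr => j _.
  by case: ifP => // _; rewrite /= !scaler0 addr0.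
move=> t w; rewrite -(refine_integral wS uS n1 t w) -(refine_integral wS' uS n2 t w) /simple_integral/=.
rewrite !mulr_sumr -big_split; apply: eq_bigr => j _.
by rewrite vdotDl !vdotZl.
Qed.

End simple_calculus.

Section real_integrable.
Context d (X : measurableType d) (R : realType) (mu : {measure set X -> \bar R})
  (D : set X) (mD : measurable D).
Implicit Types f g : X -> R.

Lemma integrable_EFinD f g : mu.-integrable D (EFin \o f) -> mu.-integrable D (EFin \o g) ->
  mu.-integrable D (EFin \o (fun x => f x + g x)).
Proof. exact: integrableD. Qed.

Lemma integrable_EFinB f g : mu.-integrable D (EFin \o f) -> mu.-integrable D (EFin \o g) ->
  mu.-integrable D (EFin \o (fun x => f x - g x)).
Proof. exact: integrableB. Qed.

Lemma integrable_EFinZ c f : mu.-integrable D (EFin \o f) ->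
  mu.-integrable D (EFin \o (fun x => c * f x)).
Proof. exact: integrableZl. Qed.

Lemma integrable_EFin_le f g : measurable_fun D f -> mu.-integrable D (EFin \o g) ->
  (forall x, D x -> `|f x| <= g x) -> mu.-integrable D (EFin \o f).
Proof.
move=> mf ig fg; apply: le_integrable ig => //; first exact/measurable_EFinP.
move=> x Dx; rewrite /= lee_fin (le_trans (fg x Dx))//; exact: ler_norm.
Qed.

Lemma integrable_EFin_ge0 f : measurable_fun D f -> (forall x, 0 <= f x) ->
  (\int[mu]_(x in D) (f x)%:E < +oo)%E -> mu.-integrable D (EFin \o f).
Proof.
move=> mf f0 fi; apply/integrableP; split; first exact/measurable_EFinP.
by under eq_integral do rewrite /= ger0_norm//.
Qed.

End real_integrable.

Section time_integrals.
Context (R : realType) (T : R).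
Local Notation mu := (@lebesgue_measure R).

Lemma integrable_sub_itv (f : R -> R) a b : 0 <= a -> b <= T ->
  mu.-integrable `[0, T] (EFin \o f) -> mu.-integrable `[a, b] (EFin \o f).
Proof.
move=> a0 bT; apply: integrableS => //; apply: subset_itv; by rewrite bnd_simp.
Qed.

Lemma Rintegral_split (f : R -> R) a b c : 0 <= a -> a <= b -> b <= c -> c <= T ->
  mu.-integrable `[0, T] (EFin \o f) ->
  \int[mu]_(u in `[a, c]) f u = \int[mu]_(u in `[a, b]) f u + \int[mu]_(u in `[b, c]) f u.
Proof.
move=> a0 ab bc cT iF.
have i1 : mu.-integrable `[a, c] (EFin \o f) by exact: integrable_sub_itv iF.
have i2 : mu.-integrable `[b, c] (EFin \o f).
  by apply: integrable_sub_itv iF => //; exact: le_trans ab.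
have := Rintegral_itvB (x := b) i1; rewrite !bnd_simp => /(_ ab bc).
rewrite Rintegral_itv_obnd_cbnd; last first.
  by apply: integrableS i2 => //; apply: subset_itv; rewrite bnd_simp.
by move=> <-; rewrite addrC subrK.
Qed.

Lemma Rintegral_itv1 (f : R -> R) a : \int[mu]_(u in `[a, a]) f u = 0.
Proof. by rewrite set_itv1 Rintegral_set1. Qed.

Lemma le_abs_Rintegral (f g : R -> R) a b : 0 <= a -> b <= T ->
  mu.-integrable `[0, T] (EFin \o f) -> mu.-integrable `[0, T] (EFin \o g) ->
  (forall t, 0 <= t -> t <= T -> `|f t| <= g t) ->
  `|\int[mu]_(u in `[a, b]) f u| <= \int[mu]_(u in `[a, b]) g u.
Proof.
move=> a0 bT /(integrable_sub_itv a0 bT) iF /(integrable_sub_itv a0 bT) iG fg.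
apply: (le_trans (le_normr_Rintegral _ iF)) => //.
apply: le_Rintegral => //; first exact: integrable_norm.
by move=> t /=; rewrite in_itv/= => /andP[at_ tb]; apply: fg; [exact: le_trans at_|exact: le_trans bT].
Qed.

End time_integrals.

Section fatou_as.
Context (R : realType) (d0 : measure_display) (Om : measurableType d0)
  (P : probability Om R) (hPc : measure_is_complete P).

Lemma fatou_as (f_ : nat -> Om -> R) (f : Om -> R) (c : \bar R) :
  (forall n, measurable_fun setT (f_ n)) -> measurable_fun setT f ->
  (forall n w, 0 <= f_ n w) -> (forall w, 0 <= f w) ->
  {ae P, forall w, f_ n w @[n --> \oo] --> f w} ->
  (forall n, (\int[P]_w (f_ n w)%:E <= c)%E) ->
  (\int[P]_w (f w)%:E <= c)%E.
Proof.
move=> mf_ mf f_0 f0 ff hc.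
have E : {ae P, forall w, limn_einf (fun n => (f_ n w)%:E) = (f w)%:E}.
  apply: filterS ff => w h.
  have h' : (f_ n w)%:E @[n --> \oo] --> (f w)%:E by apply/cvg_EFin => //; exact: nearW.
  by have [] := cvg_limn_einf_sup h'.
apply: (@le_trans _ _ (\int[P]_w (limn_einf (fun n => (f_ n w)%:E)))%E).
  apply: ae_ge0_le_integral => //.
  - by move=> w _; rewrite lee_fin.
  - exact/measurable_EFinP.
  - move=> w _; rewrite limn_einf_lim; apply: lime_ge; first exact: is_cvg_einfs.
    apply: nearW => n; apply: le_ereal_inf_tmp => _ [k _ <-].
    by rewrite lee_fin.
  - apply: (ae_measurable_fun hPc (f := EFin \o f)); last exact/measurable_EFinP.
    by apply: filterS E => w -> _.
  - by apply: filterS E => w -> _.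
apply: (le_trans (fatou P measurableT _ _)).
- by move=> n; exact/measurable_EFinP.
- by move=> n w _; rewrite lee_fin.
rewrite limn_einf_lim; apply: lime_le; first exact: is_cvg_einfs.
apply: nearW => n; apply: le_trans (hc n).
by apply: ereal_inf_lbound; exists n => /=.
Qed.

End fatou_as.

Fact qv_key : unit. Proof. exact: tt. Qed.

(** * Quadratic variation, linearity and exponential supermartingales *)

Section ito_calculus.
Context (R : realType) (d0 : measure_display) (Om : measurableType d0)
  (P : probability Om R) (hPc : measure_is_complete P) (T : R) (hT : 0 < T)
  (m : nat) (B : R -> Om -> 'cV[R]_m) (hB : brownian_motion P T B).
Local Notation Fil := (augmented_filtration P B).
Local Notation FT t :=
  (g_sigma_algebraType (natural_filtration B t `|` P.-negligible)).
Local Notation mu := (@lebesgue_measure R).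
Local Notation pm := (pmeas P T B).
Local Notation pred := (predictable_mx Fil T).
Local Notation sq := (sq_norm_integral T).

Lemma sq_ge0 n (u : R -> Om -> 'cV[R]_n) w : (0 <= sq u w)%E.
Proof. by apply: integral_ge0 => s _; rewrite lee_fin sqr_ge0. Qed.

Lemma sq_lincomb n (u v : R -> Om -> 'cV[R]_n) a b w : pred u -> pred v ->
  (sq (fun s w => (a *: u s w + b *: v s w)%R) w <=
   (2 * a ^+ 2)%:E * sq u w + (2 * b ^+ 2)%:E * sq v w)%E.
Proof.
move=> pu pv; rewrite !sq_norm_integralE.
have muu := vdot_section hT w pu pu; have mvv := vdot_section hT w pv pv.
rewrite -!ge0_integralZl_EFin//; last 6 first.
- by move=> s _; rewrite lee_fin vdot_ge0.
- exact/measurable_EFinP.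
- by rewrite mulr_ge0// sqr_ge0.
- by move=> s _; rewrite lee_fin vdot_ge0.
- exact/measurable_EFinP.
- by rewrite mulr_ge0// sqr_ge0.
rewrite -ge0_integralD//; last 4 first.
- by move=> s _; rewrite -EFinM lee_fin mulr_ge0 ?vdot_ge0// mulr_ge0 ?sqr_ge0.
- by apply/measurable_EFinP; apply: measurable_funM.
- by move=> s _; rewrite -EFinM lee_fin mulr_ge0 ?vdot_ge0// mulr_ge0 ?sqr_ge0.
- by apply/measurable_EFinP; apply: measurable_funM.
apply: ge0_le_integral => //.
- by move=> s _; rewrite lee_fin vdot_ge0.
- have pw : pred (fun s w => a *: u s w + b *: v s w).
    by apply: (predictable_mxD hT); exact: (predictable_mxZ hT).
  by apply/measurable_EFinP; exact: (vdot_section hT w pw pw).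
- by apply: emeasurable_funD; apply/measurable_EFinP; apply: measurable_funM.
- move=> s _; rewrite -!EFinM -EFinD lee_fin.
  apply: (le_trans (vdotDsq_le _ _)); rewrite !vdotZl !vdotZr.
  by rewrite le_eqVlt; apply/orP; left; apply/eqP; ring.
Qed.

Lemma sq_vdot_integrable n (u v : R -> Om -> 'cV[R]_n) w : pred u -> pred v ->
  (sq u w < +oo)%E -> (sq v w < +oo)%E ->
  mu.-integrable `[0, T] (EFin \o (fun s => vdot (u s w) (v s w))).
Proof.
move=> pu pv fu fv.
have iuu (x : R -> Om -> 'cV[R]_n) : pred x -> (sq x w < +oo)%E ->
    mu.-integrable `[0, T] (EFin \o (fun s => vdot (x s w) (x s w))).
  move=> px fx; apply/integrableP; split.
    by apply/measurable_EFinP; exact: (vdot_section hT w px px).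
  move: fx; rewrite sq_norm_integralE; congr (_ < _)%E.
  by apply: eq_integral => s _; rewrite /= ger0_norm ?vdot_ge0.
have mT : measurable (`[0, T]%classic : set (measurableTypeR R)) by [].
have i1 := integrable_EFinD mT (iuu u pu fu) (iuu v pv fv).
apply: (integrable_EFin_le _ _ i1) => //; first exact: (vdot_section hT w pu pv).
move=> s _.
have := @vdot_weighted_le R n 1 (u s w) (v s w) ltr01; rewrite invr1 !mul1r => h.
by have := vdot_ge0 (u s w); have := vdot_ge0 (v s w); lra.
Qed.

(** The quadratic variation of the Ito integral of [h] between two times, sealed so that unification
    does not open the Lebesgue integral. *)
Definition qv n (h : R -> Om -> 'cV[R]_n) (s t : R) (w : Om) : R :=
  locked_with qv_key (\int[mu]_(u in `[s, t]) vdot (h u w) (h u w)).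

Lemma qvE n (h : R -> Om -> 'cV[R]_n) s t w :
  qv h s t w = \int[mu]_(u in `[s, t]) vdot (h u w) (h u w).
Proof. by rewrite /qv unlock. Qed.

Lemma qv_ge0 n (h : R -> Om -> 'cV[R]_n) s t w : 0 <= qv h s t w.
Proof. by rewrite qvE; apply: Rintegral_ge0 => u _; exact: vdot_ge0. Qed.

Lemma sq_qv n (h : R -> Om -> 'cV[R]_n) w : (sq h w < +oo)%E -> sq h w = (qv h 0 T w)%:E.
Proof.
move=> fh; rewrite qvE /Rintegral -sq_norm_integralE fineK//.
by rewrite ge0_fin_numE// sq_ge0.
Qed.

Lemma qv_split n (h : R -> Om -> 'cV[R]_n) a b c w : pred h -> (sq h w < +oo)%E ->
  0 <= a -> a <= b -> b <= c -> c <= T -> qv h a c w = qv h a b w + qv h b c w.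
Proof.
move=> ph fh a0 ab bc cT; rewrite !qvE; apply: (Rintegral_split a0 ab bc cT).
exact: sq_vdot_integrable.
Qed.

Lemma qv_le n (h : R -> Om -> 'cV[R]_n) a b w : pred h -> (sq h w < +oo)%E ->
  0 <= a -> a <= b -> b <= T -> qv h a b w <= qv h 0 T w.
Proof.
move=> ph fh a0 ab bT; rewrite (qv_split ph fh (lexx 0) (le_trans a0 ab) bT (lexx T)).
rewrite (qv_split ph fh (lexx 0) a0 ab bT).
by have := qv_ge0 h 0 a w; have := qv_ge0 h b T w; lra.
Qed.

Lemma adapted_qv n (h : R -> Om -> 'cV[R]_n) a b : pred h -> 0 <= a -> a <= b -> b <= T ->
  meas_wrt (Fil b) (qv h a b).
Proof.
move=> ph a0 ab bT.
rewrite (_ : qv h a b = fun w => \int[mu]_(u in `[a, b]) vdot (h u w) (h u w)); last first.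
  by apply/funext => w; rewrite qvE.
apply: (meas_wrt_time_integral hT (g := fun s w => vdot (h s w) (h s w))) => //.
  exact: le_trans ab.
exact: pmeas_vdot.
Qed.

Lemma adapted_int_vdot n (h g : R -> Om -> 'cV[R]_n) a b : pred h -> pred g ->
  0 <= a -> a <= b -> b <= T ->
  meas_wrt (Fil b) (fun w => \int[mu]_(s in `[a, b]) vdot (h s w) (g s w)).
Proof.
move=> ph pg a0 ab bT.
apply: (meas_wrt_time_integral hT (g := fun s w => vdot (h s w) (g s w))) => //.
  exact: le_trans ab.
exact: pmeas_vdot.
Qed.

Lemma vdot_sq_diff n (e : R) (a b : 'cV[R]_n) : 0 < e ->
  `|vdot a a - vdot b b| <= (1 + e^-1) * vdot (a - b) (a - b) + e * vdot b b.
Proof.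
move=> e0; have := vdot_weighted_le b (a - b) e0.
have -> : vdot a a - vdot b b = vdot (a - b) (a - b) + 2 * vdot b (a - b).
  by rewrite !(vdotDl, vdotDr, vdotNl, vdotNr) (vdotC b a); ring.
have := vdot_ge0 (a - b); set x := vdot (a - b) _; set y := vdot b _; set z := vdot b b.
rewrite !ler_norml => h1 /andP[h2 h3]; set q := e^-1 in h2 h3 *.
by apply/andP; split; lra.
Qed.

(** Convergence of the integrands in L^2 of time gives convergence of the quadratic variations. It
    is uniform in the end points because all error integrals are bounded by those over the whole of
    [[0, T]]. *)
Lemma approx_quad S h I w : (forall n, simple_wf Fil T (S n)) -> pred h ->
  (sq h w < +oo)%E -> ito_approx T B S h I w ->
  forall e, 0 < e -> exists n0, forall n, (n0 <= n)%N -> forall s t,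
    0 <= s -> s <= t -> t <= T -> `|simple_quad (S n) s t w - qv h s t w| <= e.
Proof.
move=> wfS ph fh hS e e0.
pose M := qv h 0 T w; have M0 : 0 <= M by exact: qv_ge0.
(* In [vdot_sq_diff] the term with factor [d] contributes at most [d * M], hence at most half of
   [e]; the other half fixes the accuracy asked of the simple integrand. *)
pose d := e / (2 * (M + 1)); have d0' : 0 < d by rewrite divr_gt0// mulr_gt0//; lra.
have k0 : 0 < 1 + d^-1 by rewrite addr_gt0// invr_gt0.
have ed : 0 < e / (2 * (1 + d^-1)) by rewrite divr_gt0// mulr_gt0.
have [n0 hn0] := hS _ ed; exists n0 => n nn0 s t s0 st tT.
have [hn _] := hn0 n nn0.
have pS := predictable_simple hT (wfS n).
pose g := fun s w => simple_val (S n) s w - h s w.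
have pg : pred g.
  by apply: (predictable_mxD hT) => //; exact: (predictable_mxN hT).
have fg : (sq g w < +oo)%E by apply: (le_lt_trans hn); rewrite ltry.
have fS : (sq (simple_val (S n)) w < +oo)%E.
  have := sq_lincomb 1 1 w pg ph.
  rewrite (_ : (fun s w => _) = simple_val (S n)); last first.
    by apply/funext => u; apply/funext => v; rewrite !scale1r /g subrK.
  move=> /le_lt_trans; apply; rewrite (sq_qv fg) (sq_qv fh) -!EFinM -EFinD ltry//.
have wS : forall j, (j < nstep (S n))%N -> node (S n) j <= node (S n) j.+1.
  by case: (wfS n).
have -> : simple_quad (S n) s t w = qv (simple_val (S n)) s t w.
  by rewrite qvE /Rintegral simple_quadE.
have iS := sq_vdot_integrable pS pS fS fS.
have ih := sq_vdot_integrable ph ph fh fh.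
have ig := sq_vdot_integrable pg pg fg fg.
have E : qv (simple_val (S n)) s t w - qv h s t w = \int[mu]_(u in `[s, t])
    (vdot (simple_val (S n) u w) (simple_val (S n) u w) - vdot (h u w) (h u w)).
  rewrite !qvE RintegralB//; exact: (integrable_sub_itv s0 tT).
rewrite E.
have mT : measurable (`[0, T]%classic : set (measurableTypeR R)) by [].
have iD := integrable_EFinB mT iS ih.
have iG1 := integrable_EFinZ mT (1 + d^-1) ig.
have iG2 := integrable_EFinZ mT d ih.
have iG := integrable_EFinD mT iG1 iG2.
apply: (le_trans (le_abs_Rintegral s0 tT iD iG _)).
  by move=> u _ _; exact: vdot_sq_diff.
rewrite RintegralD//; [|exact: (integrable_sub_itv s0 tT iG1)|exact: (integrable_sub_itv s0 tT iG2)].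
rewrite RintegralZl//; last exact: (integrable_sub_itv s0 tT ig).
rewrite RintegralZl//; last exact: (integrable_sub_itv s0 tT ih).
rewrite -(qvE g) -(qvE h).
have h1 : qv g s t w <= e / (2 * (1 + d^-1)).
  by apply: (le_trans (qv_le pg fg s0 st tT)); rewrite -lee_fin -(sq_qv fg).
have h2 : qv h s t w <= M by exact: (qv_le ph fh s0 st tT).
have h3 : (1 + d^-1) * qv g s t w <= e / 2.
  apply: (le_trans (ler_wpM2l (ltW k0) h1)).
  move: k0; set q := 1 + d^-1 => k0.
  by rewrite le_eqVlt; apply/orP; left; apply/eqP; field; rewrite gt_eqF.
have h4 : d * qv h s t w <= e / 2.
  apply: (le_trans (ler_wpM2l (ltW d0') h2)).
  apply: (@le_trans _ _ (d * (M + 1))); first by rewrite ler_wpM2l ?(ltW d0')//; lra.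
  by rewrite le_eqVlt; apply/orP; left; apply/eqP; rewrite /d; field; rewrite gt_eqF//; lra.
by rewrite [leRHS]splitr; exact: lerD.
Qed.

Lemma ito_lincomb a a' h h' I I' : ito_integral P T B h I -> ito_integral P T B h' I' ->
  ito_integral P T B (fun t w => a *: h t w + a' *: h' t w) (fun t w => a * I t w + a' * I' t w).
Proof.
move=> iI iI'.
have [S wS hS] := ito_integral_approx hPc hT hB iI.
have [S' wS' hS'] := ito_integral_approx hPc hT hB iI'.
case: iI => ph fh aI cI _; case: iI' => ph' fh' aI' cI' _.
have /choice[S2 hS2] : forall n, exists S2, simple_wf Fil T S2 /\
    ((forall s w, simple_val S2 s w = a *: simple_val (S n) s w + a' *: simple_val (S' n) s w) /\
    (forall t w, simple_integral B S2 t w =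
       a * simple_integral B (S n) t w + a' * simple_integral B (S' n) t w)).
  by move=> n; have [S2 ? ?] := simple_lincomb a a' (wS n) (wS' n); exists S2.
apply: (approx_ito_integral hPc hT hB (S := S2)).
- by apply: (predictable_mxD hT); exact: (predictable_mxZ hT).
- apply: filterS2 fh fh' => w fh fh'.
  apply: (le_lt_trans (sq_lincomb a a' w ph ph')).
  by rewrite (sq_qv fh) (sq_qv fh') -!EFinM -EFinD ltry.
- move=> t tT; apply/meas_wrtP; apply: measurable_funD; apply: measurable_funM => //;
    apply/meas_wrtP; [exact: aI|exact: aI'].
- apply: filterS2 cI cI' => w cI cI' t.
  by apply: cvgD; apply: cvgM; [exact: cvg_cst|exact: cI|exact: cvg_cst|exact: cI'].
- by move=> n; case: (hS2 n).
apply: filterS2 hS hS' => w hS hS' e e0.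
(* [c] dominates both the factor of the energy error and the factor of the path error; adding 1
   keeps it positive. *)
pose c := 2 * (a ^+ 2 + a' ^+ 2) + `|a| + `|a'| + 1.
have c0 : 0 < c by rewrite /c; have := sqr_ge0 a; have := sqr_ge0 a';
  have := normr_ge0 a; have := normr_ge0 a'; lra.
have ec : 0 < e / c by rewrite divr_gt0.
have [n1 h1] := hS _ ec; have [n2 h2] := hS' _ ec; exists (maxn n1 n2) => n.
rewrite geq_max => /andP[/h1[h1a h1b] /h2[h2a h2b]].
have [_ [v2 i2]] := hS2 n.
have pg : pred (fun s w => simple_val (S n) s w - h s w).
  by apply: (predictable_mxD hT); [exact: predictable_simple|exact: (predictable_mxN hT)].
have pg' : pred (fun s w => simple_val (S' n) s w - h' s w).
  by apply: (predictable_mxD hT); [exact: predictable_simple|exact: (predictable_mxN hT)].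
split.
  rewrite (_ : (fun s w => _) = (fun s w => (a *: (simple_val (S n) s w - h s w) +
      a' *: (simple_val (S' n) s w - h' s w))%R)); last first.
    apply/funext => s; apply/funext => v; rewrite v2 !scalerBr.
    by apply/matrixP => i j; rewrite !mxE; ring.
  apply: (le_trans (sq_lincomb a a' w pg pg')).
  apply: (@le_trans _ _ ((2 * a ^+ 2)%:E * (e / c)%:E + (2 * a' ^+ 2)%:E * (e / c)%:E)%E).
    by apply: leeD; apply: lee_wpmul2l => //; rewrite lee_fin mulr_ge0// sqr_ge0.
  rewrite -!EFinM -EFinD lee_fin -mulrDl mulrA ler_pdivrMr// mulrC ler_wpM2l ?(ltW e0)//.
  by rewrite /c; have := normr_ge0 a; have := normr_ge0 a'; lra.
move=> t t0 tT; rewrite i2.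
have -> : a * simple_integral B (S n) t w + a' * simple_integral B (S' n) t w -
  (a * I t w + a' * I' t w) = a * (simple_integral B (S n) t w - I t w) +
    a' * (simple_integral B (S' n) t w - I' t w) by ring.
apply: (le_trans (ler_normD _ _)); rewrite !normrM.
apply: (@le_trans _ _ (`|a| * (e / c) + `|a'| * (e / c))).
  by apply: lerD; apply: ler_wpM2l => //; [exact: h1b|exact: h2b].
rewrite -mulrDl mulrA ler_pdivrMr// mulrC ler_wpM2l ?(ltW e0)//.
by rewrite /c; have := sqr_ge0 a; have := sqr_ge0 a'; lra.
Qed.

Lemma ito_zero : ito_integral P T B (fun _ _ => 0) (fun _ _ => 0).
Proof.
pose S0 : simple_integrand Om R m := SimpleIntegrand 0 (fun=> 0) (fun _ _ => 0).
have z t w : simple_val S0 t w = 0 by rewrite /simple_val big_ord0.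
have sq0 w : sq (fun _ _ => 0 : 'cV[R]_m) w = 0%E.
  by rewrite sq_norm_integralE; under eq_integral do rewrite vdot0l; rewrite integral0.
apply: (approx_ito_integral hPc hT hB (S := fun=> S0)).
- exact: predictable_mx0.
- by apply: aeW => w; rewrite sq0 ltry.
- by move=> t _; apply/meas_wrtP; exact: measurable_cst.
- by apply: aeW => w t; exact: cvg_cst.
- move=> _; split=> //=.
  + by move=> j _; rewrite in_itv/= lexx ltW.
  + by exists 0.
apply: aeW => w e e0; exists 0%N => n _; split.
  rewrite (_ : (fun s w => _) = (fun _ _ => 0)) ?sq0 ?lee_fin ?(ltW e0)//.
  by apply/funext => s; apply/funext => v; rewrite z subr0.
by move=> t t0 tT; rewrite /simple_integral big_ord0 subr0 normr0 ltW.
Qed.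

Lemma ito_at0 h I : ito_integral P T B h I -> {ae P, forall w, I 0 w = 0}.
Proof.
move=> iI; have [S wS hS] := ito_integral_approx hPc hT hB iI.
apply: filterS hS => w hS; apply/eqP; rewrite -normr_le0; apply/ler_addgt0Pr => e e0.
rewrite add0r; have [n0 hn] := hS e e0; have [_ ] := hn n0 (leqnn _).
move=> /(_ 0 (lexx 0) (ltW hT)); rewrite /simple_integral big1 ?sub0r ?normrN// => j _.
case: (wS n0) => nT _ _ _.
have nn k : (k <= nstep (S n0))%N -> Num.min 0 (node (S n0) k) = 0.
  by move=> /nT; rewrite in_itv/= => /andP[k0 _]; rewrite min_l.
by rewrite !nn ?subrr ?vdot0r// ltnW.
Qed.

Lemma ito_adapted h I t : ito_integral P T B h I -> 0 <= t -> t <= T -> meas_wrt (Fil t) (I t).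
Proof. by case=> _ _ aI _ _ t0 tT; apply: aI; rewrite in_itv/= t0. Qed.

Lemma ito_right_cont h I : ito_integral P T B h I -> {ae P, forall w, right_cont T (I ^~ w)}.
Proof. by case=> _ _ _ cI _; apply: filterS cI => w /(continuous_right_cont hT). Qed.

(** For simple integrands this is an equality; Fatou's lemma keeps only the inequality. An
    inequality in the other direction is the subject of [exp_lower_bound]. *)
Lemma ito_exp_supermartingale h I s t (W : Om -> R) : ito_integral P T B h I ->
  0 <= s -> s <= t -> t <= T -> meas_wrt (Fil s) W -> (forall w, 0 <= W w) ->
  (\int[P]_w (W w * expR (I t w - I s w - 2^-1 * qv h s t w))%:E <= \int[P]_w (W w)%:E)%E.
Proof.
move=> iI s0 st tT mW W0; have sT := le_trans st tT; have t0 := le_trans s0 st.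
have [S wS hS] := ito_integral_approx hPc hT hB iI.
have ph : pred h by case: iI.
have fh : {ae P, forall w, (sq h w < +oo)%E} by case: iI.
have mI r : 0 <= r -> r <= T -> measurable_fun setT (I r).
  by move=> r0 rT; apply: (meas_wrt_measurable hPc hB rT); exact: ito_adapted iI r0 rT.
have mWm := meas_wrt_measurable hPc hB sT mW.
apply: (fatou_as hPc (f_ := fun n w => W w * expR (simple_integral B (S n) t w -
    simple_integral B (S n) s w - 2^-1 * simple_quad (S n) s t w))).
- move=> n; apply: measurable_funM => //; apply: measurableT_comp => //.
  have mS r : 0 <= r -> r <= T -> measurable_fun setT (simple_integral B (S n) r).
    by move=> r0 rT; apply: (meas_wrt_measurable hPc hB rT); exact: adapted_simple_integral.
  apply: measurable_funB.
    by apply: measurable_funB; exact: mS.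
  apply: measurable_funM => //.
  have wS' : forall j, (j < nstep (S n))%N -> node (S n) j <= node (S n) j.+1.
    by case: (wS n).
  rewrite (_ : simple_quad (S n) s t = qv (simple_val (S n)) s t); last first.
    by apply/funext => w; rewrite qvE /Rintegral simple_quadE.
  apply: (meas_wrt_measurable hPc hB tT); apply: adapted_qv => //.
  exact: predictable_simple.
- apply: measurable_funM => //; apply: measurableT_comp => //.
  apply: measurable_funB; first by apply: measurable_funB; exact: mI.
  apply: measurable_funM => //; apply: (meas_wrt_measurable hPc hB tT).
  exact: adapted_qv.
- by move=> n w; rewrite mulr_ge0 ?expR_ge0.
- by move=> w; rewrite mulr_ge0 ?expR_ge0.
- apply: filterS2 fh hS => w fh hS.
  apply: cvgM; first exact: cvg_cst.
  apply: (cvg_comp _ expR); last exact: continuous_expR.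
  have cI r : 0 <= r -> r <= T -> simple_integral B (S n) r w @[n --> \oo] --> I r w.
    move=> r0 rT; apply/cvgrPdist_le => e e0; have [n0 hn] := hS e e0.
    by exists n0 => // n /= /hn[_ /(_ r r0 rT)]; rewrite distrC.
  apply: cvgB; first by apply: cvgB; exact: cI.
  apply: cvgM; first exact: cvg_cst.
  apply/cvgrPdist_le => e e0; have [n0 hn] := approx_quad wS ph fh hS e0.
  by exists n0 => // n /= /hn /(_ s t s0 st tT); rewrite distrC.
- by move=> n; rewrite (simple_exp_integral hPc hB (wS n)).
Qed.

End ito_calculus.

(** * Exponential moments and the measure change *)

Fact mean_key : unit. Proof. exact: tt. Qed.

(* Sealed versions of expectation and integrability: conversion then never
   unfolds Lebesgue integrals. *)
Definition mean (R : realType) d0 (Om : measurableType d0) (P : probability Om R)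
  (f : Om -> R) : R := locked_with mean_key (\int[P]_w f w).

Variant summable_rv (R : realType) d0 (Om : measurableType d0) (P : probability Om R)
  (f : Om -> R) : Prop := SummableRv of P.-integrable setT (EFin \o f).

Notation "'\mean[' P ]_ w F" := (mean P (fun w => F))
  (at level 36, P at level 10, w binder, F at level 36, right associativity) : ring_scope.

Section expectations.
Context (R : realType) (d0 : measure_display) (Om : measurableType d0)
  (P : probability Om R).
Implicit Types f g : Om -> R.

Local Notation summable_rv := (summable_rv P).
Let mT : measurable [set: Om]. Proof. exact: measurableT. Qed.

Lemma summableP f : summable_rv f <-> P.-integrable setT (EFin \o f).
Proof. by split=> [[]|]. Qed.

Lemma meanE f : \mean[P]_w f w = \int[P]_w f w.
Proof. by rewrite /mean unlock. Qed.

Lemma summable_measurable f : summable_rv f -> measurable_fun setT f.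
Proof. by case=> /integrableP[/measurable_EFinP]. Qed.

Lemma eq_mean f g : (forall w, f w = g w) -> \mean[P]_w f w = \mean[P]_w g w.
Proof. by move=> /funext ->. Qed.

Lemma eq_summable f g : (forall w, f w = g w) -> summable_rv f -> summable_rv g.
Proof. by move=> /funext ->. Qed.

Lemma integral_EFin f : summable_rv f -> (\int[P]_w (f w)%:E)%E = (\mean[P]_w f w)%:E.
Proof. by case=> h; rewrite meanE /Rintegral fineK//; exact: integrable_fin_num. Qed.

Lemma summable_cst c : summable_rv (fun=> c).
Proof. by apply/summableP; exact: finite_measure_integrable_cst. Qed.

Lemma expectation_cst c : \mean[P]_w c = c.
Proof.
rewrite meanE Rintegral_cst//; transitivity (c * fine 1%E); last by rewrite mulr1.
by congr (_ * fine _); exact: probability_setT.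
Qed.

Lemma summableD f g : summable_rv f -> summable_rv g -> summable_rv (fun w => f w + g w).
Proof. by case=> hf [hg]; apply/summableP; exact: integrable_EFinD. Qed.

Lemma summableB f g : summable_rv f -> summable_rv g -> summable_rv (fun w => f w - g w).
Proof. by case=> hf [hg]; apply/summableP; exact: integrable_EFinB. Qed.

Lemma summableZ c f : summable_rv f -> summable_rv (fun w => c * f w).
Proof. by case=> hf; apply/summableP; exact: integrable_EFinZ. Qed.

Lemma meanD f g : summable_rv f -> summable_rv g ->
  \mean[P]_w (f w + g w) = \mean[P]_w f w + \mean[P]_w g w.
Proof. by case=> hf [hg]; rewrite !meanE RintegralD. Qed.

Lemma meanB f g : summable_rv f -> summable_rv g ->
  \mean[P]_w (f w - g w) = \mean[P]_w f w - \mean[P]_w g w.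
Proof. by case=> hf [hg]; rewrite !meanE RintegralB. Qed.

Lemma meanZ c f : summable_rv f -> \mean[P]_w (c * f w) = c * \mean[P]_w f w.
Proof. by case=> hf; rewrite !meanE RintegralZl. Qed.

Lemma mean_ge0 f : (forall w, 0 <= f w) -> 0 <= \mean[P]_w f w.
Proof. by move=> f0; rewrite meanE; exact: Rintegral_ge0. Qed.

Lemma summable_sum (I : Type) (r : seq I) (f : I -> Om -> R) :
  (forall i, summable_rv (f i)) -> summable_rv (fun w => \sum_(i <- r) f i w).
Proof.
move=> hf; elim: r => [|a r IH].
  by rewrite (_ : (fun w => _) = fun=> 0); [exact: summable_cst|apply/funext => w; rewrite big_nil].
rewrite (_ : (fun w => _) = fun w => f a w + \sum_(i <- r) f i w); first exact: summableD.
by apply/funext => w; rewrite big_cons.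
Qed.

Lemma expectation_sum (I : Type) (r : seq I) (f : I -> Om -> R) :
  (forall i, summable_rv (f i)) ->
  \mean[P]_w (\sum_(i <- r) f i w) = \sum_(i <- r) \mean[P]_w f i w.
Proof.
move=> hf; elim: r => [|a r IH].
  by under eq_mean do rewrite big_nil; rewrite expectation_cst big_nil.
under eq_mean do rewrite big_cons.
by rewrite meanD; [rewrite IH big_cons|exact: hf|exact: summable_sum].
Qed.

Lemma summable_le_as f g : measurable_fun setT f -> summable_rv g ->
  {ae P, forall w, `|f w| <= g w} -> summable_rv f.
Proof.
move=> mf [/integrableP[/measurable_EFinP mg ig]] fg; apply/summableP/integrableP; split.
  exact/measurable_EFinP.
apply: le_lt_trans ig; apply: ae_ge0_le_integral => //.
- by apply: measurableT_comp => //; exact/measurable_EFinP.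
- by apply: measurableT_comp => //; exact/measurable_EFinP.
by apply: filterS fg => w h _; rewrite /= lee_fin (le_trans h)// ler_norm.
Qed.

Lemma summable_le f g : measurable_fun setT f -> summable_rv g ->
  (forall w, `|f w| <= g w) -> summable_rv f.
Proof. by move=> mf hg fg; apply: summable_le_as hg _ => //; apply: aeW. Qed.

Lemma summable_norm f : summable_rv f -> summable_rv (fun w => `|f w|).
Proof.
by case=> hf; apply/summableP; exact: integrable_norm.
Qed.

Lemma summable_ge0 f (c : R) : measurable_fun setT f -> (forall w, 0 <= f w) ->
  (\int[P]_w (f w)%:E <= c%:E)%E -> summable_rv f /\ \mean[P]_w f w <= c.
Proof.
move=> mf f0 fc; have hf : summable_rv f.
  by apply/summableP; apply: integrable_EFin_ge0 => //; apply: (le_lt_trans fc); rewrite ltry.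
by split=> //; rewrite -lee_fin -integral_EFin.
Qed.

Lemma expectation_as_eq f g : summable_rv f -> summable_rv g ->
  {ae P, forall w, f w = g w} -> \mean[P]_w f w = \mean[P]_w g w.
Proof.
move=> hf hg fg; rewrite !meanE /Rintegral; congr fine; apply: ae_eq_integral => //.
- exact/measurable_EFinP/summable_measurable.
- exact/measurable_EFinP/summable_measurable.
- by apply: filterS fg => w -> _.
Qed.

Lemma expectation_le_as f g : summable_rv f -> summable_rv g ->
  {ae P, forall w, f w <= g w} -> \mean[P]_w f w <= \mean[P]_w g w.
Proof.
move=> hf hg fg; rewrite -subr_ge0 -meanB//.
rewrite (expectation_as_eq (g := fun w => `|g w - f w|)).
- exact: mean_ge0.
- exact: summableB.
- by apply: summable_norm; exact: summableB.
- by apply: filterS fg => w h; rewrite ger0_norm// subr_ge0.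
Qed.

Lemma expectation_le f g : summable_rv f -> summable_rv g ->
  (forall w, f w <= g w) -> \mean[P]_w f w <= \mean[P]_w g w.
Proof. by move=> hf hg fg; apply: expectation_le_as => //; apply: aeW. Qed.

Lemma summable_mulL2 f g : measurable_fun setT f -> measurable_fun setT g ->
  summable_rv (fun w => f w ^+ 2) -> summable_rv (fun w => g w ^+ 2) ->
  summable_rv (fun w => f w * g w).
Proof.
move=> mf mg f2 g2; apply: (summable_le _ (summableD f2 g2)).
  exact: measurable_funM.
move=> w; have := sqr_ge0 (f w - g w); have := sqr_ge0 (f w + g w).
rewrite ler_norml !expr2 => h1 h2; apply/andP; split; nra.
Qed.

Lemma summable_L2 f : measurable_fun setT f -> summable_rv (fun w => f w ^+ 2) -> summable_rv f.
Proof.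
move=> mf f2; have := summable_mulL2 mf (@measurable_cst _ _ _ _ setT (1 : R)) f2 (summable_cst (1 ^+ 2)).
by apply: eq_summable => w; rewrite /= mulr1.
Qed.

Lemma summable_sqD f g : measurable_fun setT f -> measurable_fun setT g ->
  summable_rv (fun w => f w ^+ 2) -> summable_rv (fun w => g w ^+ 2) ->
  summable_rv (fun w => (f w + g w) ^+ 2).
Proof.
move=> mf mg f2 g2; apply: (summable_le _ (summableD (summableZ 2 f2) (summableZ 2 g2))).
  by apply: measurable_funX; exact: measurable_funD.
move=> w; rewrite ger0_norm ?sqr_ge0//; have := sqr_ge0 (f w - g w); rewrite !expr2; nra.
Qed.

Lemma summable_sqZ c f : summable_rv (fun w => f w ^+ 2) -> summable_rv (fun w => (c * f w) ^+ 2).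
Proof.
move=> f2; have := summableZ (c ^+ 2) f2.
by apply: eq_summable => w; rewrite /= exprMn.
Qed.

End expectations.

(** For [0 <= x] square [1 + x / 2 <= expR (x / 2)] and add [1 - x <= expR (- x)]: the linear terms
    cancel. *)
Lemma expR_quad (R : realType) (x : R) : 2 + x ^+ 2 / 4 <= expR x + expR (- x).
Proof.
wlog x0 : x / 0 <= x => [h|].
  case/orP: (le_total 0 x) => [|x0]; first exact: h.
  by have := h (- x); rewrite opprK sqrrN addrC (addrC (expR (-x))); apply; rewrite oppr_ge0.
have h1 : 1 + x / 2 <= expR (x / 2) by exact: expR_ge1Dx.
have h2 : 1 - x <= expR (- x) by exact: expR_ge1Dx.
have -> : expR x = expR (x / 2) ^+ 2 by rewrite expr2 -expRD -splitr.
have : (1 + x / 2) ^+ 2 <= expR (x / 2) ^+ 2 by rewrite ler_sqr ?nnegrE ?expR_ge0//; lra.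
rewrite !expr2; lra.
Qed.

Lemma cvg_expR (R : realType) (u : nat -> R) l : u n @[n --> \oo] --> l ->
  expR (u n) @[n --> \oo] --> expR l.
Proof. by move=> h; apply: cvg_comp h _; exact: continuous_expR. Qed.

(** * First and second moments from exponential bounds *)

Section exponential_moments.
Context (R : realType) (d0 : measure_display) (Om : measurableType d0)
  (P : probability Om R) (hPc : measure_is_complete P).
Variables (r M q : Om -> R).
Hypotheses (mr : measurable_fun setT r) (mM : measurable_fun setT M)
  (mq : measurable_fun setT q) (r0 : forall w, 0 <= r w) (q0 : forall w, 0 <= q w)
  (hr : summable_rv P r)
  (hexp : forall l : R, (\int[P]_w (r w * expR (l * M w - 2^-1 * (l ^+ 2 * q w)))%:E <=
     \int[P]_w (r w)%:E)%E).

Let mexp l : measurable_fun setT (fun w => r w * expR (l * M w - 2^-1 * (l ^+ 2 * q w))).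
Proof.
apply: measurable_funM => //; apply: measurableT_comp => //; apply: measurable_funB.
  exact: measurable_funM.
by apply: measurable_funM => //; exact: measurable_funM.
Qed.

Let sexp l : summable_rv P (fun w => r w * expR (l * M w - 2^-1 * (l ^+ 2 * q w))) /\
  \mean[P]_w (r w * expR (l * M w - 2^-1 * (l ^+ 2 * q w))) <= \mean[P]_w r w.
Proof.
apply: summable_ge0 => //; first by move=> w; rewrite mulr_ge0 ?expR_ge0.
by rewrite -integral_EFin.
Qed.

(** Adding the exponential bounds for [l] and [- l] cancels the linear term, and [expR_quad]
    extracts the square from what remains; divide by [l ^+ 2] and let [l] tend to 0. The constant 4
    is that of [expR_quad]. This replaces the Ito isometry. *)
Lemma second_moment_le :
  (\int[P]_w (r w * M w ^+ 2)%:E <= 4%:E * \int[P]_w (r w * q w)%:E)%E.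
Proof.
have rq0 : (0 <= \int[P]_w (r w * q w)%:E)%E.
  by apply: integral_ge0 => w _; rewrite lee_fin mulr_ge0.
have [rqoo|] := eqVneq (\int[P]_w (r w * q w)%:E)%E +oo%E.
  by rewrite rqoo gt0_muley ?lte_fin// leey.
rewrite -ltey => rqf.
have srq : summable_rv P (fun w => r w * q w).
  by apply/summableP; apply: integrable_EFin_ge0 => //; [exact: measurable_funM|move=> w; rewrite mulr_ge0].
pose l n : R := n.+1%:R^-1.
have l0 n : 0 < l n by rewrite invr_gt0.
apply: (fatou_as hPc (f_ := fun n w => r w * M w ^+ 2 * expR (- (2^-1 * ((l n) ^+ 2 * q w))))).
- move=> n; apply: measurable_funM; first by apply: measurable_funM => //; exact: measurable_funX.
  apply: measurableT_comp => //; apply: measurableT_comp => //.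
  by apply: measurable_funM => //; exact: measurable_funM.
- by apply: measurable_funM => //; exact: measurable_funX.
- by move=> n w; apply: mulr_ge0; [apply: mulr_ge0 => //; exact: sqr_ge0|exact: expR_ge0].
- by move=> w; apply: mulr_ge0 => //; exact: sqr_ge0.
- apply: aeW => w.
  have c0 : - (2^-1 * (l n ^+ 2 * q w)) @[n --> \oo] --> (0 : R).
    rewrite -[X in _ --> X]oppr0 -[X in - X](mulr0 2^-1) -[X in 2^-1 * X](mul0r (q w)).
    rewrite -[X in X * q w](mulr0 0).
    apply: cvgN; apply: cvgM; first exact: cvg_cst.
    by apply: cvgM; [apply: cvgM; exact: cvg_harmonic|exact: cvg_cst].
  have c1 : expR (- (2^-1 * (l n ^+ 2 * q w))) @[n --> \oo] --> (1 : R).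
    by rewrite -[X in _ --> X](expR0 R); exact: cvg_expR c0.
  by rewrite -[X in _ --> X]mulr1; apply: cvgM c1; exact: cvg_cst.
move=> n.
have [s1 e1] := sexp (l n); have [s2 e2] := sexp (- l n).
pose f w := r w * M w ^+ 2 * expR (- (2^-1 * ((l n) ^+ 2 * q w))).
have f0 w : 0 <= f w.
  by apply: mulr_ge0; [apply: mulr_ge0 => //; exact: sqr_ge0|exact: expR_ge0].
have mf : measurable_fun setT f.
  apply: measurable_funM; first by apply: measurable_funM => //; exact: measurable_funX.
  apply: measurableT_comp => //; apply: measurableT_comp => //.
  by apply: measurable_funM => //; exact: measurable_funM.
(* The two exponentials together cost at most [2 * r] in mean, and the term with [l ^+ 2 * q] pays
   for the factor [expR (- y) >= 1 - y]; so the mean of [g] is at most 4 times that of [r * q]. *)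
pose g w := 4 / (l n) ^+ 2 * (r w * expR (l n * M w - 2^-1 * ((l n) ^+ 2 * q w)) +
  r w * expR (- l n * M w - 2^-1 * ((- l n) ^+ 2 * q w)) - 2 * r w + (l n) ^+ 2 * (r w * q w)).
have sg : summable_rv P g.
  apply: summableZ; apply: summableD; last exact: summableZ.
  by apply: summableB; [exact: summableD|exact: summableZ].
have fg w : f w <= g w.
  rewrite /f /g sqrrN expRD (expRD (- l n * M w)) mulNr.
  set x := l n * M w; set y := 2^-1 * _.
  have := expR_quad x; have := expR_ge1Dx (- y); have := expR_ge0 (- y).
  set E := expR (- y); set A := expR x; set A' := expR (- x) => E0 h1 h2.
  rewrite -ler_pdivrMl ?divr_gt0 ?exprn_gt0// invf_div.
  have -> : (l n) ^+ 2 / 4 * (r w * M w ^+ 2 * E) = r w * ((x ^+ 2 / 4) * E).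
    by rewrite /x exprMn; ring.
  have -> : r w * (A * E) + r w * (A' * E) - 2 * r w + (l n) ^+ 2 * (r w * q w) =
     r w * ((A + A') * E - 2 + (l n) ^+ 2 * q w) by ring.
  apply: ler_wpM2l => //.
  have hy : (l n) ^+ 2 * q w = 2 * y by rewrite /y mulrA divff ?mul1r.
  rewrite hy; have : (2 + x ^+ 2 / 4) * E <= (A + A') * E by apply: ler_wpM2r.
  rewrite mulrDl; lra.
have sf : summable_rv P f by apply: summable_le sg _ => // w; rewrite ger0_norm.
rewrite (integral_EFin srq) (integral_EFin sf) -EFinM lee_fin.
apply: (le_trans (expectation_le sf sg fg)).
rewrite /g meanZ//; last first.
  apply: summableD; last exact: summableZ.
  by apply: summableB; [exact: summableD|exact: summableZ].
rewrite meanD//; [|by apply: summableB; [exact: summableD|exact: summableZ]|exact: summableZ].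
rewrite meanB//; [|exact: summableD|exact: summableZ].
rewrite meanD// !meanZ//.
set X := \mean[P]_w (r w * q w).
have -> : 4 * X = 4 / l n ^+ 2 * (l n ^+ 2 * X).
  by rewrite mulrA divfK// expf_neq0// gt_eqF.
apply: ler_wpM2l; first by rewrite divr_ge0// sqr_ge0.
by rewrite -[leRHS]add0r lerD2r; lra.
Qed.

(** The mean of [r * (expR (l * M - 2^-1 * (l ^+ 2 * q)) - 1)] is nonpositive; divide it by [l] and
    let [l] tend to 0. Applied to [M] and to [- M], this makes the weighted mean of [M] vanish. *)
Lemma first_moment_le (g : Om -> R) : measurable_fun setT g -> (forall w, 0 <= g w) ->
  (forall w, q w <= g w ^+ 2) ->
  summable_rv P (fun w => r w * M w) -> summable_rv P (fun w => r w * g w) ->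
  \mean[P]_w (r w * M w) <= 0.
Proof.
move=> mg g0 qg sM sg.
pose l n : R := n.+1%:R^-1.
have l0 n : 0 < l n by rewrite invr_gt0.
pose E n w := expR (l n * M w - 2^-1 * ((l n) ^+ 2 * q w)).
pose f_ n w := r w * ((E n w - 1) / l n + (`|M w| + g w)).
have snM : summable_rv P (fun w => r w * `|M w|).
  have := summable_norm sM; apply: eq_summable => w.
  by rewrite /= normrM (ger0_norm (r0 w)).
(* An integrable lower bound for the difference quotients, uniform in [n], for Fatou's lemma. If
   [l * g <= 1] the tangent line of the exponential suffices; otherwise the quotient is at least
   [- l^-1], hence at least [- g]. *)
have key n w : - (`|M w| + g w) <= (E n w - 1) / l n.
  rewrite ler_pdivlMr//.
  have hM := ler_norm (- M w); rewrite normrN in hM.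
  case/orP: (le_total (l n * g w) 1) => h.
    have := expR_ge1Dx (l n * M w - 2^-1 * ((l n) ^+ 2 * q w)); rewrite -/(E n w) => h1.
    have h2 : (l n) ^+ 2 * q w <= l n * g w.
      apply: (@le_trans _ _ ((l n * g w) * (l n * g w))).
        by rewrite -expr2 exprMn ler_wpM2l ?sqr_ge0.
      by rewrite -[leRHS]mulr1; apply: ler_wpM2l => //; rewrite mulr_ge0 ?(ltW (l0 n)).
    have h3 : - `|M w| * l n <= l n * M w.
      by rewrite mulrC; apply: ler_wpM2l; [exact: ltW|lra].
    have h4 : 0 <= l n * g w by rewrite mulr_ge0 ?(ltW (l0 n)).
    lra.
  have h1 := expR_ge0 (l n * M w - 2^-1 * ((l n) ^+ 2 * q w)).
  have h2 : 0 <= `|M w| * l n by rewrite mulr_ge0 ?(ltW (l0 n)).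
  rewrite /E; lra.
have f0 n w : 0 <= f_ n w by rewrite mulr_ge0// addrC -lerBlDl sub0r.
have mE n : measurable_fun setT (E n).
  apply: measurableT_comp => //; apply: measurable_funB; first exact: measurable_funM.
  by apply: measurable_funM => //; exact: measurable_funM.
have mnM : measurable_fun setT (fun w => `|M w| + g w).
  by apply: measurable_funD => //; exact: measurableT_comp.
have sf n : summable_rv P (f_ n) /\
    \mean[P]_w f_ n w <= \mean[P]_w (r w * `|M w|) + \mean[P]_w (r w * g w).
  have [s1 e1] := sexp (l n).
  have E1 : f_ n = fun w => (l n)^-1 * (r w * E n w - r w) + (r w * `|M w| + r w * g w).
    by apply/funext => w; rewrite /f_; ring.
  have s2 : summable_rv P (fun w => r w * E n w - r w) by exact: summableB.
  have s3 := summableD snM sg; have s4 := summableZ (l n)^-1 s2.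
  rewrite E1; split; first exact: summableD.
  rewrite meanD// meanZ// meanB// (meanD snM)//.
  rewrite gerDr; apply: mulr_ge0_le0; first by rewrite invr_ge0 ltW.
  by rewrite subr_le0.
have sT : summable_rv P (fun w => r w * (M w + (`|M w| + g w))).
  have := summableD sM (summableD snM sg); apply: eq_summable => w.
  by rewrite /= -!mulrDr.
have : (\int[P]_w (r w * (M w + (`|M w| + g w)))%:E <=
    (\mean[P]_w (r w * `|M w|) + \mean[P]_w (r w * g w))%:E)%E.
  apply: (fatou_as hPc (f_ := f_)) => //.
  - by move=> n; exact: summable_measurable (sf n).1.
  - exact: summable_measurable sT.
  - move=> w; rewrite mulr_ge0// addrA addr_ge0//.
    by have := ler_norm (- M w); rewrite normrN; lra.
  - apply: aeW => w; apply: cvgM; first exact: cvg_cst.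
    apply: cvgD; last exact: cvg_cst.
    have cl : l n @[n --> \oo] --> (0 : R) by exact: cvg_harmonic.
    have cx : M w - 2^-1 * (l n * q w) @[n --> \oo] --> M w.
      rewrite -[X in _ --> X]subr0 -[X in _ - X](mulr0 2^-1) -[X in 2^-1 * X](mul0r (q w)).
      apply: cvgB; first exact: cvg_cst.
      by apply: cvgM; [exact: cvg_cst|apply: cvgM => //; exact: cvg_cst].
    have cE : E n w @[n --> \oo] --> (1 : R).
      rewrite -(expR0 R) -(mul0r (M w)).
      rewrite (_ : (fun n => _) = fun n => expR (l n * (M w - 2^-1 * (l n * q w)))); last first.
        by apply/funext => n; rewrite /E; congr expR; ring.
      exact: cvg_expR (cvgM cl cx).
    have cxE : (M w - 2^-1 * (l n * q w)) * E n w @[n --> \oo] --> M w.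
      by rewrite -[X in _ --> X]mulr1; exact: cvgM.
    (* The tangent inequalities at [l * y] and at its opposite trap the quotient between [y] and
       [y * expR (l * y)]. *)
    apply: squeeze_cvgr cx cxE; apply: nearW => n.
    set y := M w - 2^-1 * (l n * q w).
    have Ey : E n w = expR (l n * y) by rewrite /E /y; congr expR; ring.
    rewrite Ey (ler_pdivlMr _ _ (l0 n)) (ler_pdivrMr _ _ (l0 n)).
    have h1 := expR_ge1Dx (l n * y); apply/andP; split; first by lra.
    have h2 := expR_ge1Dx (- (l n * y)).
    have h3 : expR (l n * y) * expR (- (l n * y)) = 1 by rewrite expRN divff// gt_eqF ?expR_gt0.
    have h4 := ler_wpM2l (expR_ge0 (l n * y)) h2; rewrite h3 mulrBr mulr1 in h4.
    lra.
  - by move=> n; rewrite integral_EFin ?lee_fin; case: (sf n).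
rewrite integral_EFin// lee_fin.
rewrite (_ : \mean[P]_w (r w * (M w + (`|M w| + g w))) = \mean[P]_w (r w * M w) +
  (\mean[P]_w (r w * `|M w|) + \mean[P]_w (r w * g w))); first by rewrite gerDr.
have s3 := summableD snM sg.
rewrite -(meanD snM)// -meanD//; apply: eq_mean => w.
by rewrite -!mulrDr.
Qed.

End exponential_moments.

Fact time_dot_key : unit. Proof. exact: tt. Qed.
Fact gdens_key : unit. Proof. exact: tt. Qed.
Fact gincr_key : unit. Proof. exact: tt. Qed.

(** * Increments weighted by the Girsanov density *)

Section girsanov_weights.
Context (R : realType) (d0 : measure_display) (Om : measurableType d0)
  (P : probability Om R) (hPc : measure_is_complete P) (T : R) (hT : 0 < T)
  (m : nat) (B : R -> Om -> 'cV[R]_m) (hB : brownian_motion P T B).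
Local Notation Fil := (augmented_filtration P B).
Local Notation mu := (@lebesgue_measure R).
Local Notation pred := (predictable_mx Fil T).
Local Notation sq := (sq_norm_integral T).
Local Notation ito := (ito_integral P T B).

Lemma measurable_sqrt_comp (f : Om -> R) : measurable_fun setT f ->
  measurable_fun setT (fun w => Num.sqrt (f w)).
Proof.
by move=> mf; apply: measurableT_comp mf; apply: continuous_measurable_fun; exact: sqrt_continuous.
Qed.

Definition time_dot n (h g : R -> Om -> 'cV[R]_n) (s t : R) (w : Om) : R :=
  locked_with time_dot_key (\int[mu]_(u in `[s, t]) vdot (h u w) (g u w)).

Lemma time_dotE n (h g : R -> Om -> 'cV[R]_n) s t w :
  time_dot h g s t w = \int[mu]_(u in `[s, t]) vdot (h u w) (g u w).
Proof. by rewrite /time_dot unlock. Qed.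

Lemma time_dot_split n (h g : R -> Om -> 'cV[R]_n) a b c w : pred h -> pred g ->
  (sq h w < +oo)%E -> (sq g w < +oo)%E -> 0 <= a -> a <= b -> b <= c -> c <= T ->
  time_dot h g a c w = time_dot h g a b w + time_dot h g b c w.
Proof.
move=> ph pg fh fg a0 ab bc cT; rewrite !time_dotE; apply: (Rintegral_split a0 ab bc cT).
exact: (sq_vdot_integrable hT ph pg fh fg).
Qed.

Lemma time_dotC n (h g : R -> Om -> 'cV[R]_n) s t w : time_dot h g s t w = time_dot g h s t w.
Proof. by rewrite !time_dotE; apply: eq_Rintegral => u _; exact: vdotC. Qed.

Lemma vdot_lincomb n a b (u v : 'cV[R]_n) : vdot (a *: u + b *: v) (a *: u + b *: v) =
  a ^+ 2 * vdot u u + 2 * a * b * vdot u v + b ^+ 2 * vdot v v.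
Proof. by rewrite !(vdotDl, vdotDr, vdotZl, vdotZr) (vdotC v u); ring. Qed.

Lemma qv_lincomb n (u v : R -> Om -> 'cV[R]_n) a b s t w : pred u -> pred v ->
  (sq u w < +oo)%E -> (sq v w < +oo)%E -> 0 <= s -> t <= T ->
  qv (fun s w => a *: u s w + b *: v s w) s t w =
  a ^+ 2 * qv u s t w + 2 * a * b * time_dot u v s t w + b ^+ 2 * qv v s t w.
Proof.
move=> pu pv fu fv s0 tT; rewrite !qvE time_dotE.
have iuu := integrable_sub_itv s0 tT (sq_vdot_integrable hT pu pu fu fu).
have iuv := integrable_sub_itv s0 tT (sq_vdot_integrable hT pu pv fu fv).
have ivv := integrable_sub_itv s0 tT (sq_vdot_integrable hT pv pv fv fv).
have mI : measurable (`[s, t]%classic : set (measurableTypeR R)) by [].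
have j1 := integrable_EFinZ mI (a ^+ 2) iuu.
have j2 := integrable_EFinZ mI (2 * a * b) iuv.
have j3 := integrable_EFinZ mI (b ^+ 2) ivv.
have j12 := integrable_EFinD mI j1 j2.
rewrite -(RintegralZl _ mI iuu) -(RintegralZl _ mI iuv) -(RintegralZl _ mI ivv).
rewrite -(RintegralD mI j1 j2) -(RintegralD mI j12 j3).
by apply: eq_Rintegral => x _; exact: vdot_lincomb.
Qed.

Lemma time_dot_sq_le n (h g : R -> Om -> 'cV[R]_n) s t w : pred h -> pred g ->
  (sq h w < +oo)%E -> (sq g w < +oo)%E -> 0 <= s -> t <= T ->
  time_dot h g s t w ^+ 2 <= qv h s t w * qv g s t w.
Proof.
move=> ph pg fh fg s0 tT.
set a := qv h s t w; set b := qv g s t w; set c := time_dot h g s t w.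
have a0 : 0 <= a by exact: qv_ge0.
have b0 : 0 <= b by exact: qv_ge0.
have k x y : 0 <= x ^+ 2 * a + 2 * x * y * c + y ^+ 2 * b.
  by rewrite -(qv_lincomb x y ph pg fh fg s0 tT) qv_ge0.
have [b00|bn0] := eqVneq b 0.
  (* With [b = 0] the form is affine in [y]; at [x = c] and [y = - (a + 1) / 2] it equals
     [- c ^+ 2]. *)
  have := k c (- (a + 1) / 2); rewrite b00 mulr0 addr0 mulr0 => h1.
  have -> : c = 0.
    apply/eqP; rewrite -sqrf_eq0; apply/eqP/le_anti; rewrite sqr_ge0 andbT.
    by move: h1; rewrite !expr2; nra.
  by rewrite expr0n.
have bp : 0 < b by rewrite lt_neqAle eq_sym bn0.
have := k b (- c); rewrite (_ : _ + _ = b * (a * b - c ^+ 2)); last by ring.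
by rewrite pmulr_rge0// subr_ge0.
Qed.

Lemma M2_summable (h : R -> Om -> 'cV[R]_m) : M2 P T Fil h -> summable_rv P (qv h 0 T).
Proof.
case=> ph hh; have mh := measurable_sq hPc hT hB ph.
have mq : measurable_fun setT (qv h 0 T).
  exact: (meas_wrt_measurable hPc hB (lexx T) (adapted_qv hT ph (lexx 0) (ltW hT) (lexx T))).
apply/summableP/integrableP; split; first exact/measurable_EFinP.
apply: le_lt_trans hh; apply: ge0_le_integral => //.
- by apply: measurableT_comp => //; exact/measurable_EFinP.
move=> w _ /=; rewrite ger0_norm ?qv_ge0//.
have [fh|] := ltP (sq h w) +oo%E; first by rewrite (sq_qv fh).
by rewrite leye_eq => /eqP ->; exact: leey.
Qed.

Lemma M2_finite (h : R -> Om -> 'cV[R]_m) : M2 P T Fil h -> {ae P, forall w, (sq h w < +oo)%E}.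
Proof.
case=> ph hh; have mh := measurable_sq hPc hT hB ph.
have : P.-integrable setT (sq h).
  by apply/integrableP; split=> //; under eq_integral do rewrite gee0_abs ?sq_ge0//.
move=> /(integrable_ae measurableT); apply: filterS => w /(_ I) fw.
by rewrite ltey_eq fw.
Qed.

Lemma M2_expectation (h : R -> Om -> 'cV[R]_m) : M2 P T Fil h ->
  (\int[P]_w sq h w)%E = (\mean[P]_w qv h 0 T w)%:E.
Proof.
move=> Mh; have [ph hh] := Mh; rewrite -integral_EFin; last exact: M2_summable.
have mh := measurable_sq hPc hT hB ph.
apply: ae_eq_integral => //.
  exact/measurable_EFinP/summable_measurable/M2_summable.
by apply: filterS (M2_finite Mh) => w fw _; rewrite sq_qv.
Qed.

Lemma measurable_qv n (h : R -> Om -> 'cV[R]_n) s t : pred h -> 0 <= s -> s <= t -> t <= T -> measurable_fun setT (qv h s t).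
Proof.
by move=> ph s0 st tT; exact: (meas_wrt_measurable hPc hB tT (adapted_qv hT ph s0 st tT)).
Qed.

Lemma measurable_time_dot n (h g : R -> Om -> 'cV[R]_n) s t : pred h -> pred g -> 0 <= s -> s <= t -> t <= T ->
  measurable_fun setT (time_dot h g s t).
Proof.
move=> ph pg s0 st tT.
rewrite (_ : time_dot h g s t = fun w => \int[mu]_(u in `[s, t]) vdot (h u w) (g u w)).
  exact: (meas_wrt_measurable hPc hB tT (adapted_int_vdot hT ph pg s0 st tT)).
by apply/funext => w; rewrite time_dotE.
Qed.

Lemma measurable_ito h I t : ito h I -> 0 <= t -> t <= T -> measurable_fun setT (I t).
Proof. by move=> iI t0 tT; exact: (meas_wrt_measurable hPc hB tT (ito_adapted iI t0 tT)). Qed.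

Lemma summable_qv (h : R -> Om -> 'cV[R]_m) s t : M2 P T Fil h -> 0 <= s -> s <= t -> t <= T -> summable_rv P (qv h s t).
Proof.
move=> Mh s0 st tT; have [ph _] := Mh.
apply: (summable_le_as (measurable_qv ph s0 st tT) (M2_summable Mh)).
by apply: filterS (M2_finite Mh) => w fw; rewrite ger0_norm ?qv_ge0//; exact: (qv_le hT ph fw).
Qed.

Section weights.
Variables (theta : R -> Om -> 'cV[R]_m) (Th : R -> Om -> R).
Hypothesis iTh : ito theta Th.

Let ptheta : pred theta. Proof. by case: iTh. Qed.
Let ftheta : {ae P, forall w, (sq theta w < +oo)%E}. Proof. by case: iTh. Qed.

(** The Girsanov density between the times [s] and [t]: the ratio of two values of the stochastic
    exponential of minus the integral of [theta]. Its companion [gincr] is the increment of the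
    integral of [h] against [dB + theta dt], that is of a wealth. *)
Definition gdens s t w :=
  locked_with gdens_key (expR (- (Th t w - Th s w) - 2^-1 * qv theta s t w)).

Definition gincr h (N : R -> Om -> R) s t w :=
  locked_with gincr_key (N t w - N s w + time_dot h theta s t w).

Lemma gdensE s t w :
  gdens s t w = expR (- (Th t w - Th s w) - 2^-1 * qv theta s t w).
Proof. by rewrite /gdens unlock. Qed.

Lemma gdens_gt0 s t w : 0 < gdens s t w.
Proof. by rewrite gdensE expR_gt0. Qed.

Lemma gincrE h N s t w : gincr h N s t w = N t w - N s w + time_dot h theta s t w.
Proof. by rewrite /gincr unlock. Qed.

Lemma gincr_self s t w : gincr theta Th s t w = Th t w - Th s w + qv theta s t w.
Proof. by rewrite gincrE time_dotE qvE. Qed.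

Lemma adapted_gdens s t : 0 <= s -> s <= t -> t <= T -> meas_wrt (Fil t) (gdens s t).
Proof.
move=> s0 st tT; apply/meas_wrtP.
rewrite (_ : gdens s t = fun w => expR (- (Th t w - Th s w) - 2^-1 * qv theta s t w)); last first.
  by apply/funext => w; exact: gdensE.
apply: measurableT_comp => //; apply: measurable_funB.
  apply: measurableT_comp => //; apply: measurable_funB; apply/meas_wrtP.
    by apply: (ito_adapted iTh) => //; exact: (le_trans s0 st).
  by apply: (meas_wrt_mono st); apply: (ito_adapted iTh) => //; exact: (le_trans st tT).
by apply: measurable_funM => //; apply/meas_wrtP; exact: (adapted_qv hT ptheta).
Qed.

Lemma measurable_gdens s t : 0 <= s -> s <= t -> t <= T -> measurable_fun setT (gdens s t).
Proof.
by move=> s0 st tT; exact: (meas_wrt_measurable hPc hB tT (adapted_gdens s0 st tT)).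
Qed.

Lemma measurable_gincr h N s t : ito h N -> 0 <= s -> s <= t -> t <= T ->
  measurable_fun setT (gincr h N s t).
Proof.
move=> iN s0 st tT; have ph : pred h by case: iN.
rewrite (_ : gincr h N s t = fun w => N t w - N s w + time_dot h theta s t w); last first.
  by apply/funext => w; exact: gincrE.
apply: measurable_funD; last exact: measurable_time_dot.
apply: measurable_funB; apply: measurable_ito iN _ _ => //.
  exact: (le_trans s0 st).
exact: (le_trans st tT).
Qed.

(** Density times exponential is again an exponential, that of the integral of [- theta + l h]: the
    cross term in the square of this integrand is exactly the drift part of [gincr]. *)
Lemma gdens_exp_le h N s t W : ito h N -> 0 <= s -> s <= t -> t <= T ->
  meas_wrt (Fil s) W -> (forall w, 0 <= W w) -> forall l : R,
  (\int[P]_w (W w * gdens s t w *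
     expR (l * gincr h N s t w - 2^-1 * (l ^+ 2 * qv h s t w)))%:E <= \int[P]_w (W w)%:E)%E.
Proof.
move=> iN s0 st tT mW W0 l.
have ph : pred h by case: iN.
have fh : {ae P, forall w, (sq h w < +oo)%E} by case: iN.
have iL := ito_lincomb hPc hT hB (-1) l iTh iN.
apply: le_trans (ito_exp_supermartingale hPc hT hB iL s0 st tT mW W0).
have mWm := meas_wrt_measurable hPc hB (le_trans st tT) mW.
rewrite le_eqVlt; apply/orP; left; apply/eqP.
apply: ae_eq_integral => //.
- apply/measurable_EFinP; apply: measurable_funM.
    by apply: measurable_funM => //; exact: measurable_gdens.
  apply: measurableT_comp => //; apply: measurable_funB; apply: measurable_funM => //.
    exact: measurable_gincr.
  by apply: measurable_funM => //; exact: measurable_qv.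
- apply/measurable_EFinP; apply: measurable_funM => //; apply: measurableT_comp => //.
  apply: measurable_funB.
    by apply: measurable_funB; apply: (measurable_ito iL) => //;
      [exact: (le_trans s0 st)|exact: (le_trans st tT)].
  apply: measurable_funM => //; apply: measurable_qv => //; by case: iL.
apply: filterS2 ftheta fh => w f1 f2 _.
rewrite gdensE gincrE -mulrA -expRD; congr (EFin (_ * expR _)).
by rewrite (qv_lincomb (-1) l ptheta ph f1 f2 s0 tT) (time_dotC theta); field.
Qed.

Lemma gdens_le s t W : 0 <= s -> s <= t -> t <= T ->
  meas_wrt (Fil s) W -> (forall w, 0 <= W w) ->
  (\int[P]_w (W w * gdens s t w)%:E <= \int[P]_w (W w)%:E)%E.
Proof.
move=> s0 st tT mW W0; have := gdens_exp_le (ito_zero hPc hT hB) s0 st tT mW W0 0.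
by under eq_integral do rewrite mul0r expr0n/= mul0r mulr0 subr0 expR0 mulr1.
Qed.

(** The comparison of the two masses says that the density loses nothing on [W]. The exponential
    bounds then hold relative to the weight [W] times the density, and [first_moment_le] applies to
    the increment and to its opposite. *)
Lemma weighted_martingale h N s t W : ito h N -> 0 <= s -> s <= t -> t <= T ->
  meas_wrt (Fil s) W -> (forall w, 0 <= W w) -> summable_rv P (fun w => W w * gdens s t w) ->
  (\int[P]_w (W w)%:E <= \int[P]_w (W w * gdens s t w)%:E)%E ->
  summable_rv P (fun w => W w * gdens s t w * gincr h N s t w) ->
  summable_rv P (fun w => W w * gdens s t w * Num.sqrt (qv h s t w)) ->
  \mean[P]_w (W w * gdens s t w * gincr h N s t w) = 0.
Proof.
move=> iN s0 st tT mW W0 sW eW sM sq_.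
have ph : pred h by case: iN.
have mq := measurable_qv ph s0 st tT.
have msq : measurable_fun setT (fun w => Num.sqrt (qv h s t w)) by exact: measurable_sqrt_comp.
have r0 w : 0 <= W w * gdens s t w by rewrite mulr_ge0 ?(ltW (gdens_gt0 _ _ _)).
have qs w : qv h s t w <= Num.sqrt (qv h s t w) ^+ 2 by rewrite sqr_sqrtr ?qv_ge0.
have H l := le_trans (gdens_exp_le iN s0 st tT mW W0 l) eW.
apply: le_anti; apply/andP; split.
  by apply: (first_moment_le hPc (summable_measurable sW) (measurable_gincr iN s0 st tT)
    mq r0 sW H msq) => // w; exact: sqrtr_ge0.
have H' l : (\int[P]_w (W w * gdens s t w * expR (l * - gincr h N s t w -
    2^-1 * (l ^+ 2 * qv h s t w)))%:E <= \int[P]_w (W w * gdens s t w)%:E)%E.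
  have := H (- l); rewrite sqrrN; under eq_integral do rewrite mulNr -mulrN.
  by [].
rewrite -oppr_le0 -mulN1r -meanZ//.
under eq_mean do rewrite mulN1r -mulrN.
have mM : measurable_fun setT (fun w => - gincr h N s t w).
  by apply: measurableT_comp => //; exact: measurable_gincr.
apply: (first_moment_le hPc (summable_measurable sW) mM mq r0 sW H' msq) => //.
by apply: eq_summable (summableZ (-1) sM) => w; rewrite mulN1r -mulrN.
Qed.

End weights.

(** The case [theta = 0], in which the density is 1. *)
Lemma ito_incr_L2 h N s t W : ito h N -> 0 <= s -> s <= t -> t <= T ->
  meas_wrt (Fil s) W -> (forall w, 0 <= W w) -> summable_rv P W ->
  (\int[P]_w (W w * (N t w - N s w) ^+ 2)%:E <= 4%:E * \int[P]_w (W w * qv h s t w)%:E)%E.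
Proof.
move=> iN s0 st tT mW W0 sW; have sT := le_trans st tT; have t0 := le_trans s0 st.
have ph : pred h by case: iN.
have fh : {ae P, forall w, (sq h w < +oo)%E} by case: iN.
apply: (second_moment_le hPc) => //.
- exact: summable_measurable sW.
- by apply: measurable_funB; exact: measurable_ito iN _ _.
- exact: measurable_qv.
- by move=> w; exact: qv_ge0.
have zz : gdens (fun _ _ => 0 : 'cV[R]_m) (fun _ _ => 0) s t = fun=> 1.
  apply/funext => w; rewrite gdensE qvE subrr oppr0 sub0r.
  by under eq_Rintegral do rewrite vdot0l; rewrite Rintegral_cst// mul0r mulr0 oppr0 expR0.
have zi : gincr (fun _ _ => 0 : 'cV[R]_m) h N s t = fun w => N t w - N s w.
  apply/funext => w; rewrite gincrE time_dotE.
  by under eq_Rintegral do rewrite vdot0r; rewrite Rintegral_cst// mul0r addr0.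
move=> l; have := gdens_exp_le (ito_zero hPc hT hB) iN s0 st tT mW W0 l.
by rewrite zz zi; under eq_integral do rewrite mulr1.
Qed.

Lemma ito_L2 h N s t : ito h N -> M2 P T Fil h -> 0 <= s -> s <= t -> t <= T ->
  summable_rv P (fun w => (N t w - N s w) ^+ 2) /\
  \mean[P]_w ((N t w - N s w) ^+ 2) <= 4 * \mean[P]_w qv h s t w.
Proof.
move=> iN Mh s0 st tT; apply: summable_ge0.
- apply: measurable_funX; apply: measurable_funB; apply: measurable_ito iN _ _ => //.
    exact: (le_trans s0 st).
  exact: (le_trans st tT).
- by move=> w; exact: sqr_ge0.
have := @ito_incr_L2 h N s t (fun=> 1) iN s0 st tT _ (fun=> ler01) (summable_cst P 1).
under eq_integral do rewrite mul1r.
rewrite (_ : (fun w => (1 * qv h s t w)%:E) = EFin \o qv h s t); last first.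
  by apply/funext => w; rewrite mul1r.
rewrite (integral_EFin (summable_qv Mh s0 st tT)) -EFinM; apply.
by apply/meas_wrtP; exact: measurable_cst.
Qed.

(** The weighted martingale property concerns nonnegative weights, so [V] is split into its positive
    and negative parts. *)
Lemma ito_martingale_L2 h N s t V : ito h N -> M2 P T Fil h -> 0 <= s -> s <= t -> t <= T ->
  meas_wrt (Fil s) V -> summable_rv P (fun w => V w ^+ 2) ->
  \mean[P]_w (V w * (N t w - N s w)) = 0.
Proof.
move=> iN Mh s0 st tT mV V2; have sT := le_trans st tT.
have mVm := meas_wrt_measurable hPc hB sT mV.
have [ph _] := Mh.
have zz : gdens (fun _ _ => 0 : 'cV[R]_m) (fun _ _ => 0) s t = fun=> 1.
  apply/funext => w; rewrite gdensE qvE subrr oppr0 sub0r.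
  by under eq_Rintegral do rewrite vdot0l; rewrite Rintegral_cst// mul0r mulr0 oppr0 expR0.
have zi : gincr (fun _ _ => 0 : 'cV[R]_m) h N s t = fun w => N t w - N s w.
  apply/funext => w; rewrite gincrE time_dotE.
  by under eq_Rintegral do rewrite vdot0r; rewrite Rintegral_cst// mul0r addr0.
have mN : measurable_fun setT (fun w => N t w - N s w).
  by apply: measurable_funB; apply: measurable_ito iN _ _ => //; exact: (le_trans s0 st).
have [N2 _] := ito_L2 iN Mh s0 st tT.
have mq := measurable_qv ph s0 st tT.
have msq : measurable_fun setT (fun w => Num.sqrt (qv h s t w)) by exact: measurable_sqrt_comp.
have q2 : summable_rv P (fun w => Num.sqrt (qv h s t w) ^+ 2).
  have := summable_qv Mh s0 st tT; apply: eq_summable => w.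
  by rewrite sqr_sqrtr// qv_ge0.
have key (W : Om -> R) : meas_wrt (Fil s) W -> (forall w, 0 <= W w) ->
    summable_rv P (fun w => W w ^+ 2) ->
    summable_rv P (fun w => W w * (N t w - N s w)) /\ \mean[P]_w (W w * (N t w - N s w)) = 0.
  move=> mW W0 W2; have mWm := meas_wrt_measurable hPc hB sT mW.
  have s1 := summable_mulL2 mWm mN W2 N2; split=> //.
  have := weighted_martingale (ito_zero hPc hT hB) iN s0 st tT mW W0.
  rewrite zz zi.
  under eq_mean do rewrite mulr1; apply.
  - by apply: eq_summable (summable_L2 mWm W2) => w; rewrite mulr1.
  - by under [leRHS]eq_integral do rewrite mulr1.
  - by apply: eq_summable s1 => w; rewrite mulr1.
  - by apply: eq_summable (summable_mulL2 mWm msq W2 q2) => w; rewrite mulr1.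
have mx (g : R -> R) : measurable_fun setT g -> meas_wrt (Fil s) (fun w => g (V w)).
  by move=> mg; apply/meas_wrtP; apply: measurableT_comp => //; exact/meas_wrtP.
have mp : measurable_fun setT (fun x : R => Num.max x 0) by exact: measurable_maxr.
have mn : measurable_fun setT (fun x : R => Num.max (- x) 0) by exact: measurable_maxr.
have p2 (g : R -> R) : measurable_fun setT g -> (forall x, `|g x| <= `|x|) ->
    summable_rv P (fun w => g (V w) ^+ 2).
  move=> mg gl; apply: summable_le V2 _.
    by apply: measurable_funX; exact: measurableT_comp mg mVm.
  by move=> w; rewrite ger0_norm ?sqr_ge0// -(real_normK (num_real (g _))) -(real_normK (num_real (V w))) ler_sqr ?nnegrE.
have pos_le (x : R) : `|Num.max x 0| <= `|x|.
  by rewrite ger0_norm ?le_max ?lexx ?orbT// ge_max normr_ge0 ler_norm.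
have [s1 e1] := key _ (mx _ mp) (fun w => ltac:(by rewrite le_max lexx orbT))
   (p2 _ mp pos_le).
have [s2 e2] := key _ (mx _ mn) (fun w => ltac:(by rewrite le_max lexx orbT))
   (p2 _ mn (fun x => ltac:(by rewrite -[leRHS]normrN; exact: pos_le))).
rewrite (_ : \mean[P]_w _ = \mean[P]_w (Num.max (V w) 0 * (N t w - N s w) -
    Num.max (- V w) 0 * (N t w - N s w))); last first.
  apply: eq_mean => w; rewrite -mulrBl; congr (_ * _).
  by case: (lerP (V w) 0); case: (lerP (- V w) 0); lra.
by rewrite meanB// e1 e2 subrr.
Qed.

End girsanov_weights.

(** * Maximal inequality, and superhedging when [theta] has bounded energy *)

Section girsanov_bounded.
Context (R : realType) (d0 : measure_display) (Om : measurableType d0)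
  (P : probability Om R) (hPc : measure_is_complete P) (T : R) (hT : 0 < T)
  (m : nat) (B : R -> Om -> 'cV[R]_m) (hB : brownian_motion P T B).
Local Notation Fil := (augmented_filtration P B).
Local Notation pred := (predictable_mx Fil T).
Local Notation sq := (sq_norm_integral T).
Local Notation ito := (ito_integral P T B).

Lemma meas_wrt_indic t G : Fil t G -> meas_wrt (Fil t) (\1_G : Om -> R).
Proof. by move=> FG; apply/meas_wrtP; exact: measurable_indic. Qed.

Lemma meas_wrtM t (f g : Om -> R) : meas_wrt (Fil t) f -> meas_wrt (Fil t) g ->
  meas_wrt (Fil t) (fun w => f w * g w).
Proof. by move=> /meas_wrtP mf /meas_wrtP mg; apply/meas_wrtP; exact: measurable_funM. Qed.

Lemma meas_wrtD t (f g : Om -> R) : meas_wrt (Fil t) f -> meas_wrt (Fil t) g ->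
  meas_wrt (Fil t) (fun w => f w + g w).
Proof. by move=> /meas_wrtP mf /meas_wrtP mg; apply/meas_wrtP; exact: measurable_funD. Qed.

Lemma meas_wrtB t (f g : Om -> R) : meas_wrt (Fil t) f -> meas_wrt (Fil t) g ->
  meas_wrt (Fil t) (fun w => f w - g w).
Proof. by move=> /meas_wrtP mf /meas_wrtP mg; apply/meas_wrtP; exact: measurable_funB. Qed.

Lemma meas_wrt_cst t (c : R) : meas_wrt (Fil t) (fun=> c).
Proof. by apply/meas_wrtP; exact: measurable_cst. Qed.

Lemma meas_wrt_comp t (g : R -> R) (f : Om -> R) : measurable_fun setT g ->
  meas_wrt (Fil t) f -> meas_wrt (Fil t) (fun w => g (f w)).
Proof. by move=> mg /meas_wrtP mf; apply/meas_wrtP; exact: measurableT_comp mg mf. Qed.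

Lemma Fil_setI t A A' : Fil t A -> Fil t A' -> Fil t (A `&` A').
Proof. exact: (@measurableI _ (g_sigma_algebraType (natural_filtration B t `|` P.-negligible))). Qed.

Lemma Fil_setU t A A' : Fil t A -> Fil t A' -> Fil t (A `|` A').
Proof. exact: (@measurableU _ (g_sigma_algebraType (natural_filtration B t `|` P.-negligible))). Qed.

Lemma Fil_setC t A : Fil t A -> Fil t (~` A).
Proof. exact: (@measurableC _ (g_sigma_algebraType (natural_filtration B t `|` P.-negligible))). Qed.

Lemma Fil_setT t : Fil t setT.
Proof. exact: (@measurableT _ (g_sigma_algebraType (natural_filtration B t `|` P.-negligible))). Qed.

Lemma Fil_ltr t (f : Om -> R) c : meas_wrt (Fil t) f -> Fil t [set w | c < f w].
Proof.
move=> mf; have := mf `]c, +oo[%classic; rewrite /preimage/=.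
rewrite (_ : [set x | _] = [set w | c < f w]); last first.
  by apply/seteqP; split=> w /=; rewrite in_itv/= andbT.
exact.
Qed.

Lemma Fil_ltl t (f : Om -> R) c : meas_wrt (Fil t) f -> Fil t [set w | f w < c].
Proof.
move=> mf; have := mf `]-oo, c[%classic; rewrite /preimage/=.
rewrite (_ : [set x | _] = [set w | f w < c]); last first.
  by apply/seteqP; split=> w /=; rewrite in_itv/=.
exact.
Qed.

Lemma summable_indicM (G : set Om) (f : Om -> R) : measurable G -> summable_rv P f ->
  summable_rv P (fun w => \1_G w * f w).
Proof.
move=> mG sf; apply: summable_le (summable_norm sf) _.
  by apply: measurable_funM => //; exact: summable_measurable sf.
move=> w; rewrite normrM indicE; case: (_ \in _); rewrite ?normr1 ?mul1r//.
by rewrite normr0 mul0r.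
Qed.

Lemma summable_indic (G : set Om) : measurable G -> summable_rv P (\1_G : Om -> R).
Proof.
by move=> mG; apply: eq_summable (summable_indicM mG (summable_cst P 1)) => w; rewrite mulr1.
Qed.

Lemma expectation_indic (G : set Om) : measurable G -> (\mean[P]_w (\1_G w : R))%:E = P G.
Proof. by move=> mG; rewrite -integral_EFin ?integral_indic ?setIT//; exact: summable_indic. Qed.

Lemma expectation_eq0 (f : Om -> R) : summable_rv P f -> (forall w, 0 <= f w) ->
  \mean[P]_w f w <= 0 -> {ae P, forall w, f w = 0}.
Proof.
move=> sf f0 fi.
have h : (\int[P]_w `|(f w)%:E| = 0)%E.
  under eq_integral do rewrite abse_EFin ger0_norm//.
  rewrite integral_EFin//; congr EFin; apply/le_anti; rewrite fi/=.
  exact: mean_ge0.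
have mf := summable_measurable sf.
have /(ae_eq_integral_abs P measurableT)[+ _] : measurable_fun setT (EFin \o f).
  exact/measurable_EFinP.
by move=> /(_ h); apply: filterS => w /(_ I)[].
Qed.

(** Let [G] be the event that the level is passed for the first time at index [k]. On [G] the square
    of [N T] is at least [e ^+ 2] plus twice [N (u k)] times the later increment, and this product
    has mean zero on [G]. *)
Lemma doob_maximal_step h N (u : nat -> R) n (e : R) : ito h N -> M2 P T Fil h ->
  (forall i, 0 <= u i <= T) -> (forall i, (i < n)%N -> u i <= u i.+1) -> 0 <= e ->
  forall k, (k <= n)%N -> let A := [set w | exists2 i, (i < k)%N & e < `|N (u i) w|] in
  Fil (u k) A /\
  e ^+ 2 * \mean[P]_w \1_A w <= \mean[P]_w (\1_A w * N T w ^+ 2).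
Proof.
move=> iN Mh u0T um e0.
have u0 i : 0 <= u i by case/andP: (u0T i).
have uT i : u i <= T by case/andP: (u0T i).
have N0 := ito_at0 hPc hT hB iN.
have N2 (t : R) : 0 <= t -> t <= T -> summable_rv P (fun w => N t w ^+ 2).
  move=> t0 tT; have [s2 _] := ito_L2 hPc hT hB iN Mh (lexx 0) t0 tT.
  apply: (summable_le_as _ s2).
    by apply: measurable_funX; exact: (measurable_ito hPc hB iN).
  by apply: filterS N0 => w ->; rewrite subr0 ger0_norm ?sqr_ge0.
elim=> [_|k IH kn] /=.
  have -> : [set w | exists2 i, (i < 0)%N & e < `|N (u i) w|] = set0.
    by apply/seteqP; split=> // w [].
  split; first exact: (@measurable0 _ (g_sigma_algebraType (natural_filtration B (u 0%N) `|` P.-negligible))).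
  rewrite indic0; under [leRHS]eq_mean do rewrite mul0r.
  by rewrite !expectation_cst mulr0.
have [FA hA] := IH (ltnW kn).
set A := [set w | exists2 i, (i < k)%N & e < `|N (u i) w|] in FA hA *.
have FAk := FA; have kk := um k kn.
pose G := [set w | e < `|N (u k) w|] `&` ~` A.
have mNk : meas_wrt (Fil (u k)) (N (u k)) by exact: ito_adapted iN _ _.
have FG : Fil (u k) G.
  apply: Fil_setI; last exact: Fil_setC.
  by apply: Fil_ltr; apply: meas_wrt_comp mNk; exact: normr_measurable.
have E : [set w | exists2 i, (i < k.+1)%N & e < `|N (u i) w|] = A `|` G.
  apply/seteqP; split=> w.
    case=> i; rewrite ltnS leq_eqVlt => /orP[/eqP -> hi|ik hi].
      by case: (pselect (A w)) => Aw; [left|right; split].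
    by left; exists i.
  by case=> [[i ik hi]|[hi _]]; [exists i => //; exact: ltnW|exists k].
rewrite E; split; first by apply: (Fil_mono kk); exact: Fil_setU.
have mA := Fil_measurable hPc hB (uT k) FA.
have mG := Fil_measurable hPc hB (uT k) FG.
have iE w : \1_(A `|` G) w = \1_A w + \1_G w :> R.
  rewrite !indicE; have [Aw|Aw] := pselect (A w).
    by rewrite mem_set; [rewrite mem_set// memNset ?addr0//; case|left].
  rewrite (memNset Aw) add0r; congr (_ %:R); congr nat_of_bool.
  by apply/idP/idP => /set_mem hw; apply/mem_set; [case: hw|right].
under eq_mean do rewrite iE.
under [leRHS]eq_mean do rewrite iE mulrDl.
rewrite meanD//; [|exact: summable_indic|exact: summable_indic].
rewrite meanD//; [|by apply: summable_indicM => //; exact: N2 (ltW hT) (lexx T)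
  |by apply: summable_indicM => //; exact: N2 (ltW hT) (lexx T)].
rewrite mulrDr; apply: lerD => //.
have mN1 := meas_wrt_measurable hPc hB (uT k) mNk.
have mNT := measurable_ito hPc hB iN (ltW hT) (lexx T).
have V2 : summable_rv P (fun w => (2 * (\1_G w * N (u k) w)) ^+ 2).
  apply: eq_summable (summableZ 4 (summable_indicM mG (N2 _ (u0 k) (uT k)))) => w.
  by rewrite indicE; case: (_ \in _); rewrite ?mul1r ?mul0r ?mulr0 ?expr0n// exprMn; congr (_ * _); ring.
have mV : meas_wrt (Fil (u k)) (fun w => 2 * (\1_G w * N (u k) w)).
  by apply: meas_wrtM; [exact: meas_wrt_cst|apply: meas_wrtM => //; exact: meas_wrt_indic].
have := ito_martingale_L2 hPc hT hB iN Mh (u0 k) (uT k) (lexx T) mV V2.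
set V := fun w => 2 * (\1_G w * N (u k) w) => hV.
have mVm := meas_wrt_measurable hPc hB (uT k) mV.
have [d2 _] := ito_L2 hPc hT hB iN Mh (u0 k) (uT k) (lexx T).
have sV : summable_rv P (fun w => V w * (N T w - N (u k) w)).
  apply: summable_mulL2 => //; exact: measurable_funB.
have sG := summable_indic mG.
rewrite -meanZ// -[leLHS]addr0 -hV -meanD//; last exact: summableZ.
apply: expectation_le.
- by apply: summableD => //; exact: summableZ.
- by apply: summable_indicM => //; exact: N2 (ltW hT) (lexx T).
move=> w; rewrite /V indicE; case: (boolP (w \in G)) => [/set_mem[/= hw _]|_]; last first.
  by rewrite /= !(mulr0, mul0r) addr0.
rewrite mul1r mulr1 mul1r.
have : e ^+ 2 <= `|N (u k) w| ^+ 2 by rewrite ler_sqr ?nnegrE ?(ltW hw).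
rewrite real_normK ?num_real//; have := sqr_ge0 (N T w - N (u k) w); rewrite !expr2; lra.
Qed.

(** Finitely many times of [tq] are sorted into a grid for [doob_maximal_step], and the
    corresponding events increase to the whole one. The factor 4 is the constant of [ito_L2]. *)
Lemma doob_maximal h N (e : R) : ito h N -> M2 P T Fil h -> 0 < e ->
  let A := [set w | exists n, e < `|N (tq T n) w|] in
  measurable A /\ (P A <= (4 * \mean[P]_w qv h 0 T w / e ^+ 2)%:E)%E.
Proof.
move=> iN Mh e0 A.
have mN n : measurable [set w | e < `|N (tq T n) w|].
  have := measurable_ito hPc hB iN (tq_ge0 hT n) (tq_le hT n).
  move=> /(measurableT_comp (@normr_measurable R setT)) mf.
  have := mf measurableT `]e, +oo[%classic (measurable_itv _); rewrite setTI.
  rewrite (_ : _ @^-1` _ = [set w | e < `|N (tq T n) w|])//.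
  by apply/seteqP; split=> w /=; rewrite in_itv/= andbT.
have AE : A = \bigcup_n [set w | e < `|N (tq T n) w|].
  by apply/seteqP; split=> w [n]; [exists n|exists n].
have mA : measurable A by rewrite AE; exact: bigcup_measurable.
split=> //.
pose A_ n := [set w | exists2 i, (i < n)%N & e < `|N (tq T i) w|].
have A_E n : A_ n = \bigcup_(i < n) [set w | e < `|N (tq T i) w|].
  by apply/seteqP; split=> w [i ni hi]; exists i.
have mA_ n : measurable (A_ n) by rewrite A_E; exact: bigcup_measurable.
have AU : \bigcup_n A_ n = A.
  by apply/seteqP; split=> w; [case=> n _ [i _ hi]; exists i|case=> i hi; exists i.+1 => //; exists i].
have hcv : P (A_ n) @[n --> \oo] --> P A.
  rewrite -AU; apply: nondecreasing_cvg_mu => //; first by rewrite AU.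
  move=> i j ij; apply/subsetPset => w [k ki hk]; exists k => //; exact: leq_trans ij.
rewrite -(cvg_lim _ hcv)//; apply: lime_le; first by apply/cvg_ex; exists (P A).
apply: nearW => n.
pose s := sort <=%O (mkseq (tq T) n).
pose u i := nth T s i.
have ss : size s = n by rewrite size_sort size_mkseq.
have us i : (i < n)%N -> exists2 j, (j < n)%N & u i = tq T j.
  move=> ni; have : u i \in s by rewrite mem_nth// ss.
  by rewrite mem_sort => /mapP[j]; rewrite mem_iota add0n => /andP[_ jn] ->; exists j.
have u0T i : 0 <= u i <= T.
  have [ni|ni] := ltnP i n; last by rewrite /u nth_default ?ss// lexx andbT ltW.
  by have [j _ ->] := us i ni; rewrite (tq_ge0 hT) (tq_le hT).
have um i : (i < n)%N -> u i <= u i.+1.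
  rewrite leq_eqVlt => /orP[/eqP e1|i1n].
    by rewrite {2}/u nth_default ?ss ?e1//; case/andP: (u0T i).
  by apply: (sorted_leq_nth le_trans le_refl) => //; [exact: sort_le_sorted|rewrite inE ss ltnW|rewrite inE ss].
have [_] := doob_maximal_step iN Mh u0T um (ltW e0) (leqnn n).
rewrite (_ : [set w | _] = A_ n); last first.
  apply/seteqP; split=> w [i ni hi].
    by have [j jn uj] := us i ni; exists j => //; rewrite -uj.
  have : tq T i \in s by rewrite mem_sort; apply/mapP; exists i => //; rewrite mem_iota.
  by move=> /(nthP T)[j]; rewrite ss => jn uj; exists j => //; rewrite /u uj.
move=> h1.
have [s2 h2] := ito_L2 hPc hT hB iN Mh (lexx 0) (ltW hT) (lexx T).
rewrite -expectation_indic// lee_fin ler_pdivlMr ?exprn_gt0// mulrC.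
apply: (le_trans h1); apply: le_trans h2.
have N0 := ito_at0 hPc hT hB iN.
have sN : summable_rv P (fun w => \1_(A_ n) w * N T w ^+ 2).
  apply: summable_indicM => //; apply: (summable_le_as _ s2).
    by apply: measurable_funX; exact: (measurable_ito hPc hB iN (ltW hT) (lexx T)).
  by apply: filterS N0 => w ->; rewrite subr0 ger0_norm ?sqr_ge0.
apply: expectation_le_as => //.
apply: filterS N0 => w ->; rewrite subr0 indicE; case: (_ \in _); rewrite ?mul1r// mul0r sqr_ge0//.
Qed.

Lemma le_pair_eq (a b a' b' : R) : a <= b -> a' <= b' -> b + b' <= a + a' -> a = b.
Proof. lra. Qed.

Section bounded.
Variables (theta : R -> Om -> 'cV[R]_m) (Th : R -> Om -> R) (K : R).
Hypotheses (iTh : ito theta Th)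
  (hK : {ae P, forall w, (sq theta w <= K%:E)%E}).
Local Notation Z := (gdens theta Th).
Let pth : pred theta. Proof. by case: iTh. Qed.

Lemma qv_theta_le s t : 0 <= s -> s <= t -> t <= T -> {ae P, forall w, qv theta s t w <= K}.
Proof.
move=> s0 st tT; apply: filterS hK => w h.
have fw : (sq theta w < +oo)%E by apply: (le_lt_trans h); rewrite ltry.
by apply: (le_trans (qv_le hT pth fw s0 st tT)); rewrite -lee_fin -sq_qv.
Qed.

(** For [h = theta] and [l = -1] the exponential bound concerns the exponential of minus twice the
    increment of [Th] minus twice the energy; the square of the density is this times the
    exponential of the energy, itself at most [expR K]. *)
Lemma gdens_L2 t : 0 <= t -> t <= T -> summable_rv P (fun w => Z 0 t w ^+ 2) /\
  \mean[P]_w (Z 0 t w ^+ 2) <= expR K.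
Proof.
move=> t0 tT.
have mZ := measurable_gdens hPc hT hB iTh (lexx 0) t0 tT.
have := gdens_exp_le hPc hT hB iTh iTh (lexx 0) t0 tT (ltac:(exact: meas_wrt_cst) : meas_wrt (Fil 0) (fun=> 1)) (fun=> ler01) (-1).
under [leRHS]eq_integral do rewrite /=.
rewrite (_ : (\int[P]_w 1%:E)%E = 1%E); last first.
  by rewrite integral_EFin ?expectation_cst//; exact: summable_cst.
pose f w := 1 * Z 0 t w * expR (-1 * gincr theta theta Th 0 t w - 2^-1 * ((-1) ^+ 2 * qv theta 0 t w)).
have mf : measurable_fun setT f.
  apply: measurable_funM; first by apply: measurable_funM.
  apply: measurableT_comp => //; apply: measurable_funB; apply: measurable_funM => //.
    exact: (measurable_gincr hPc hT hB iTh iTh).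
  by apply: measurable_funM => //; exact: (measurable_qv hPc hT hB).
have f0 w : 0 <= f w by rewrite /f mul1r mulr_ge0 ?expR_ge0// ltW// gdens_gt0.
move=> /(summable_ge0 mf f0)[sf ef].
have eK : {ae P, forall w, Z 0 t w ^+ 2 <= expR K * f w}.
  apply: filterS (qv_theta_le (lexx 0) t0 tT) => w h.
  rewrite /f mul1r expr2 gdensE -!expRD ler_expR gincr_self; lra.
have s2 : summable_rv P (fun w => Z 0 t w ^+ 2).
  apply: (summable_le_as _ (summableZ (expR K) sf)); first exact: measurable_funX.
  by apply: filterS eK => w h; rewrite ger0_norm ?sqr_ge0.
split=> //; apply: (le_trans (expectation_le_as s2 (summableZ (expR K) sf) eK)).
by rewrite meanZ// -[leRHS]mulr1 ler_wpM2l ?expR_ge0.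
Qed.

Lemma gdens_summable t : 0 <= t -> t <= T -> summable_rv P (Z 0 t).
Proof.
move=> t0 tT; apply: summable_L2; last by case: (gdens_L2 t0 tT).
exact: (measurable_gdens hPc hT hB iTh).
Qed.

Lemma gdens_mulr s t : 0 <= s -> s <= t -> t <= T ->
  {ae P, forall w, Z 0 t w = Z 0 s w * Z s t w}.
Proof.
move=> s0 st tT; apply: filterS hK => w h.
have fw : (sq theta w < +oo)%E by apply: (le_lt_trans h); rewrite ltry.
rewrite !gdensE -expRD; congr expR.
rewrite (qv_split hT pth fw (lexx 0) s0 st tT); lra.
Qed.

Hypothesis hZ : \mean[P]_w Z 0 T w = 1.

(** The supermartingale inequality holds on [G] and on its complement, while the total mass is 1 at
    [T] and at most 1 at [t]; so both inequalities are equalities. *)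
Lemma gdens_cond t G : 0 <= t -> t <= T -> Fil t G ->
  \mean[P]_w (\1_G w * Z 0 T w) = \mean[P]_w (\1_G w * Z 0 t w).
Proof.
move=> t0 tT FG.
have sT := gdens_summable (ltW hT) (lexx T); have st := gdens_summable t0 tT.
have le G' : Fil t G' -> \mean[P]_w (\1_G' w * Z 0 T w) <= \mean[P]_w (\1_G' w * Z 0 t w).
  move=> FG'; have mG := Fil_measurable hPc hB tT FG'.
  have mW : meas_wrt (Fil t) (fun w => \1_G' w * Z 0 t w).
    by apply: meas_wrtM; [exact: meas_wrt_indic|exact: (adapted_gdens hT iTh (lexx 0))].
  have W0 w : 0 <= \1_G' w * Z 0 t w by rewrite mulr_ge0 ?(ltW (gdens_gt0 _ _ _ _ _))// indicE.
  have := gdens_le hPc hT hB iTh t0 tT (lexx T) mW W0.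
  rewrite [X in (_ <= X)%E](integral_EFin (summable_indicM mG st)).
  have mZ := measurable_gdens hPc hT hB iTh t0 tT (lexx T).
  have mWm := meas_wrt_measurable hPc hB tT mW.
  have mWZ : measurable_fun setT (fun w => \1_G' w * Z 0 t w * Z t T w).
    exact: (measurable_funM mWm mZ).
  move=> /(summable_ge0 mWZ (fun w => mulr_ge0 (W0 w) (ltW (gdens_gt0 _ _ _ _ _))))[s1].
  apply: le_trans; rewrite le_eqVlt; apply/orP; left; apply/eqP.
  apply: (expectation_as_eq (summable_indicM mG sT) s1).
  by apply: filterS (gdens_mulr t0 tT (lexx T)) => w ->; rewrite mulrA.
have mG := Fil_measurable hPc hB tT FG.
have sum t' : summable_rv P (Z 0 t') -> \mean[P]_w (\1_G w * Z 0 t' w) +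
    \mean[P]_w (\1_(~` G) w * Z 0 t' w) = \mean[P]_w Z 0 t' w.
  move=> s; rewrite -meanD//; last 2 first.
  - exact: summable_indicM.
  - by apply: summable_indicM => //; exact: measurableC.
  by apply: eq_mean => w; rewrite !indicE in_setC; case: (_ \in _);
    rewrite /= ?mul1r ?mul0r ?addr0 ?add0r.
have h1 := le G FG; have h2 := le _ (Fil_setC FG).
have h3 : \mean[P]_w Z 0 t w <= 1.
  have := gdens_le hPc hT hB iTh (lexx 0) t0 tT (ltac:(exact: meas_wrt_cst) : meas_wrt (Fil 0) (fun=> 1)) (fun=> ler01).
  rewrite (_ : (\int[P]_w 1%:E)%E = 1%E); last first.
    by rewrite integral_EFin ?expectation_cst//; exact: summable_cst.
  by under eq_integral do rewrite mul1r; rewrite integral_EFin// lee_fin.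
apply: (le_pair_eq h1 h2).
by apply: (le_trans (y := 1)); [rewrite (sum _ st)|rewrite (sum _ sT) hZ].
Qed.

Lemma gincr_L2 h N t : ito h N -> M2 P T Fil h -> 0 <= t -> t <= T ->
  summable_rv P (fun w => gincr theta h N t T w ^+ 2).
Proof.
move=> iN Mh t0 tT; have [ph _] := Mh.
have [s2 _] := ito_L2 hPc hT hB iN Mh t0 tT (lexx T).
have md := measurable_time_dot hPc hT hB ph pth t0 tT (lexx T).
apply: (eq_summable (f := fun w => (N T w - N t w + time_dot h theta t T w) ^+ 2)).
  by move=> w; rewrite gincrE.
apply: summable_sqD => //.
  by apply: measurable_funB; apply: (measurable_ito hPc hB iN) => //; exact: ltW.
apply: (summable_le_as _ (summableZ K (summable_qv hPc hT hB Mh t0 tT (lexx T)))).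
  exact: measurable_funX.
apply: filterS3 (M2_finite hPc hT hB Mh) hK (qv_theta_le t0 tT (lexx T)) => w fh hw hq.
have fw : (sq theta w < +oo)%E by apply: (le_lt_trans hw); rewrite ltry.
rewrite ger0_norm ?sqr_ge0//; apply: (le_trans (time_dot_sq_le hT ph pth fh fw t0 (lexx T))).
by rewrite mulrC ler_wpM2r ?qv_ge0.
Qed.

(** Weighted by the density, [gincr] has mean zero on the event [c < U], where [U - c] is positive
    and at most [gincr]; hence the event is negligible. This is absence of arbitrage, and it yields
    the lower bounds on values and portfolios below. *)
Lemma superhedging_le h N U t c : ito h N -> M2 P T Fil h -> 0 <= t -> t <= T ->
  meas_wrt (Fil t) U -> {ae P, forall w, U w <= c + gincr theta h N t T w} ->
  {ae P, forall w, U w <= c}.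
Proof.
move=> iN Mh t0 tT mU hU; have [ph _] := Mh.
pose G := [set w | c < U w].
have FG : Fil t G by exact: Fil_ltr.
have mG := Fil_measurable hPc hB tT FG.
have sT := gdens_summable (ltW hT) (lexx T); have st := gdens_summable t0 tT.
have mM := measurable_gincr hPc hT hB iTh iN t0 tT (lexx T).
have mZT := measurable_gdens hPc hT hB iTh (lexx 0) (ltW hT) (lexx T).
have mZt := measurable_gdens hPc hT hB iTh t0 tT (lexx T).
have mZ0 := measurable_gdens hPc hT hB iTh (lexx 0) t0 tT.
have [Z2 _] := gdens_L2 (ltW hT) (lexx T).
have [W WE] : exists W, forall w, W w = \1_G w * Z 0 t w by exists (fun w => \1_G w * Z 0 t w).
have mW : meas_wrt (Fil t) W.
  rewrite (funext WE).
  by apply: meas_wrtM; [exact: meas_wrt_indic|exact: (adapted_gdens hT iTh (lexx 0))].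
have mWm := meas_wrt_measurable hPc hB tT mW.
have W0 w : 0 <= W w by rewrite WE mulr_ge0 ?(ltW (gdens_gt0 _ _ _ _ _))// indicE.
have WZ : {ae P, forall w, W w * Z t T w = \1_G w * Z 0 T w}.
  by apply: filterS (gdens_mulr t0 tT (lexx T)) => w ->; rewrite WE mulrA.
have sX (X : Om -> R) : measurable_fun setT X -> summable_rv P (fun w => X w ^+ 2) ->
    summable_rv P (fun w => W w * Z t T w * X w).
  move=> mX X2; apply: (summable_le_as _ (summable_norm (summable_mulL2 mZT mX Z2 X2))).
    exact: (measurable_funM (measurable_funM mWm mZt) mX).
  apply: filterS WZ => w e; rewrite (congr1 (fun z => z * X w) e) -mulrA normrM indicE.
  by case: (_ \in _); [rewrite normr1 mul1r|rewrite normr0 mul0r normr_ge0].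
have s1 : summable_rv P (fun w => W w * Z t T w).
  apply: (eq_summable (f := fun w => W w * Z t T w * 1)); first by move=> w; rewrite mulr1.
  exact: (sX (fun=> 1) (@measurable_cst _ _ _ _ setT (1 : R)) (summable_cst P (1 ^+ 2))).
have sM := sX _ mM (gincr_L2 iN Mh t0 tT).
have mq := measurable_qv hPc hT hB ph t0 tT (lexx T).
have sq_ : summable_rv P (fun w => W w * Z t T w * Num.sqrt (qv h t T w)).
  apply: sX; first exact: measurable_sqrt_comp.
  apply: eq_summable (summable_qv hPc hT hB Mh t0 tT (lexx T)) => w.
  by rewrite sqr_sqrtr ?qv_ge0.
have eW : (\int[P]_w (W w)%:E <= \int[P]_w (W w * Z t T w)%:E)%E.
  rewrite [X in (_ <= X)%E](integral_EFin s1) [X in (X <= _)%E](_ : _ = (\mean[P]_w (\1_G w * Z 0 t w))%:E) ?lee_fin; last first.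
    by under eq_integral do rewrite WE; rewrite (integral_EFin (summable_indicM mG st)).
  rewrite -[leLHS](gdens_cond t0 tT FG) le_eqVlt; apply/orP; left; apply/eqP.
  apply: (expectation_as_eq (summable_indicM mG sT) s1).
  by apply: filterS WZ => w ->.
have key := weighted_martingale hPc hT hB iTh iN t0 tT (lexx T) mW W0 s1 eW sM sq_.
pose D w := W w * Z t T w * (U w - c).
have D0 w : 0 <= D w.
  rewrite /D WE indicE; case: (boolP (w \in G)) => [/set_mem hw|_]; last by rewrite !mul0r.
  by rewrite !mulr_ge0 ?(ltW (gdens_gt0 _ _ _ _ _))// subr_ge0 ltW.
have mUm := meas_wrt_measurable hPc hB tT mU.
have DM : {ae P, forall w, D w <= W w * Z t T w * gincr theta h N t T w}.
  apply: filterS hU => w hw; apply: ler_wpM2l; last by rewrite lerBlDl.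
  by rewrite mulr_ge0 ?(ltW (gdens_gt0 _ _ _ _ _)).
have sD : summable_rv P D.
  apply: (summable_le_as _ sM).
    exact: (measurable_funM (measurable_funM mWm mZt) (measurable_funB mUm (measurable_cst c))).
  by apply: filterS DM => w hw; rewrite ger0_norm.
have D00 : \mean[P]_w D w <= 0 by rewrite -key; exact: expectation_le_as.
apply: filterS (expectation_eq0 sD D0 D00) => w /eqP.
rewrite /D WE !mulf_eq0 indicE => hw; rewrite leNgt; apply/negP => cU.
move: hw; rewrite mem_set// oner_eq0 (gt_eqF (gdens_gt0 theta Th 0 t w)) (gt_eqF (gdens_gt0 theta Th t T w)) !orFb subr_eq0.
by move=> /eqP hw; move: cU; rewrite hw ltxx.
Qed.

End bounded.

End girsanov_bounded.

Lemma le_exprn_ge1 (R : realType) (r : nat) (x : R) : (0 < r)%N -> 1 <= x -> x <= x ^+ r.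
Proof. by case: r => // r _ x1; rewrite exprS ler_peMr ?exprn_ege1//; exact: le_trans x1. Qed.

(** * Lower bound for exponentials *)

Section grid_stopping.
Context (R : realType) (d0 : measure_display) (Om : measurableType d0)
  (P : probability Om R) (hPc : measure_is_complete P) (T : R) (hT : 0 < T)
  (m : nat) (B : R -> Om -> 'cV[R]_m) (hB : brownian_motion P T B).
Local Notation Fil := (augmented_filtration P B).
Local Notation FT t := (g_sigma_algebraType (natural_filtration B t `|` P.-negligible)).
Variables (n : nat) (u : nat -> R) (E : nat -> Om -> R) (c : R).
Hypotheses (hu : forall i, 0 <= u i <= T) (um : forall i, (i < n)%N -> u i <= u i.+1)
  (mE : forall i, (i <= n)%N -> meas_wrt (Fil (u i)) (E i)).

Let u0 i : 0 <= u i. Proof. by case/andP: (hu i). Qed.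
Let uT i : u i <= T. Proof. by case/andP: (hu i). Qed.

(** The first index below [n] at which the level [c] is reached, with the default [n] when there is
    none: stopping never happens after the last grid point. *)
Definition first_idx w := find (fun i => c <= E i w) (iota 0 n).

Lemma first_idx_le w : (first_idx w <= n)%N.
Proof. by have := find_size (fun i => c <= E i w) (iota 0 n); rewrite size_iota. Qed.

Lemma first_idx_ge w : (first_idx w < n)%N -> c <= E (first_idx w) w.
Proof.
move=> h; have hh : has (fun i => c <= E i w) (iota 0 n) by rewrite has_find size_iota.
by have := nth_find 0%N hh; rewrite nth_iota.
Qed.

Lemma first_idx_before w i : (i < first_idx w)%N -> E i w < c.
Proof.
move=> h; have := before_find 0%N h.
rewrite nth_iota ?add0n; last exact: leq_trans h (first_idx_le w).
by move=> /negbT; rewrite -ltNge.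
Qed.

Lemma Fil_first_idx_gt k : (k <= n)%N -> Fil (u k) [set w | (k < first_idx w)%N].
Proof.
rewrite leq_eqVlt => /orP[/eqP ->|].
  rewrite (_ : [set w | _] = set0); last first.
    by apply/seteqP; split=> // w /=; rewrite ltnNge first_idx_le.
  exact: (@measurable0 _ (FT (u n))).
elim: k => [|k IH] kn.
  rewrite (_ : [set w | _] = ~` [set w | c <= E 0%N w]); last first.
    apply/seteqP; split=> w /=; first by move=> /first_idx_before; rewrite ltNge => /negP.
    move=> h; rewrite lt0n; apply/eqP => h0; apply: h.
    by have := @first_idx_ge w; rewrite h0 => /(_ kn).
  apply: Fil_setC; rewrite (_ : [set w | _] = ~` [set w | E 0%N w < c]); last first.
    by apply/seteqP; split=> w /=; rewrite leNgt => /negP.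
  by apply: Fil_setC; apply: Fil_ltl; exact: mE.
rewrite (_ : [set w | _] = [set w | (k < first_idx w)%N] `&` [set w | E k.+1 w < c]); last first.
  apply/seteqP; split=> w /=; first by move=> h; split; [exact: ltnW|exact: first_idx_before].
  case=> h1 h2; rewrite ltn_neqAle h1 andbT; apply/eqP => h3.
  by have := @first_idx_ge w; rewrite -h3 => /(_ kn); rewrite leNgt h2.
apply: Fil_setI; first by apply: (Fil_mono (um (ltnW kn))); exact: IH (ltnW kn).
by apply: Fil_ltl; exact: mE (ltnW kn).
Qed.

Lemma Fil_first_idx k : (k <= n)%N -> Fil (u k) [set w | first_idx w = k].
Proof.
case: k => [|k] kn.
  rewrite (_ : [set w | _] = ~` [set w | (0 < first_idx w)%N]).
    by apply: Fil_setC; exact: Fil_first_idx_gt.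
  by apply/seteqP; split=> w /=; [move=> ->|move/negP; rewrite -eqn0Ngt => /eqP].
rewrite (_ : [set w | _] = [set w | (k < first_idx w)%N] `&` ~` [set w | (k.+1 < first_idx w)%N]).
  apply: Fil_setI; last by apply: Fil_setC; exact: Fil_first_idx_gt.
  by apply: (Fil_mono (um kn)); exact: Fil_first_idx_gt (ltnW kn).
apply/seteqP; split=> w /=; first by move=> ->; rewrite ltnn ltnSn.
by case=> h1 /negP; rewrite -leqNgt => h2; apply/eqP; rewrite eqn_leq h1 h2.
Qed.

Lemma first_time_stopping : stopping_time Fil T (fun w => u (first_idx w)).
Proof.
split=> [w|t]; rewrite in_itv/= => // /andP[t0 tT].
rewrite (_ : [set w | _] = \bigcup_i (if ((i <= n)%N && (u i <= t)) then [set w | first_idx w = i] else set0)).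
  apply: (@bigcup_measurable _ (FT t)) => i _.
  case: ifP => [/andP[ni uit]|_]; last exact: (@measurable0 _ (FT t)).
  by apply: (Fil_mono uit); exact: Fil_first_idx.
apply/seteqP; split=> w /=.
  by move=> h; exists (first_idx w) => //; rewrite first_idx_le h.
by case=> i _; case: ifP => // /andP[_ h] /= ->.
Qed.

Lemma stoppedE (X : nat -> Om -> R) w :
  X (first_idx w) w = \sum_(i < n.+1) \1_[set w | first_idx w = i] w * X i w.
Proof.
rewrite (bigD1 (Ordinal (first_idx_le w : (first_idx w < n.+1)%N)))//= big1 => [|i ni].
  by rewrite addr0 indicE mem_set// mul1r.
rewrite indicE memNset ?mul0r//= => h; case/eqP: ni; exact/val_inj.
Qed.

Lemma measurable_first_idx (Q : pred nat) : measurable [set w | Q (first_idx w)].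
Proof.
rewrite (_ : [set w | _] = \bigcup_i (if ((i <= n)%N && Q i) then [set w | first_idx w = i] else set0)).
  apply: bigcup_measurable => i _; case: ifP => // /andP[ni _].
  exact: (Fil_measurable hPc hB (uT i) (Fil_first_idx ni)).
apply/seteqP; split=> w /=; first by move=> h; exists (first_idx w) => //; rewrite first_idx_le h.
by case=> i _; case: ifP => // /andP[_ h] /= ->.
Qed.

Lemma measurable_stopped (X : nat -> Om -> R) :
  (forall i, (i <= n)%N -> measurable_fun setT (X i)) ->
  measurable_fun setT (fun w => X (first_idx w) w).
Proof.
move=> mX; rewrite (funext (stoppedE X)); apply: measurable_sum => i.
apply: measurable_funM; last by apply: mX; rewrite -ltnS.
apply: measurable_indic; have := measurable_first_idx (pred1 (i : nat)).
by congr (measurable _); apply/seteqP; split=> w /eqP.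
Qed.

Hypotheses (sE : forall i, (i <= n)%N -> summable_rv P (E i))
  (martE : forall i A, (i < n)%N -> Fil (u i) A ->
     \mean[P]_w (\1_A w * E i.+1 w) = \mean[P]_w (\1_A w * E i w)).

(** Induction on [k] for the index [minn k (first_idx w)]: one more step changes the mean only on
    the event [k < first_idx w], which is known at time [u k], and there the martingale property
    applies. *)
Lemma optional_stopping G : Fil (u 0%N) G ->
  summable_rv P (fun w => \1_G w * E (first_idx w) w) /\
  \mean[P]_w (\1_G w * E (first_idx w) w) = \mean[P]_w (\1_G w * E 0%N w).
Proof.
move=> FG.
have FGk k : (k <= n)%N -> Fil (u k) G.
  elim: k => // k IH kn; apply: (Fil_mono (um kn)); exact: IH (ltnW kn).
have mG := Fil_measurable hPc hB (uT 0) FG.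
suff H k : (k <= n)%N -> summable_rv P (fun w => \1_G w * E (minn k (first_idx w)) w) /\
    \mean[P]_w (\1_G w * E (minn k (first_idx w)) w) = \mean[P]_w (\1_G w * E 0%N w).
  have := H n (leqnn n).
  rewrite (_ : (fun w => _) = fun w => \1_G w * E (first_idx w) w)//.
  by apply/funext => w; rewrite (minn_idPr (first_idx_le w)).
elim: k => [_|k IH kn].
  rewrite (_ : (fun w => _) = fun w => \1_G w * E 0%N w); last by apply/funext => w; rewrite min0n.
  by split=> //; apply: summable_indicM => //; exact: sE.
have [sk ek] := IH (ltnW kn).
pose A := G `&` [set w | (k < first_idx w)%N].
have FA : Fil (u k) A by apply: Fil_setI; [exact: FGk (ltnW kn)|exact: Fil_first_idx_gt (ltnW kn)].
have mA := Fil_measurable hPc hB (uT k) FA.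
have s1 := summable_indicM mA (sE kn); have s2 := summable_indicM mA (sE (ltnW kn)).
have D w : \1_G w * E (minn k.+1 (first_idx w)) w =
    \1_G w * E (minn k (first_idx w)) w + (\1_A w * E k.+1 w - \1_A w * E k w).
  rewrite /A indicI /=; have [h|h] := boolP (k < first_idx w)%N.
    rewrite (minn_idPl h) (minn_idPl (ltnW h)).
    rewrite (_ : \1_[set w0 | (k < first_idx w0)%N] w = 1); last by rewrite indicE mem_set.
    ring.
  rewrite -leqNgt in h; rewrite (minn_idPr (leqW h)) (minn_idPr h).
  rewrite (_ : \1_[set w0 | (k < first_idx w0)%N] w = 0); first ring.
  by rewrite indicE memNset//=; apply/negP; rewrite -leqNgt.
split; first by apply: (eq_summable (fun w => esym (D w))); apply: summableD => //; exact: summableB.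
by rewrite (eq_mean P D) meanD ?meanB//; [rewrite ek (martE kn FA) subrr addr0|exact: summableB].
Qed.

(** Uniform integrability in the form that the grid argument consumes: finitely valued stopping
    times not before [t0], and only the part of the exponential on [G]. Both a dominating variable
    and the admissibility class provide it. *)
Definition grid_stopped (t0 : R) (D : R -> Om -> R) (G : set Om) (e c' : R) : Prop :=
  forall tau, stopping_time Fil T tau -> (forall w, t0 <= tau w) ->
  (exists s : seq R, forall w, tau w \in s) ->
  measurable_fun setT (fun w => expR (D (tau w) w)) ->
  (\int[P]_w (\1_[set w | G w /\ c' <= expR (D (tau w) w)] w * expR (D (tau w) w))%:E <= e%:E)%E.

(* Stopping the exponential martingale [E] when it first exceeds [c]: the
   overshoot beyond [2 * c] is paid by the [r]-th moments of the increments. *)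
Lemma stopped_exp_bound (x : nat -> Om -> R) (r : nat) (CR : R) D G Bad c' e eps :
  (forall i w, 0 < E i w) -> (forall w, E 0%N w = 1) ->
  (forall i w, (i < n)%N -> 0 < x i w) ->
  (forall i w, (i < n)%N -> E i.+1 w = E i w * x i w) ->
  (forall i, (i < n)%N -> summable_rv P (fun w => x i w ^+ r) /\ \mean[P]_w (x i w ^+ r) <= CR) ->
  (0 < r)%N -> u n = T -> (forall i, u 0%N <= u i) ->
  (forall s, u 0%N <= s -> s <= T -> meas_wrt (Fil s) (D s)) ->
  Fil (u 0%N) G -> measurable Bad -> 1 < c -> 0 <= c' -> grid_stopped (u 0%N) D G e c' ->
  (forall w i, G w -> ~ Bad w -> (i <= n)%N -> E i w <= expR eps * expR (D (u i) w)) ->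
  summable_rv P (fun w => \1_G w * expR (D T w)) ->
  \mean[P]_w (\1_G w) <= n%:R * (c * 2 * 2^-1 ^+ r * CR) + 2 * c * \mean[P]_w (\1_Bad w) +
    expR eps * (\mean[P]_w (\1_G w * expR (D T w)) + e + c' / c).
Proof.
move=> E0 E00 x0 ER sR r0 un ut mD FG mBad c1 c'0 ui hBad sDT.
pose idx := first_idx.
have mG := Fil_measurable hPc hB (uT 0) FG.
have [sG eG] := optional_stopping FG.
have FuT : Fil (u 0%N) setT by exact: Fil_setT.
have [sO eO] := optional_stopping FuT.
rewrite -/idx in sG eG sO eO.
have {}eG : \mean[P]_w (\1_G w * E (idx w) w) = \mean[P]_w (\1_G w).
  by rewrite eG; apply: eq_mean => w; rewrite E00 mulr1.
have {}eO : \mean[P]_w (\1_setT w * E (idx w) w) = 1.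
  rewrite eO -[RHS](expectation_cst P); apply: eq_mean => w.
  by rewrite E00 mulr1 indicT.
pose L := [set w | (idx w < n)%N].
have mL : measurable L by exact: (measurable_first_idx (fun i => i < n)%N).
have c0 : 0 < c by lra.
(* Markov's inequality for the stopped martingale, whose mean is 1. *)
have PL : \mean[P]_w (\1_L w) <= c^-1.
  rewrite -[leRHS]mulr1 ler_pdivlMl// -meanZ; last exact: summable_indic.
  rewrite -eO; apply: expectation_le => //; first by apply: summableZ; exact: summable_indic.
  move=> w; rewrite indicT mul1r indicE; case: (boolP (w \in L)) => [/set_mem hw|_].
    by rewrite mulr1; exact: first_idx_ge hw.
  by rewrite mulr0 ltW.
pose Rr i w := x i w ^+ r.
pose ov := c * 2 * 2^-1 ^+ r.
have ov0 : 0 <= ov by rewrite /ov mulr_ge0 ?exprn_ge0//; lra.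
pose Ov w := \sum_(i < n) ov * Rr i w.
have sOv : summable_rv P Ov by apply: summable_sum => i; apply: summableZ; case: (sR i (ltn_ord i)).
have eOv : \mean[P]_w Ov w <= n%:R * (ov * CR).
  rewrite /Ov expectation_sum; last by move=> i; apply: summableZ; case: (sR i (ltn_ord i)).
  rewrite (_ : n%:R * _ = \sum_(i < n) ov * CR); last first.
    by rewrite sumr_const card_ord mulr_natl.
  by apply: ler_sum => i _; case: (sR i (ltn_ord i)) => s1 e1; rewrite meanZ// ler_wpM2l.
pose tau w := u (idx w).
have st : stopping_time Fil T tau by exact: first_time_stopping.
have tt w : u 0%N <= tau w by exact: ut.
have ts : exists s : seq R, forall w, tau w \in s.
  exists (mkseq u n.+1) => w; apply/mapP; exists (idx w) => //.
  by rewrite mem_iota add0n ltnS first_idx_le.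
pose A := [set w | G w /\ c' <= expR (D (tau w) w)].
have mDt : measurable_fun setT (fun w => expR (D (tau w) w)).
  apply: (measurable_stopped (X := fun i w => expR (D (u i) w))) => i _.
  by apply: measurableT_comp => //; exact: (meas_wrt_measurable hPc hB (uT i) (mD _ (ut i) (uT i))).
have mA : measurable A.
  apply: measurableI => //.
  have := mDt measurableT `[c', +oo[%classic (measurable_itv _); rewrite setTI.
  rewrite (_ : _ @^-1` _ = [set w | c' <= expR (D (tau w) w)])//.
  by apply/seteqP; split=> w /=; rewrite in_itv/= andbT.
have mfA : measurable_fun setT (fun w => \1_A w * expR (D (tau w) w)) by apply: measurable_funM.
have fA0 w : 0 <= \1_A w * expR (D (tau w) w) by rewrite mulr_ge0 ?expR_ge0// indicE.
have [sA eA] := summable_ge0 mfA fA0 (ui _ st tt ts mDt).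
have sBad := summable_indic P mBad; have sL := summable_indic P mL.
have s45 := summableD sDT sA; have s6 := summableD s45 (summableZ c' sL).
have s2 := summableD sOv (summableZ (2 * c) sBad).
have sAll := summableD s2 (summableZ (expR eps) s6).
rewrite -eG; apply: (@le_trans _ _ (\mean[P]_w (Ov w + 2 * c * \1_Bad w +
    expR eps * (\1_G w * expR (D T w) + \1_A w * expR (D (tau w) w) + c' * \1_L w)))).
  apply: (expectation_le sG sAll) => w.
  have Ov0 : 0 <= Ov w.
    by apply: sumr_ge0 => i _; rewrite mulr_ge0// exprn_ge0// ltW// x0.
  have p1 : 0 <= \1_G w * expR (D T w) by rewrite mulr_ge0 ?expR_ge0// indicE.
  have p2 : 0 <= c' * \1_L w by rewrite mulr_ge0// indicE.
  have p3 : 0 <= 2 * c * \1_Bad w by rewrite mulr_ge0 ?indicE//; lra.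
  have p4 : 0 <= expR eps * (\1_G w * expR (D T w) + \1_A w * expR (D (tau w) w) + c' * \1_L w).
    by rewrite mulr_ge0 ?expR_ge0// !addr_ge0.
  have [Gw|nGw] := pselect (G w); last first.
    by rewrite [\1_G w in leLHS]indicE memNset// mul0r; rewrite !addr_ge0.
  rewrite [\1_G w in leLHS]indicE mem_set// mul1r.
  (* Just before stopping the value is below [c], so exceeding [2 * c] forces the last factor [y]
     above 2; then [y / 2 <= (y / 2) ^+ r] bounds the stopped value by one term of [Ov]. *)
  have [hbig|hsmall] := ltP (2 * c) (E (idx w) w).
    suff : E (idx w) w <= Ov w by move=> h; rewrite -addrA (le_trans h)// lerDl addr_ge0.
    move: hbig; case def_i: (idx w) => [|i]; first by rewrite E00 => hb; exfalso; lra.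
    have ni : (i < n)%N by rewrite -def_i; exact: first_idx_le.
    have Ei : E i w < c by apply: first_idx_before; rewrite -/(idx w) def_i.
    rewrite (ER i w ni); move: (x0 i w ni) => xi0; set y := x i w => hbig.
    have Ei0 := E0 i w.
    have x2 : 1 <= y / 2.
      rewrite ler_pdivlMr// mul1r leNgt; apply/negP => hx.
      have : E i w * y <= c * 2 by apply: ler_pM; exact: ltW.
      by rewrite mulrC [c * 2]mulrC leNgt -[y * _]mulrC hbig.
    have xr := le_exprn_ge1 r0 x2.
    apply: (@le_trans _ _ (ov * Rr i w)).
      rewrite /ov /Rr -/y; apply: (@le_trans _ _ (c * (2 * (y / 2)))).
        by rewrite [2 * _]mulrC divfK//; apply: ler_wpM2r; exact: ltW.
      rewrite -!mulrA ler_wpM2l ?(ltW c0)// ler_wpM2l//.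
      by apply: (le_trans xr); rewrite expr_div_n mulrC exprVn.
    rewrite /Ov (bigD1 (Ordinal ni))//= lerDl; apply: sumr_ge0 => j _.
    by rewrite mulr_ge0// exprn_ge0// ltW// x0.
  have [Bw|nBw] := pselect (Bad w).
    suff : E (idx w) w <= 2 * c * \1_Bad w.
      by move=> h; apply: (le_trans h); rewrite addrAC lerDr addr_ge0.
    by rewrite indicE mem_set// mulr1.
  have hE := hBad w (idx w) Gw nBw (first_idx_le w).
  rewrite -/(u _) -/(tau w) in hE.
  suff h : expR (D (tau w) w) <= \1_G w * expR (D T w) + \1_A w * expR (D (tau w) w) + c' * \1_L w.
    apply: (le_trans hE); apply: (le_trans (ler_wpM2l (expR_ge0 eps) h)).
    by rewrite lerDr addr_ge0.
  (* Three cases: not stopped before the last index, so that [tau w] is [T]; stopped with the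
     exponential at least [c'], on the tail event [A]; stopped with the exponential below [c'], on
     the rare event [L]. *)
  have [/= hl|hl] := boolP (idx w < n)%N; last first.
    have -> : tau w = T.
      rewrite /tau -un; congr u; apply/eqP; rewrite eqn_leq [(n <= _)%N]leqNgt hl andbT.
      exact: first_idx_le.
    by rewrite [\1_G w]indicE mem_set// mul1r -addrA lerDl addr_ge0//; exact: fA0.
  have [hc|hc] := leP c' (expR (D (tau w) w)).
    by rewrite [\1_A w]indicE mem_set// mul1r addrAC lerDr addr_ge0.
  by rewrite [\1_L w]indicE mem_set// mulr1 (le_trans (ltW hc))// lerDr addr_ge0.
rewrite (meanD s2 (summableZ _ s6)) (meanD sOv (summableZ _ sBad)) !meanZ//.
rewrite (meanD s45 (summableZ _ sL)) (meanD sDT sA) (meanZ _ sL).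
apply: lerD; first by apply: lerD.
apply: ler_wpM2l; first exact: expR_ge0.
by apply: lerD; [apply: lerD|apply: ler_wpM2l].
Qed.

End grid_stopping.

(** * Exponentials of simple integrands and their moments *)

Section simple_exponentials.
Context (R : realType) (d0 : measure_display) (Om : measurableType d0)
  (P : probability Om R) (hPc : measure_is_complete P) (T : R) (hT : 0 < T)
  (m : nat) (B : R -> Om -> 'cV[R]_m) (hB : brownian_motion P T B).
Local Notation Fil := (augmented_filtration P B).
Variables (S : simple_integrand Om R m) (wfS : simple_wf Fil T S) (K : R)
  (hK : forall j w, (j < nstep S)%N -> enorm (coef S j w) <= K).

Definition simple_exp s t w := expR (simple_integral B S t w - simple_integral B S s w -
  2^-1 * simple_quad S s t w).

Lemma simple_exp_gt0 s t w : 0 < simple_exp s t w.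
Proof. exact: expR_gt0. Qed.

Lemma simple_quad_le s t w : s <= t -> simple_quad S s t w <= K ^+ 2 * (t - s).
Proof.
move=> st; case: wfS => _ nS _ _.
apply: (@le_trans _ _ (\sum_(j < nstep S) K ^+ 2 *
    (clamp s t (node S j.+1) - clamp s t (node S j)))).
  apply: ler_sum => j _; apply: ler_wpM2r.
    by rewrite subr_ge0; apply: clamp_mono; exact: nS.
  by rewrite -sqr_enorm ler_sqr ?nnegrE ?sqrtr_ge0 ?hK// (le_trans _ (hK w (ltn_ord j)))// sqrtr_ge0.
rewrite -mulr_sumr; apply: ler_wpM2l; first exact: sqr_ge0.
rewrite -(big_mkord xpredT (fun j => clamp s t (node S j.+1) - clamp s t (node S j))).
rewrite telescope_sumr//; apply: lerB; [exact: clamp_le|exact: clamp_ge].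
Qed.

Lemma simple_quad_ge0 s t w : 0 <= simple_quad S s t w.
Proof.
case: wfS => _ nS _ _; apply: sumr_ge0 => j _; apply: mulr_ge0; first exact: vdot_ge0.
by rewrite subr_ge0; apply: clamp_mono; exact: nS.
Qed.

Lemma clampD (s t u x : R) : s <= t -> t <= u -> clamp s u x = clamp s t x + clamp t u x - t.
Proof.
move=> st tu; rewrite /clamp.
have [xt|tx] := lerP x t.
  rewrite (min_r (le_trans xt tu)) (max_l xt); lra.
rewrite (max_r st).
have [ux|xu] := lerP u x; first by rewrite (max_r (le_trans st tu)) (max_r tu); lra.
rewrite (max_r (ltW tx)) (max_r (le_trans st (ltW tx))); lra.
Qed.

Lemma simple_expM s t u w : s <= t -> t <= u ->
  simple_exp s u w = simple_exp s t w * simple_exp t u w.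
Proof.
move=> st tu; rewrite /simple_exp -expRD; congr expR.
have -> : simple_quad S s u w = simple_quad S s t w + simple_quad S t u w; last lra.
rewrite /simple_quad -big_split/=; apply: eq_bigr => j _.
rewrite !(clampD _ st tu); lra.
Qed.

Lemma simple_exp_refl s w : simple_exp s s w = 1.
Proof.
rewrite /simple_exp subrr sub0r /simple_quad big1 ?mulr0 ?oppr0 ?expR0// => j _.
have c x : clamp s s x = s by apply/le_anti; rewrite clamp_le// clamp_ge.
by rewrite !c subrr mulr0.
Qed.

Lemma adapted_simple_exp s t : 0 <= s -> s <= t -> t <= T -> meas_wrt (Fil t) (simple_exp s t).
Proof.
move=> s0 st tT.
have mS r : 0 <= r -> r <= t -> meas_wrt (Fil t) (simple_integral B S r).
  move=> r0 rt; apply: (meas_wrt_mono rt).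
  by apply: (adapted_simple_integral wfS r0); exact: (le_trans rt tT).
have nS : forall j, (j < nstep S)%N -> node S j <= node S j.+1 by case: wfS.
have mq : meas_wrt (Fil t) (simple_quad S s t).
  rewrite (_ : simple_quad S s t = qv (simple_val S) s t).
    exact: (adapted_qv hT (predictable_simple hT wfS) s0 st tT).
  by apply/funext => w; rewrite qvE /Rintegral simple_quadE.
apply: (meas_wrt_comp (g := expR)) => //.
apply: meas_wrtB; last by apply: meas_wrtM => //; exact: meas_wrt_cst.
by apply: meas_wrtB; apply: mS => //; exact: le_trans st.
Qed.

Lemma simple_exp_weighted s t W : 0 <= s -> s <= t -> t <= T -> meas_wrt (Fil s) W ->
  (forall w, 0 <= W w) ->
  (\int[P]_w (W w * simple_exp s t w)%:E = \int[P]_w (W w)%:E)%E.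
Proof. by move=> s0 st tT mW W0; exact: (simple_exp_integral hPc hB wfS). Qed.

Lemma summable_simple_exp s t : 0 <= s -> s <= t -> t <= T ->
  summable_rv P (simple_exp s t) /\ \mean[P]_w simple_exp s t w <= 1.
Proof.
move=> s0 st tT; apply: summable_ge0.
- exact: (meas_wrt_measurable hPc hB tT (adapted_simple_exp s0 st tT)).
- by move=> w; exact: ltW (simple_exp_gt0 _ _ _).
have := simple_exp_weighted s0 st tT (ltac:(exact: meas_wrt_cst) : meas_wrt (Fil s) (fun=> 1)) (fun=> ler01).
under eq_integral do rewrite mul1r; move=> ->.
by rewrite (integral_EFin (summable_cst P 1)) expectation_cst.
Qed.

End simple_exponentials.

Section simple_exponential_moments.
Context (R : realType) (d0 : measure_display) (Om : measurableType d0)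
  (P : probability Om R) (hPc : measure_is_complete P) (T : R) (hT : 0 < T)
  (m : nat) (B : R -> Om -> 'cV[R]_m) (hB : brownian_motion P T B).
Local Notation Fil := (augmented_filtration P B).

(** The [r]-th power is the exponential of [r] times the integrand, up to a factor that involves the
    quadratic variation only; the bound [K] on the coefficients controls this factor. *)
Lemma simple_exp_moment (S : simple_integrand Om R m) (K : R) s t (r : nat) :
  simple_wf Fil T S -> (forall j w, (j < nstep S)%N -> enorm (coef S j w) <= K) ->
  0 <= s -> s <= t -> t <= T ->
  summable_rv P (fun w => simple_exp B S s t w ^+ r) /\
  \mean[P]_w (simple_exp B S s t w ^+ r) <= expR (2^-1 * (r%:R ^+ 2 * (K ^+ 2 * (t - s)))).
Proof.
move=> wfS hK s0 st tT.
pose S2 := SimpleIntegrand (nstep S) (node S) (fun j w => r%:R *: coef S j w).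
have wf2 : simple_wf Fil T S2.
  case: wfS => h1 h2 h3 _; split=> //=.
    move=> j i jn; rewrite (_ : (fun w => _) = fun w => r%:R * coef S j w i ord0).
      by apply: meas_wrtM; [exact: meas_wrt_cst|exact: h3].
    by apply/funext => w; rewrite mxE.
  by exists (`|r%:R| * K) => j w jn; rewrite enormZ ler_wpM2l// hK.
have [s2 e2] := summable_simple_exp hPc hT hB wf2 s0 st tT.
set c := expR _.
have key w : simple_exp B S s t w ^+ r <= c * simple_exp B S2 s t w.
  rewrite -expRM_natl /c -expRD ler_expR.
  have -> : simple_integral B S2 t w - simple_integral B S2 s w =
      r%:R * (simple_integral B S t w - simple_integral B S s w).
    rewrite /simple_integral -!sumrB mulr_sumr; apply: eq_bigr => j _ /=.
    by rewrite !vdotZl mulrBr.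
  have -> : simple_quad S2 s t w = r%:R ^+ 2 * simple_quad S s t w.
    rewrite /simple_quad mulr_sumr; apply: eq_bigr => j _ /=.
    by rewrite vdotZl vdotZr; ring.
  have q0 := simple_quad_ge0 wfS s t w.
  have qK := ler_wpM2l (sqr_ge0 r%:R) (simple_quad_le wfS hK w st).
  have rq := mulr_ge0 (ler0n R r) q0; rewrite mulrBr; move: q0 qK rq.
  set x := r%:R * (_ - _); set y := r%:R ^+ 2; set q := simple_quad S s t w.
  set k := K ^+ 2 * _; rewrite (mulrCA r%:R) => q0; nra.
have mS := meas_wrt_measurable hPc hB tT (adapted_simple_exp hT wfS s0 st tT).
have ss : summable_rv P (fun w => simple_exp B S s t w ^+ r).
  apply: summable_le (summableZ c s2) _; first exact: measurable_funX.
  by move=> w; rewrite ger0_norm// exprn_ge0// ltW// simple_exp_gt0.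
split=> //; apply: (le_trans (expectation_le ss (summableZ c s2) key)).
by rewrite meanZ// -[leRHS]mulr1 ler_wpM2l ?expR_ge0.
Qed.

Variables (t0 : R) (ht0 : 0 <= t0) (t0T : t0 <= T).

(** For [0 < r], the times from [t0] to [T] in [r ^ 2] equal steps, constant afterwards. The square
    answers the factor [r ^+ 2] in [simple_exp_moment]: over one step the bound for the [r]-th
    moment no longer depends on [r], while the total overshoot is of order [r ^ 2 * 2^-1 ^+ r]. *)
Definition grid (r i : nat) : R := t0 + (T - t0) * ((minn i (r ^ 2))%:R / (r ^ 2)%:R).

Lemma grid_in r i : t0 <= grid r i <= T.
Proof.
pose q : R := (minn i (r ^ 2))%:R / (r ^ 2)%:R.
have q0 : 0 <= q by rewrite divr_ge0.
have q1 : q <= 1.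
  rewrite /q; case: (posnP (r ^ 2)) => [->|r0]; first by rewrite invr0 mulr0.
  by rewrite ler_pdivrMr ?ltr0n// mul1r ler_nat geq_minr.
rewrite /grid -/q lerDl mulr_ge0 ?subr_ge0//= -lerBrDl.
by rewrite -[leRHS]mulr1 ler_wpM2l// subr_ge0.
Qed.

Lemma grid0 r : grid r 0 = t0.
Proof. by rewrite /grid min0n mul0r mulr0 addr0. Qed.

Lemma grid_last r : (0 < r)%N -> grid r (r ^ 2) = T.
Proof.
move=> r0; rewrite /grid minnn divff; first by rewrite mulr1 addrC subrK.
by rewrite pnatr_eq0 expn_eq0 negb_and -lt0n r0.
Qed.

Lemma gridS r i : (i < r ^ 2)%N -> (grid r i.+1 = grid r i + (T - t0) / (r ^ 2)%:R).
Proof.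
move=> ir; rewrite /grid (minn_idPl ir) (minn_idPl (ltnW ir)) -addrA; congr (_ + _).
by rewrite -mulrDr; congr (_ * _); rewrite -natr1 mulrDl mul1r.
Qed.

Lemma grid_mono r i : (i < r ^ 2)%N -> grid r i <= grid r i.+1.
Proof. by move=> ir; rewrite gridS// lerDl divr_ge0// subr_ge0. Qed.

Lemma grid_exp_bound S K r (D : R -> Om -> R) G Bad c1 c e eps :
  simple_wf Fil T S -> (forall j w, (j < nstep S)%N -> enorm (coef S j w) <= K) ->
  (0 < r)%N -> (forall s, t0 <= s -> s <= T -> meas_wrt (Fil s) (D s)) ->
  Fil t0 G -> measurable Bad -> 1 < c1 -> 0 <= c -> grid_stopped P T B t0 D G e c ->
  (forall w i, G w -> ~ Bad w -> (i <= r ^ 2)%N ->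
     simple_exp B S t0 (grid r i) w <= expR eps * expR (D (grid r i) w)) ->
  summable_rv P (fun w => \1_G w * expR (D T w)) ->
  \mean[P]_w (\1_G w) <= (r ^ 2)%:R * (c1 * 2 * 2^-1 ^+ r * expR (2^-1 * (K ^+ 2 * T))) +
    2 * c1 * \mean[P]_w (\1_Bad w) +
    expR eps * (\mean[P]_w (\1_G w * expR (D T w)) + e + c / c1).
Proof.
move=> wfS hK r0 mD FG mBad c11 c0 ui hBad sDT.
pose n := (r ^ 2)%N.
have ut i : t0 <= grid r i by case/andP: (grid_in r i).
have uT i : grid r i <= T by case/andP: (grid_in r i).
have hu i : 0 <= grid r i <= T by rewrite uT (le_trans ht0 (ut i)).
have um i : (i < n)%N -> grid r i <= grid r i.+1 by exact: grid_mono.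
have u0 : grid r 0%N = t0 by exact: grid0.
have [E EE] : exists E, forall i w, E i w = simple_exp B S t0 (grid r i) w.
  by exists (fun i => simple_exp B S t0 (grid r i)).
have EE' i : E i = simple_exp B S t0 (grid r i) by apply/funext.
have mE i : (i <= n)%N -> meas_wrt (Fil (grid r i)) (E i).
  by rewrite EE' => _; exact: (adapted_simple_exp hT wfS ht0 (ut i) (uT i)).
have sE i : (i <= n)%N -> summable_rv P (E i).
  by rewrite EE'; case: (summable_simple_exp hPc hT hB wfS ht0 (ut i) (uT i)).
have E0 i w : 0 < E i w by rewrite EE simple_exp_gt0.
have ER i w : (i < n)%N -> E i.+1 w = E i w * simple_exp B S (grid r i) (grid r i.+1) w.
  by move=> ni; rewrite !EE (simple_expM B S w (ut i) (um i ni)).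
have martE i A : (i < n)%N -> Fil (grid r i) A ->
    \mean[P]_w (\1_A w * E i.+1 w) = \mean[P]_w (\1_A w * E i w).
  move=> ni FA; have mA := Fil_measurable hPc hB (uT i) FA.
  have sA := summable_indicM mA (sE _ ni); have sA' := summable_indicM mA (sE _ (ltnW ni)).
  have mW : meas_wrt (Fil (grid r i)) (fun w => \1_A w * E i w).
    by apply: meas_wrtM; [exact: meas_wrt_indic|exact: mE (ltnW ni)].
  have W0 w : 0 <= \1_A w * E i w by rewrite mulr_ge0 ?(ltW (E0 _ _))// indicE.
  have /andP[ui0 _] := hu i.
  have := simple_exp_weighted hPc hB wfS ui0 (um i ni) (uT i.+1) mW W0.
  rewrite [RHS](integral_EFin sA') => h; apply: EFin_inj.
  rewrite -h -(integral_EFin sA); apply: eq_integral => w _.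
  by rewrite (ER _ _ ni) mulrA.
have := stopped_exp_bound hPc hB hu um mE sE martE
  (x := fun i => simple_exp B S (grid r i) (grid r i.+1)) (r := r)
  (CR := expR (2^-1 * (K ^+ 2 * T))) (D := D) (G := G) (Bad := Bad) (c := c1) (c' := c)
  (e := e) (eps := eps).
rewrite u0; apply => //.
- by move=> w; rewrite EE u0 simple_exp_refl.
- by move=> i w _; exact: simple_exp_gt0.
- move=> i ni; have /andP[ui0 _] := hu i.
  have [s1 e1] := simple_exp_moment r wfS hK ui0 (um i ni) (uT i.+1).
  split=> //; apply: (le_trans e1); rewrite ler_expR ler_wpM2l//.
  rewrite (gridS ni) (addrC (grid r i)) addrK natrX mulrCA ler_wpM2l ?sqr_ge0//.
  by rewrite mulrC divfK ?expf_neq0 ?pnatr_eq0 -?lt0n// lerBlDr lerDl.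
- exact: grid_last.
- by move=> w i Gw Bw ni; rewrite EE; exact: hBad.
Qed.

Lemma square_pow2_small (a e : R) : 0 <= a -> 0 < e ->
  exists2 r, (0 < r)%N & (r ^ 2)%:R * (a * 2^-1 ^+ r) <= e.
Proof.
move=> a0 e0; have [k hk] := exists_natr_gt (16 * a / e).
(* For this [r] the number [2 ^ r] is the square of [4 ^ k.+1], and [k.+1 ^ 2 <= 4 ^ k.+1] leaves
   one factor [4 ^ k.+1] in the denominator. *)
exists (4 * k.+1)%N => //.
have h2 : (k.+1 ^ 2 <= 4 ^ k.+1)%N.
  have -> : (4 ^ k.+1 = (2 ^ k.+1) ^ 2)%N by rewrite -expnM mulnC (expnM 2 2).
  by rewrite leq_exp2r// ltnW// ltn_expl.
have h4 : (k.+1 <= 4 ^ k.+1)%N by rewrite ltnW// ltn_expl.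
pose q : R := (4 ^ k.+1)%:R.
have q0 : 0 < q by rewrite ltr0n expn_gt0.
have -> : (2^-1 : R) ^+ (4 * k.+1) = q^-1 * q^-1.
  rewrite exprVn -invfM; congr (_^-1).
  by rewrite /q -natrM -natrX; congr (_%:R); rewrite -expnMn -(expnM 2 4) .
have -> : ((4 * k.+1) ^ 2)%:R = 16 * (k.+1 ^ 2)%:R :> R by rewrite expnMn natrM.
have h2' : (k.+1 ^ 2)%:R <= q by rewrite ler_nat.
apply: (@le_trans _ _ (16 * q * (a * (q^-1 * q^-1)))).
  apply: ler_wpM2r; first by rewrite !mulr_ge0// invr_ge0 ltW.
  by apply: ler_wpM2l.
have -> : 16 * q * (a * (q^-1 * q^-1)) = 16 * a / q by field; rewrite gt_eqF.
rewrite ler_pdivrMr// [e * q]mulrC -ler_pdivrMr//; apply: (le_trans (ltW hk)).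
by apply: (@le_trans _ _ k.+1%:R); rewrite ler_nat.
Qed.

(** The constants depend on each other in this order: [e], the tail level [c] given by uniform
    integrability, the stopping level [c1] with [c / c1 <= e], and then the simple integrand, whose
    coefficient bound [K n] decides the number of grid steps. On the event [Bad], where the simple
    exponential is not dominated by that of [D], the stopped value is at most [2 * c1] up to
    overshoot, so the probability of [Bad] has to be small compared with [c1^-1]. *)
Lemma exp_lower_bound h N G D : ito_integral P T B h N -> Fil t0 G ->
  (forall s, t0 <= s -> s <= T -> meas_wrt (Fil s) (D s)) ->
  (forall s, t0 <= s -> s <= T -> {ae P, forall w, G w ->
     N s w - N t0 w - 2^-1 * qv h t0 s w <= D s w}) ->
  (forall e, 0 < e -> exists2 c, 0 <= c & grid_stopped P T B t0 D G e c) ->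
  (P G <= \int[P]_w (\1_G w * expR (D T w))%:E)%E.
Proof.
move=> iN FG mD hD ui.
have mG := Fil_measurable hPc hB t0T FG.
have mDT := meas_wrt_measurable hPc hB (lexx T) (mD T t0T (lexx T)).
have mf : measurable_fun setT (fun w => \1_G w * expR (D T w)).
  by apply: measurable_funM => //; exact: measurableT_comp.
have f0 w : 0 <= \1_G w * expR (D T w) by rewrite mulr_ge0 ?expR_ge0// indicE.
have [->|] := eqVneq (\int[P]_w (\1_G w * expR (D T w))%:E)%E +oo%E; first exact: leey.
rewrite -ltey => fin.
have {fin} sDT : summable_rv P (fun w => \1_G w * expR (D T w)).
  by apply/summableP; exact: integrable_EFin_ge0.
rewrite (integral_EFin sDT) -expectation_indic// lee_fin.
set X := \mean[P]_w (_ * _); have X0 : 0 <= X by exact: mean_ge0.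
apply/ler_addgt0Pr => d d0'.
(* The final bound is [2 * e + (1 + e) * (X + 2 * e)], which is at most [X + e * (6 + X)] when
   [e <= 1]. *)
pose e := Num.min 1 (d / (6 + X)).
have e0 : 0 < e by rewrite lt_min ltr01 divr_gt0//; lra.
have e1 : e <= 1 by rewrite ge_min lexx.
have ed : e * (6 + X) <= d by rewrite -ler_pdivlMr ?ge_min ?lexx ?orbT//; lra.
have [c c0 hc] := ui e e0.
pose c1 := Num.max 2 (c / e).
have c12 : 2 <= c1 by rewrite le_max lexx.
have c11 : 1 < c1 by lra.
have cc1 : c / c1 <= e.
  rewrite ler_pdivrMr; last by apply: lt_trans c11.
  by rewrite mulrC -ler_pdivrMr// le_max lexx orbT.
pose eps := ln (1 + e).
have eps0 : 0 < eps by rewrite ln_gt0; lra.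
have eeps : expR eps = 1 + e by rewrite lnK// posrE; lra.
have [S wfS hS] := ito_integral_approx hPc hT hB iN.
have /choice[K hK] : forall n, exists K, forall j w, (j < nstep (S n))%N -> enorm (coef (S n) j w) <= K.
  by move=> n; case: (wfS n).
have /choice[r hr] : forall n, exists r, (0 < r)%N /\
    (r ^ 2)%:R * (c1 * 2 * expR (2^-1 * (K n ^+ 2 * T)) * 2^-1 ^+ r) <= e.
  move=> n; have [|r r0 hr] := @square_pow2_small (c1 * 2 * expR (2^-1 * (K n ^+ 2 * T))) e _ e0.
    by rewrite !mulr_ge0 ?expR_ge0//; lra.
  by exists r.
pose g n i := grid (r n) i.
have gt n i : t0 <= g n i by case/andP: (grid_in (r n) i).
have gT n i : g n i <= T by case/andP: (grid_in (r n) i).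
pose Bd n i := [set w | expR eps * expR (D (g n i) w) < simple_exp B (S n) t0 (g n i) w] `&` G.
pose Bad n := \bigcup_i Bd n i.
have mBd n i : measurable (Bd n i).
  apply: measurableI => //.
  have m1 := meas_wrt_measurable hPc hB (gT n i) (mD _ (gt n i) (gT n i)).
  have m2 := meas_wrt_measurable hPc hB (gT n i) (adapted_simple_exp hT (wfS n) ht0 (gt n i) (gT n i)).
  rewrite (_ : [set w | _] = [set w | 0 < simple_exp B (S n) t0 (g n i) w - expR eps * expR (D (g n i) w)]).
    have m3 : measurable_fun setT (fun w => simple_exp B (S n) t0 (g n i) w - expR eps * expR (D (g n i) w)).
      by apply: measurable_funB => //; apply: measurable_funM => //; exact: measurableT_comp.
    have := m3 measurableT `]0, +oo[%classic (measurable_itv _); rewrite setTI.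
    by congr (measurable _); apply/seteqP; split=> w /=; rewrite in_itv/= andbT.
  by apply/seteqP; split=> w /=; rewrite subr_gt0.
have mBad n : measurable (Bad n) by exact: bigcup_measurable.
have hDg : {ae P, forall w, forall n i, G w ->
    N (g n i) w - N t0 w - 2^-1 * qv h t0 (g n i) w <= D (g n i) w}.
  by apply: ae_foralln => n; apply: ae_foralln => i; exact: hD.
have ph : predictable_mx Fil T h by case: iN.
have fh : {ae P, forall w, (sq_norm_integral T h w < +oo)%E} by case: iN.
(* The approximation is uniform in time, so on almost every path all grid points are good from some
   rank on, although the grid changes with [n]. *)
have ev : {ae P, forall w, exists n0, forall n, (n0 <= n)%N -> ~ Bad n w}.
  apply: filterS3 hDg hS fh => w hDw hSw fw.
  have e4 : 0 < eps / 4 by rewrite divr_gt0.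
  have [n1 h1] := hSw _ e4; have [n2 h2] := approx_quad hT wfS ph fw hSw e4.
  exists (maxn n1 n2) => n; rewrite geq_max => /andP[n1n n2n] [i _ [/= + Gw]].
  have [_ h1n] := h1 n n1n.
  have /ler_normlP[_ a1] := h1n (g n i) (le_trans ht0 (gt n i)) (gT n i).
  have /ler_normlP[a2 _] := h1n t0 ht0 t0T.
  have /ler_normlP[a3 _] := h2 n n2n t0 (g n i) ht0 (gt n i) (gT n i).
  have a4 := hDw n i Gw.
  rewrite /simple_exp -expRD ltr_expR ltNge => /negP; apply; lra.
have mX n : measurable_fun setT (fun w => (\1_(Bad n) w : R)%:E).
  by apply/measurable_EFinP; exact: measurable_indic.
have prob : cvg0_in_probability P (fun n w => (\1_(Bad n) w : R)%:E).
  apply: as_to_prob => //; apply: filterS ev => w [n0 hn0] e' e'0.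
  by exists n0 => n /hn0 hn; rewrite indicE memNset// lee_fin ltW.
have ec : 0 < e / (2 * c1) by rewrite divr_gt0//; lra.
have [n hn] : exists n, \mean[P]_w (\1_(Bad n) w) <= e / (2 * c1).
  have h2 : (0 : R) < 2^-1 by [].
  have /fine_cvgP[_ cv] := prob _ h2.
  move/cvgrPdist_le : cv => /(_ _ ec)[n0 _ /(_ n0 (leqnn _))/=].
  rewrite sub0r normrN => hn; exists n0.
  apply: le_trans (le_trans (ler_norm _) hn).
  have mS : measurable [set w | ((2^-1 : R)%:E < (\1_(Bad n0) w)%:E)%E].
    by rewrite -[X in measurable X]setTI; exact: emeasurable_fun_o_infty.
  rewrite -lee_fin expectation_indic// fineK; last exact: fin_num_measure.
  apply: le_measure; rewrite ?inE//.
  by move=> w Bw /=; rewrite indicE mem_set// lte_fin invf_lt1// ltr1n.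
have [rn0 hrn] := hr n.
have hB' w i : G w -> ~ Bad n w -> (i <= r n ^ 2)%N ->
    simple_exp B (S n) t0 (grid (r n) i) w <= expR eps * expR (D (grid (r n) i) w).
  by move=> Gw nB _; rewrite leNgt; apply/negP => hb; apply: nB; exists i.
apply: (le_trans (grid_exp_bound (wfS n) (hK n) rn0 mD FG (mBad n) c11 c0 hc hB' sDT)).
rewrite eeps -/X; move: hrn hn.
set A := _ * (_ * _ * _ * _); set A' := (_ ^ 2)%:R * _.
have -> : A' = A by rewrite /A /A'; ring.
set M := mean _ _ => hA hM.
have hM2 : 2 * c1 * M <= e.
  by rewrite mulrC -ler_pdivlMr//; lra.
have : (1 + e) * (X + e + c / c1) <= (1 + e) * (X + e + e) by apply: ler_wpM2l; lra.
have : e * e <= e * 1 by apply: ler_wpM2l; lra.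
move: hM2 hA ed; set y := c / c1; nra.
Qed.

End simple_exponential_moments.

(** * The dominated case: energy estimate and comparison *)

Section domination.
Context (R : realType) (d0 : measure_display) (Om : measurableType d0)
  (P : probability Om R) (hPc : measure_is_complete P) (T : R) (hT : 0 < T)
  (m : nat) (B : R -> Om -> 'cV[R]_m) (hB : brownian_motion P T B).
Local Notation Fil := (augmented_filtration P B).
Local Notation sq := (sq_norm_integral T).
Local Notation ito := (ito_integral P T B).

Lemma summable_tail (X : Om -> R) e : summable_rv P X -> (forall w, 0 <= X w) -> 0 < e ->
  exists2 c, 0 <= c & \mean[P]_w (\1_[set w | c <= X w] w * X w) <= e.
Proof.
move=> sX X0 e0; have mX := summable_measurable sX.
have mA c : measurable [set w | c <= X w].
  have := mX measurableT `[c, +oo[%classic (measurable_itv _); rewrite setTI.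
  by congr (measurable _); apply/seteqP; split=> w /=; rewrite in_itv/= andbT.
pose f n w := \1_[set w | n%:R <= X w] w * X w.
have sf n : summable_rv P (f n) by exact: summable_indicM.
have [] := @dominated_convergence _ _ _ P setT measurableT (fun n w => (f n w)%:E)
  (cst 0%E) (EFin \o X).
- by move=> n; exact/measurable_EFinP/summable_measurable.
- exact: measurable_cst.
- apply: aeW => w _; apply: cvg_near_cst; have [n0 hn0] := exists_natr_gt (X w).
  exists n0 => // n /= nn0; rewrite /f indicE memNset ?mul0r//= => h.
  by move: hn0; rewrite ltNge (le_trans _ h)// ler_nat.
- by case: sX.
- apply: aeW => w n _; rewrite /= lee_fin /f normrM indicE (ger0_norm (X0 w)).
  by case: (_ \in _); rewrite ?normr1 ?mul1r// normr0 mul0r.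
move=> _ _; rewrite integral0.
rewrite (_ : (fun n => _) = fun n => (\mean[P]_w f n w)%:E); last first.
  by apply/funext => n; rewrite -integral_EFin.
move=> /fine_cvgP[_] /cvgrPdist_le /(_ e e0)[n _ /(_ n (leqnn _))/=].
rewrite sub0r normrN => h; exists n%:R => //.
exact: le_trans (ler_norm _) h.
Qed.

(** A stopping time with values in a finite list meets only the null sets of finitely many times, so
    the bound at fixed times holds at the stopping time as well. *)
Lemma grid_stopped_dominated t0 D G (X : Om -> R) : 0 <= t0 -> t0 <= T ->
  measurable G -> summable_rv P X -> (forall w, 0 <= X w) ->
  (forall s, t0 <= s -> s <= T -> {ae P, forall w, G w -> expR (D s w) <= X w}) ->
  forall e, 0 < e -> exists2 c, 0 <= c & grid_stopped P T B t0 D G e c.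
Proof.
move=> t00 t0T mG sX X0 hD e e0; have [c c0 hc] := summable_tail sX X0 e0.
exists c => // tau [st _] tt [s hs] mDt.
have mX := summable_measurable sX.
have mA (f : Om -> R) : measurable_fun setT f -> measurable [set w | c <= f w].
  move=> mf; have := mf measurableT `[c, +oo[%classic (measurable_itv _); rewrite setTI.
  by congr (measurable _); apply/seteqP; split=> w /=; rewrite in_itv/= andbT.
have sA := summable_indicM (mA _ mX) sX.
rewrite -lee_fin -(integral_EFin sA) in hc; apply: le_trans hc.
apply: ae_ge0_le_integral => //.
- apply/measurable_EFinP; apply: measurable_funM => //; apply: measurable_indic.
  by apply: measurableI => //; exact: mA.
- by move=> w _; rewrite lee_fin mulr_ge0// indicE.
- exact/measurable_EFinP/(summable_measurable sA).
have h : {ae P, forall w, forall i, t0 <= nth t0 s i -> nth t0 s i <= T -> G w ->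
    expR (D (nth t0 s i) w) <= X w}.
  apply: ae_foralln => i; have [h1|h1] := boolP (t0 <= nth t0 s i); last by apply: aeW => w /negP.
  have [h2|h2] := boolP (nth t0 s i <= T); last by apply: aeW => w _ /negP.
  by apply: filterS (hD _ h1 h2) => w h _ _.
apply: filterS h => w h _; rewrite lee_fin.
have [i _ ti] := nthP t0 (hs w).
have tT : tau w <= T by have := st w; rewrite in_itv/= => /andP[].
have := h i; rewrite ti => /(_ (tt w) tT) hw.
rewrite !indicE; have [[Gw cD]|nA] := pselect (G w /\ c <= expR (D (tau w) w)).
  rewrite (mem_set (conj Gw cD : [set w | _] w)) !mul1r mem_set ?mul1r; first exact: hw.
  exact: le_trans cD (hw Gw).
rewrite (@memNset _ _ w)//= mul0r mulr_ge0//.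
Qed.

Lemma ito_scale l h I : ito h I -> ito (fun t w => l *: h t w) (fun t w => l * I t w).
Proof.
move=> iI; have := ito_lincomb hPc hT hB l 0 iI (ito_zero hPc hT hB).
rewrite (_ : (fun t w => l *: h t w + 0 *: 0) = (fun t w => l *: h t w)); last first.
  by apply/funext => t; apply/funext => w; rewrite scale0r addr0.
by rewrite (_ : (fun t w => l * I t w + 0 * 0) = (fun t w => l * I t w))//;
  apply/funext => t; apply/funext => w; rewrite mul0r addr0.
Qed.

Lemma qv_scale n (h : R -> Om -> 'cV[R]_n) l s t w :
  predictable_mx Fil T h -> (sq h w < +oo)%E -> 0 <= s -> t <= T ->
  qv (fun s w => l *: h s w) s t w = l ^+ 2 * qv h s t w.
Proof.
move=> ph fh s0 tT; have := qv_lincomb hT l 0 ph ph fh fh s0 tT.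
rewrite (_ : (fun t w => l *: h t w + 0 *: h t w) = (fun t w => l *: h t w)); last first.
  by apply/funext => r; apply/funext => v; rewrite scale0r addr0.
by move=> ->; ring.
Qed.

Lemma expR_le_quad (c x : R) : 0 <= c -> x <= c -> expR x <= 1 + x + expR c * x ^+ 2.
Proof.
move=> c0 xc.
have h1 := expR_ge1Dx (- x); have h2 := expR_ge1Dx x.
have h3 : expR x * expR (- x) = 1 by rewrite expRN divff// gt_eqF ?expR_gt0.
have h4 := ler_wpM2l (expR_ge0 x) h1; rewrite h3 mulrBr mulr1 in h4.
have ec : expR x <= expR c by rewrite ler_expR.
have c1 : 1 <= expR c by rewrite -[leLHS]expR0 ler_expR.
have x2 := sqr_ge0 x; rewrite expr2 in x2 *.
have [x0|x0] := lerP 0 x.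
  have h5 : x * (expR x - 1) <= x * (expR c * x).
    apply: ler_wpM2l => //; apply: le_trans (ler_wpM2r x0 ec); lra.
  nra.
have h5 : - x * (1 - expR x) <= - x * (- x) by apply: ler_wpM2l; lra.
nra.
Qed.

(* [x := - l N - l^2 q / 2] satisfies [1 <= E[exp x]] by the lower bound for
   exponentials and [exp x <= 1 + x + exp c * x^2]; let [l] tend to [0]. *)
Lemma energy_le h N (c : R) : ito h N -> M2 P T Fil h -> 0 <= c ->
  summable_rv P (fun w => qv h 0 T w ^+ 2) ->
  (forall l s, 0 < l -> l <= 1 -> 0 <= s -> s <= T ->
     {ae P, forall w, - l * N s w - 2^-1 * (l ^+ 2 * qv h 0 s w) <= c}) ->
  \mean[P]_w qv h 0 T w <= 4 * expR c * \mean[P]_w (N T w ^+ 2).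
Proof.
move=> iN Mh c0 sq2 hc; have [ph _] := Mh.
have fh := M2_finite hPc hT hB Mh.
have N0 := ito_at0 hPc hT hB iN.
have mNT := measurable_ito hPc hB iN (ltW hT) (lexx T).
have sN2 : summable_rv P (fun w => N T w ^+ 2).
  have [s2 _] := ito_L2 hPc hT hB iN Mh (lexx 0) (ltW hT) (lexx T).
  apply: (summable_le_as _ s2); first exact: measurable_funX.
  by apply: filterS N0 => w ->; rewrite subr0 ger0_norm ?sqr_ge0.
have sN := summable_L2 mNT sN2.
have EN0 : \mean[P]_w N T w = 0.
  have := ito_martingale_L2 hPc hT hB iN Mh (lexx 0) (ltW hT) (lexx T)
    (ltac:(exact: meas_wrt_cst) : meas_wrt (Fil 0) (fun=> 1)) (summable_cst P (1 ^+ 2)) => <-.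
  apply: expectation_as_eq => //.
    apply: (summable_le_as _ (summable_norm sN)).
      apply: measurable_funM => //; apply: measurable_funB => //.
      exact: (measurable_ito hPc hB iN (lexx 0) (ltW hT)).
    by apply: filterS N0 => w ->; rewrite subr0 mul1r.
  by apply: filterS N0 => w ->; rewrite subr0 mul1r.
have sq_ := M2_summable hPc hT hB Mh.
set Q := \mean[P]_w _; set V := \mean[P]_w (N T w ^+ 2).
pose Q2 := \mean[P]_w (qv h 0 T w ^+ 2).
have V0 : 0 <= V by apply: mean_ge0 => w; exact: sqr_ge0.
have Q20 : 0 <= Q2 by apply: mean_ge0 => w; exact: sqr_ge0.
(* The remainder comes from the fourth-order term in the square of [x]; its factor [Q2] is finite by
   the square integrability of the energy, and it vanishes with [l]. *)
suff key l : 0 < l -> l <= 1 -> Q <= 4 * expR c * V + l * (expR c * Q2).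
  apply/ler_addgt0Pr => e e0.
  have k0 : 0 <= expR c * Q2 by rewrite mulr_ge0 ?expR_ge0.
  pose l := Num.min 1 (e / (expR c * Q2 + 1)).
  have l0 : 0 < l by rewrite lt_min ltr01 divr_gt0//; lra.
  have l1 : l <= 1 by rewrite ge_min lexx.
  apply: (le_trans (key l l0 l1)); rewrite lerD2l.
  apply: (@le_trans _ _ (l * (expR c * Q2 + 1))); first by rewrite ler_wpM2l ?(ltW l0)//; lra.
  by rewrite -ler_pdivlMr ?ge_min ?lexx ?orbT//; lra.
move=> l0 l1.
pose h' t w := - l *: h t w; pose N' t w := - l * N t w.
have iN' : ito h' N' by exact: ito_scale.
pose D s w := N' s w - 2^-1 * qv h' 0 s w.
have ph' : predictable_mx Fil T h' by case: iN'.
have qE s : 0 <= s -> s <= T -> {ae P, forall w, qv h' 0 s w = l ^+ 2 * qv h 0 s w}.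
  by move=> s0 sT; apply: filterS fh => w fw; rewrite qv_scale// sqrrN.
have DE s : 0 <= s -> s <= T -> {ae P, forall w, D s w = - l * N s w - 2^-1 * (l ^+ 2 * qv h 0 s w)}.
  by move=> s0 sT; apply: filterS (qE s s0 sT) => w; rewrite /D => ->.
have Dc s : 0 <= s -> s <= T -> {ae P, forall w, D s w <= c}.
  by move=> s0 sT; apply: filterS2 (DE s s0 sT) (hc l s l0 l1 s0 sT) => w ->.
have mD s : 0 <= s -> s <= T -> meas_wrt (Fil s) (D s).
  move=> s0 sT; apply: meas_wrtB; first exact: (ito_adapted iN').
  apply: meas_wrtM; first exact: meas_wrt_cst.
  exact: (adapted_qv hT ph' (lexx 0) s0 sT).
have FT0 : Fil 0 setT by exact: Fil_setT.
have lb : (P setT <= \int[P]_w (\1_setT w * expR (D T w))%:E)%E.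
  apply: (exp_lower_bound hPc hT hB (lexx 0) (ltW hT) iN' FT0 mD) => [s s0 sT|].
    by apply: filterS N0 => w N0w _; rewrite /D /N' N0w mulr0 subr0.
  apply: (grid_stopped_dominated (lexx 0) (ltW hT) measurableT (summable_cst P (expR c))).
    by move=> w; exact: expR_ge0.
  by move=> s s0 sT; apply: filterS (Dc s s0 sT) => w hw _; rewrite ler_expR.
have mDT := meas_wrt_measurable hPc hB (lexx T) (mD T (ltW hT) (lexx T)).
pose x w := - l * N T w - 2^-1 * (l ^+ 2 * qv h 0 T w).
have sx : summable_rv P x.
  by apply: summableB; [exact: summableZ|apply: summableZ; exact: summableZ].
have mx := summable_measurable sx.
have sx2 : summable_rv P (fun w => x w ^+ 2).
  apply: (eq_summable (f := fun w => (- l * N T w + (- (2^-1 * l ^+ 2)) * qv h 0 T w) ^+ 2)).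
    by move=> w; rewrite /x; ring.
  have mq := summable_measurable sq_.
  apply: summable_sqD; [exact: measurable_funM|exact: measurable_funM| |]; exact: summable_sqZ.
have s3 := summableD (summableD (summable_cst P 1) sx) (summableZ (expR c) sx2).
have up : 1 <= \mean[P]_w (1 + x w + expR c * x w ^+ 2).
  have sD : summable_rv P (fun w => expR (D T w)).
    apply: (summable_le_as _ (summable_cst P (expR c))); first exact: measurableT_comp.
    by apply: filterS (Dc T (ltW hT) (lexx T)) => w hw; rewrite ger0_norm ?expR_ge0// ler_expR.
  rewrite probability_setT in lb.
  apply: (@le_trans _ _ (\mean[P]_w expR (D T w))).
    rewrite -lee_fin -(integral_EFin sD); apply: (le_trans lb).
    by under eq_integral do rewrite indicT mul1r.
  apply: (expectation_le_as sD s3).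
  apply: filterS2 (DE T (ltW hT) (lexx T)) (Dc T (ltW hT) (lexx T)) => w hw hcw.
  by rewrite hw in hcw *; exact: expR_le_quad.
move: up; rewrite (meanD (summableD (summable_cst P 1) sx) (summableZ _ sx2)).
rewrite (meanD (summable_cst P 1) sx) expectation_cst (meanZ _ sx2).
have -> : \mean[P]_w x w = - (2^-1 * (l ^+ 2 * Q)).
  rewrite (meanB (summableZ _ sN) (summableZ _ (summableZ _ sq_))) (meanZ _ sN) EN0.
  by rewrite (meanZ _ (summableZ _ sq_)) (meanZ _ sq_) mulr0 sub0r.
have : \mean[P]_w (x w ^+ 2) <= 2 * l ^+ 2 * V + 2^-1 * l ^+ 4 * Q2.
  rewrite -(meanZ _ sN2) -(meanZ _ sq2) -(meanD (summableZ _ sN2) (summableZ _ sq2)).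
  apply: (expectation_le sx2); first by apply: summableD; exact: summableZ.
  move=> w; rewrite /x; set a := N T w; set b := qv _ _ _ _.
  have := sqr_ge0 (l * a - 2^-1 * l ^+ 2 * b); nra.
set X2 := \mean[P]_w (x w ^+ 2); clearbody X2 V Q2 Q => hX up.
have {}hX := ler_wpM2l (expR_ge0 c) hX.
have l2 : 0 < l ^+ 2 by rewrite exprn_gt0.
rewrite -(ler_pM2l l2).
have : l ^+ 2 * Q <= 2 * (expR c * (2 * l ^+ 2 * V + 2^-1 * l ^+ 4 * Q2)) by lra.
move=> h2; apply: (le_trans h2); rewrite (mulrDr (expR c)) (mulrDr 2) (mulrDr (l ^+ 2)); apply: lerD.
  by rewrite le_eqVlt; apply/orP; left; apply/eqP; ring.
have -> : 2 * (expR c * (2^-1 * l ^+ 4 * Q2)) = l ^+ 4 * (expR c * Q2) by field.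
have k0 : 0 <= expR c * Q2 by rewrite mulr_ge0 ?expR_ge0.
rewrite mulrA; apply: ler_wpM2r => //.
by rewrite -exprSr; apply: ler_wiXn2l => //; exact: ltW.
Qed.

(** On the event [G] that [D t0] exceeds [d], the process [D - d] starts above 0, so the lower bound
    applies to its exponential. Since [D T <= 0] it gives [P G <= expR (- d) * P G], and [G] is
    negligible for every [d > 0]. *)
Lemma exp_comparison h N t0 D X : ito h N -> 0 <= t0 -> t0 <= T ->
  (forall s, t0 <= s -> s <= T -> meas_wrt (Fil s) (D s)) ->
  {ae P, forall w, D T w <= 0} ->
  (forall s, t0 <= s -> s <= T -> {ae P, forall w,
     N s w - N t0 w - 2^-1 * qv h t0 s w <= D s w - D t0 w}) ->
  summable_rv P X -> (forall w, 0 <= X w) ->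
  (forall s, t0 <= s -> s <= T -> {ae P, forall w, expR (D s w) <= X w}) ->
  {ae P, forall w, D t0 w <= 0}.
Proof.
move=> iN t00 t0T mD DT hD sX X0 DX.
have key n : {ae P, forall w, D t0 w <= n.+1%:R^-1}.
  set d : R := n.+1%:R^-1; have d0' : 0 < d by rewrite invr_gt0.
  pose G := [set w | d < D t0 w].
  have FG : Fil t0 G by apply: Fil_ltr; exact: mD.
  have mG := Fil_measurable hPc hB t0T FG.
  have mD' s : t0 <= s -> s <= T -> meas_wrt (Fil s) (fun w => D s w - d).
    by move=> ts sT; apply: meas_wrtB; [exact: mD|exact: meas_wrt_cst].
  have lb : (P G <= \int[P]_w (\1_G w * expR (D T w - d))%:E)%E.
    apply: (exp_lower_bound hPc hT hB t00 t0T iN FG mD') => [s ts sT|].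
      apply: filterS (hD s ts sT) => w hw Gw; apply: (le_trans hw).
      by rewrite lerB// ltW.
    apply: (grid_stopped_dominated t00 t0T mG sX X0) => s ts sT.
    apply: filterS (DX s ts sT) => w hw _; apply: le_trans hw.
    by rewrite ler_expR gerBl ltW.
  have sG := summable_indic P mG.
  have up : (\int[P]_w (\1_G w * expR (D T w - d))%:E <= (expR (- d) * \mean[P]_w (\1_G w))%:E)%E.
    rewrite -(meanZ _ sG) -(integral_EFin (summableZ _ sG)).
    apply: ae_ge0_le_integral => //.
    - apply/measurable_EFinP; apply: measurable_funM => //; apply: measurableT_comp => //.
      apply: measurable_funB => //.
      exact: (meas_wrt_measurable hPc hB (lexx T) (mD T t0T (lexx T))).
    - exact/measurable_EFinP/(summable_measurable (summableZ _ sG)).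
    apply: filterS DT => w hw _; rewrite lee_fin mulrC; apply: ler_wpM2r; first by rewrite indicE.
    by rewrite ler_expR; lra.
  have := le_trans lb up; rewrite -expectation_indic// lee_fin => h1.
  have p0 : 0 <= \mean[P]_w (\1_G w : R) by apply: mean_ge0 => w; rewrite indicE.
  have p00 : \mean[P]_w (\1_G w : R) = 0.
    apply/eqP; rewrite eq_le p0 andbT leNgt; apply/negP => p1.
    have : expR (- d) < 1 by rewrite expR_lt1 oppr_lt0.
    by move: h1; rewrite -[leLHS]mul1r ler_pM2r// leNgt => /negP.
  have PG0 : P G = 0%E by rewrite -expectation_indic// p00.
  exists G; split=> // w /= /negP; rewrite -ltNge.
  exact.
have hn : {ae P, forall w, forall n, D t0 w <= n.+1%:R^-1} by exact: ae_foralln.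
apply: filterS hn => w hw; apply/ler_addgt0Pr => e e0; rewrite add0r.
by have [n hn] := exists_invS_lt e0; exact: le_trans (hw n) (ltW hn).
Qed.

End domination.

(** * Distance to the constraints *)

Section predictable_matrices.
Context (R : realType) (d0 : measure_display) (Om : measurableType d0)
  (P : probability Om R) (T : R) (hT : 0 < T)
  (m : nat) (B : R -> Om -> 'cV[R]_m).
Local Notation Fil := (augmented_filtration P B).
Local Notation pm := (pmeas P T B).
Local Notation pred := (predictable_mx Fil T).

(** The inverse is written as [x] times the exponential of [- (2 * ln |x|)], which is correct also
    at 0, where both sides vanish. *)
Lemma measurable_inv : measurable_fun setT (fun x : R => x^-1).
Proof.
rewrite (_ : (fun x : R => x^-1) = fun x => x * expR (- (2 * ln `|x|))).
  apply: measurable_funM => //; apply: measurableT_comp => //; apply: measurableT_comp => //.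
  apply: measurable_funM => //; apply: measurableT_comp; [exact: measurable_ln|exact: normr_measurable].
apply/funext => x; have [->|x0] := eqVneq x 0; first by rewrite invr0 mul0r.
rewrite mulr2n mulrDl !mul1r -[in RHS](mulr1n (ln _)).
have n0 : 0 < `|x| by rewrite normr_gt0.
rewrite opprD expRD expRN mulr1n lnK ?posrE// -invfM -expr2 real_normK ?num_real//.
by rewrite expr2 invfM mulrA divff// mul1r.
Qed.

Lemma pmeasV f : pm f -> pm (fun t w => (f t w)^-1).
Proof. by move=> mf; exact: (pmeas_comp measurable_inv mf). Qed.

Lemma pmeas_det n (A : R -> Om -> 'M[R]_n) : (forall i j, pm (fun t w => A t w i j)) ->
  pm (fun t w => \det (A t w)).
Proof.
move=> mA; apply: pmeas_sum => s; apply: pmeasM; first exact: pmeas_cst.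
by apply: pmeas_prod => i; exact: mA.
Qed.

Lemma predictable_mx_inv n (A : R -> Om -> 'M[R]_n) : pred A -> pred (fun t w => invmx (A t w)).
Proof.
move=> /(predictable_mxP _ hT) mA; apply/(predictable_mxP _ hT) => i j.
(* [invmx] returns the matrix itself when the determinant is 0; the indicator [g] switches between
   this default and the cofactor formula. *)
pose g (x : R) : R := (x != 0)%:R.
have mg : measurable_fun setT g.
  rewrite (_ : g = \1_(~` [set 0])); first by apply: measurable_indic; exact: measurableC.
  apply/funext => x; rewrite /g indicE; congr (_ %:R); congr nat_of_bool.
  apply/idP/idP => [/eqP h|/set_mem/= h]; [exact/mem_set|exact/eqP].
have mdet := pmeas_det mA; have mgd := pmeas_comp mg mdet.
apply: (eq_pmeas (f := fun t w => g (\det (A t w)) * ((\det (A t w))^-1 *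
    ((-1) ^+ (j + i) * \det (row' j (col' i (A t w))))) +
    (1 - g (\det (A t w))) * A t w i j)).
  move=> t w; rewrite /invmx unitmxE unitfE /g; case: eqP => h /=.
    by rewrite mul0r add0r subr0 mul1r.
  by rewrite mul1r subrr mul0r addr0 !mxE.
apply: pmeasD; last by apply: pmeasM => //; apply: pmeasB => //; exact: pmeas_cst.
apply: pmeasM => //; apply: pmeasM; first exact: pmeasV.
apply: pmeasM; first exact: pmeas_cst.
apply: pmeas_det => i' j'.
by apply: (eq_pmeas (f := fun t w => A t w (lift j i') (lift i j'))) (mA _ _) => t w; rewrite !mxE.
Qed.

Lemma pmeas_enorm n (z : R -> Om -> 'cV[R]_n) : pred z -> pm (fun t w => enorm (z t w)).
Proof.
move=> pz; apply: (pmeas_comp (g := Num.sqrt)); last exact: pmeas_vdot.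
by apply: continuous_measurable_fun; exact: sqrt_continuous.
Qed.

End predictable_matrices.

Section countable_density.
Context (R : realType) (n : nat).

Lemma rat_vector_dense (x : 'cV[R]_n) e : 0 < e ->
  exists q : 'cV[rat]_n, enorm (x - map_mx ratr q) < e.
Proof.
move=> e0; pose dl := e / n.+1%:R; have dl0 : 0 < dl by rewrite divr_gt0.
have /choice[q hq] : forall i, exists q : rat, `|x i ord0 - ratr q| < dl.
  move=> i; have : x i ord0 - dl < x i ord0 + dl by lra.
  move=> /rat_in_itvoo[q]; rewrite in_itv/= => /andP[q1 q2]; exists q.
  by rewrite ltr_norml; apply/andP; split; lra.
exists (\col_i q i).
rewrite -(@ltr_pXn2r _ 2) ?nnegrE ?enorm_ge0 ?(ltW e0)// sqr_enorm vdotE.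
apply: (@le_lt_trans _ _ (\sum_(i < n) dl ^+ 2)).
  apply: ler_sum => i _; rewrite -expr2 -real_normK ?num_real//.
  by rewrite ler_sqr ?nnegrE ?(ltW dl0)// !mxE ltW.
rewrite sumr_const card_ord -mulr_natl.
have -> : e = n.+1%:R * dl by rewrite /dl mulrC divfK.
rewrite [ltRHS]exprMn ltr_pM2r ?exprn_gt0// -natrX ltr_nat.
by rewrite -[(n.+1 ^ 2)%N]/(n.+1 * n.+1)%N; exact: leq_pmulr.
Qed.

(** Each code of a rational centre and a radius selects a point of [C] in the corresponding ball
    when there is one, and [c0] otherwise. *)
Lemma countable_dense (C : set 'cV[R]_n) c0 : C c0 -> exists p : nat -> 'cV[R]_n,
  (forall k, C (p k)) /\ forall x e, C x -> 0 < e -> exists k, enorm (x - p k) < e.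
Proof.
move=> Cc0.
have /choice[p hp] : forall k : nat, exists y, C y /\
    forall (q : 'cV[rat]_n) (j : nat), unpickle k = Some (q, j) ->
    (exists x, C x /\ enorm (x - map_mx ratr q) < j.+1%:R^-1) ->
    enorm (y - map_mx ratr q) < j.+1%:R^-1.
  move=> k; case E : (unpickle k : option ('cV[rat]_n * nat)) => [[q j]|]; last by exists c0.
  have [[x [Cx hx]]|nx] := pselect (exists x, C x /\ enorm (x - map_mx ratr q) < j.+1%:R^-1).
    by exists x; split=> // q' j' [<- <-].
  by exists c0; split=> // q' j' [<- <-] h; case: nx.
exists p; split=> [k|x e Cx e0]; first by case: (hp k).
have [j hj] := exists_invS_lt (divr_gt0 e0 (ltr0Sn R 1)).
have j0 : (0 : R) < j.+1%:R^-1 by rewrite invr_gt0.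
have [q hq] := rat_vector_dense x j0.
exists (pickle (q, j)); have [_ /(_ q j)] := hp (pickle (q, j)).
rewrite pickleK => /(_ erefl) h; have {}h := h (ex_intro _ x (conj Cx hq)).
rewrite (_ : x - _ = (x - map_mx ratr q) + (- (p (pickle (q, j)) - map_mx ratr q))); last first.
  by rewrite opprB addrA subrK.
apply: (le_lt_trans (enormD _ _)); rewrite enormN (splitr e).
by apply: ltrD; apply: lt_trans hj.
Qed.

Lemma enorm_mulmx_le p (A : 'M[R]_(p, n)) :
  exists2 M, 0 <= M & forall x : 'cV[R]_n, enorm (A *m x) <= M * enorm x.
Proof.
pose r i : 'cV[R]_n := (row i A)^T.
exists (Num.sqrt (\sum_i vdot (r i) (r i))) => [|x]; first exact: sqrtr_ge0.
have s0 : 0 <= \sum_i vdot (r i) (r i) by apply: sumr_ge0 => i _; exact: vdot_ge0.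
rewrite -(@ler_pXn2r _ 2) ?nnegrE ?enorm_ge0 ?mulr_ge0 ?sqrtr_ge0 ?enorm_ge0//.
rewrite [leRHS]exprMn [X in _ <= X * _]sqr_sqrtr// [leLHS]sqr_enorm vdotE mulr_suml; apply: ler_sum => i _.
have -> : (A *m x) i ord0 = vdot (r i) x.
  by rewrite vdotE mxE; apply: eq_bigr => j _; rewrite !mxE.
rewrite -expr2 -real_normK ?num_real// -sqr_enorm -exprMn ler_sqr ?nnegrE ?mulr_ge0 ?enorm_ge0//.
exact: cauchy_schwarz.
Qed.

End countable_density.

Section distance_to_constraints.
Context (R : realType) (d0 : measure_display) (Om : measurableType d0)
  (P : probability Om R) (T : R) (hT : 0 < T)
  (d m : nat) (B : R -> Om -> 'cV[R]_m).
Local Notation Fil := (augmented_filtration P B).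
Local Notation pm := (pmeas P T B).
Local Notation pred := (predictable_mx Fil T).
Variables (sigma : R -> Om -> 'M[R]_(d, m)) (C : set 'cV[R]_d).
Hypotheses (hsigma : pred sigma) (hC0 : C 0).
Local Notation K := (constraint_image sigma C).

Lemma constraint_image0 t w : K t w 0.
Proof. by exists 0 => //; rewrite mulmx0. Qed.

Lemma constraint_image_nonempty t w : K t w !=set0.
Proof. by exists 0; exact: constraint_image0. Qed.

(** The constraint set varies with time and path, but a single countable dense subset of [C] is
    mapped by every [sigma^T] onto a dense subset of it; the distance is thus a countable infimum of
    predictable processes. *)
Lemma pmeas_edistance (z : R -> Om -> 'cV[R]_m) : pred z ->
  pm (fun t w => edistance (K t w) (z t w)).
Proof.
move=> pz; have [p [Cp pd]] := countable_dense hC0.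
pose e k t w := enorm (z t w - (sigma t w)^T *m p k).
apply: (eq_pmeas (f := fun t w => infs (fun k => e k t w) 0%N)).
  move=> t w; rewrite /infs.
  have lb : has_lbound (sdrop (fun k => e k t w) 0%N).
    by exists 0 => _ [k _ <-]; exact: enorm_ge0.
  apply/le_anti/andP; split.
    apply/ler_addgt0Pr => x x0.
    have x2 : 0 < x / 2 by rewrite divr_gt0.
    have [_ [q Cq <-] hq] := edistance_adherent (constraint_image_nonempty t w) (z t w) x2.
    have [M M0 hM] := enorm_mulmx_le (sigma t w)^T.
    have xM : 0 < x / 2 / (M + 1) by rewrite divr_gt0//; lra.
    have [k hk] := pd q _ Cq xM.
    apply: (@le_trans _ _ (e k t w)); first by apply: ge_inf => //; exists k.
    rewrite /e (_ : z t w - (sigma t w)^T *m p k = (z t w - (sigma t w)^T *m q) +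
        (sigma t w)^T *m (q - p k)); last by rewrite mulmxBr addrA subrK.
    apply: (le_trans (enormD _ _)); apply: (le_trans (lerD (ltW hq) (hM _))).
    rewrite -addrA lerD2l [leRHS](splitr x) lerD2l.
    apply: (@le_trans _ _ (M * (x / 2 / (M + 1)))); first by rewrite ler_wpM2l// ltW.
    rewrite mulrA ler_pdivrMr; last by lra.
    by rewrite mulrC ler_wpM2l ?(ltW x2)//; lra.
  apply: lb_le_inf; first by exists (e 0%N t w); exists 0%N.
  by move=> _ [k _ <-]; apply: edistance_le; exists (p k).
have := @measurable_fun_infs _ (g_sigma_algebraType (predictable_gen P T B)) R
  [set p | p.1 \in `[0, T]] (fun k tw => e k tw.1 tw.2) 0%N.
apply.
  by move=> tw _; exists 0 => _ [k _ <-]; exact: enorm_ge0.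
move=> k; suff : pm (e k) by [].
apply: (pmeas_enorm hT); apply: (predictable_mxD hT) => //.
apply: (predictable_mxN hT); apply: (predictable_mxM hT); first exact: (predictable_mx_tr hT).
by apply/(predictable_mxP _ hT) => i j; exact: pmeas_cst.
Qed.

End distance_to_constraints.

Lemma half_sum_le (R : realFieldType) (x y c : R) : x <= c -> y <= c -> 2^-1 * (x + y) <= c.
Proof. lra. Qed.

Lemma le_of_sqr_le (R : realDomainType) (x y : R) : 0 <= y -> x ^+ 2 <= y ^+ 2 -> x <= y.
Proof.
move=> y0 h; rewrite leNgt; apply/negP => yx.
by move: h; rewrite leNgt ltr_sqr ?nnegrE ?yx// (le_trans y0 (ltW yx)).
Qed.

Lemma sqrB_le (R : realDomainType) (x y : R) : (x - y) ^+ 2 <= 2 * (x ^+ 2 + y ^+ 2).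
Proof. by rewrite -subr_ge0 (_ : _ - _ = (x + y) ^+ 2) ?sqr_ge0//; ring. Qed.

Lemma uniform_continuity (R : realType) (T : R) (f : R -> R) e :
  {within `[0, T], continuous f} -> 0 < e ->
  exists2 dl, 0 < dl & forall x y, 0 <= x <= T -> 0 <= y <= T -> `|x - y| < dl ->
    `|f x - f y| <= e.
Proof.
move=> /subspace_continuousP fc e0.
have H : \forall dl \near 0^'+, `[0, T] `<=` [set x | forall y, 0 <= y <= T ->
    `|x - y| < dl -> `|f x - f y| <= e].
  apply: (near_covering_withinP _).2 ((compact_near_coveringP _).1 (@segment_compact R 0 T)) _ _
    (fun dl x => forall y, 0 <= y <= T -> `|x - y| < dl -> `|f x - f y| <= e) _ _.
  move=> x xT.
  have e2 : 0 < e / 2 by rewrite divr_gt0.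
  have := fc x xT; move=> /cvgrPdist_lt /(_ _ e2); rewrite near_withinE => /nbhs_ballP [r r0 hr].
  have r2 : 0 < r / 2 by rewrite divr_gt0.
  exists (ball x (r / 2), [set dl | dl < r / 2]) => /=.
    by split; [exact: nbhsx_ballx|exact: nbhs_right_lt].
  move=> [x' dl] /= [bx dlr] x'T y yT xy.
  have h1 : `|f x - f x'| < e / 2.
    by apply: (hr x'); [rewrite /ball/= (lt_trans bx)//; lra|].
  have h2 : `|f x - f y| < e / 2.
    apply: (hr y); last by rewrite /= in_itv.
    rewrite /ball/= -(subrK x' x) -addrA (le_lt_trans (ler_normD _ _))//.
    by move: bx xy dlr; rewrite /ball/=; move: `|x - x'| `|x' - y| => p q; lra.
  by move: h1 h2 => /ltr_normlP[h1 h1'] /ltr_normlP[h2 h2']; rewrite ler_norml; apply/andP; split; lra.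
have [dl [dl0 hdl]] : exists dl, 0 < dl /\ `[0, T] `<=` [set x | forall y, 0 <= y <= T ->
    `|x - y| < dl -> `|f x - f y| <= e].
  by near (0 : R)^'+ => dl; exists dl; split; near: dl; [exact: nbhs_right_gt|exact: H].
by exists dl => // x y xT; apply: hdl; rewrite /= in_itv.
Unshelve. all: by end_near. Qed.

Lemma mean_dominated_small (R : realType) (d0 : measure_display) (Om : measurableType d0)
  (P : probability Om R) (f : nat -> Om -> R) g e : (forall n, measurable_fun setT (f n)) ->
  summable_rv P g -> (forall n, {ae P, forall w, `|f n w| <= g w}) ->
  {ae P, forall w, f n w @[n --> \oo] --> 0} -> 0 < e ->
  exists n, \mean[P]_w f n w <= e.
Proof.
move=> mf sg fg f0 e0.
have sf n := summable_le_as (mf n) sg (fg n).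
have [] := @dominated_convergence _ _ _ P setT measurableT (fun n => EFin \o f n)
    (cst 0%E) (EFin \o g).
- by move=> n; exact/measurable_EFinP.
- exact: measurable_cst.
- by apply: filterS f0 => w h _; apply: cvg_EFin => //; exact: nearW.
- exact/summableP.
- have := ae_foralln fg; apply: filterS => w h n _; rewrite /= lee_fin; exact: h.
move=> _ _ h.
move: h; rewrite integral0 => h.
have {}h : \mean[P]_w f n w @[n --> \oo] --> (0 : R).
  have /fine_cvgP[_] := h; rewrite (_ : fine \o _ = (fun n => \mean[P]_w f n w))//.
  by apply/funext => n /=; rewrite (integral_EFin (sf n)).
move: h => /cvgrPdist_le /(_ _ e0) [n _ /(_ n (leqnn n))]; rewrite /= sub0r normrN => h.
by exists n; exact: le_trans (ler_norm _) h.
Qed.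

Lemma sum_norm_le (R : realType) n (f r : nat -> R) : (forall i, (i < n)%N -> - r i <= f i /\ 0 <= r i) ->
  \sum_(i < n) `|f i| <= \sum_(i < n) f i + 2 * \sum_(i < n) r i.
Proof.
move=> h; rewrite mulr_sumr -big_split/=; apply: ler_sum => i _.
have [h1 h2] := h i (ltn_ord i); rewrite ler_norml; apply/andP; split; lra.
Qed.

Lemma sum_sqr_le (R : realType) n (f : nat -> R) e : (forall i, (i < n)%N -> `|f i| <= e) ->
  \sum_(i < n) f i ^+ 2 <= e * \sum_(i < n) `|f i|.
Proof.
move=> h; rewrite mulr_sumr; apply: ler_sum => i _.
by rewrite -real_normK ?num_real// expr2 ler_wpM2r//; exact: h.
Qed.

Lemma sum_sqr_le_sqr (R : realType) n (f : nat -> R) :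
  \sum_(i < n) f i ^+ 2 <= (\sum_(i < n) `|f i|) ^+ 2.
Proof.
rewrite [leRHS]expr2; apply: sum_sqr_le => i ni.
by rewrite (bigD1 (Ordinal ni))//= lerDl sumr_ge0.
Qed.

(** Discrete integration by parts for [M = y + A], with [f] the increments of [A]. In its
    application [M] is a martingale and [y] is dominated: the last sum has mean zero, the one with
    [y] is controlled by the variation of [A], and the sum of squares vanishes with the mesh. *)
Lemma square_decomposition (R : realType) n (M y : nat -> R) : M 0%N = 0 -> y 0%N = 0 ->
  let f i := (M i.+1 - M i) - (y i.+1 - y i) in
  M n ^+ 2 = y n ^+ 2 + 2 * (\sum_(i < n) y i.+1 * f i) + \sum_(i < n) f i ^+ 2
    + 2 * \sum_(i < n) (M i - y i) * (M i.+1 - M i).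
Proof.
move=> M0 y0 f; elim: n => [|n IH].
  by rewrite !big_ord0 M0 y0; ring.
rewrite !big_ord_recr/=.
have -> : M n.+1 ^+ 2 = M n ^+ 2 + (M n.+1 ^+ 2 - M n ^+ 2) by rewrite addrC subrK.
by rewrite [X in X + _]IH /f; ring.
Qed.

Section as_helpers.
Context (R : realType) (d0 : measure_display) (Om : measurableType d0)
  (P : probability Om R) (T : R) (hT : 0 < T).
Local Notation mu := (@lebesgue_measure R).

Lemma ae_time_mono (Q Q' : R -> Prop) : (forall t, Q t -> Q' t) ->
  {ae mu, forall t, Q t} -> {ae mu, forall t, Q' t}.
Proof. by move=> QQ'; apply: negligibleS => t; apply: contra_not; exact: QQ'. Qed.

Lemma ae_time_mono2 (Q1 Q2 Q' : R -> Prop) : (forall t, Q1 t -> Q2 t -> Q' t) ->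
  {ae mu, forall t, Q1 t} -> {ae mu, forall t, Q2 t} -> {ae mu, forall t, Q' t}.
Proof.
move=> QQ' h1 h2; apply: negligibleS (negligibleU h1 h2) => t /= nQ.
by apply/not_andP => -[q1 q2]; apply: nQ; exact: QQ'.
Qed.

Lemma le_Rintegral_ae (f g : R -> R) a b : 0 <= a -> b <= T ->
  mu.-integrable `[0, T] (EFin \o f) -> mu.-integrable `[0, T] (EFin \o g) ->
  {ae mu, forall t, t \in `[0, T] -> f t <= g t} ->
  \int[mu]_(u in `[a, b]) f u <= \int[mu]_(u in `[a, b]) g u.
Proof.
move=> a0 bT /(integrable_sub_itv a0 bT) iF /(integrable_sub_itv a0 bT) iG fg.
rewrite -subr_ge0 -RintegralB//.
rewrite (_ : \int[mu]_(u in _) _ = \int[mu]_(u in `[a, b]) `|g u - f u|).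
  by apply: Rintegral_ge0.
have mI : measurable (`[a, b]%classic : set (measurableTypeR R)) by [].
have iB := integrable_EFinB mI iG iF.
rewrite /Rintegral; congr fine; apply: ae_eq_integral => //.
- by case/integrableP: iB.
- have /integrableP[/measurable_EFinP mB _] := iB.
  by apply/measurable_EFinP; apply: measurableT_comp.
apply: ae_time_mono fg => t h; rewrite /= in_itv/= => /andP[at_ tb].
rewrite ger0_norm// subr_ge0; apply: h.
by rewrite in_itv/= (le_trans a0 at_) (le_trans tb bT).
Qed.

Lemma ae_and (A A' : Om -> Prop) : {ae P, forall w, A w} -> {ae P, forall w, A' w} ->
  {ae P, forall w, A w /\ A' w}.
Proof. by move=> hA hA'; apply: filterS2 hA hA' => w; split. Qed.

Lemma as_all_at (S : R -> Om -> Prop) t : as_all P T S -> 0 <= t -> t <= T ->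
  {ae P, forall w, S t w}.
Proof. by move=> h t0 tT; apply: filterS h => w; apply; rewrite in_itv/= t0. Qed.

End as_helpers.

Lemma predictable_adapted (R : realType) (d0 : measure_display) (Om : measurableType d0)
  (P : probability Om R) (T : R) (hT : 0 < T) (m : nat) (B : R -> Om -> 'cV[R]_m) f t :
  pmeas P T B f -> 0 <= t -> t <= T -> meas_wrt (augmented_filtration P B t) (f t).
Proof.
move=> pf t0 tT; apply/meas_wrtP.
have mj := pmeas_joint hT t0 tT pf.
set FT := g_sigma_algebraType _.
have h : measurable_fun [set: FT] (fun w : FT => (t, w) : measurableTypeR R * FT).
  by apply/measurable_fun_pairP; split; [exact: measurable_cst|exact: measurable_id].
have mD : measurable (`[0, t] `*` setT : set (measurableTypeR R * FT)%type).
  by apply: measurableX.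
have := measurable_comp mD _ mj h; apply.
by move=> _ [w _ <-]; split=> //=; rewrite in_itv/= t0 lexx.
Qed.

Lemma time_dot_self (R : realType) (d0 : measure_display) (Om : measurableType d0) n
  (h g : R -> Om -> 'cV[R]_n) s w : time_dot h g s s w = 0.
Proof. by rewrite time_dotE Rintegral_itv1. Qed.

Lemma meas_wrtZ (R : realType) (d0 : measure_display) (Om : measurableType d0)
  (P : probability Om R) (m : nat) (B : R -> Om -> 'cV[R]_m) t c (f : Om -> R) :
  meas_wrt (augmented_filtration P B t) f ->
  meas_wrt (augmented_filtration P B t) (fun w => c * f w).
Proof.
move=> mf; have mc : meas_wrt (augmented_filtration P B t) (fun=> c) by exact: meas_wrt_cst.
exact: (meas_wrtM mc mf).
Qed.

Lemma meas_wrtN (R : realType) (d0 : measure_display) (Om : measurableType d0)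
  (P : probability Om R) (m : nat) (B : R -> Om -> 'cV[R]_m) t (f : Om -> R) :
  meas_wrt (augmented_filtration P B t) f ->
  meas_wrt (augmented_filtration P B t) (fun w => - f w).
Proof.
move=> /(@meas_wrtZ R d0 Om P m B t (-1)).
by rewrite (_ : (fun w => -1 * f w) = (fun w => - f w))//; apply/funext => w; rewrite mulN1r.
Qed.

Lemma predictable_mxB (R : realType) (d0 : measure_display) (Om : measurableType d0)
  (P : probability Om R) (T : R) (hT : 0 < T) (n : nat) (B : R -> Om -> 'cV[R]_n) p q
  (u v : R -> Om -> 'M[R]_(p, q)) :
  predictable_mx (augmented_filtration P B) T u -> predictable_mx (augmented_filtration P B) T v ->
  predictable_mx (augmented_filtration P B) T (fun t w => u t w - v t w).
Proof. by move=> pu pv; apply: (predictable_mxD hT) => //; exact: (predictable_mxN hT). Qed.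

Lemma sq_subtr_finite (R : realType) (d0 : measure_display) (Om : measurableType d0)
  (P : probability Om R) (T : R) (hT : 0 < T) (n p : nat) (B : R -> Om -> 'cV[R]_n)
  (u v : R -> Om -> 'cV[R]_p) w :
  predictable_mx (augmented_filtration P B) T u -> predictable_mx (augmented_filtration P B) T v ->
  (sq_norm_integral T u w < +oo)%E -> (sq_norm_integral T v w < +oo)%E ->
  (sq_norm_integral T (fun t w => (u t w - v t w)%R) w < +oo)%E.
Proof.
move=> pu pv fu fv; have := sq_lincomb hT 1 (-1) w pu pv.
rewrite (_ : (fun s w => (1 *: u s w + -1 *: v s w)%R) = (fun t w => (u t w - v t w)%R)); last first.
  by apply/funext => t; apply/funext => x; rewrite scale1r scaleN1r.
by move=> /le_lt_trans; apply; rewrite (sq_qv fu) (sq_qv fv) -!EFinM -EFinD ltry.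
Qed.

Lemma itoB (R : realType) (d0 : measure_display) (Om : measurableType d0)
  (P : probability Om R) (hPc : measure_is_complete P) (T : R) (hT : 0 < T)
  (n : nat) (B : R -> Om -> 'cV[R]_n) (hB : brownian_motion P T B) h h' I I' :
  ito_integral P T B h I -> ito_integral P T B h' I' ->
  ito_integral P T B (fun t w => h t w - h' t w) (fun t w => I t w - I' t w).
Proof.
move=> iI iI'; have := ito_lincomb hPc hT hB 1 (-1) iI iI'.
congr ito_integral; apply/funext => t; apply/funext => w; first by rewrite scale1r scaleN1r.
by rewrite mul1r mulN1r.
Qed.

Lemma M2_lincomb (R : realType) (d0 : measure_display) (Om : measurableType d0)
  (P : probability Om R) (hPc : measure_is_complete P) (T : R) (hT : 0 < T)
  (n : nat) (B : R -> Om -> 'cV[R]_n) (hB : brownian_motion P T B) (u v : R -> Om -> 'cV[R]_n) a c :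
  M2 P T (augmented_filtration P B) u -> M2 P T (augmented_filtration P B) v ->
  M2 P T (augmented_filtration P B) (fun t w => a *: u t w + c *: v t w).
Proof.
move=> [pu iu] [pv iv]; have pw := predictable_mxD hT (predictable_mxZ hT a pu) (predictable_mxZ hT c pv).
split; first exact: pw.
have mu_ := measurable_sq hPc hT hB pu; have mv := measurable_sq hPc hT hB pv.
have a0 : (0 <= (2 * a ^+ 2)%:E)%E by rewrite lee_fin mulr_ge0// sqr_ge0.
have c0 : (0 <= (2 * c ^+ 2)%:E)%E by rewrite lee_fin mulr_ge0// sqr_ge0.
apply: (@le_lt_trans _ _ (\int[P]_w ((2 * a ^+ 2)%:E * sq_norm_integral T u w +
    (2 * c ^+ 2)%:E * sq_norm_integral T v w))%E).
  apply: ge0_le_integral => //.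
  - by move=> w _; exact: sq_ge0.
  - exact: (measurable_sq hPc hT hB pw).
  - by apply: emeasurable_funD; exact: measurable_funeM.
  - by move=> w _; exact: (sq_lincomb hT a c w pu pv).
rewrite ge0_integralD//; try (by move=> w _; rewrite mule_ge0// sq_ge0); try exact: measurable_funeM.
rewrite !ge0_integralZl//; try (by move=> w _; exact: sq_ge0).
move: iu iv; set x := (\int[P]_w _)%E; set y := (\int[P]_w _)%E; clearbody x y => xoo yoo.
by apply: lte_add_pinfty; apply: lte_mul_pinfty.
Qed.

Lemma M2B (R : realType) (d0 : measure_display) (Om : measurableType d0)
  (P : probability Om R) (hPc : measure_is_complete P) (T : R) (hT : 0 < T)
  (n : nat) (B : R -> Om -> 'cV[R]_n) (hB : brownian_motion P T B) (u v : R -> Om -> 'cV[R]_n) :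
  M2 P T (augmented_filtration P B) u -> M2 P T (augmented_filtration P B) v ->
  M2 P T (augmented_filtration P B) (fun t w => u t w - v t w).
Proof.
move=> hu hv; have := M2_lincomb hPc hT hB 1 (-1) hu hv.
by congr M2; apply/funext => t; apply/funext => w; rewrite scale1r scaleN1r.
Qed.

(** * Limits of processes and integrals *)

Section right_regularization.
Context (R : realType) (T : R) (hT : 0 < T).
Local Notation tq := (tq T).
Variables (a : R -> R) (a_mono : forall i j, tq i <= tq j -> a (tq i) <= a (tq j)).

(** Right limits of a function known to be increasing only along [tq], taken as infima over the
    later times of [tq]. No time comes after [T], so the value there is kept. *)
Definition right_regularize (t : R) : R :=
  if t < T then inf [set a (tq i) | i in [set i | t < tq i]] else a T.
Local Notation reg := right_regularize.

Let a_lo i : a 0 <= a (tq i).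
Proof. by have [i0 e] := tq_0 hT; rewrite -e; apply: a_mono; rewrite e tq_ge0. Qed.

Let inf_ok t : t < T -> has_inf [set a (tq i) | i in [set i | t < tq i]].
Proof.
move=> tT; split; first by have [i e] := tq_T hT; exists (a (tq i)), i => //=; rewrite e.
by exists (a 0) => _ [i _ <-].
Qed.

Lemma right_regularizeT : reg T = a T.
Proof. by rewrite /reg ltxx. Qed.

Lemma right_regularize_le t i : t < tq i -> reg t <= a (tq i).
Proof.
move=> ti; rewrite /reg (lt_le_trans ti (tq_le hT i)).
by apply: ge_inf; [case: (inf_ok (lt_le_trans ti (tq_le hT i)))|exists i].
Qed.

Lemma right_regularize_ge t c : t < T -> (forall i, t < tq i -> c <= a (tq i)) -> c <= reg t.
Proof.
move=> tT h; rewrite /reg tT; apply: lb_le_inf; first by case: (inf_ok tT).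
by move=> _ [i ti <-]; exact: h.
Qed.

Lemma right_regularize_mono s t : s <= t -> t <= T -> reg s <= reg t.
Proof.
rewrite le_eqVlt => /orP[/eqP -> //|st]; rewrite le_eqVlt => /orP[/eqP tT|tT].
  by rewrite tT right_regularizeT; have [i e] := tq_T hT; rewrite -e right_regularize_le// e -tT.
by apply: right_regularize_ge => // i ti; apply: right_regularize_le; exact: lt_trans ti.
Qed.

Lemma right_regularize_ge0 t : t <= T -> a 0 <= reg t.
Proof.
rewrite le_eqVlt => /orP[/eqP ->|tT]; last exact: right_regularize_ge.
by rewrite right_regularizeT; have [i <-] := tq_T hT.
Qed.

Lemma right_regularize_cont : right_cont T reg.
Proof.
move=> t t0 tT; apply/cvgrPdist_le => e e0.
have [_ [i ti <-] hi] := inf_adherent e0 (inf_ok tT).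
have ti' : t < tq i := ti.
near=> s.
have ts : t < s by near: s; exact: nbhs_right_gt.
have si : s < tq i by near: s; exact: nbhs_right_lt.
have sT := lt_le_trans si (tq_le hT i).
have h1 := right_regularize_mono (ltW ts) (ltW sT); have h2 := right_regularize_le si.
have h3 : a (tq i) < reg t + e by rewrite /reg tT.
by rewrite ler_norml; apply/andP; split; lra.
Unshelve. all: by end_near. Qed.

Lemma right_regularize_left_lim t : 0 < t -> t <= T -> cvg (reg s @[s --> t^'-]).
Proof.
move=> t0 tT; apply: nondecreasing_at_left_is_cvgr.
  apply: nearW => x p q; rewrite !in_itv/= => _ /andP[_ qt] pq.
  by apply: right_regularize_mono => //; rewrite (le_trans (ltW qt)).
apply: nearW => x; exists (reg T) => z [p]; rewrite /= in_itv/= => /andP[_ pt] <-.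
by apply: right_regularize_mono => //; rewrite (le_trans (ltW pt)).
Qed.

End right_regularization.

Lemma within_continuous_left_lim (R : realType) (T : R) (f : R -> R) t : 0 < T ->
  {within `[0, T], continuous f} -> 0 < t -> t <= T -> f s @[s --> t^'-] --> f t.
Proof.
move=> hT /(continuous_within_itvP _ hT)[f1 _ f2] t0; rewrite le_eqVlt => /orP[/eqP ->//|tT].
by apply: cvg_at_left_filter; apply: f1; rewrite in_itv/= t0.
Qed.

Lemma time_dot_continuous (R : realType) (d0 : measure_display) (Om : measurableType d0)
  (P : probability Om R) (T : R) (hT : 0 < T) (m n : nat) (B : R -> Om -> 'cV[R]_m)
  (h g : R -> Om -> 'cV[R]_n) w :
  predictable_mx (augmented_filtration P B) T h -> predictable_mx (augmented_filtration P B) T g ->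
  (sq_norm_integral T h w < +oo)%E -> (sq_norm_integral T g w < +oo)%E ->
  {within `[0, T], continuous (fun t => time_dot h g 0 t w)}.
Proof.
move=> ph pg fh fg.
have := parameterized_integral_continuous (ltW hT) (sq_vdot_integrable hT ph pg fh fg).
rewrite (_ : (fun t => time_dot h g 0 t w) =
  (parameterized_integral lebesgue_measure 0)^~ (fun s : R => vdot (h s w) (g s w)))//.
by apply/funext => t; rewrite time_dotE.
Qed.

Lemma S2_of_dominated (R : realType) (d0 : measure_display) (Om : measurableType d0)
  (P : probability Om R) (hPc : measure_is_complete P) (T : R) (hT : 0 < T) (m : nat)
  (B : R -> Om -> 'cV[R]_m) (hB : brownian_motion P T B) (X : R -> Om -> R) (Xi : Om -> R) :
  adapted (augmented_filtration P B) T X -> {ae P, forall w, cadlag T (X ^~ w)} ->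
  summable_rv P (fun w => Xi w ^+ 2) ->
  {ae P, forall w t, 0 <= t -> t <= T -> `|X t w| <= Xi w} ->
  S2 P T (augmented_filtration P B) X.
Proof.
move=> aX cX sXi hX; split=> //.
have SE w : ereal_sup [set (`|X t w| ^+ 2)%:E | t in `[0%R, T]] =
    ereal_sup [set (`|X t w ^+ 2|)%:E | t in `[0%R, T]].
  by congr ereal_sup; apply: eq_imagel => t _; rewrite normrX.
have mS : measurable_fun setT (fun w => ereal_sup [set (`|X t w| ^+ 2)%:E | t in `[0%R, T]]).
  under eq_fun do rewrite SE.
  apply: (measurable_sup_norm hT hPc) => [t tT|].
    apply: measurable_funX; move: (tT); rewrite in_itv/= => /andP[t0 tT'].
    exact: (meas_wrt_measurable hPc hB tT' (aX t tT)).
  apply: filterS cX => w [rc _] t t0 tT; rewrite expr2; under eq_fun do rewrite expr2.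
  by apply: cvgM; exact: rc.
apply: (@le_lt_trans _ _ (\int[P]_w (Xi w ^+ 2)%:E)%E); last by rewrite (integral_EFin sXi) ltry.
apply: ae_ge0_le_integral => //.
- move=> w _; apply: (@le_trans _ _ (`|X 0 w| ^+ 2)%:E); first by rewrite lee_fin sqr_ge0.
  by apply: ereal_sup_ubound; exists 0 => //=; rewrite in_itv/= lexx ltW.
- by move=> w _; rewrite lee_fin sqr_ge0.
- exact/measurable_EFinP/(summable_measurable sXi).
apply: filterS hX => w hw _; apply: ge_ereal_sup => _ [t tT <-].
move: tT; rewrite /= in_itv/= => /andP[t0 tT]; rewrite lee_fin.
by have h := hw t t0 tT; rewrite ler_sqr ?nnegrE// (le_trans _ h).
Qed.

(* The infima of the cost over a decreasing sequence of convex sets converge;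
   near-minimisers then form a Cauchy sequence by the parallelogram identity. *)
Lemma hilbert_selection (R : realType) (V : Type) (G : nat -> V -> Prop)
  (cost : V -> R) (mid : V -> V -> V) (M : R) (eta : nat -> R) :
  (forall n v, G n.+1 v -> G n v) ->
  (forall n v v', G n v -> G n v' -> G n (mid v v')) ->
  (forall v, 0 <= cost v) -> (forall n, exists2 v, G n v & cost v <= M) ->
  (forall n, 0 < eta n) -> (forall n, eta n.+1 <= eta n) ->
  exists2 v : nat -> V, forall n, G n (v n) &
    forall n, 2 * cost (v n) + 2 * cost (v n.+1) - 4 * cost (mid (v n) (v n.+1)) <= 8 * eta n.
Proof.
move=> Gdec Gmid c0 GM e0 edec.
have Gmono n n' v : (n <= n')%N -> G n' v -> G n v.
  by move=> /subnKC <-; elim: (n' - n)%N v => [|i IH] v; rewrite ?addn0// addnS => /Gdec /IH.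
pose A n := [set cost v | v in [set v | G n v]].
have infA n : has_inf (A n).
  split; first by have [v Gv _] := GM n; exists (cost v), v.
  by exists 0 => _ [v _ <-].
pose i n := inf (A n).
have i_le n v : G n v -> i n <= cost v by move=> Gv; apply: ge_inf; [case: (infA n)|exists v].
have i_mono n n' : (n <= n')%N -> i n <= i n'.
  move=> nn'; apply: lb_le_inf; first by case: (infA n').
  by move=> _ [v Gv <-]; apply: i_le; exact: Gmono Gv.
have supI : has_sup (range i).
  split; first by exists (i 0%N), 0%N.
  by exists M => _ [n _ <-]; have [v Gv vM] := GM n; exact: le_trans (i_le n v Gv) vM.
pose L := sup (range i).
have iL n : i n <= L by apply: ub_le_sup; [case: supI|exists n].
have near_min k : exists v, [/\ G k v, (exists n, [/\ (k <= n)%N, G n v & L - eta k < i n]) &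
    cost v < L + eta k].
  have [_ [n0 _ <-] hn] := sup_adherent (e0 k) supI.
  have [_ [v Gv <-] hv] := inf_adherent (e0 k) (infA (maxn n0 k)).
  exists v; split; first exact: Gmono (leq_maxr _ _) Gv.
    exists (maxn n0 k); split=> //; first exact: leq_maxr.
    by apply: lt_le_trans hn _; apply: i_mono; exact: leq_maxl.
  by apply: (lt_le_trans hv); rewrite lerD2r; exact: iL.
have [v hv] := choice near_min; exists v => k; first by have [] := hv k.
have [_ [n [_ Gn hn]] c1] := hv k; have [_ [n' [_ Gn' hn']] c2] := hv k.+1.
have h3 : L - eta k < cost (mid (v k) (v k.+1)).
  have ek := edec k.
  have [nn|/ltnW nn] := leqP n n'.
    by apply: (lt_le_trans hn); apply: i_le; apply: Gmid => //; exact: Gmono Gn'.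
  have : L - eta k.+1 < cost (mid (v k) (v k.+1)); last lra.
  by apply: (lt_le_trans hn'); apply: i_le; apply: Gmid => //; exact: Gmono Gn.
have := edec k; lra.
Qed.

(* A total and measurable substitute for the limit; junk when the upper limit is infinite. *)
Definition real_limsup (R : realType) (u : nat -> R) : R := fine (limn_esup (EFin \o u)).

Lemma real_limsupE (R : realType) (u : nat -> R) l : u n @[n --> \oo] --> l -> real_limsup u = l.
Proof.
move=> ul; rewrite /real_limsup.
have : (EFin \o u) n @[n --> \oo] --> l%:E by apply: cvg_EFin => //; exact: nearW.
by move=> /cvg_limn_einf_sup[_ ->].
Qed.

(** For a bounded sequence the upper limit is finite, so [fine] loses nothing. *)
Lemma real_limsupP (R : realType) (u : nat -> R) (lo hi : R) :
  (forall n, lo <= u n) -> (forall n, u n <= hi) ->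
  (forall c N, (forall n, (N <= n)%N -> u n <= c) -> real_limsup u <= c) /\
  (forall e, 0 < e -> exists N, forall n, (N <= n)%N -> u n <= real_limsup u + e).
Proof.
move=> ulo uhi; pose v := EFin \o u.
have LE : limn_esup v = ereal_inf (range (esups v)).
  by rewrite limn_esup_lim; apply/cvg_lim => //; exact: cvg_esups_inf.
have esups_le c N : (forall n, (N <= n)%N -> u n <= c) -> (esups v N <= c%:E)%E.
  by move=> h; apply: ge_ereal_sup => _ [n Nn <-]; rewrite lee_fin h.
have le_esups n N : (N <= n)%N -> ((u n)%:E <= esups v N)%E.
  by move=> Nn; apply: ereal_sup_ubound; exists n.
have L_lo : (lo%:E <= limn_esup v)%E.
  rewrite LE; apply: le_ereal_inf_tmp => _ [N _ <-].
  by apply: le_trans (le_esups N N (leqnn N)); rewrite lee_fin.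
have L_le c N : (forall n, (N <= n)%N -> u n <= c) -> (limn_esup v <= c%:E)%E.
  by move=> h; rewrite LE; apply: le_trans (esups_le c N h); apply: ereal_inf_lbound; exists N.
have fL : limn_esup v \is a fin_num.
  rewrite fin_numElt (lt_le_trans _ L_lo) ?ltNyr//=.
  by apply: le_lt_trans (L_le hi 0%N _) (ltry _) => n _.
split=> [c N h|e e0].
  by rewrite -lee_fin /real_limsup fineK//; exact: L_le h.
have : (ereal_inf (range (esups v)) < (real_limsup u + e)%:E)%E.
  by rewrite -LE EFinD /real_limsup fineK// lteDl// lte_fin.
move=> /ereal_inf_lt[_ [N _ <-] hN]; exists N => n Nn.
by rewrite -lee_fin; apply: le_trans (le_esups n N Nn) (ltW hN).
Qed.

Lemma measurable_real_limsup d (X : measurableType d) (R : realType) (D : set X) (f : nat -> X -> R) :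
  (forall n, measurable_fun D (f n)) -> measurable_fun D (fun x => real_limsup (f ^~ x)).
Proof.
move=> mf; apply: (measurableT_comp (f := fine)) => //.
by apply: measurable_fun_limn_esup => n; exact/measurable_EFinP.
Qed.

Lemma cvg_real_cauchy (R : realType) (u : nat -> R) :
  (forall e, 0 < e -> exists n0, forall n n', (n0 <= n)%N -> (n0 <= n')%N -> `|u n - u n'| < e) ->
  cvg (u n @[n --> \oo]).
Proof.
move=> h; apply/cauchy_cvgP/cauchy_ballP => e e0; have [n0 hn] := h e e0.
pose A := [set u n | n in [set n | (n0 <= n)%N]].
exists (A, A) => /= [|[x x'] /= [[n nn <-] [n' nn' <-]]]; last by rewrite /ball/=; exact: hn.
by split; exists n0 => // n nn; exists n.
Qed.

Lemma cvg_sum_seq (R : realType) (I : Type) (r : seq I) (f : nat -> I -> R) (l : I -> R) :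
  (forall i, f k i @[k --> \oo] --> l i) ->
  \sum_(i <- r) f k i @[k --> \oo] --> \sum_(i <- r) l i.
Proof.
move=> h; elim: r => [|i r IH].
  by rewrite big_nil; under eq_fun do rewrite big_nil; exact: cvg_cst.
by rewrite big_cons; under eq_fun do rewrite big_cons; apply: cvgD.
Qed.

Lemma rateS (R : realType) n : 2 * rate R n.+1 = rate R n.
Proof.
rewrite /rate !natrX exprS; set x := _ ^+ n.+1.
have x0 : x != 0 by rewrite expf_neq0// pnatr_eq0.
by field.
Qed.

(** The increments from rank [k] on sum to at most [2 * rate R k]. *)
Lemma geometric_limit (R : realType) (u : nat -> R) N :
  (forall k, (N <= k)%N -> `|u k.+1 - u k| <= rate R k) ->
  u k @[k --> \oo] --> real_limsup u /\
  forall k, (N <= k)%N -> `|u k - real_limsup u| <= 2 * rate R k.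
Proof.
move=> hu.
have step j : forall k, (N <= k)%N -> `|u (k + j)%N - u k| <= 2 * rate R k.
  elim: j => [|j IH] k Nk.
    by rewrite addn0 subrr normr0 mulr_ge0// ltW// rate_gt0.
  rewrite -(subrK (u k.+1) (u _)) -addrA (le_trans (ler_normD _ _))//.
  have := IH k.+1 (leqW Nk); have := hu k Nk; have := rateS R k; rewrite addSnnS; lra.
have cu : cvg (u k @[k --> \oo]).
  apply: cvg_real_cauchy => e e0; have e8 : 0 < e / 8 by rewrite divr_gt0.
  have [n0 hn] := rate_small e8; exists (maxn N n0) => n n' nn nn'.
  have := hn _ (leq_maxr N n0); have := step (n - maxn N n0)%N _ (leq_maxl N n0).
  have := step (n' - maxn N n0)%N _ (leq_maxl N n0); rewrite !subnKC//.
  move=> /ler_normlP[h1 h2] /ler_normlP[h3 h4] h5; rewrite ltr_norml; apply/andP; split; lra.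
have lim : u k @[k --> \oo] --> real_limsup u by rewrite (real_limsupE cu).
split=> // k Nk; rewrite distrC.
have h : `|u n - u k| @[n --> \oo] --> `|real_limsup u - u k|.
  by apply: cvg_norm; apply: cvgB => //; exact: cvg_cst.
rewrite -(cvg_lim _ h)//; apply: limr_le; first by apply/cvg_ex; eexists; exact: h.
by exists k => // n /= kn; rewrite -(subnKC kn); exact: step.
Qed.

(** * Limits of Ito integrals along a fast sequence of integrands *)

Section limits.
Context (R : realType) (d0 : measure_display) (Om : measurableType d0)
  (P : probability Om R) (hPc : measure_is_complete P) (T : R) (hT : 0 < T)
  (m : nat) (B : R -> Om -> 'cV[R]_m) (hB : brownian_motion P T B).
Local Notation Fil := (augmented_filtration P B).
Local Notation mu := (@lebesgue_measure R).
Local Notation pred := (predictable_mx Fil T).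
Local Notation sq := (sq_norm_integral T).
Local Notation ito := (ito_integral P T B).
Local Notation rate := (rate R).

Lemma sum_rate_le : (\sum_(i <oo) (rate i)%:E <= 1%:E)%E.
Proof. exact: (epsilon_trick0 xpredT (@ler01 R)). Qed.

(** Induction with the bound of a squared sum by twice the squares; the doubling is absorbed by
    [2 * rate k.+1 = rate k]. A single weighted series thus dominates all squared increments at
    once. *)
Lemma increments_le n (z : nat -> 'cV[R]_n) k j :
  vdot (z (k + j)%N - z k) (z (k + j)%N - z k) <= 2 * rate k *
    \sum_(i < j) (rate (k + i)%N)^-1 * vdot (z (k + i).+1 - z (k + i)%N) (z (k + i).+1 - z (k + i)%N).
Proof.
elim: j k => [|j IH] k; first by rewrite addn0 subrr vdot0l big_ord0 mulr0.
have -> : z (k + j.+1)%N - z k = (z k.+1 - z k) + (z (k.+1 + j)%N - z k.+1).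
  by rewrite [RHS]addrC addrA subrK addSnnS.
apply: (le_trans (vdotDsq_le _ _)); rewrite big_ord_recl/= mulrDr addn0; apply: lerD.
  by rewrite mulrA mulfK// gt_eqF// rate_gt0.
rewrite -(rateS R k) -mulrA; apply: (@ler_wpM2l _ 2) => //; apply: (le_trans (IH k.+1)).
rewrite le_eqVlt; apply/orP; left; apply/eqP; congr (_ * _).
by apply: eq_bigr => i _; rewrite /bump/= add1n addSnnS.
Qed.

Variables (z : nat -> R -> Om -> 'cV[R]_m) (pz : forall k, pred (z k)).
Definition mx_limsup t w : 'cV[R]_m := \col_i real_limsup (fun k => z k t w i ord0).
Local Notation dz k := (fun t w => z k.+1 t w - z k t w).
Local Notation W w := (\sum_(i <oo) ((rate i)^-1)%:E * sq (dz i) w)%E.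

Lemma predictable_mx_limsup : pred mx_limsup.
Proof.
apply/(predictable_mxP _ hT) => i j.
have h k := (proj1 (predictable_mxP _ hT _ _)) (pz k) i ord0.
have := measurable_real_limsup h.
congr measurable_fun; apply/funext => -[t w] /=; rewrite /mx_limsup mxE; congr real_limsup.
Qed.
Let pH := predictable_mx_limsup.
Let pd k : pred (dz k). Proof. exact: (predictable_mxB hT). Qed.

Lemma mx_limsup_le t w (s : R) :
  (\sum_(i <oo) ((rate i)^-1 * vdot (dz i t w) (dz i t w))%:E <= s%:E)%E ->
  forall k, vdot (mx_limsup t w - z k t w) (mx_limsup t w - z k t w) <= 2 * rate k * s.
Proof.
move=> hs.
have g0 i : 0 <= (rate i)^-1 * vdot (dz i t w) (dz i t w).
  by rewrite mulr_ge0 ?vdot_ge0// invr_ge0 ltW// rate_gt0.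
have part k j : vdot (z (k + j)%N t w - z k t w) (z (k + j)%N t w - z k t w) <= 2 * rate k * s.
  apply: (le_trans (increments_le (fun i => z i t w) k j)).
  apply: ler_wpM2l; first by rewrite mulr_ge0// ltW// rate_gt0.
  rewrite -lee_fin; apply: le_trans hs.
  apply: le_trans (nneseries_lim_ge (k + j) _); last by move=> i _ _; rewrite lee_fin.
  rewrite sumEFin lee_fin big_mkord big_split_ord/= lerDr; exact: sumr_ge0.
have s0 : 0 <= s.
  by rewrite -lee_fin; apply: le_trans hs; apply: nneseries_ge0 => i _ _; rewrite lee_fin.
have comp (u : 'cV[R]_m) i : (u i ord0) ^+ 2 <= vdot u u.
  rewrite vdotE (bigD1 i)//= expr2 lerDl; apply: sumr_ge0 => j _; rewrite -expr2; exact: sqr_ge0.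
have cv i : cvg (z k t w i ord0 @[k --> \oo]).
  apply: cvg_real_cauchy => e e0.
  have e1 : 0 < (e / 4) ^+ 2 / (1 + s) by rewrite divr_gt0 ?exprn_gt0 ?divr_gt0//; lra.
  have [n0 hn] := rate_small e1; exists n0.
  have main n : (n0 <= n)%N -> `|z n t w i ord0 - z n0 t w i ord0| < e / 2.
    move=> /subnKC <-; have := le_trans (comp _ i) (part n0 (n - n0)%N); rewrite !mxE => h.
    have h2 : 2 * rate n0 * s <= 2 * (e / 4) ^+ 2.
      rewrite -mulrA ler_pM2l//; apply: (@le_trans _ _ ((e / 4) ^+ 2 / (1 + s) * s)).
        by apply: ler_wpM2r => //; exact: hn.
      by rewrite mulrAC ler_pdivrMr; [rewrite ler_wpM2l ?sqr_ge0//; lra|lra].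
    have h3 : `|z (n0 + (n - n0))%N t w i ord0 - z n0 t w i ord0| ^+ 2 < (e / 2) ^+ 2.
      by rewrite real_normK ?num_real//; nra.
    by rewrite -ltr_sqr ?nnegrE// ltW// divr_gt0.
  move=> n n' nn nn'; have := main n nn; have := main n' nn'; rewrite (distrC (z n' _ _ _ _)).
  move=> h1 h2; rewrite -(subrK (z n0 t w i ord0) (z n t w i ord0)) -addrA.
  by apply: le_lt_trans (ler_normD _ _) _; lra.
move=> k.
have lim : vdot (z n t w - z k t w) (z n t w - z k t w) @[n --> \oo] -->
    vdot (mx_limsup t w - z k t w) (mx_limsup t w - z k t w).
  under eq_fun do rewrite vdotE; rewrite vdotE; apply: cvg_sum_seq => i.
  have ci : z n t w i ord0 @[n --> \oo] --> mx_limsup t w i ord0.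
    by rewrite mxE (real_limsupE (cv i)); exact: cv.
  have E n : (z n t w - z k t w) i ord0 = z n t w i ord0 - z k t w i ord0 by rewrite !mxE.
  have E' : (mx_limsup t w - z k t w) i ord0 = mx_limsup t w i ord0 - z k t w i ord0.
    by rewrite [LHS]mxE [X in _ + X = _]mxE.
  by under eq_fun do rewrite E; rewrite E'; apply: cvgM; apply: cvgB => //; exact: cvg_cst.
rewrite -(cvg_lim _ lim)//; apply: limr_le; first by apply/cvg_ex; eexists; exact: lim.
by exists k => // n /= kn; rewrite -(subnKC kn); exact: part.
Qed.

(** [W] is the time integral of the weighted series. If it is finite, the series is finite at almost
    every time and the upper limits there are true limits; if it is infinite, the bound is
    trivial. *)
Lemma sq_limsup_le k w : (sq (fun t w => (mx_limsup t w - z k t w)%R) w <= (2 * rate k)%:E * W w)%E.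
Proof.
have r0 : 0 < 2 * rate k by rewrite mulr_gt0// rate_gt0.
have ri i : 0 <= (rate i)^-1 by rewrite invr_ge0 ltW// rate_gt0.
pose g i t := (((rate i)^-1 * vdot (dz i t w) (dz i t w))%R)%:E.
have g0 i t : (0 <= g i t)%E by rewrite lee_fin mulr_ge0// vdot_ge0.
have mT : measurable (`[0, T]%classic : set (measurableTypeR R)) by [].
have mg i : measurable_fun `[0, T] (g i).
  by apply/measurable_EFinP; apply: measurable_funM => //; exact: (vdot_section hT w (pd i) (pd i)).
have WE : W w = (\int[mu]_(t in `[0%R, T]) \sum_(i <oo) g i t)%E.
  rewrite integral_nneseries//; apply: eq_eseriesr => i _.
  rewrite sq_norm_integralE.
  have -> : (\int[mu]_(t in `[0%R, T]) g i t =
      \int[mu]_(t in `[0%R, T]) (((rate i)^-1)%:E * (vdot (dz i t w) (dz i t w))%:E))%E.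
    by apply: eq_integral => t _; rewrite /g EFinM.
  rewrite ge0_integralZl//.
  - by apply/measurable_EFinP; exact: (vdot_section hT w (pd i) (pd i)).
  - by move=> t _; rewrite lee_fin vdot_ge0.
  - by rewrite lee_fin.
have S0 t : (0 <= \sum_(i <oo) g i t)%E by apply: nneseries_ge0 => ? _ _.
have mS : measurable_fun `[0, T] (fun t => \sum_(i <oo) g i t)%E.
  exact: ge0_emeasurable_sum.
have [Woo|] := eqVneq (W w) +oo%E; first by rewrite Woo gt0_muley ?lte_fin// leey.
rewrite -ltey => Wfin.
have aeS : {ae mu, forall t, `[0, T]%classic t -> (\sum_(i <oo) g i t)%E \is a fin_num}.
  apply: (integrable_ae mT); apply/integrableP; split=> //.
  by under eq_integral do rewrite gee0_abs//; rewrite -WE.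
rewrite sq_norm_integralE WE -ge0_integralZl//=; last by rewrite lee_fin ltW.
apply: ae_ge0_le_integral => //.
- by move=> t _; rewrite lee_fin vdot_ge0.
- have ph := predictable_mxB hT pH (pz k).
  by apply/measurable_EFinP; exact: (vdot_section hT w ph ph).
- by move=> t _; apply: mule_ge0 => //; rewrite lee_fin ltW.
- exact: measurable_funeM.
apply: ae_time_mono aeS => t h tT; have fS := h tT.
rewrite -(fineK fS) -EFinM lee_fin; apply: mx_limsup_le.
by rewrite fineK.
Qed.

Variables (I : nat -> R -> Om -> R) (iI : forall k, ito (z k) (I k))
  (Mz : forall k, M2 P T Fil (z k))
  (dz_small : forall k, \mean[P]_w qv (dz k) 0 T w <= rate k ^+ 3 / 4).
Let Md k : M2 P T Fil (dz k). Proof. exact: (M2B hPc hT hB). Qed.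
Let W0 w : (0 <= W w)%E.
Proof.
apply: nneseries_ge0 => i _ _; apply: mule_ge0; last exact: sq_ge0.
by rewrite lee_fin invr_ge0 ltW// rate_gt0.
Qed.
Let mW : measurable_fun setT (fun w => W w).
Proof.
apply: ge0_emeasurable_sum => [i w _ _|i _].
  apply: mule_ge0; last exact: sq_ge0.
  by rewrite lee_fin invr_ge0 ltW// rate_gt0.
by apply: measurable_funeM; exact: (measurable_sq hPc hT hB (pd i)).
Qed.
Let W_le1 : (\int[P]_w W w <= 1%:E)%E.
Proof.
rewrite integral_nneseries//; last 2 first.
- by move=> i; apply: measurable_funeM; exact: (measurable_sq hPc hT hB (pd i)).
- move=> i w _; apply: mule_ge0; last exact: sq_ge0.
  by rewrite lee_fin invr_ge0 ltW// rate_gt0.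
apply: le_trans sum_rate_le; apply: lee_nneseries => [i _ _|i _].
  by apply: integral_ge0 => w _; apply: mule_ge0; [rewrite lee_fin invr_ge0 ltW// rate_gt0|exact: sq_ge0].
have r0 := rate_gt0 R i.
rewrite ge0_integralZl//; last 3 first.
- exact: (measurable_sq hPc hT hB (pd i)).
- by move=> w _; exact: sq_ge0.
- by rewrite lee_fin invr_ge0 ltW.
rewrite (M2_expectation hPc hT hB (Md i)) -EFinM lee_fin ler_pdivrMl//.
apply: (le_trans (dz_small i)).
have r1 : rate i <= 1 by apply: (le_trans (rate_le_invS R i)); rewrite invf_le1// ler1n.
by move: r0 r1; move: (rate i) => x x0 x1; nra.
Qed.
Let W_fin : {ae P, forall w, W w \is a fin_num}.
Proof.
have : P.-integrable setT (fun w => W w).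
  apply/integrableP; split; first exact: mW.
  under eq_integral do rewrite gee0_abs//.
  by apply: (le_lt_trans W_le1); rewrite ltry.
by move/(integrable_ae measurableT); apply: filterS => w; apply.
Qed.

Let pHz k : pred (fun t w => mx_limsup t w - z k t w). Proof. exact: (predictable_mxB hT). Qed.

Let M2Hz k : M2 P T Fil (fun t w => mx_limsup t w - z k t w) /\
  \mean[P]_w qv (fun t w => mx_limsup t w - z k t w) 0 T w <= 2 * rate k.
Proof.
have r0 : 0 < 2 * rate k by rewrite mulr_gt0// rate_gt0.
have h : (\int[P]_w sq (fun t w => (mx_limsup t w - z k t w)%R) w <= (2 * rate k)%:E)%E.
  apply: (@le_trans _ _ (\int[P]_w ((2 * rate k)%:E * W w))%E).
    apply: ge0_le_integral => //.
    - by move=> w _; exact: sq_ge0.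
    - exact: (measurable_sq hPc hT hB (pHz k)).
    - exact: (measurable_funeM _ mW).
    - by move=> w _; exact: sq_limsup_le.
  rewrite ge0_integralZl//; last by rewrite lee_fin ltW.
  by rewrite -[leRHS]mule1 lee_pmul2l// lte_fin.
have M : M2 P T Fil (fun t w => mx_limsup t w - z k t w).
  by split; [exact: pHz|apply: (le_lt_trans h); rewrite ltry].
by split=> //; rewrite -lee_fin -(M2_expectation hPc hT hB M).
Qed.

Lemma M2_mx_limsup : M2 P T Fil mx_limsup.
Proof.
have := M2_lincomb hPc hT hB 1 1 (proj1 (M2Hz 0)) (Mz 0%N).
by congr M2; apply/funext => t; apply/funext => w; rewrite !scale1r subrK.
Qed.

Definition ito_limsup t w : R := real_limsup (fun k => I k t w).

(** The maximal inequality at level [rate k] gives the probability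
    [4 * (rate k ^+ 3 / 4) / rate k ^+ 2], that is [rate k], which is summable: this explains the
    cube and the 4 in the speed demanded of the integrands. *)
Let I_steps : {ae P, forall w, exists N, forall k, (N <= k)%N ->
  forall t, 0 <= t -> t <= T -> `|I k.+1 t w - I k t w| <= rate k}.
Proof.
pose A k := [set w | exists n, rate k < `|I k.+1 (tq T n) w - I k (tq T n) w|].
have hA k : measurable (A k) /\ (P (A k) <= (rate k)%:E)%E.
  have [mA PA] := doob_maximal hPc hT hB (itoB hPc hT hB (iI k.+1) (iI k)) (Md k) (rate_gt0 R k).
  split=> //; apply: (le_trans PA); rewrite lee_fin.
  have r0 := rate_gt0 R k; have := dz_small k.
  rewrite ler_pdivrMr ?exprn_gt0// -exprS; lra.
have bc := borel_cantelli (fun k => (hA k).1) (fun k => (hA k).2).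
have rc : {ae P, forall w k, right_cont T (I k ^~ w)}.
  by apply: ae_foralln => k; exact: (ito_right_cont hT (iI k)).
apply: filterS2 bc rc => w [N hN] rw; exists N => k Nk t t0 tT.
apply: (right_cont_le hT (right_cont_norm (right_contB (rw k.+1) (rw k)))) => // n.
by rewrite leNgt; apply/negP => h; apply: (hN k Nk); exists n.
Qed.

Let I_close : {ae P, forall w, exists N, forall k, (N <= k)%N ->
  forall t, 0 <= t -> t <= T -> `|I k t w - ito_limsup t w| <= 2 * rate k}.
Proof.
apply: filterS I_steps => w [N hN]; exists N => k Nk t t0 tT.
have [_] := geometric_limit (fun k Nk => hN k Nk t t0 tT); exact.
Qed.

Lemma ito_limit_close : {ae P, forall w e, 0 < e -> exists n0, forall n, (n0 <= n)%N ->
  (sq (fun t w => (mx_limsup t w - z n t w)%R) w <= e%:E)%E /\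
  forall t, 0 <= t -> t <= T -> `|I n t w - ito_limsup t w| <= e}.
Proof.
apply: filterS2 W_fin I_close => w fw [N hN] e e0.
have f0 : 0 <= fine (W w) by exact: fine_ge0.
have e1 : 0 < e / (2 * (1 + fine (W w))) by rewrite divr_gt0// mulr_gt0//; lra.
have e2 : 0 < e / 2 by rewrite divr_gt0.
have [n1 h1] := rate_small e1; have [n2 h2] := rate_small e2.
exists (maxn N (maxn n1 n2)) => n; rewrite !geq_max => /and3P[Nn n1n n2n]; split.
  apply: (le_trans (sq_limsup_le n w)); rewrite -(fineK fw) -EFinM lee_fin.
  have := h1 n n1n; rewrite ler_pdivlMr; last by rewrite mulr_gt0//; lra.
  have := rate_gt0 R n; move: (rate n) (fine (W w)) f0 => x y y0 x0; nra.
by move=> t t0 tT; apply: (le_trans (hN n Nn t t0 tT)); have := h2 n n2n; lra.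
Qed.

(** A diagonal choice: the simple integrand of rank [k] approximates [z k] and [I k] within [rate k]
    outside an event of probability at most [rate k], and Borel-Cantelli applies. Continuity of the
    limit comes from uniform convergence of the paths. *)
Lemma ito_limit : ito mx_limsup ito_limsup.
Proof.
have /choice[S hS] : forall k, exists S : simple_integrand Om R m, [/\ simple_wf Fil T S,
    (P [set w | ((rate k)%:E < sq (fun s w => (simple_val S s w - z k s w)%R) w)%E] < (rate k / 2)%:E)%E &
    (P [set w | ((rate k)%:E < ereal_sup [set (`|simple_integral B S t w - I k t w|)%:E |
                          t in `[0%R, T]])%E] < (rate k / 2)%:E)%E].
  move=> k; have [_ _ _ _ [S [wfS h1 h2]]] := iI k.
  have r2 : 0 < rate k / 2 by rewrite divr_gt0// rate_gt0.
  by have [n [p1 p2]] := cvg0_in_probability_pick h1 h2 (rate_gt0 R k) r2; exists (S n).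
have wfS k : simple_wf Fil T (S k) by have [] := hS k.
have mS (f : Om -> \bar R) (c : \bar R) : measurable_fun setT f -> measurable [set w | (c < f w)%E].
  by move=> mf; rewrite -[X in measurable X]setTI; exact: emeasurable_fun_o_infty.
have rc : {ae P, forall w k, right_cont T (I k ^~ w)}.
  by apply: ae_foralln => k; exact: (ito_right_cont hT (iI k)).
have aI k : adapted Fil T (I k) by case: (iI k).
have m1 k : measurable_fun setT (sq (fun s w => (simple_val (S k) s w - z k s w)%R)).
  by apply: (measurable_sq hPc hT hB); apply: (predictable_mxB hT) => //; exact: predictable_simple.
have m2 k := measurable_sup_simple hPc hT hB (wfS k) (aI k) (ito_right_cont hT (iI k)).
pose A k := [set w | ((rate k)%:E < sq (fun s w => (simple_val (S k) s w - z k s w)%R) w)%E] `|`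
  [set w | ((rate k)%:E < ereal_sup [set (`|simple_integral B (S k) t w - I k t w|)%:E | t in `[0%R, T]])%E].
have bc : {ae P, forall w, exists N, forall k, (N <= k)%N -> ~ A k w}.
  apply: borel_cantelli => k; first by apply: measurableU; exact: mS.
  apply: (le_trans (measureU2 _ _ _)); [exact: mS|exact: mS|].
  have [_ h1 h2] := hS k; rewrite [rate k in leRHS]splitr EFinD.
  by apply: leeD; exact: ltW.
have cI : {ae P, forall w k, {within `[0, T], continuous (I k ^~ w)}}.
  by apply: ae_foralln => k; case: (iI k).
apply: (approx_ito_integral hPc hT hB (S := S)) => //.
- exact: (M2_finite hPc hT hB M2_mx_limsup).
- move=> t; rewrite in_itv/= => /andP[t0 tT]; apply/meas_wrtP.
  apply: measurable_real_limsup => k; apply/meas_wrtP; exact: (ito_adapted (iI k)).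
- apply: filterS2 cI ito_limit_close => w cw hw.
  apply/subspace_continuousP => x xT; apply/cvgrPdist_le => e e0.
  have e3 : 0 < e / 3 by rewrite divr_gt0.
  have [n /(_ n (leqnn n)) [_ hn]] := hw _ e3.
  have := (proj1 (subspace_continuousP _ _)) (cw n) x xT; move=> /cvgrPdist_le /(_ _ e3).
  rewrite !near_withinE; apply: filterS => y hy yT; have {}hy : `|I n x w - I n y w| <= e / 3 := hy yT.
  have hx := hn x; move: xT yT; rewrite /= !in_itv/= => /andP[x0 xT] /andP[y0 yT].
  move: (hn x x0 xT) (hn y y0 yT) hy => /ler_normlP[a1 a2] /ler_normlP[b1 b2] /ler_normlP[c1 c2].
  by change (`|ito_limsup x w - ito_limsup y w| <= e); rewrite ler_norml; apply/andP; split; lra.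
apply: filterS2 bc ito_limit_close => w [N hN] hw e e0.
have e4 : 0 < e / 4 by rewrite divr_gt0.
have [n1 h1] := hw _ e4; have [n2 h2] := rate_small e4.
exists (maxn N (maxn n1 n2)) => n; rewrite !geq_max => /and3P[Nn n1n n2n].
have [q1 i1] := h1 n n1n; have r4 := h2 n n2n.
have /not_orP[q2 i2] := hN n Nn; split.
  have := sq_lincomb hT 1 (-1) w (predictable_mxB hT (predictable_simple hT (wfS n)) (pz n)) (pHz n).
  rewrite (_ : (fun s w => (1 *: (simple_val (S n) s w - z n s w) + -1 *: (mx_limsup s w - z n s w))%R) =
     (fun s w => (simple_val (S n) s w - mx_limsup s w)%R)); last first.
    by apply/funext => s; apply/funext => v; rewrite scale1r scaleN1r opprB addrA subrK.
  move=> /le_trans; apply; rewrite sqrrN expr1n mulr1.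
  have q2' : (sq (fun s w => (simple_val (S n) s w - z n s w)%R) w <= (e / 4)%:E)%E.
    by apply: (@le_trans _ _ (rate n)%:E); [rewrite leNgt; exact/negP|rewrite lee_fin].
  apply: (@le_trans _ _ (2%:E * (e / 4)%:E + 2%:E * (e / 4)%:E)%E).
    by apply: leeD; apply: lee_wpmul2l => //; rewrite lee_fin.
  by rewrite -!EFinM -EFinD lee_fin; lra.
move=> t t0 tT; have := i1 t t0 tT.
have : `|simple_integral B (S n) t w - I n t w| <= e / 4.
  rewrite -lee_fin; apply: (@le_trans _ _ (rate n)%:E); last by rewrite lee_fin.
  apply: le_trans (_ : (ereal_sup _ <= _)%E); last by rewrite leNgt; apply/negP; exact: i2.
  by apply: ereal_sup_ubound; exists t => //=; rewrite in_itv/= t0.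
move=> /ler_normlP[a1 a2] /ler_normlP[b1 b2]; rewrite ler_norml; apply/andP; split; lra.
Qed.

Lemma mean_qv_limsup_le k : \mean[P]_w qv (fun t w => mx_limsup t w - z k t w) 0 T w <= 2 * rate k.
Proof. by have [] := M2Hz k. Qed.

End limits.

(** * The quadratic equations *)

Section market.
Context (R : realType) (d0 : measure_display) (Om : measurableType d0)
  (P : probability Om R) (hPc : measure_is_complete P) (T : R) (hT : 0 < T)
  (d m : nat) (B : R -> Om -> 'cV[R]_m) (hB : brownian_motion P T B).
Local Notation Fil := (augmented_filtration P B).
Local Notation pm := (pmeas P T B).
Local Notation pred := (predictable_mx Fil T).
Local Notation sq := (sq_norm_integral T).
Local Notation ito := (ito_integral P T B).
Local Notation mu := (@lebesgue_measure R).
Variables (b : R -> Om -> 'cV[R]_d) (sigma : R -> Om -> 'M[R]_(d, m)) (C : set 'cV[R]_d).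
Hypotheses (hb : pred b) (hsigma : pred sigma) (hC0 : C 0).
Local Notation theta := (market_price_of_risk b sigma).
Local Notation K := (constraint_image sigma C).
Local Notation gen := (generator b sigma C).

Lemma predictable_theta : pred theta.
Proof.
have ps := predictable_mx_tr hT hsigma.
apply: (predictable_mxM hT (predictable_mxM hT ps _) hb).
apply: (predictable_mx_inv hT); exact: (predictable_mxM hT hsigma ps).
Qed.
Let pth := predictable_theta.

(** The point [k] competes in the distance, and expanding the square around [z - k] cancels the
    terms in [theta] except [vdot k theta]. Multiplied by [alpha], the remaining square is half of
    that of [alpha *: (z - k)]: the compensator of an exponential martingale. *)
Lemma gen_le alpha t w z k : 0 < alpha -> K t w k ->
  gen alpha t w z <= alpha / 2 * vdot (z - k) (z - k) - vdot k (theta t w).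
Proof.
move=> a0 Kk; rewrite /generator; set th := theta t w.
have Kn := constraint_image_nonempty sigma hC0 t w.
have h0 := edistance_ge0 Kn (z + alpha^-1 *: th).
have h1 := edistance_le (z + alpha^-1 *: th) Kk.
have h2 : edistance (K t w) (z + alpha^-1 *: th) ^+ 2 <=
    vdot (z + alpha^-1 *: th - k) (z + alpha^-1 *: th - k).
  by rewrite -sqr_enorm ler_sqr ?nnegrE ?enorm_ge0.
have a2 : 0 <= alpha / 2 by rewrite divr_ge0// ltW.
have := ler_wpM2l a2 h2.
have -> : z + alpha^-1 *: th - k = (z - k) + alpha^-1 *: th by rewrite addrAC.
rewrite sqr_enorm !(vdotDl (z - k), vdotDr _ (alpha^-1 *: th), vdotDr (z - k)) .
rewrite !(vdotZl, vdotZr) !(vdotDl, vdotDr, vdotNl, vdotNr) (vdotC th z) (vdotC th k) (vdotC k z).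
set zz := vdot z z; set zk := vdot z k; set kk := vdot k k; set zt := vdot z th.
set kt := vdot k th; set tt := vdot th th; set D := _ * _ ^+ 2 => h.
have -> : (2 * alpha)^-1 = alpha^-1 / 2 by rewrite invfM mulrC.
have aa : alpha * alpha^-1 = 1 by rewrite divff// gt_eqF.
move: h aa; set a' := alpha^-1 => h aa.
have e1 : alpha / 2 * (zz - zk + (- zk - - kk) + a' * (zt - kt) + (a' * (zt - kt) + a' * (a' * tt))) =
  alpha / 2 * (zz - zk + (- zk - - kk)) + (alpha * a') * (zt - kt) + (alpha * a') * (a' / 2 * tt) by field.
by rewrite e1 aa !mul1r in h; lra.
Qed.

Lemma gen_ge alpha t w z : 0 < alpha ->
  - vdot z (theta t w) - (2 * alpha)^-1 * vdot (theta t w) (theta t w) <= gen alpha t w z.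
Proof.
move=> a0; rewrite /generator sqr_enorm lerD2r lerBrDr addNr.
by rewrite mulr_ge0 ?sqr_ge0// divr_ge0// ltW.
Qed.

Lemma pmeas_gen alpha z : pred z -> pm (fun t w => gen alpha t w (z t w)).
Proof.
move=> pz; apply: pmeasB; last first.
  apply: pmeasM; first exact: pmeas_cst.
  by apply: (eq_pmeas (f := fun t w => vdot (theta t w) (theta t w))) (pmeas_vdot hT pth pth) => t w; rewrite sqr_enorm.
apply: pmeasB; last exact: (pmeas_vdot hT).
apply: pmeasM; first exact: pmeas_cst.
have pd : pm (fun t w => edistance (K t w) (z t w + alpha^-1 *: theta t w)).
  by apply: (pmeas_edistance hT) => //; apply: (predictable_mxD hT) => //; exact: (predictable_mxZ hT).
by apply: (eq_pmeas (f := fun t w => edistance (K t w) (z t w + alpha^-1 *: theta t w) *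
  edistance (K t w) (z t w + alpha^-1 *: theta t w))) (pmeasM pd pd) => t w; rewrite expr2.
Qed.

Lemma gen_integrable alpha z w : 0 < alpha -> pred z -> (sq z w < +oo)%E -> (sq theta w < +oo)%E ->
  mu.-integrable `[0, T] (EFin \o (fun t => gen alpha t w (z t w))).
Proof.
move=> a0 pz fz fth.
have mT : measurable (`[0, T]%classic : set (measurableTypeR R)) by [].
have i1 := integrable_EFinZ mT (alpha / 2 + 2^-1) (sq_vdot_integrable hT pz pz fz fz).
have i2 := integrable_EFinZ mT (2^-1 + (2 * alpha)^-1) (sq_vdot_integrable hT pth pth fth fth).
have i3 := integrable_EFinD mT i1 i2.
apply: (integrable_EFin_le mT _ i3); first exact: (pmeas_section hT w (pmeas_gen alpha pz)).
move=> t _.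
have h1 := gen_le (z t w) a0 (constraint_image0 sigma hC0 t w).
have h2 := gen_ge t w (z t w) a0.
rewrite subr0 vdot0l subr0 in h1.
have := @vdot_weighted_le R m 1 (z t w) (theta t w) ltr01; rewrite invr1 !mul1r => /ler_normlP[h3 h4].
have z0 := vdot_ge0 (z t w); have t0 := vdot_ge0 (theta t w).
have a2 : 0 <= (2 * alpha)^-1 by rewrite invr_ge0 mulr_ge0// ltW.
have p1 := mulr_ge0 a2 t0; have p2 := mulr_ge0 (ltW a0) z0.
rewrite ler_norml; move: h1 h2 h3 h4 z0 t0 p1 p2.
set zz := vdot (z t w) (z t w); set tt := vdot (theta t w) _; set zt := vdot (z t w) _.
set g := gen _ _ _ _; set q := (2 * alpha)^-1 => *; apply/andP; split; nra.
Qed.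

Definition gen_int alpha (z : R -> Om -> 'cV[R]_m) s t w : R :=
  \int[mu]_(u in `[s, t]) gen alpha u w (z u w).

Lemma gen_int_split alpha z s t u w : 0 < alpha -> pred z -> (sq z w < +oo)%E ->
  (sq theta w < +oo)%E -> 0 <= s -> s <= t -> t <= u -> u <= T ->
  gen_int alpha z s u w = gen_int alpha z s t w + gen_int alpha z t u w.
Proof.
move=> a0 pz fz fth s0 st tu uT.
by rewrite /gen_int (Rintegral_split s0 st tu uT (gen_integrable a0 pz fz fth)).
Qed.

Lemma gen_int_ge alpha z s t w : 0 < alpha -> pred z -> (sq z w < +oo)%E ->
  (sq theta w < +oo)%E -> 0 <= s -> t <= T ->
  - time_dot z theta s t w - (2 * alpha)^-1 * qv theta s t w <= gen_int alpha z s t w.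
Proof.
move=> a0 pz fz fth s0 tT.
have mT : measurable (`[0, T]%classic : set (measurableTypeR R)) by [].
have mI : measurable (`[s, t]%classic : set (measurableTypeR R)) by [].
have i1 := integrable_EFinZ mT (-1) (sq_vdot_integrable hT pz pth fz fth).
have i2 := integrable_EFinZ mT ((2 * alpha)^-1) (sq_vdot_integrable hT pth pth fth fth).
rewrite time_dotE qvE -mulN1r -(RintegralZl _ mI (integrable_sub_itv s0 tT (sq_vdot_integrable hT pz pth fz fth))).
rewrite -(RintegralZl _ mI (integrable_sub_itv s0 tT (sq_vdot_integrable hT pth pth fth fth))).
rewrite -(RintegralB mI (integrable_sub_itv s0 tT i1) (integrable_sub_itv s0 tT i2)).
have := le_Rintegral_ae s0 tT (integrable_EFinB mT i1 i2) (gen_integrable a0 pz fz fth).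
apply.
by apply: (ae_time_mono (Q := fun=> True)) (aeW _ (fun=> I)) => u _ _; rewrite mulN1r; exact: gen_ge.
Qed.

Lemma gen_int_le alpha z H s t w : 0 < alpha -> pred z -> pred H -> (sq z w < +oo)%E ->
  (sq H w < +oo)%E -> (sq theta w < +oo)%E -> 0 <= s -> t <= T ->
  {ae mu, forall u, u \in `[0, T] -> K u w (H u w)} ->
  gen_int alpha z s t w <= alpha / 2 * qv (fun u w => z u w - H u w) s t w - time_dot H theta s t w.
Proof.
move=> a0 pz pH fz fH fth s0 tT hK.
have mT : measurable (`[0, T]%classic : set (measurableTypeR R)) by [].
have mI : measurable (`[s, t]%classic : set (measurableTypeR R)) by [].
pose D u w := z u w - H u w.
have pD : pred D by exact: (predictable_mxB hT).
have fD : (sq D w < +oo)%E by exact: (sq_subtr_finite hT pz pH).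
have j1 := sq_vdot_integrable hT pD pD fD fD; have i1 := integrable_EFinZ mT (alpha / 2) j1.
have i2 := sq_vdot_integrable hT pH pth fH fth.
rewrite qvE time_dotE -(RintegralZl _ mI (integrable_sub_itv s0 tT j1)).
rewrite -(RintegralB mI (integrable_sub_itv s0 tT i1) (integrable_sub_itv s0 tT i2)).
have := le_Rintegral_ae s0 tT (gen_integrable a0 pz fz fth) (integrable_EFinB mT i1 i2).
apply.
by apply: ae_time_mono hK => u hu uT; apply: gen_le => //; exact: hu.
Qed.

Definition dist_int (g : R -> Om -> 'cV[R]_m) w : R :=
  \int[mu]_(u in `[0, T]) edistance (K u w) (g u w) ^+ 2.

Variables (Kth : R) (Kth0 : 0 <= Kth)
  (hth : as_ae P T (fun t w => enorm (theta t w) <= Kth)).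

Lemma theta_sq_le : {ae P, forall w, (sq theta w <= (Kth ^+ 2 * T)%:E)%E}.
Proof.
apply: filterS hth => w h; rewrite sq_norm_integralE.
apply: (@le_trans _ _ (\int[mu]_(s in `[0%R, T]) (Kth ^+ 2)%:E)%E).
  apply: ae_ge0_le_integral => //.
  - by move=> s _; rewrite lee_fin vdot_ge0.
  - by apply/measurable_EFinP; exact: (vdot_section hT w pth pth).
  - by move=> s _; rewrite lee_fin sqr_ge0.
  apply: ae_time_mono h => s hs; rewrite /= => sT; rewrite lee_fin -sqr_enorm.
  by rewrite ler_sqr ?nnegrE ?enorm_ge0//; apply: hs.
rewrite integral_cst//= lebesgue_measure_itv/= lte_fin hT sube0 -EFinM//.
Qed.
Let fth : {ae P, forall w, (sq theta w < +oo)%E}.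
Proof. by apply: filterS theta_sq_le => w /le_lt_trans; apply; rewrite ltry. Qed.

Variables (Th : R -> Om -> R) (iTh : ito theta Th)
  (hZ : \mean[P]_w gdens theta Th 0 T w = 1)
  (F : Om -> R) (k : R) (hk : 0 <= k) (hF_below : {ae P, forall w, - k <= F w}).

(** * One quadratic equation: moments, lower bound and comparison *)

Section solution.
Variables (alpha : R) (Y : R -> Om -> R) (Z : R -> Om -> 'cV[R]_m)
  (a0 : 0 < alpha) (hYZ : exp_bsde P T B b sigma C alpha F Y Z).

Lemma exp_bsde_predictable : pred Z.
Proof. by case: hYZ => -[]. Qed.
Let pZ := exp_bsde_predictable.

Lemma exp_bsde_adapted t : 0 <= t -> t <= T -> meas_wrt (Fil t) (Y t).
Proof.
move=> t0 tT; case: hYZ => -[pY _ _] _ _ _ _.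
apply: (predictable_adapted hT _ t0 tT); exact/predictable_pmeas.
Qed.

Lemma exp_bsde_moment (p : R) : 1 <= p ->
  (\int[P]_w ((sq Z w) `^ (p / 2)) < +oo)%E.
Proof. by case: hYZ => _ _ _ h _; exact: h. Qed.

Lemma exp_bsde_M2 : M2 P T Fil Z.
Proof.
split; first exact: pZ.
have h2 : (1 : R) <= 2 by lra.
have := exp_bsde_moment h2; rewrite divff//; apply: le_lt_trans.
rewrite le_eqVlt; apply/orP; left; apply/eqP; apply: eq_integral => w _.
by rewrite poweRe1// sq_ge0.
Qed.

(** The moment condition at [p = 4]; it makes the remainder in [energy_le] finite. *)
Lemma exp_bsde_qv2 : summable_rv P (fun w => qv Z 0 T w ^+ 2).
Proof.
have fZ := M2_finite hPc hT hB exp_bsde_M2.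
have mq := measurable_qv hPc hT hB pZ (lexx 0) (ltW hT) (lexx T).
apply/summableP; apply: integrable_EFin_ge0 => //; first exact: measurable_funX.
  by move=> w; exact: sqr_ge0.
have h1 : (1 : R) <= 4 by lra.
apply: le_lt_trans (exp_bsde_moment h1).
apply: ae_ge0_le_integral => //.
- by move=> w _; rewrite lee_fin sqr_ge0.
- by apply/measurable_EFinP; exact: measurable_funX.
- by move=> w _; exact: poweR_ge0.
- exact: (measurableT_comp (measurable_poweR _) (measurable_sq hPc hT hB pZ)).
apply: filterS fZ => w fw _; rewrite (sq_qv fw) poweR_EFin lee_fin.
by rewrite (_ : 4 / 2 = 2%:R) ?powR_mulrn ?qv_ge0//; field.
Qed.

Lemma exp_bsde_continuous : {ae P, forall w, {within `[0, T], continuous (Y ^~ w)}}.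
Proof. by case: hYZ => -[]. Qed.

(** The dominating variable is the supremum over time of the exponential of [alpha * pos_part Y],
    integrable by the moment condition at [p = 1]. *)
Lemma exp_bsde_dominated : exists X, [/\ summable_rv P X, forall w, 0 <= X w &
  {ae P, forall w t, 0 <= t -> t <= T -> expR (alpha * Y t w) <= X w}].
Proof.
pose D t w := expR (1 * alpha * pos_part (Y t w)).
pose S w := ereal_sup [set (`|D t w|)%:E | t in `[0, T]].
have DE w : [set (`|D t w|)%:E | t in `[0%R, T]] = [set (D t w)%:E | t in `[0%R, T]].
  by apply: eq_imagel => t _; rewrite ger0_norm// expR_ge0.
have mD t : t \in `[0, T] -> measurable_fun setT (D t).
  rewrite in_itv/= => /andP[t0 tT].
  apply: measurableT_comp => //; apply: measurable_funM => //.
  apply: measurable_maxr => //.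
  exact: (meas_wrt_measurable hPc hB tT (exp_bsde_adapted t0 tT)).
have rD : {ae P, forall w, right_cont T (D ^~ w)}.
  apply: filterS exp_bsde_continuous => w /(continuous_right_cont hT) rY t t0 tT.
  apply: continuous_cvg; first exact: continuous_expR.
  have -> : (fun s => 1 * alpha * pos_part (Y s w)) =
      (fun s => (1 * alpha) * (2^-1 * (Y s w + `|Y s w|))).
    by apply/funext => s; rewrite /pos_part maxr_absE addr0 subr0 (mulrC 2^-1).
  have -> : 1 * alpha * pos_part (Y t w) = (1 * alpha) * (2^-1 * (Y t w + `|Y t w|)).
    by rewrite /pos_part maxr_absE addr0 subr0 (mulrC 2^-1).
  exact: (right_contZ (right_contZ (right_contD rY (right_cont_norm rY)))).
have mS := measurable_sup_norm hT hPc mD rD.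
have S0 w : (0 <= S w)%E.
  apply: (@le_trans _ _ (`|D 0 w|)%:E); first by rewrite lee_fin.
  by apply: ereal_sup_ubound; exists 0 => //=; rewrite in_itv/= lexx ltW.
have iS : (\int[P]_w S w < +oo)%E.
  by case: hYZ => _ _ h _ _; have := h 1 (lexx 1); rewrite (eq_integral S)// => w _; rewrite /S DE.
have finS : {ae P, forall w, S w \is a fin_num}.
  have : P.-integrable setT S.
    apply/integrableP; split=> //; rewrite (eq_integral S)// => w _.
    by rewrite gee0_abs.
  by move/(integrable_ae measurableT); apply: filterS => w; apply.
have mf : measurable_fun setT (fun w => fine (S w)) by exact: measurableT_comp.
have f0 w : 0 <= fine (S w) by exact: fine_ge0.
exists (fun w => fine (S w)); split=> //.
  apply/summableP; apply: integrable_EFin_ge0 => //.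
  apply: le_lt_trans iS; apply: ge0_le_integral => //.
  - by move=> w _; rewrite lee_fin.
  - exact/measurable_EFinP.
  move=> w _; by case: (S w) (S0 w) => [r|_|]//=; rewrite leey.
apply: filterS finS => w fw t t0 tT.
have : ((D t w)%:E <= S w)%E.
  rewrite -[D t w]ger0_norm ?expR_ge0//; apply: ereal_sup_ubound.
  by exists t => //=; rewrite in_itv/= t0.
rewrite -(fineK fw) lee_fin; apply: le_trans.
rewrite ler_expR mul1r; apply: ler_wpM2l; first exact: ltW.
by rewrite /pos_part le_max lexx.
Qed.

Variables (I : R -> Om -> R) (iI : ito Z I)
  (hI : as_all P T (fun t w => Y t w = F w + gen_int alpha Z t T w - (I T w - I t w))).

Lemma exp_bsde_final : {ae P, forall w, Y T w = F w}.
Proof.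
have T0 := ltW hT.
apply: filterS (as_all_at hI T0 (lexx T)) => w ->.
by rewrite /gen_int Rintegral_itv1 subrr subr0 addr0.
Qed.

Let fZ : {ae P, forall w, (sq Z w < +oo)%E}.
Proof. by case: iI. Qed.

Lemma exp_bsde_incr : {ae P, forall w s t, 0 <= s -> s <= t -> t <= T ->
  Y s w = Y t w + gen_int alpha Z s t w - (I t w - I s w)}.
Proof.
apply: filterS3 hI fZ fth => w h fw ft s t s0 st tT.
have t0 := le_trans s0 st; have sT := le_trans st tT.
rewrite (h s) ?in_itv/= ?s0 ?sT// (h t) ?in_itv/= ?t0 ?tT//.
by rewrite (gen_int_split a0 pZ fw ft s0 st tT (lexx T)); ring.
Qed.

Let qth s t : 0 <= s -> s <= t -> t <= T -> {ae P, forall w, qv theta s t w <= Kth ^+ 2 * T}.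
Proof. exact: (qv_theta_le hT iTh theta_sq_le). Qed.

(** Dropping the squared distance from the generator leaves the portfolio of integrand [Z] and a
    bounded term; [superhedging_le] then applies to [- Y t]. *)
Lemma exp_bsde_ge t : 0 <= t -> t <= T ->
  {ae P, forall w, - (k + (2 * alpha)^-1 * (Kth ^+ 2 * T)) <= Y t w}.
Proof.
move=> t0 tT.
have mY : meas_wrt (Fil t) (fun w => - Y t w).
  exact: meas_wrtN (exp_bsde_adapted t0 tT).
have := superhedging_le hPc hT hB iTh theta_sq_le hZ iI exp_bsde_M2 t0 tT mY.
move=> /(_ (k + (2 * alpha)^-1 * (Kth ^+ 2 * T))) h.
apply: filterS (h _) => [w|]; first by rewrite lerNl.
have hq := qth t0 tT (lexx T).
apply: filterS3 hF_below (as_all_at hI t0 tT) (ae_and fZ (ae_and fth hq)) => w Fk -> [fw [ft qK]]; rewrite gincrE.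
have a2 : 0 <= (2 * alpha)^-1 by rewrite invr_ge0 mulr_ge0// ltW.
have := gen_int_ge a0 pZ fw ft t0 (lexx T).
have := ler_wpM2l a2 qK.
set g := gen_int _ _ _ _ _; set td := time_dot _ _ _ _ _; set q := qv _ _ _ _; 
by move: (_ * q) (_ * (_ * T)) => x y; lra.
Qed.

(** Let [X] be the portfolio started from [c0]. By [gen_le], the increments of [D = alpha * (Y - X)]
    dominate the exponent of the exponential martingale of [alpha *: (Z - H)], and [D T <= 0] by
    superhedging. Absence of arbitrage keeps [X] above [- k], so the exponential of [D] is dominated
    by a multiple of the supremum of that of [alpha * Y]. *)
Lemma exp_bsde_comparison s c0 H J : 0 <= s -> s <= T -> meas_wrt (Fil s) c0 ->
  ito H J -> M2 P T Fil H -> as_ae P T (fun t w => K t w (H t w)) ->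
  {ae P, forall w, F w <= c0 w + gincr theta H J s T w} ->
  {ae P, forall w, Y s w <= c0 w}.
Proof.
move=> s0 sT mc iJ MH hK hF.
have pH : pred H by case: iJ.
have fH : {ae P, forall w, (sq H w < +oo)%E} by case: iJ.
pose X r w := c0 w + gincr theta H J s r w.
have mX r : s <= r -> r <= T -> meas_wrt (Fil r) (X r).
  move=> sr rT; have r0 := le_trans s0 sr.
  apply: meas_wrtD; first exact: meas_wrt_mono mc.
  have : meas_wrt (Fil r) (fun w => (J r w - J s w) + \int[mu]_(u in `[s, r]) vdot (H u w) (theta u w)).
    apply: meas_wrtD; last exact: (adapted_int_vdot hT).
    apply: meas_wrtB; first exact: (ito_adapted iJ).
    apply: meas_wrt_mono (ito_adapted iJ s0 sT) => //.
  by congr meas_wrt; apply/funext => w; rewrite gincrE time_dotE.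
have gsplit : {ae P, forall w r, s <= r -> r <= T ->
    gincr theta H J s T w = gincr theta H J s r w + gincr theta H J r T w}.
  apply: filterS2 fH fth => w fw ft r sr rT.
  by rewrite !gincrE (time_dot_split hT pH pth fw ft s0 sr rT (lexx T)); ring.
have X_ge r : s <= r -> r <= T -> {ae P, forall w, - k <= X r w}.
  move=> sr rT; have r0 := le_trans s0 sr.
  have mN : meas_wrt (Fil r) (fun w => - X r w) by exact: meas_wrtN (mX r sr rT).
  have := superhedging_le hPc hT hB iTh theta_sq_le hZ iJ MH r0 rT mN.
  move=> /(_ k) h; apply: filterS (h _) => [w|]; first by rewrite lerNl.
  apply: filterS3 hF hF_below gsplit => w Fw Fk /(_ r sr rT) e.
  rewrite /X; move: Fw Fk; rewrite e; move: (gincr _ _ _ _ _ _) (gincr _ _ _ _ _ _) => x y; lra.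
have [Xi [sXi Xi0 hXi]] := exp_bsde_dominated.
pose D r w := alpha * (Y r w - X r w).
have iN := ito_lincomb hPc hT hB alpha (- alpha) iI iJ.
have qE : {ae P, forall w r, s <= r -> r <= T ->
    qv (fun t w => alpha *: Z t w + (- alpha) *: H t w) s r w =
    alpha ^+ 2 * qv (fun u w => Z u w - H u w) s r w}.
  apply: filterS2 fZ fH => w fw fHw r sr rT.
  have -> : (fun t w => alpha *: Z t w + (- alpha) *: H t w) = (fun t w => alpha *: (Z t w - H t w)).
    by apply/funext => t; apply/funext => v; rewrite scalerBr scaleNr.
  exact: (qv_scale hT alpha (predictable_mxB hT pZ pH) (sq_subtr_finite hT pZ pH fw fHw) s0 rT).
have := exp_comparison hPc hT hB iN s0 sT (D := D) (X := fun w => expR (alpha * k) * Xi w).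
move=> h; apply: filterS (h _ _ _ _ _ _) => {h}.
- move=> w; rewrite /D /X gincrE subrr add0r time_dot_self addr0.
  by rewrite pmulr_rle0// subr_le0.
- move=> r sr rT; have r0 := le_trans s0 sr.
  exact: meas_wrtZ (meas_wrtB (exp_bsde_adapted r0 rT) (mX r sr rT)).
- apply: filterS2 exp_bsde_final hF => w e hw.
  by rewrite /D e pmulr_rle0// subr_le0.
- move=> r sr rT; apply: filterS3 exp_bsde_incr qE (ae_and (ae_and fZ hK) (ae_and fH fth)).
  move=> w Yi qw [[fw hKw] [fHw ft]]; rewrite (qw r sr rT).
  have := gen_int_le a0 pZ pH fw fHw ft s0 rT hKw.
  rewrite /D /X !gincrE subrr time_dot_self.
  rewrite (Yi s r s0 sr rT) -(@ler_pM2l _ alpha a0).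
  move: (gen_int _ _ _ _ _) (qv _ _ _ _) (time_dot _ _ _ _ _) => g q td; nra.
- exact: summableZ.
- by move=> w; rewrite mulr_ge0// expR_ge0.
move=> r sr rT; have r0 := le_trans s0 sr; apply: filterS2 hXi (X_ge r sr rT) => w h1 h2.
apply: le_trans (ler_wpM2l (expR_ge0 _) (h1 r r0 rT)); rewrite -expRD ler_expR /D.
by rewrite -mulrDr ler_pM2l//; lra.
Qed.

(** * A priori estimates, uniform in [alpha >= 1] *)

Section apriori.
Variables (Xi : Om -> R) (k0 : R) (mXi : measurable_fun setT Xi) (Xi0 : forall w, 0 <= Xi w)
  (sXi2 : summable_rv P (fun w => Xi w ^+ 2)) (a1 : 1 <= alpha)
  (Y_le : forall t, 0 <= t -> t <= T -> {ae P, forall w, `|Y t w| <= Xi w})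
  (Y0_le : {ae P, forall w, Y 0 w <= k0}).
Let kap := Kth ^+ 2 * T.
Let kap0 : 0 <= kap. Proof. by rewrite mulr_ge0 ?sqr_ge0// ltW. Qed.
Let M t w := I t w - I 0 w.
Let y t w := Y t w - Y 0 w.
Let T0 : 0 <= T. Proof. exact: ltW. Qed.
Let MZ := exp_bsde_M2.
Let mY t : 0 <= t -> t <= T -> measurable_fun setT (Y t).
Proof. by move=> t0 tT; exact: (meas_wrt_measurable hPc hB tT (exp_bsde_adapted t0 tT)). Qed.
Let sY2 t : 0 <= t -> t <= T -> summable_rv P (fun w => Y t w ^+ 2).
Proof.
move=> t0 tT; apply: (summable_le_as _ sXi2); first by apply: measurable_funX; exact: mY.
apply: filterS (Y_le t0 tT) => w h.
by rewrite ger0_norm ?sqr_ge0// -real_normK ?num_real// ler_sqr ?nnegrE.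
Qed.
Let sy2 t : 0 <= t -> t <= T -> summable_rv P (fun w => y t w ^+ 2).
Proof.
move=> t0 tT; have s0 := sY2 (lexx 0) T0.
have mN : measurable_fun setT (fun w => -1 * Y 0 w) by apply: measurable_funM => //; exact: mY.
have := summable_sqD (mY t0 tT) mN (sY2 t0 tT) (summable_sqZ (-1) s0).
by apply: eq_summable => w; rewrite /y mulN1r.
Qed.
Let mM t : 0 <= t -> t <= T -> measurable_fun setT (M t).
Proof. by move=> t0 tT; apply: measurable_funB; exact: (measurable_ito hPc hB iI). Qed.
Let my t : 0 <= t -> t <= T -> measurable_fun setT (y t).
Proof. by move=> t0 tT; apply: measurable_funB; exact: mY. Qed.
Let sM2 t : 0 <= t -> t <= T -> summable_rv P (fun w => M t w ^+ 2).
Proof. by move=> t0 tT; have [] := ito_L2 hPc hT hB iI MZ (lexx 0) t0 tT. Qed.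
Let mq : measurable_fun setT (qv Z 0 T).
Proof. exact: (measurable_qv hPc hT hB pZ). Qed.

Let Phi w := `|M T w| + 2 * Xi w + ((1 + kap) * Num.sqrt (qv Z 0 T w) + 2 * kap).
Let mPhi : measurable_fun setT Phi.
Proof.
apply: measurable_funD; apply: measurable_funD => //.
- by apply: measurableT_comp => //; exact: mM.
- exact: measurable_funM.
- by apply: measurable_funM => //; exact: measurable_sqrt_comp.
Qed.
Let sPhi2 : summable_rv P (fun w => Phi w ^+ 2).
Proof.
have ms := measurable_sqrt_comp mq.
have mMT : measurable_fun setT (fun w => `|M T w|) by apply: measurableT_comp => //; exact: mM.
apply: summable_sqD.
- by apply: measurable_funD => //; exact: measurable_funM.
- by apply: measurable_funD => //; exact: measurable_funM.
- apply: summable_sqD => //; first exact: measurable_funM; last exact: summable_sqZ.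
  by apply: eq_summable (sM2 T0 (lexx T)) => w; rewrite real_normK ?num_real.
- apply: summable_sqD => //; [exact: measurable_funM| |exact: summable_cst].
  apply: summable_sqZ; apply: eq_summable (M2_summable hPc hT hB MZ) => w.
  by rewrite sqr_sqrtr// qv_ge0.
Qed.

Let f r i w := (M (grid T 0 r i.+1) w - M (grid T 0 r i) w)
               - (y (grid T 0 r i.+1) w - y (grid T 0 r i) w).
Let g_in r i : 0 <= grid T 0 r i /\ grid T 0 r i <= T.
Proof. by have /andP[] := grid_in T0 r i. Qed.

(** The increments [f] are integrals of the generator and bounded below by the small terms [- rr],
    so their total variation is at most their sum plus twice the sum of the [rr]. It grows only like
    the square root of the energy, which lets the energy be absorbed later. *)
Let sum_f_le : {ae P, forall w, forall r, (0 < r)%N -> \sum_(i < (r ^ 2)%N) `|f r i w| <= Phi w}.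
Proof.
apply: filterS3 exp_bsde_incr (ae_and fZ fth) (ae_and (qth (lexx 0) T0 (lexx T))
  (ae_and (Y_le T0 (lexx T)) (Y_le (lexx 0) T0))) => w Yi [fw ft] [qw [YT Y0]] r r0.
set s := Num.sqrt (qv Z 0 T w); have s0 : 0 <= s by exact: sqrtr_ge0.
have s2 : s ^+ 2 = qv Z 0 T w by rewrite sqr_sqrtr// qv_ge0.
have s1 : 0 < 1 + s by lra.
(* With this weight in Young's inequality the energy term is at most [s], the square root of the
   energy; the inverse weight [1 + s] multiplies only the bounded energy of [theta]. *)
pose e := (1 + s)^-1; have e0 : 0 < e by rewrite invr_gt0.
have ee : e * (1 + s) = 1 by rewrite mulVf// gt_eqF.
pose rr i := 2^-1 * (e * qv Z (grid T 0 r i) (grid T 0 r i.+1) w +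
   (2 + s) * qv theta (grid T 0 r i) (grid T 0 r i.+1) w).
have tele (h : R -> Om -> 'cV[R]_m) : predictable_mx Fil T h -> (sq h w < +oo)%E ->
    \sum_(i < (r ^ 2)%N) qv h (grid T 0 r i) (grid T 0 r i.+1) w = qv h 0 T w.
  move=> ph fh; rewrite -(big_mkord xpredT (fun i => qv h (grid T 0 r i) (grid T 0 r i.+1) w)).
  rewrite (telescope_sumr_eq (fun i => qv h 0 (grid T 0 r i) w))//; last first.
    move=> i /andP[_ ir]; have [g0 _] := g_in r i; have [_ gT] := g_in r i.+1.
    by rewrite (qv_split hT ph fh (lexx 0) g0 (grid_mono T0 ir) gT) addrC addKr.
  by rewrite grid_last// grid0 qvE [X in _ - X]qvE Rintegral_itv1 subr0.
have hf i : (i < r ^ 2)%N -> - rr i <= f r i w /\ 0 <= rr i.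
  move=> ir; have [g0 gT0] := g_in r i; have [g1 gT] := g_in r i.+1.
  have gm := grid_mono T0 ir; split; last first.
    by rewrite /rr !(mulr_ge0, addr_ge0, qv_ge0, invr_ge0, ltW e0).
  have -> : f r i w = gen_int alpha Z (grid T 0 r i) (grid T 0 r i.+1) w.
    by rewrite /f /M /y (Yi _ _ g0 gm gT); ring.
  apply: le_trans (gen_int_ge a0 pZ fw ft g0 gT).
  rewrite -lerN2 opprK opprB opprK /rr.
  set qq := qv Z _ _ w; set qt := qv theta _ _ w; set td := time_dot _ _ _ _ _.
  have h1 : td ^+ 2 <= qq * qt by exact: (time_dot_sq_le hT pZ pth fw ft g0 gT).
  have q0 : 0 <= qq := qv_ge0 _ _ _ _; have t0 : 0 <= qt := qv_ge0 _ _ _ _.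
  have a2 : (2 * alpha)^-1 * qt <= 2^-1 * qt.
    apply: ler_wpM2r => //; rewrite lef_pV2 ?posrE ?mulr_gt0//.
    by rewrite ler_peMr.
  have h2 : td <= 2^-1 * (e * qq + (1 + s) * qt).
    have h3 : (2 * td) ^+ 2 <= (e * qq + (1 + s) * qt) ^+ 2.
      rewrite exprMn; have : 0 <= (e * qq - (1 + s) * qt) ^+ 2 by exact: sqr_ge0.
      have : e * qq * ((1 + s) * qt) = qq * qt by rewrite mulrACA [X in X = _]mulrC mulrC ee mul1r.
      by move: h1; move: (e * qq) ((1 + s) * qt) (qq * qt) => a' b' c' h1 h2 h3; nra.
    have h4 : 0 <= e * qq + (1 + s) * qt by rewrite addr_ge0 ?mulr_ge0 ?(ltW e0) ?(ltW s1).
    by rewrite -(@ler_pM2l _ 2)// mulrA divff// mul1r; exact: le_of_sqr_le.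
  by lra.
apply: (le_trans (sum_norm_le hf)).
have -> : \sum_(i < (r ^ 2)%N) f r i w = M T w - y T w.
  rewrite -(big_mkord xpredT (fun i => f r i w)).
  rewrite (telescope_sumr_eq (fun i => M (grid T 0 r i) w - y (grid T 0 r i) w))//.
    by rewrite grid_last// grid0 /M /y; ring.
  by move=> i _; rewrite /f; ring.
have -> : 2 * \sum_(i < (r ^ 2)%N) rr i = e * qv Z 0 T w + (2 + s) * qv theta 0 T w.
  have e1 := tele _ pZ fw; have e2 := tele _ pth ft.
  rewrite /rr -mulr_sumr big_split/= -!mulr_sumr e1 e2.
  by rewrite mulrA divff// mul1r.
have h1 : e * qv Z 0 T w <= s.
  by rewrite -s2 expr2 mulrA ler_piMl//; nra.
have h2 : (2 + s) * qv theta 0 T w <= (2 + s) * kap by rewrite ler_wpM2l//; lra.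
rewrite /Phi -/s; have := ler_norm (M T w); move: YT Y0 => /ler_normlP[YT1 YT2] /ler_normlP[Y01 Y02].
rewrite {1}/y; move: h1 h2; move: (e * _) ((2 + s) * qv _ _ _ _) => x1 x2; lra.
Qed.

(** The sum of squares is at most the largest increment times the total variation, and the largest
    increment vanishes with the mesh because [I - Y] is uniformly continuous on [[0, T]]. *)
Let f_small : {ae P, forall w, \sum_(i < (n.+1 ^ 2)%N) f n.+1 i w ^+ 2 @[n --> \oo] --> 0}.
Proof.
have cI : {ae P, forall w, {within `[0, T], continuous (I ^~ w)}} by case: iI.
apply: filterS3 sum_f_le cI exp_bsde_continuous => w hf cIw cYw.
have cg : {within `[0, T], continuous (fun t => I t w - Y t w)}.
  by move=> t; apply: cvgB; [exact: cIw|exact: cYw].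
apply/cvgrPdist_le => e e0.
have Ph0 : 0 <= Phi w.
  by apply: le_trans (hf 1%N isT); apply: sumr_ge0 => i _.
have e1 : 0 < e / (1 + Phi w) by rewrite divr_gt0//; lra.
have [dl dl0 hdl] := uniform_continuity cg e1.
have [n0 hn0] := exists_natr_gt (T / dl).
exists n0 => // n /= n0n; rewrite sub0r normrN ger0_norm; last by apply: sumr_ge0 => i _; exact: sqr_ge0.
have mesh : T / (n.+1 ^ 2)%N%:R < dl.
  rewrite ltr_pdivrMr ?ltr0n ?expn_gt0// -ltr_pdivrMl// mulrC; apply: (lt_le_trans hn0).
  by rewrite ler_nat (leq_trans n0n)// (leq_trans (leqnSn n))// leq_pmulr.
apply: (@le_trans _ _ (e / (1 + Phi w) * \sum_(i < (n.+1 ^ 2)%N) `|f n.+1 i w|)).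
  apply: (sum_sqr_le (f := fun i => f n.+1 i w)) => i ir; rewrite /f /M /y.
  rewrite (_ : _ - _ = (I (grid T 0 n.+1 i.+1) w - Y (grid T 0 n.+1 i.+1) w) -
     (I (grid T 0 n.+1 i) w - Y (grid T 0 n.+1 i) w)); last by ring.
  apply: hdl; [by apply/andP; exact: g_in|by apply/andP; exact: g_in|].
  by rewrite gridS// addrAC subrr add0r subr0 ger0_norm// divr_ge0.
rewrite mulrAC ler_pdivrMr; last by lra.
rewrite ler_pM2l//; have := hf n.+1 isT; lra.
Qed.

(** Mean of [square_decomposition] along finer grids: the martingale sum disappears and the sum of
    squares becomes arbitrarily small, being dominated by [Phi ^+ 2]. What remains is of first order
    in [M] and in the square root of the energy. *)
Let meanM2_le : \mean[P]_w (M T w ^+ 2) <= \mean[P]_w (4 * Xi w ^+ 2 + 4 * (Xi w * Phi w)).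
Proof.
have sXP : summable_rv P (fun w => Xi w * Phi w) by exact: summable_mulL2.
have sB : summable_rv P (fun w => 4 * Xi w ^+ 2 + 4 * (Xi w * Phi w)).
  by apply: summableD; exact: summableZ.
have mf r i : measurable_fun setT (f r i).
  have [g0 gT] := g_in r i; have [g1 g1T] := g_in r i.+1.
  by apply: measurable_funB; apply: measurable_funB; (exact: mM || exact: my).
apply/ler_addgt0Pr => e e0.
have [n hn] : exists n, \mean[P]_w (\sum_(i < (n.+1 ^ 2)%N) f n.+1 i w ^+ 2) <= e.
  apply: (mean_dominated_small (g := fun w => Phi w ^+ 2)) e0 => //.
    by move=> n; apply: measurable_sum => i; exact: measurable_funX.
  move=> n; apply: filterS sum_f_le => w /(_ n.+1 isT) h.
  rewrite ger0_norm; last by apply: sumr_ge0 => i _; exact: sqr_ge0.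
  apply: (le_trans (sum_sqr_le_sqr _ (fun i => f n.+1 i w))); rewrite ler_sqr ?nnegrE//; first by apply: sumr_ge0.
  by apply: le_trans h; apply: sumr_ge0.
pose r := n.+1; rewrite -/r in hn.
pose g i := grid T 0 r i.
pose V i w := M (g i) w - y (g i) w.
have sV i : summable_rv P (fun w => V i w ^+ 2).
  have [g0 gT] := g_in r i.
  have mN : measurable_fun setT (fun w => -1 * y (g i) w) by apply: measurable_funM => //; exact: my.
  have := summable_sqD (mM g0 gT) mN (sM2 g0 gT) (summable_sqZ (-1) (sy2 g0 gT)).
  by apply: eq_summable => w; rewrite /V mulN1r.
have FV i : meas_wrt (Fil (g i)) (V i).
  have [g0 gT] := g_in r i.
  have F0 (W : Om -> R) : meas_wrt (Fil 0) W -> meas_wrt (Fil (g i)) W by exact: meas_wrt_mono.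
  apply: meas_wrtB; apply: meas_wrtB.
  - exact: (ito_adapted iI).
  - by apply: F0; exact: (ito_adapted iI).
  - exact: exp_bsde_adapted.
  - by apply: F0; exact: exp_bsde_adapted.
have VM i : (i < r ^ 2)%N -> summable_rv P (fun w => V i w * (M (g i.+1) w - M (g i) w)) /\
    \mean[P]_w (V i w * (M (g i.+1) w - M (g i) w)) = 0.
  move=> ir; have [g0 gT] := g_in r i; have [g1 g1T] := g_in r i.+1.
  have gm := grid_mono T0 ir; have E w : M (g i.+1) w - M (g i) w = I (g i.+1) w - I (g i) w.
    by rewrite /M; ring.
  split; last first.
    rewrite -[RHS](ito_martingale_L2 hPc hT hB iI MZ g0 gm g1T (FV i) (sV i)).
    by apply: eq_mean => w; rewrite E.
  apply: summable_mulL2 (sV i) _.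
  - by apply: measurable_funB; [exact: mM|exact: my].
  - by apply: measurable_funB; exact: mM.
  - have [h _] := ito_L2 hPc hT hB iI MZ g0 gm g1T.
    by apply: eq_summable h => w; rewrite E.
have sf i : summable_rv P (fun w => f r i w ^+ 2).
  have [g0 gT] := g_in r i; have [g1 g1T] := g_in r i.+1.
  apply: (summable_le _ (summableZ 2 (summableD (sV i.+1) (sV i)))); first exact: measurable_funX.
  move=> w; rewrite ger0_norm ?sqr_ge0// /f -/(g i) -/(g i.+1).
  have -> : (M (g i.+1) w - M (g i) w) - (y (g i.+1) w - y (g i) w) = V i.+1 w - V i w.
    by rewrite /V; ring.
  exact: sqrB_le.
have sSf : summable_rv P (fun w => \sum_(i < (r ^ 2)%N) f r i w ^+ 2) by apply: summable_sum.
have sSV : summable_rv P (fun w => \sum_(i < (r ^ 2)%N) V i w * (M (g i.+1) w - M (g i) w)).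
  by apply: summable_sum => i; have [] := VM i (ltn_ord i).
have SV0 : \mean[P]_w (\sum_(i < (r ^ 2)%N) V i w * (M (g i.+1) w - M (g i) w)) = 0.
  rewrite expectation_sum => [|i]; last by have [] := VM i (ltn_ord i).
  by rewrite big1// => i _; have [] := VM i (ltn_ord i).
have -> : \mean[P]_w (M T w ^+ 2) = \mean[P]_w (M T w ^+ 2 -
    2 * \sum_(i < (r ^ 2)%N) V i w * (M (g i.+1) w - M (g i) w)).
  rewrite meanB; [|exact: sM2|exact: summableZ].
  by rewrite meanZ// SV0 mulr0 subr0.
apply: (@le_trans _ _ (\mean[P]_w ((4 * Xi w ^+ 2 + 4 * (Xi w * Phi w)) +
    \sum_(i < (r ^ 2)%N) f r i w ^+ 2))); last by rewrite meanD// lerD2l.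
apply: expectation_le_as.
- by apply: summableB; [exact: sM2|exact: summableZ].
- exact: summableD.
have Yg : {ae P, forall w i, `|Y (g i) w| <= Xi w}.
  by apply: ae_foralln => i; have [g0 gT] := g_in r i; exact: Y_le.
apply: filterS3 sum_f_le Yg (Y_le (lexx 0) T0) => w /(_ r isT) hf Ygw Y0.
have g0E : g 0%N = 0 by exact: grid0.
have gnE : g (r ^ 2)%N = T by exact: grid_last.
have M0 : M (g 0%N) w = 0 by rewrite g0E /M subrr.
have y0 : y (g 0%N) w = 0 by rewrite g0E /y subrr.
have := square_decomposition (M := fun i => M (g i) w) (y := fun i => y (g i) w) (r ^ 2) M0 y0.
rewrite gnE => ->.
have yle i : `|y (g i) w| <= 2 * Xi w.
  by apply: (le_trans (ler_normB _ _)); have := Ygw i; lra.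
have h1 : y T w ^+ 2 <= 4 * Xi w ^+ 2.
  have := yle (r ^ 2)%N; rewrite gnE => /ler_normlP[p1 p2]; have := Xi0 w.
  move: p1 p2; move: (y T w) (Xi w) => p q; nra.
have h2 : \sum_(i < (r ^ 2)%N) y (g i.+1) w * f r i w <= 2 * (Xi w * Phi w).
  apply: (@le_trans _ _ (\sum_(i < (r ^ 2)%N) 2 * Xi w * `|f r i w|)).
    apply: ler_sum => i _; apply: (le_trans (ler_norm _)); rewrite normrM.
    by apply: ler_wpM2r.
  rewrite -mulr_sumr -mulrA ler_pM2l//; apply: ler_wpM2l => //.
move: h1 h2; rewrite /f /V /g; lra.
Qed.

(** The constant for [energy_le]. Minus the integral is [Y 0 - Y s] minus the integral of the
    generator: [k + kap / 2] bounds [- Y s], [|k0|] bounds [Y 0], one half of the last [kap] bounds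
    the term in [alpha^-1], and its other half remains after absorbing the term linear in [Z] into
    the quadratic variation. *)
Definition energy_exponent := k + kap / 2 + `|k0| + kap.
Let c := energy_exponent.
Let c0 : 0 <= c. Proof. by rewrite !addr_ge0// divr_ge0. Qed.
Let cE : c = k + kap / 2 + `|k0| + kap. Proof. by []. Qed.

Let I0 : {ae P, forall w, I 0 w = 0}. Proof. exact: (ito_at0 hPc hT hB iI). Qed.

Let energy : \mean[P]_w qv Z 0 T w <= 4 * expR c * \mean[P]_w (M T w ^+ 2).
Proof.
have sI : summable_rv P (fun w => I T w ^+ 2).
  apply: (summable_le_as _ (sM2 T0 (lexx T))); first exact: measurable_funX (measurable_ito hPc hB iI T0 (lexx T)).
  by apply: filterS I0 => w e; rewrite /M e subr0 ger0_norm ?sqr_ge0.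
have -> : \mean[P]_w (M T w ^+ 2) = \mean[P]_w (I T w ^+ 2).
  apply: expectation_as_eq => //; first exact: sM2.
  by apply: filterS I0 => w e; rewrite /M e subr0.
apply: (energy_le hPc hT hB iI MZ c0 exp_bsde_qv2) => l s l0 l1 s0 sT.
have := exp_bsde_ge s0 sT => Yge.
apply: filterS3 (ae_and exp_bsde_incr Y0_le) (ae_and (ae_and I0 Yge) (qth (lexx 0) s0 sT)) (ae_and fZ fth).
move=> w [Yi Yk0] [[e Ygew] qs] [fw ft].
have := Yi 0 s (lexx 0) s0 sT; rewrite e subr0 => YE.
have gg := gen_int_ge a0 pZ fw ft (lexx 0) sT.
have td2 := time_dot_sq_le hT pZ pth fw ft (lexx 0) sT.
have q0 := qv_ge0 Z 0 s w; have t0 := qv_ge0 theta 0 s w.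
have ai : (2 * alpha)^-1 <= 2^-1 by rewrite lef_pV2 ?posrE ?mulr_gt0// ler_peMr.
have ai0 : 0 <= (2 * alpha)^-1 by rewrite invr_ge0 mulr_ge0// ltW.
have IE : I s w = Y s w - Y 0 w + gen_int alpha Z 0 s w by rewrite YE; ring.
have k0a : k0 <= `|k0| by exact: ler_norm.
rewrite cE; move: YE gg td2 q0 t0 Ygew qs; rewrite IE -/kap; clear IE.
have := normr_ge0 k0; move: (gen_int _ _ _ _ _) (time_dot _ _ _ _ _) (qv Z _ _ _) (qv theta _ _ _) (Y s w) (Y 0 w) `|k0| k0a Yk0 (2 * alpha)^-1 ai ai0.
move=> g td q qt ys y0 ak k0a Yk0 ia ai ai0 ak0 YE gg td2 q0 t0 Ygew qs.
have td_le : l * td <= 2^-1 * (l ^+ 2 * q + kap).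
  rewrite -(@ler_pM2l _ 2)// [leRHS]mulrA divff// mul1r; apply: le_of_sqr_le.
    by rewrite addr_ge0// mulr_ge0// sqr_ge0.
  have h1 : (2 * (l * td)) ^+ 2 <= 4 * (l ^+ 2 * q * kap).
    rewrite (_ : (2 * _) ^+ 2 = 4 * (l ^+ 2 * td ^+ 2)); last by ring.
    rewrite ler_pM2l// -mulrA ler_wpM2l ?sqr_ge0//; apply: (le_trans td2).
    by rewrite ler_wpM2l.
  apply: (le_trans h1); rewrite -subr_ge0 (_ : _ - _ = (l ^+ 2 * q - kap) ^+ 2) ?sqr_ge0//; ring.
have b1 : ia * qt <= 2^-1 * kap.
  by apply: (le_trans (ler_wpM2r t0 ai)); rewrite ler_pM2l.
have b2 : ia * kap <= 2^-1 * kap by rewrite ler_wpM2r.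
have b3 : - (ys - y0 + g) <= (k + kap / 2 + ak + kap / 2) + td by lra.
have b4 := ler_wpM2l (ltW l0) b3.
have b5 : l * (k + kap / 2 + ak + kap / 2) <= k + kap / 2 + ak + kap / 2.
  rewrite ler_piMl// !addr_ge0// divr_ge0//.
rewrite mulrDr in b4; rewrite mulNr -mulrN; lra.
Qed.

(** Write V for the second moment of [M T]. Young's inequality bounds it by V/4, plus the energy
    divided by [16 * expR c], plus a multiple of the mean of [Xi ^+ 2 + 1]. As the energy is at most
    [4 * expR c] times V, the first two terms make V/2, whence the leading 2; the number 28 is 4 + 8
    + 16. The value does not depend on [alpha]. *)
Definition energy_bound := 2 * (28 + 4 * (1 + kap) ^+ 2 * (16 * expR c) + 4 * kap) *
  (\mean[P]_w (Xi w ^+ 2) + 1).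
Let D := energy_bound.

Let meanM2_bound : \mean[P]_w (M T w ^+ 2) <= D.
Proof.
pose E := expR c; have E0 : 0 < E by exact: expR_gt0.
pose Cd := 28 + 4 * (1 + kap) ^+ 2 * (16 * E) + 4 * kap.
have sXP : summable_rv P (fun w => Xi w * Phi w) by exact: summable_mulL2.
have sB : summable_rv P (fun w => 4 * Xi w ^+ 2 + 4 * (Xi w * Phi w)).
  by apply: summableD; exact: summableZ.
have sq_ := M2_summable hPc hT hB MZ.
have s1 := summableZ 4^-1 (sM2 T0 (lexx T)).
have s2 := summableZ (16 * E)^-1 sq_.
have s3 := summableZ Cd (summableD sXi2 (summable_cst P 1)).
have h : \mean[P]_w (4 * Xi w ^+ 2 + 4 * (Xi w * Phi w)) <=
    \mean[P]_w ((4^-1 * M T w ^+ 2 + (16 * E)^-1 * qv Z 0 T w) + Cd * (Xi w ^+ 2 + 1)).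
  apply: expectation_le => // [|w]; first by apply: summableD => //; exact: summableD.
  rewrite /Phi; set q := qv Z 0 T w; set s := Num.sqrt q.
  have s2q : q = s ^+ 2 by rewrite sqr_sqrtr// qv_ge0.
  have M2 : `|M T w| ^+ 2 = M T w ^+ 2 by rewrite real_normK// num_real.
  rewrite s2q -M2; clearbody s; clear s2q; move: `|M T w| (Xi w) s => n x s'.
  have h1 : 4 * (x * n) <= 4^-1 * n ^+ 2 + 16 * x ^+ 2.
    rewrite -subr_ge0 (_ : _ - _ = 4^-1 * (n - 8 * x) ^+ 2); last by field.
    by rewrite mulr_ge0// sqr_ge0.
  have h2 : 4 * (1 + kap) * (x * s') <= (16 * E)^-1 * s' ^+ 2 + 4 * (1 + kap) ^+ 2 * (16 * E) * x ^+ 2.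
    rewrite -subr_ge0 (_ : _ - _ = (16 * E)^-1 * (s' - 2 * (1 + kap) * (16 * E) * x) ^+ 2).
      by rewrite mulr_ge0 ?sqr_ge0// invr_ge0 mulr_ge0// ltW.
    by field; rewrite gt_eqF.
  have h3 : 8 * (kap * x) <= 4 * kap * (x ^+ 2 + 1).
    rewrite -subr_ge0 (_ : _ - _ = 4 * kap * (x - 1) ^+ 2); last by ring.
    by rewrite mulr_ge0 ?sqr_ge0// mulr_ge0.
  have h4 : 0 <= 4 * (1 + kap) ^+ 2 * (16 * E).
    by apply: mulr_ge0; apply: mulr_ge0; rewrite ?sqr_ge0// ltW.
  move: h1 h2 h3 h4; rewrite /Cd.
  by move: (4 * (1 + kap) ^+ 2 * (16 * E)) (16 * E)^-1 => u v h1 h2 h3 h4; nra.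
have := le_trans meanM2_le h.
rewrite (meanD (summableD s1 s2) s3) (meanD s1 s2) (meanZ _ (sM2 T0 (lexx T))) (meanZ _ sq_).
rewrite (meanZ _ (summableD sXi2 (summable_cst P 1))) (meanD sXi2 (summable_cst P 1)) expectation_cst => h1.
have h2 : (16 * E)^-1 * \mean[P]_w qv Z 0 T w <= 4^-1 * \mean[P]_w (M T w ^+ 2).
  rewrite ler_pdivrMl; last by rewrite mulr_gt0.
  by apply: (le_trans energy); rewrite /E mulrCA -mulrA [leRHS]mulrA mulrA; lra.
rewrite /D /energy_bound -/E -/Cd -mulrA; move: h1 h2.
move: (Cd * _) (_^-1 * \mean[P]_w qv _ _ _ _) (\mean[P]_w (M _ _ ^+ 2)) => p q r; lra.
Qed.

Lemma exp_bsde_energy : \mean[P]_w qv Z 0 T w <= 4 * expR c * D.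
Proof. by apply: (le_trans energy); rewrite ler_pM2l ?mulr_gt0 ?expR_gt0//; exact: meanM2_bound. Qed.

(** The equation is solved for its penalty: [alpha / 2] times the integrated squared distance equals
    the integral of the generator plus terms controlled by the energy estimates. Hence the factor
    [alpha^-1]. *)
Lemma exp_bsde_dist : summable_rv P (dist_int (fun t w => Z t w + alpha^-1 *: theta t w)) /\
  \mean[P]_w dist_int (fun t w => Z t w + alpha^-1 *: theta t w) w <=
  alpha^-1 * (2 * (D + \mean[P]_w (Xi w ^+ 2) + 2 + 2 * expR c * D + kap)).
Proof.
set z := fun t w => _.
have pz : pred z by apply: (predictable_mxD hT) => //; exact: (predictable_mxZ hT).
have pd : pm (fun t w => edistance (K t w) (z t w) ^+ 2).
  have pd1 : pm (fun t w => edistance (K t w) (z t w)) by exact: (pmeas_edistance hT).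
  by apply: (eq_pmeas _ (pmeasM pd1 pd1)) => t w; rewrite expr2.
have mD : measurable_fun setT (dist_int z).
  apply: (meas_wrt_measurable hPc hB (lexx T)).
  exact: (meas_wrt_time_integral hT (lexx 0) (lexx T) T0 (lexx T) pd).
pose X w := (M T w ^+ 2 + 1) + (Xi w ^+ 2 + 1) + 2^-1 * qv Z 0 T w + kap.
have s1 := summableD (sM2 T0 (lexx T)) (summable_cst P 1).
have s2 := summableD sXi2 (summable_cst P 1).
have s3 := summableZ 2^-1 (M2_summable hPc hT hB MZ).
have sX := summableD (summableD (summableD s1 s2) s3) (summable_cst P kap) : summable_rv P X.
have D0 w : 0 <= dist_int z w by apply: Rintegral_ge0 => // u _; exact: sqr_ge0.
have key : {ae P, forall w, dist_int z w <= 2 * alpha^-1 * X w}.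
  apply: filterS3 (ae_and exp_bsde_incr (Y_le (lexx 0) T0)) (ae_and (Y_le T0 (lexx T)) (qth (lexx 0) T0 (lexx T)))
    (ae_and fZ fth) => w [Yi Y0] [YT qK] [fw ft].
  have i1 := sq_vdot_integrable hT pZ pth fw ft; have i2 := sq_vdot_integrable hT pth pth ft ft.
  have i3 := gen_integrable a0 pZ fw ft.
  have mT : measurable (`[0, T]%classic : set (measurableTypeR R)) by [].
  have DE : dist_int z w = 2 * alpha^-1 * (gen_int alpha Z 0 T w + time_dot Z theta 0 T w +
      (2 * alpha)^-1 * qv theta 0 T w).
    rewrite qvE time_dotE /gen_int -(RintegralZl _ mT i2) -(RintegralD mT i3 i1).
    rewrite -(RintegralD mT (integrable_EFinD mT i3 i1) (integrable_EFinZ mT _ i2)).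
    rewrite -(RintegralZl _ mT); last exact: (integrable_EFinD mT (integrable_EFinD mT i3 i1) (integrable_EFinZ mT _ i2)).
    apply: eq_Rintegral => u _; rewrite /generator sqr_enorm -/(z u w).
    by field; rewrite gt_eqF.
  rewrite DE; apply: ler_wpM2l; first by rewrite mulr_ge0// invr_ge0 ltW.
  have := Yi 0 T (lexx 0) T0 (lexx T); rewrite -/(M T w) => YE.
  have td2 := time_dot_sq_le hT pZ pth fw ft (lexx 0) (lexx T).
  have q0 := qv_ge0 Z 0 T w; have t0 := qv_ge0 theta 0 T w.
  have ai : (2 * alpha)^-1 <= 2^-1 by rewrite lef_pV2 ?posrE ?mulr_gt0// ler_peMr.
  have td_le : time_dot Z theta 0 T w <= 2^-1 * (qv Z 0 T w + kap).
    rewrite -(@ler_pM2l _ 2)// [leRHS]mulrA divff// mul1r; apply: le_of_sqr_le; first exact: addr_ge0.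
    apply: (@le_trans _ _ (4 * (qv Z 0 T w * kap))).
      rewrite exprMn (_ : 2 ^+ 2 = 4 :> R); last by ring.
      by rewrite ler_pM2l//; apply: (le_trans td2); rewrite ler_wpM2l.
    rewrite -subr_ge0 (_ : _ - _ = (qv Z 0 T w - kap) ^+ 2) ?sqr_ge0//; ring.
  have b1 : (2 * alpha)^-1 * qv theta 0 T w <= 2^-1 * kap.
    by apply: (le_trans (ler_wpM2r t0 ai)); rewrite ler_pM2l.
  have n1 : 0 <= (M T w - 2^-1) ^+ 2 by exact: sqr_ge0.
  have n2 : 0 <= (Xi w - 1) ^+ 2 by exact: sqr_ge0.
  move: YT Y0 => /ler_normlP[YT1 YT2] /ler_normlP[Y01 Y02].
  rewrite /X; move: YE td_le b1 n1 n2.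
  move: (gen_int _ _ _ _ _) (time_dot _ _ _ _ _) (_^-1 * qv theta _ _ _) => g td q YE td_le b1 n1 n2.
  by nra.
have sD : summable_rv P (dist_int z).
  apply: (summable_le_as mD (summableZ (2 * alpha^-1) sX)).
  by apply: filterS key => w; rewrite ger0_norm.
split=> //; apply: (le_trans (expectation_le_as sD (summableZ _ sX) key)).
rewrite (meanZ _ sX) (mulrC 2 alpha^-1) -[leLHS]mulrA ler_pM2l ?invr_gt0// ler_pM2l//.
rewrite /X (meanD (summableD (summableD s1 s2) s3) (summable_cst P _)) (meanD (summableD s1 s2) s3) (meanD s1 s2).
rewrite (meanD (sM2 T0 (lexx T)) (summable_cst P 1)) (meanD sXi2 (summable_cst P 1)) !expectation_cst.
rewrite meanZ; last exact: (M2_summable hPc hT hB MZ).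
have := exp_bsde_energy; have := meanM2_bound; lra.
Qed.

End apriori.

End solution.

Lemma exp_bsde_ito alpha Y Z : exp_bsde P T B b sigma C alpha F Y Z ->
  exists2 I, ito Z I & as_all P T (fun t w => Y t w = F w + gen_int alpha Z t T w - (I T w - I t w)).
Proof. by case. Qed.

(** * The integrated distance to the constraints, and domination by constrained solutions *)

Let T0 : 0 <= T. Proof. exact: ltW. Qed.
Local Notation kap := (Kth ^+ 2 * T).
Let kap0 : 0 <= kap. Proof. by rewrite mulr_ge0 ?sqr_ge0. Qed.
Let mT : measurable (`[0, T]%classic : set (measurableTypeR R)). Proof. by []. Qed.

Lemma pmeas_dist_sq z : pred z -> pm (fun t w => edistance (K t w) (z t w) ^+ 2).
Proof.
move=> pz; have pd1 : pm (fun t w => edistance (K t w) (z t w)) by exact: (pmeas_edistance hT).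
by apply: (eq_pmeas _ (pmeasM pd1 pd1)) => t w; rewrite expr2.
Qed.

Lemma dist_sq_le t w (x : 'cV[R]_m) : edistance (K t w) x ^+ 2 <= vdot x x.
Proof.
rewrite -sqr_enorm ler_sqr ?nnegrE ?enorm_ge0//.
  have := edistance_le x (constraint_image0 sigma hC0 t w); rewrite subr0; exact.
exact: edistance_ge0 (constraint_image_nonempty sigma hC0 t w) _.
Qed.

Lemma dist_sq_integrable z w : pred z -> (sq z w < +oo)%E ->
  mu.-integrable `[0, T] (EFin \o (fun t => edistance (K t w) (z t w) ^+ 2)).
Proof.
move=> pz fz; apply: (integrable_EFin_le mT _ (sq_vdot_integrable hT pz pz fz fz)).
  exact: (pmeas_section hT w (pmeas_dist_sq pz)).
by move=> t _; rewrite ger0_norm ?sqr_ge0//; exact: dist_sq_le.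
Qed.

Lemma dist_int_ge0 z w : 0 <= dist_int z w.
Proof. by apply: Rintegral_ge0 => // t _; exact: sqr_ge0. Qed.

Lemma measurable_dist_int z : pred z -> measurable_fun setT (dist_int z).
Proof.
move=> pz; apply: (meas_wrt_measurable hPc hB (lexx T)).
exact: (meas_wrt_time_integral hT (lexx 0) (lexx T) T0 (lexx T) (pmeas_dist_sq pz)).
Qed.

Lemma le_Rintegral_time (f g : R -> R) : mu.-integrable `[0, T] (EFin \o f) ->
  mu.-integrable `[0, T] (EFin \o g) -> (forall t, f t <= g t) ->
  \int[mu]_(u in `[0, T]) f u <= \int[mu]_(u in `[0, T]) g u.
Proof.
move=> iF iG fg; apply: (le_Rintegral_ae (lexx 0) (lexx T) iF iG).
by apply: (ae_time_mono (Q := fun=> True)) (aeW _ (fun=> I)) => u _ _; exact: fg.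
Qed.

Lemma summable_dist_int z : M2 P T Fil z -> summable_rv P (dist_int z).
Proof.
move=> Mz; have pz := proj1 Mz; have fz := M2_finite hPc hT hB Mz.
apply: (summable_le_as (measurable_dist_int pz) (M2_summable hPc hT hB Mz)).
apply: filterS fz => w fw; rewrite ger0_norm ?dist_int_ge0// qvE.
apply: (le_Rintegral_time (dist_sq_integrable pz fw) (sq_vdot_integrable hT pz pz fw fw)).
by move=> t; exact: dist_sq_le.
Qed.

Lemma dist_int_le z z' w : pred z -> pred z' -> (sq z w < +oo)%E -> (sq z' w < +oo)%E ->
  dist_int z w <= 2 * dist_int z' w + 2 * qv (fun t w => z t w - z' t w) 0 T w.
Proof.
move=> pz pz' fz fz'; have pd := predictable_mxB hT pz pz'; have fd := sq_subtr_finite hT pz pz' fz fz'.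
have i1 := dist_sq_integrable pz' fz'; have i2 := sq_vdot_integrable hT pd pd fd fd.
rewrite qvE -(RintegralZl _ mT i1) -(RintegralZl _ mT i2).
rewrite -(RintegralD mT (integrable_EFinZ mT _ i1) (integrable_EFinZ mT _ i2)).
apply: le_Rintegral_time; first exact: dist_sq_integrable.
  by apply: integrable_EFinD => //; exact: integrable_EFinZ.
move=> t; rewrite -sqr_enorm.
have Kn := constraint_image_nonempty sigma hC0 t w.
have h0 := edistance_ge0 Kn (z t w); have h1 := edistance_lip Kn (z t w) (z' t w).
have h2 := edistance_ge0 Kn (z' t w); have h3 := enorm_ge0 (z t w - z' t w).
move: h0 h1 h2 h3; move: (edistance _ _) (edistance _ _) (enorm _) => y x e h0 h1 h2 h3.
have : x ^+ 2 <= (y + e) ^+ 2 by rewrite ler_sqr ?nnegrE// addr_ge0.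
have : 0 <= (y - e) ^+ 2 by exact: sqr_ge0.
nra.
Qed.

Variable hCmid : forall x y, C x -> C y -> C (2^-1 *: (x + y)).

Lemma constraint_mid t w x y : K t w x -> K t w y -> K t w (2^-1 *: (x + y)).
Proof.
by move=> [p Cp <-] [q Cq <-]; exists (2^-1 *: (p + q)); [exact: hCmid|rewrite -scalemxAr mulmxDr].
Qed.

Lemma dist_int_mid z z' w : pred z -> pred z' -> (sq z w < +oo)%E -> (sq z' w < +oo)%E ->
  (sq (fun t w => (2^-1 *: z t w + 2^-1 *: z' t w)%R) w < +oo)%E ->
  dist_int (fun t w => 2^-1 *: z t w + 2^-1 *: z' t w) w <= 2^-1 * (dist_int z w + dist_int z' w).
Proof.
move=> pz pz' fz fz' fm.
have pm_ := predictable_mxD hT (predictable_mxZ hT 2^-1 pz) (predictable_mxZ hT 2^-1 pz').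
have i1 := dist_sq_integrable pz fz; have i2 := dist_sq_integrable pz' fz'.
rewrite -(RintegralD mT i1 i2) -(RintegralZl _ mT (integrable_EFinD mT i1 i2)).
apply: le_Rintegral_time; first exact: (dist_sq_integrable pm_ fm).
  by apply: integrable_EFinZ => //; exact: integrable_EFinD.
move=> t; have Kn := constraint_image_nonempty sigma hC0 t w.
have := edistance_mid Kn (@constraint_mid t w) (z t w) (z' t w); rewrite scalerDr.
have := edistance_ge0 Kn (2^-1 *: z t w + 2^-1 *: z' t w).
move: (edistance _ _) (edistance _ _) (edistance _ _) => x y e h0 h1.
have : e ^+ 2 <= (2^-1 * (y + x)) ^+ 2 by rewrite ler_sqr ?nnegrE// (le_trans h0).
have : 0 <= (y - x) ^+ 2 by exact: sqr_ge0.
nra.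
Qed.

Hypotheses (hC_closed : closed C)
  (hsigma_inv : as_ae P T (fun t w => sigma t w *m (sigma t w)^T \in unitmx)).

(** When [sigma sigma^T] is invertible, [sigma^T] has the left inverse [L]. Near-best points [q] of
    [C] are then close to [L *m x], which lies in [C] by closedness and is mapped to [x]. *)
Lemma constraint_image_closed t w (x : 'cV[R]_m) : sigma t w *m (sigma t w)^T \in unitmx ->
  edistance (K t w) x = 0 -> K t w x.
Proof.
move=> su d0_; set s := sigma t w.
have Kn := constraint_image_nonempty sigma hC0 t w.
pose L := invmx (s *m s^T) *m s; pose p := L *m x.
have LK q : L *m (s^T *m q) = q by rewrite /L -!mulmxA (mulmxA s) mulKmx.
have [M M0 hM] := enorm_mulmx_le L; have [M' M'0 hM'] := enorm_mulmx_le s^T.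
have near_ e : 0 < e -> exists2 q, C q & enorm (x - s^T *m q) < e.
  move=> e0; have [_ [q Cq <-]] := edistance_adherent Kn x e0; rewrite d0_ add0r => h.
  by exists q.
have pq q : enorm (p - q) <= M * enorm (x - s^T *m q).
  by rewrite -{1}(LK _ q) /p -mulmxBr.
have Cp : C p.
  apply: hC_closed => U /nbhs_ballP[e e0 he].
  have e1 : 0 < e / (1 + M) by rewrite divr_gt0//; lra.
  have [q Cq hq] := near_ _ e1; exists q; split=> //; apply: he; split=> // i j.
  rewrite /ball/= (ord1 j).
  have h1 : enorm (p - q) < e.
    apply: (le_lt_trans (pq q)); move: hq; rewrite ltr_pdivlMr; last lra.
    by have := enorm_ge0 (x - s^T *m q); move: (enorm _) => y y0 hq; nra.
  apply: le_lt_trans h1; rewrite -ler_sqr ?nnegrE ?enorm_ge0//.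
  rewrite real_normK ?num_real// sqr_enorm vdotE (bigD1 i)//= !mxE expr2 lerDl.
  by apply: sumr_ge0 => l _; rewrite -expr2 sqr_ge0.
exists p => //; apply/eqP; rewrite eq_sym -subr_eq0; apply/eqP/vdot_eq0; rewrite -sqr_enorm.
suff -> : enorm (x - s^T *m p) = 0 by rewrite expr2 mul0r.
apply/le_anti; rewrite enorm_ge0 andbT; apply/ler_addgt0Pr => e e0; rewrite add0r.
have e1 : 0 < e / (1 + M' * M) by rewrite divr_gt0//; have := mulr_ge0 M'0 M0; lra.
have [q Cq hq] := near_ _ e1.
have -> : x - s^T *m p = (x - s^T *m q) + s^T *m (q - p) by rewrite mulmxBr addrA subrK.
apply: (le_trans (enormD _ _)).
have h1 : enorm (s^T *m (q - p)) <= M' * (M * enorm (x - s^T *m q)).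
  by apply: (le_trans (hM' _)); rewrite ler_wpM2l// -enormN opprB.
have MM := mulr_ge0 M'0 M0.
move: hq; rewrite ltr_pdivlMr; last lra.
by rewrite mulrA in h1; move: h1; move: (enorm _) (enorm _) (M' * M) => u v c; nra.
Qed.

Lemma dist_int_eq0 z : M2 P T Fil z -> \mean[P]_w dist_int z w <= 0 ->
  as_ae P T (fun t w => K t w (z t w)).
Proof.
move=> Mz m0; have pz := proj1 Mz.
have e0 := expectation_eq0 (summable_dist_int Mz) (dist_int_ge0 z) m0.
apply: filterS3 e0 (M2_finite hPc hT hB Mz) hsigma_inv => w dw fw su.
have i1 := dist_sq_integrable pz fw.
have ge0 t : (0 <= (edistance (K t w) (z t w) ^+ 2)%:E)%E by rewrite lee_fin sqr_ge0.
have mz := pmeas_section hT w (pmeas_dist_sq pz).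
have i0 : (\int[mu]_(t in `[0%R, T]) `|(edistance (K t w) (z t w) ^+ 2)%:E| = 0)%E.
  under eq_integral do rewrite gee0_abs//.
  have := integrable_fin_num mT i1; move=> fi; rewrite -[LHS](fineK fi).
  by rewrite -[fine _]/(dist_int z w) dw.
have /ae_eq_integral_abs h := i0.
have {}h : {ae mu, forall t, `[0, T]%classic t -> (edistance (K t w) (z t w) ^+ 2)%:E = 0%E}.
  by apply: h => //; exact/measurable_EFinP.
apply: ae_time_mono2 h su => t h su tT; apply: constraint_image_closed; first exact: su.
have [h'] := h tT; apply/eqP; rewrite -sqrf_eq0; exact/eqP.
Qed.

(** A solution of the constrained equation is the portfolio of [H'] minus an increasing process, so
    from time [t] on the portfolio started from [C' t] ends above [F], and comparison applies. *)
Lemma solution_dominates C' H' A' alpha Y Z t : 0 < alpha -> exp_bsde P T B b sigma C alpha F Y Z ->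
  constrained_bsde P T B b sigma C F C' H' A' -> 0 <= t -> t <= T ->
  {ae P, forall w, Y t w <= C' t w}.
Proof.
move=> a0 hYZ [[[aC _ _] MH _] Amono [J iJ hC'] HK] t0 tT.
have [I iI hI] := exp_bsde_ito hYZ.
apply: (exp_bsde_comparison a0 hYZ iI hI t0 tT _ iJ MH HK).
  by apply: aC; rewrite in_itv/= t0.
apply: filterS2 (as_all_at hC' t0 tT) Amono => w -> /(_ t T t0 tT (lexx T)) At.
rewrite gincrE time_dotE; move: (\int[_]_(_ in _) _) => x; lra.
Qed.

Lemma S2_dominated Yc : S2 P T Fil Yc -> exists X : Om -> R, [/\ measurable_fun setT X, forall w, 0 <= X w,
  summable_rv P (fun w => X w ^+ 2) &
  {ae P, forall w t, 0 <= t -> t <= T -> `|Yc t w| <= X w}].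
Proof.
move=> [aY cY iY].
pose S w := ereal_sup [set (`|Yc t w ^+ 2|)%:E | t in `[0%R, T]].
have SE w : S w = ereal_sup [set (`|Yc t w| ^+ 2)%:E | t in `[0%R, T]].
  by congr ereal_sup; apply: eq_imagel => t _; rewrite normrX.
have mS : measurable_fun setT S.
  apply: (measurable_sup_norm hT hPc) => [t tT|].
    apply: measurable_funX; move: (tT); rewrite in_itv/= => /andP[t0 tT'].
    exact: (meas_wrt_measurable hPc hB tT' (aY t tT)).
  apply: filterS cY => w [rc _] t t0 tT; rewrite expr2; under eq_fun do rewrite expr2.
  by apply: cvgM; exact: rc.
have S0 w : (0 <= S w)%E.
  apply: (@le_trans _ _ (`|Yc 0 w ^+ 2|)%:E); first by rewrite lee_fin.
  by apply: ereal_sup_ubound; exists 0 => //=; rewrite in_itv/= lexx ltW.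
have iS : (\int[P]_w S w < +oo)%E by under eq_integral do rewrite SE.
have finS : {ae P, forall w, S w \is a fin_num}.
  have : P.-integrable setT S.
    by apply/integrableP; split; [exact: mS|under eq_integral do rewrite gee0_abs//].
  by move/(integrable_ae measurableT); apply: filterS => w; apply.
have mf : measurable_fun setT (fun w => fine (S w)) by exact: measurableT_comp.
have f0 w : 0 <= fine (S w) by exact: fine_ge0.
exists (fun w => Num.sqrt (fine (S w))); split.
- exact: measurable_sqrt_comp.
- by move=> w; exact: sqrtr_ge0.
- apply: (eq_summable (f := fun w => fine (S w))) => [w|]; first by rewrite sqr_sqrtr.
  apply/summableP; apply: integrable_EFin_ge0 => //.
  apply: le_lt_trans iS; apply: ge0_le_integral => //.
  + by move=> w _; rewrite lee_fin.
  + exact/measurable_EFinP.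
  by move=> w _; case: (S w) (S0 w) => [r|_|]//=; rewrite leey.
apply: filterS finS => w fw t t0 tT.
rewrite -(@ler_sqr _ `|Yc t w|) ?nnegrE ?sqrtr_ge0// sqr_sqrtr// -lee_fin fineK// SE.
by apply: ereal_sup_ubound; exists t => //=; rewrite in_itv/= t0.
Qed.

(** * The minimal solution *)

Section construction.
Variables (al : nat -> R) (hal : forall n, n.+1%:R <= al n)
  (y : nat -> R -> Om -> R) (zz : nat -> R -> Om -> 'cV[R]_m)
  (hy : forall n, exp_bsde P T B b sigma C (al n) F (y n) (zz n))
  (Iz : nat -> R -> Om -> R) (iIz : forall n, ito (zz n) (Iz n))
  (hIz : forall n, as_all P T (fun t w => y n t w =
     F w + gen_int (al n) (zz n) t T w - (Iz n T w - Iz n t w)))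
  (Cb : R -> Om -> R) (Hb : R -> Om -> 'cV[R]_m) (Ab : R -> Om -> R)
  (hb_sol : constrained_bsde P T B b sigma C F Cb Hb Ab)
  (Xb : Om -> R) (mXb : measurable_fun setT Xb) (Xb0 : forall w, 0 <= Xb w)
  (sXb2 : summable_rv P (fun w => Xb w ^+ 2))
  (hXb : {ae P, forall w t, 0 <= t -> t <= T -> `|Cb t w| <= Xb w})
  (cb : R) (hcb : {ae P, forall w, Cb 0 w = cb}).

Let al1 n : 1 <= al n.
Proof. by apply: le_trans (hal n); rewrite ler1n. Qed.
Let al0 n : 0 < al n. Proof. exact: lt_le_trans ltr01 (al1 n). Qed.
Let ali n : (al n)^-1 <= n.+1%:R^-1.
Proof. by rewrite lef_pV2 ?posrE ?ltr0n. Qed.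
Let al2 n : (2 * al n)^-1 <= 2^-1.
Proof. by rewrite lef_pV2 ?posrE ?mulr_gt0// ler_peMr. Qed.

Definition lower_bound := k + kap / 2.
Local Notation k' := lower_bound.
Let k'0 : 0 <= k'. Proof. by rewrite addr_ge0// divr_ge0. Qed.

Let y_le n t : 0 <= t -> t <= T -> {ae P, forall w, y n t w <= Cb t w}.
Proof. exact: (solution_dominates (al0 n) (hy n) hb_sol). Qed.

Let y_ge n t : 0 <= t -> t <= T -> {ae P, forall w, - k' <= y n t w}.
Proof.
move=> t0 tT; apply: filterS (exp_bsde_ge (al0 n) (hy n) (iIz n) (hIz n) t0 tT) => w.
apply: le_trans; rewrite lerN2 lerD2l mulrC ler_wpM2l//.
Qed.

Let Xi w := k' + Xb w.
Let mXi : measurable_fun setT Xi. Proof. exact: measurable_funD. Qed.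
Let Xi0 w : 0 <= Xi w. Proof. exact: addr_ge0. Qed.
Let sXi2 : summable_rv P (fun w => Xi w ^+ 2).
Proof. by apply: summable_sqD => //; exact: summable_cst. Qed.
Let y_norm n t : 0 <= t -> t <= T -> {ae P, forall w, `|y n t w| <= Xi w}.
Proof.
move=> t0 tT; apply: filterS3 (y_le n t0 tT) (y_ge n t0 tT) hXb => w h1 h2 /(_ t t0 tT) /ler_normlP[h3 h4].
by have := Xb0 w; have := k'0; rewrite ler_norml /Xi => ? ?; apply/andP; split; lra.
Qed.
Let y0_le n : {ae P, forall w, y n 0 w <= cb}.
Proof. by apply: filterS2 (y_le n (lexx 0) T0) hcb => w h <-. Qed.

Let Mzz n : M2 P T Fil (zz n). Proof. exact: (exp_bsde_M2 (hy n)). Qed.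

(** The a priori bound on the distance concerns [zz n] shifted by [theta] over [al n]. Removing the
    shift costs a term of order [(al n)^-1], because [theta] has bounded energy. *)
Lemma approximations_bounded : exists2 Cq, 0 <= Cq & forall n,
  \mean[P]_w qv (zz n) 0 T w <= Cq /\ \mean[P]_w dist_int (zz n) w <= Cq / n.+1%:R.
Proof.
(* Opening the existential before [n] is introduced forces a bound common to all [n]: every [y n] is
   dominated by the same [Xi] and starts below the same [cb]. *)
have [c1 E] : exists c1, forall n, \mean[P]_w qv (zz n) 0 T w <= c1.
  by eexists => n; exact: (exp_bsde_energy (al0 n) (hy n) (iIz n) (hIz n) mXi Xi0 sXi2 (al1 n) (@y_norm n) (y0_le n)).
have [c2 D] : exists c2, forall n, summable_rv P (dist_int (fun t w => zz n t w + (al n)^-1 *: theta t w)) /\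
    \mean[P]_w dist_int (fun t w => zz n t w + (al n)^-1 *: theta t w) w <= (al n)^-1 * c2.
  by eexists => n; exact: (exp_bsde_dist (al0 n) (hy n) (iIz n) (hIz n) mXi Xi0 sXi2 (al1 n) (@y_norm n) (y0_le n)).
have c1_0 : 0 <= c1 by apply: le_trans (E 0%N); apply: mean_ge0 => w; exact: qv_ge0.
have c2_0 : 0 <= c2.
  have [_ h] := D 0%N; rewrite -(pmulr_rge0 _ (x := (al 0%N)^-1)) ?invr_gt0//.
  by apply: le_trans h; apply: mean_ge0 => w; exact: dist_int_ge0.
exists (c1 + (2 * c2 + 2 * kap)); first by rewrite !addr_ge0// mulr_ge0.
move=> n; split; first by apply: (le_trans (E n)); rewrite lerDl addr_ge0// mulr_ge0.
have [sD hD] := D n.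
have pz := proj1 (Mzz n); have fz := M2_finite hPc hT hB (Mzz n).
have pz' : pred (fun t w => zz n t w + (al n)^-1 *: theta t w).
  by apply: (predictable_mxD hT) => //; exact: (predictable_mxZ hT).
have key : {ae P, forall w, dist_int (zz n) w <=
    2 * dist_int (fun t w => zz n t w + (al n)^-1 *: theta t w) w + 2 * (kap * (al n)^-1)}.
  apply: filterS3 fz fth (qv_theta_le hT iTh theta_sq_le (lexx 0) T0 (lexx T)) => w fw ft qt.
  have fz' : (sq (fun t w => (zz n t w + (al n)^-1 *: theta t w)%R) w < +oo)%E.
    have := sq_lincomb hT 1 (al n)^-1 w pz pth.
    rewrite (_ : (fun s w => (1 *: zz n s w + _)%R) = (fun t w => (zz n t w + (al n)^-1 *: theta t w)%R)).
      by move=> /le_lt_trans; apply; rewrite (sq_qv fw) (sq_qv ft) -!EFinM -EFinD ltry.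
    by apply/funext => s; apply/funext => v; rewrite scale1r.
  apply: (le_trans (dist_int_le pz pz' fw fz')); rewrite lerD2l ler_pM2l//.
  rewrite (_ : (fun t w => zz n t w - _) = (fun t w => (- (al n)^-1) *: theta t w)); last first.
    by apply/funext => s; apply/funext => v; rewrite opprD addrA subrr add0r scaleNr.
  rewrite (qv_scale hT _ pth ft (lexx 0) (lexx T)) sqrrN mulrC expr2 mulrA.
  have i0 : 0 <= (al n)^-1 by rewrite invr_ge0 ltW.
  have i1 : (al n)^-1 <= 1 by rewrite invf_le1.
  apply: ler_wpM2r => //; apply: le_trans (ler_wpM2r i0 qt) _.
  by rewrite ler_piMr.
have h := expectation_le_as (summable_dist_int (Mzz n))
  (summableD (summableZ 2 sD) (summable_cst P (2 * (kap * (al n)^-1)))) key.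
apply: (le_trans h); rewrite meanD//; [|exact: summableZ|exact: summable_cst].
rewrite meanZ// expectation_cst.
apply: (@le_trans _ _ ((2 * c2 + 2 * kap) * (al n)^-1)).
  by rewrite [leRHS]mulrDl -[X in _ <= X + _]mulrA -[X in _ <= _ + X]mulrA lerD2r ler_pM2l// mulrC.
apply: (@le_trans _ _ ((2 * c2 + 2 * kap) * n.+1%:R^-1)).
  by apply: ler_wpM2l => //; rewrite addr_ge0// mulr_ge0.
by apply: ler_wpM2r; rewrite ?invr_ge0// lerDr.
Qed.

(** The candidate for the minimal value, taken over the whole sequence since no order between the
    [y n] is known. It is junk where the supremum is infinite, which [sup_priceP] excludes almost
    surely at each time. *)
Definition sup_price t w : R := fine (ereal_sup (range (fun n => (y n t w)%:E))).

Lemma sup_priceP t : 0 <= t -> t <= T -> {ae P, forall w, (forall n, y n t w <= sup_price t w) /\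
  (forall c, (forall n, y n t w <= c) -> sup_price t w <= c)}.
Proof.
move=> t0 tT; have h := ae_foralln (fun n => y_le n t0 tT).
apply: filterS h => w hw; rewrite /sup_price; set s := ereal_sup _.
have le_s n : ((y n t w)%:E <= s)%E by apply: ereal_sup_ubound; exists n.
have s_le c : (forall n, y n t w <= c) -> (s <= c%:E)%E.
  by move=> hc; apply: ge_ereal_sup => _ [n _ <-]; rewrite lee_fin.
have fs : s \is a fin_num.
  rewrite fin_numElt (lt_le_trans _ (le_s 0%N)) ?ltNyr//=.
  exact: le_lt_trans (s_le _ hw) (ltry _).
by split=> [n|c hc]; rewrite -lee_fin fineK//; exact: s_le.
Qed.

Lemma sup_price_adapted t : 0 <= t -> t <= T -> meas_wrt (Fil t) (sup_price t).
Proof.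
move=> t0 tT; apply/meas_wrtP; apply: (measurableT_comp (f := fine)) => //.
set FT := g_sigma_algebraType _.
have := @measurable_fun_esups _ FT R setT (fun n w => (y n t w)%:E) _ 0%N.
rewrite /esups/=; under eq_fun do rewrite /sdrop/=.
rewrite (_ : [set n | (0 <= n)%N] = setT); last by apply/seteqP; split.
apply=> n; apply/measurable_EFinP; apply/meas_wrtP.
exact: (exp_bsde_adapted (hy n) t0 tT).
Qed.

Local Notation eps n := (kap / n.+1%:R).
Variables (Cq : R) (Cq0 : 0 <= Cq) (hCq : forall n, \mean[P]_w qv (zz n) 0 T w <= Cq /\
  \mean[P]_w dist_int (zz n) w <= Cq / n.+1%:R).

Let Cq1 : 0 < 1 + Cq. Proof. exact: ltr_wpDr. Qed.
Let kap1 : 0 < 1 + kap. Proof. exact: ltr_wpDr. Qed.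

(** The triple consists of an integrand, its integral and a value process; it superhedges up to
    [eps n] and meets the constraints up to [Cq / n.+1%:R]. The conditions are closed under
    midpoints and weaken as [n] decreases, as the selection requires. Keeping the value below
    [sup_price] is what later identifies its limit. *)
Record near_superhedge (n : nat) (v : (R -> Om -> 'cV[R]_m) * (R -> Om -> R) * (R -> Om -> R)) : Prop :=
  NearSuperhedge {
    nsh_ito : ito v.1.1 v.1.2;
    nsh_M2 : M2 P T Fil v.1.1;
    nsh_adapted : forall t, 0 <= t -> t <= T -> meas_wrt (Fil t) (v.2 t);
    nsh_final : {ae P, forall w, v.2 T w = F w};
    nsh_le : forall t, 0 <= t -> t <= T -> {ae P, forall w, v.2 t w <= sup_price t w};
    nsh_incr : forall s t, 0 <= s -> s <= t -> t <= T ->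
      {ae P, forall w, v.2 t w <= v.2 s w + gincr theta v.1.1 v.1.2 s t w + eps n};
    nsh_dist : \mean[P]_w dist_int v.1.1 w <= Cq / n.+1%:R }.

Let inv_dec n : (n.+2%:R : R)^-1 <= n.+1%:R^-1.
Proof. by rewrite lef_pV2 ?posrE ?ltr0n// ler_nat. Qed.

Lemma near_superhedge_dec n v : near_superhedge n.+1 v -> near_superhedge n v.
Proof.
case=> h1 h2 h3 h4 h5 h6 h7; apply: NearSuperhedge => //.
  move=> s t s0 st tT; apply: filterS (h6 s t s0 st tT) => w /le_trans; apply.
  by rewrite lerD2l ler_wpM2l.
by apply: (le_trans h7); rewrite ler_wpM2l.
Qed.

(** The error [eps n] pays for the term [(2 * al n)^-1] times the energy of [theta] in the lower
    bound of the generator. *)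
Lemma near_superhedge_exists n : near_superhedge n (zz n, Iz n, y n).
Proof.
apply: NearSuperhedge => /=.
- exact: iIz.
- exact: Mzz.
- by move=> t t0 tT; exact: (exp_bsde_adapted (hy n)).
- exact: (exp_bsde_final (hIz n)).
- by move=> t t0 tT; apply: filterS (sup_priceP t0 tT) => w [].
- move=> s t s0 st tT.
  apply: filterS3 (exp_bsde_incr (al0 n) (hy n) (iIz n) (hIz n)) (ae_and (M2_finite hPc hT hB (Mzz n)) fth)
    (qv_theta_le hT iTh theta_sq_le s0 st tT) => w /(_ s t s0 st tT) -> [fw ft] qt.
  have h := gen_int_ge (al0 n) (proj1 (Mzz n)) fw ft s0 tT.
  have e1 : (2 * al n)^-1 * qv theta s t w <= eps n.
    rewrite mulrC; apply: (@le_trans _ _ (kap * (2 * al n)^-1)).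
      by apply: ler_wpM2r qt; rewrite invr_ge0 mulr_ge0// ltW.
    apply: ler_wpM2l => //; rewrite lef_pV2 ?posrE ?ltr0n ?mulr_gt0//.
    by have := hal n; have := ltW (al0 n); lra.
  rewrite gincrE; move: h e1; move: (gen_int _ _ _ _ _) (_^-1 * qv _ _ _ _) (time_dot _ _ _ _ _) (eps n) => g q td e.
  by lra.
- by case: (hCq n).
Qed.

Definition midpoint (v v' : (R -> Om -> 'cV[R]_m) * (R -> Om -> R) * (R -> Om -> R)) :
    (R -> Om -> 'cV[R]_m) * (R -> Om -> R) * (R -> Om -> R) :=
  (fun t w => 2^-1 *: v.1.1 t w + 2^-1 *: v'.1.1 t w,
   fun t w => 2^-1 * v.1.2 t w + 2^-1 * v'.1.2 t w,
   fun t w => 2^-1 * v.2 t w + 2^-1 * v'.2 t w).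

Lemma mean_half_sum_le (f g : Om -> R) c : summable_rv P f -> summable_rv P g ->
  \mean[P]_w f w <= c -> \mean[P]_w g w <= c -> \mean[P]_w (2^-1 * (f w + g w)) <= c.
Proof. by move=> sf sg; rewrite (meanZ _ (summableD sf sg)) (meanD sf sg); exact: half_sum_le. Qed.

Lemma time_dot_lincomb (u v g : R -> Om -> 'cV[R]_m) a c s t w : pred u -> pred v -> pred g ->
  (sq u w < +oo)%E -> (sq v w < +oo)%E -> (sq g w < +oo)%E -> 0 <= s -> t <= T ->
  time_dot (fun t w => a *: u t w + c *: v t w) g s t w = a * time_dot u g s t w + c * time_dot v g s t w.
Proof.
move=> pu pv pg fu fv fg s0 tT.
have mI : measurable (`[s, t]%classic : set (measurableTypeR R)) by [].
have i1 := integrable_sub_itv s0 tT (sq_vdot_integrable hT pu pg fu fg).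
have i2 := integrable_sub_itv s0 tT (sq_vdot_integrable hT pv pg fv fg).
rewrite !time_dotE -(RintegralZl _ mI i1) -(RintegralZl _ mI i2).
rewrite -(RintegralD mI (integrable_EFinZ mI _ i1) (integrable_EFinZ mI _ i2)).
by apply: eq_Rintegral => x _; rewrite vdotDl !vdotZl.
Qed.

Lemma gincr_lincomb h J h' J' a c : ito h J -> ito h' J' -> {ae P, forall w s t, 0 <= s -> t <= T ->
  gincr theta (fun t w => a *: h t w + c *: h' t w) (fun t w => a * J t w + c * J' t w) s t w =
  a * gincr theta h J s t w + c * gincr theta h' J' s t w}.
Proof.
move=> [ph fh _ _ _] [ph' fh' _ _ _]; apply: filterS3 fh fh' fth => w f1 f2 f3 s t s0 tT.
by rewrite !gincrE (time_dot_lincomb a c ph ph' pth f1 f2 f3 s0 tT); ring.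
Qed.

Lemma near_superhedge_mid n v v' : near_superhedge n v -> near_superhedge n v' ->
  near_superhedge n (midpoint v v').
Proof.
case: v v' => -[z J] u [[z' J'] u'] [/= i1 M1 a1 f1 l1 e1 d1] [/= i2 M2_ a2 f2 l2 e2 d2].
have iM := ito_lincomb hPc hT hB 2^-1 2^-1 i1 i2.
have MM := M2_lincomb hPc hT hB 2^-1 2^-1 M1 M2_.
apply: NearSuperhedge => /=.
- exact: iM.
- exact: MM.
- by move=> t t0 tT; apply: meas_wrtD; apply: meas_wrtZ; [exact: a1|exact: a2].
- by apply: filterS2 f1 f2 => w -> ->; lra.
- by move=> t t0 tT; apply: filterS2 (l1 t t0 tT) (l2 t t0 tT) => w; lra.
- move=> s t s0 st tT.
  apply: filterS3 (e1 s t s0 st tT) (e2 s t s0 st tT) (gincr_lincomb 2^-1 2^-1 i1 i2).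
  move=> w + + /(_ s t s0 tT) ->.
  move: (gincr _ _ _ _ _ _) (gincr _ _ _ _ _ _) (eps n) => g g' e h1 h2; lra.
have sd := summable_dist_int M1; have sd' := summable_dist_int M2_.
have h : {ae P, forall w, dist_int (fun t w => 2^-1 *: z t w + 2^-1 *: z' t w) w <=
    2^-1 * (dist_int z w + dist_int z' w)}.
  apply: filterS3 (M2_finite hPc hT hB M1) (M2_finite hPc hT hB M2_) (M2_finite hPc hT hB MM) => w q1 q2 q3.
  exact: (dist_int_mid (proj1 M1) (proj1 M2_) q1 q2 q3).
apply: (le_trans (expectation_le_as (summable_dist_int MM) (summableZ 2^-1 (summableD sd sd')) h)).
exact: mean_half_sum_le sd sd' d1 d2.
Qed.

Lemma mean_qv_parallelogram (h h' : R -> Om -> 'cV[R]_m) : M2 P T Fil h -> M2 P T Fil h' ->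
  \mean[P]_w qv (fun t w => h' t w - h t w) 0 T w =
  2 * \mean[P]_w qv h 0 T w + 2 * \mean[P]_w qv h' 0 T w -
  4 * \mean[P]_w qv (fun t w => 2^-1 *: h t w + 2^-1 *: h' t w) 0 T w.
Proof.
move=> Mh Mh'; have s1 := M2_summable hPc hT hB Mh; have s2 := M2_summable hPc hT hB Mh'.
have MM := M2_lincomb hPc hT hB 2^-1 2^-1 Mh Mh'; have s3 := M2_summable hPc hT hB MM.
have s4 := M2_summable hPc hT hB (M2B hPc hT hB Mh' Mh).
rewrite -(meanZ _ s1) -(meanZ _ s2) -(meanZ _ s3) -(meanD (summableZ _ s1) (summableZ _ s2)).
rewrite -(meanB (summableD (summableZ _ s1) (summableZ _ s2)) (summableZ _ s3)).
apply: expectation_as_eq => //.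
  by apply: summableB; [apply: summableD|]; exact: summableZ.
apply: filterS2 (M2_finite hPc hT hB Mh) (M2_finite hPc hT hB Mh') => w f1 f2.
rewrite (qv_lincomb hT 2^-1 2^-1 (proj1 Mh) (proj1 Mh') f1 f2 (lexx 0) (lexx T)).
have := qv_lincomb hT 1 (-1) (proj1 Mh') (proj1 Mh) f2 f1 (lexx 0) (lexx T).
rewrite (_ : (fun t w => 1 *: h' t w + -1 *: h t w) = (fun t w => h' t w - h t w)); last first.
  by apply/funext => t; apply/funext => v; rewrite scale1r scaleN1r.
by move=> ->; rewrite (time_dotC h' h); field.
Qed.

Lemma near_superhedge_select : exists2 v : nat -> (R -> Om -> 'cV[R]_m) * (R -> Om -> R) * (R -> Om -> R),
  forall n, near_superhedge n (v n) &
  forall n, \mean[P]_w qv (fun t w => (v n.+1).1.1 t w - (v n).1.1 t w) 0 T w <= rate R n ^+ 3 / 4.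
Proof.
(* The selection bounds the energy of a difference by 8 times this quantity, which is the
   [rate R n ^+ 3 / 4] demanded for convergence of the integrals. *)
have r0 n : 0 < rate R n ^+ 3 / 32 by rewrite divr_gt0// exprn_gt0// rate_gt0.
have [||||||v hv dv] := hilbert_selection (G := near_superhedge) (cost := fun v => \mean[P]_w qv v.1.1 0 T w)
  (mid := midpoint) (M := Cq) (eta := fun n => rate R n ^+ 3 / 32).
- exact: near_superhedge_dec.
- exact: near_superhedge_mid.
- by move=> v; apply: mean_ge0 => w; exact: qv_ge0.
- by move=> n; exists (zz n, Iz n, y n); [exact: near_superhedge_exists|case: (hCq n)].
- exact: r0.
- move=> n; rewrite ler_pM2r//; have := rateS R n; have := rate_gt0 R n.+1 => h1 h2.
  by rewrite lerXn2r ?nnegrE ?ltW ?rate_gt0//; lra.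
exists v => // n.
rewrite (mean_qv_parallelogram (nsh_M2 (hv n)) (nsh_M2 (hv n.+1))); apply: (le_trans (dv n)).
by move: (rate R n ^+ 3) => x; lra.
Qed.

(** * The limit of the selected triples *)

Section selected.
Variables (v : nat -> (R -> Om -> 'cV[R]_m) * (R -> Om -> R) * (R -> Om -> R))
  (hv : forall n, near_superhedge n (v n))
  (dv : forall n, \mean[P]_w qv (fun t w => (v n.+1).1.1 t w - (v n).1.1 t w) 0 T w <= rate R n ^+ 3 / 4).
Let z n := (v n).1.1.
Let J n := (v n).1.2.
Let u n := (v n).2.
Let iJ n : ito (z n) (J n). Proof. exact: nsh_ito (hv n). Qed.
Let Mz n : M2 P T Fil (z n). Proof. exact: nsh_M2 (hv n). Qed.
Let pz n : pred (z n). Proof. exact: (proj1 (Mz n)). Qed.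
Definition limit_integrand := mx_limsup z.
Definition limit_integral := ito_limsup J.
Local Notation H := limit_integrand.
Local Notation G := limit_integral.

Lemma limit_ito : ito H G. Proof. exact: (ito_limit hPc hT hB pz iJ Mz dv). Qed.
Lemma limit_M2 : M2 P T Fil H. Proof. exact: (M2_mx_limsup hPc hT hB pz Mz dv). Qed.

(** The integrated distance of [H] is at most twice that of [z n] plus twice the energy of
    [H - z n], and both are small in mean by strong convergence. Mean zero then gives membership, by
    closedness. *)
Lemma limit_constraint : as_ae P T (fun t w => K t w (H t w)).
Proof.
apply: (dist_int_eq0 limit_M2); apply/ler_addgt0Pr => e e0; rewrite add0r.
have sD := summable_dist_int limit_M2.
have e1 : 0 < e / 8 by rewrite divr_gt0.
have e2 : 0 < e / (4 * (1 + Cq)) by rewrite divr_gt0// mulr_gt0//; exact: Cq1.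
have [n1 h1] := rate_small e1; have [n2 h2] := exists_invS_lt e2.
pose n := maxn n1 n2.
have MHz := M2B hPc hT hB limit_M2 (Mz n); have sz := summable_dist_int (Mz n).
have sq_ := M2_summable hPc hT hB MHz.
have h : {ae P, forall w, dist_int H w <= 2 * dist_int (z n) w + 2 * qv (fun t w => H t w - z n t w) 0 T w}.
  apply: filterS2 (M2_finite hPc hT hB limit_M2) (M2_finite hPc hT hB (Mz n)) => w f1 f2.
  exact: (dist_int_le (proj1 limit_M2) (pz n) f1 f2).
apply: (le_trans (expectation_le_as sD (summableD (summableZ 2 sz) (summableZ 2 sq_)) h)).
rewrite (meanD (summableZ 2 sz) (summableZ 2 sq_)) (meanZ _ sz) (meanZ _ sq_).
have b1 := mean_qv_limsup_le hPc hT hB pz Mz dv n; rewrite -/H in b1.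
have b2 := h1 n (leq_maxl _ _).
have b3 := nsh_dist (hv n); rewrite -/(z n) in b3.
have b4 : Cq / n.+1%:R <= e / 4.
  have i1 : n.+1%:R^-1 <= e / (4 * (1 + Cq)).
    by apply: le_trans (ltW h2); rewrite lef_pV2 ?posrE ?ltr0n// ler_nat ltnS leq_maxr.
  apply: (le_trans (ler_wpM2l Cq0 i1)).
  rewrite mulrA ler_pdivrMr; last by rewrite mulr_gt0//; exact: Cq1.
  by rewrite mulrAC mulrA (mulrC _ e) -!mulrA ler_pM2l//; have := Cq0; lra.
move: b1 b2 b3 b4; move: (Cq / _) (\mean[P]_w qv _ _ _ _) (\mean[P]_w dist_int (z n) w) (rate R n).
by move=> p q r s; lra.
Qed.

(** Uniform in both times: the stochastic integral converges uniformly on [[0, T]], and the drift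
    part is handled by Cauchy-Schwarz with the bounded energy of [theta]. *)
Lemma gincr_limit : {ae P, forall w e, 0 < e -> exists n0, forall n, (n0 <= n)%N ->
  forall s t, 0 <= s -> s <= t -> t <= T ->
  `|gincr theta (z n) (J n) s t w - gincr theta H G s t w| <= e}.
Proof.
have ffin : {ae P, forall w n, (sq (z n) w < +oo)%E}.
  by apply: ae_foralln => n; exact: (M2_finite hPc hT hB (Mz n)).
have pH := proj1 limit_M2.
apply: filterS3 (ito_limit_close hPc hT hB pz iJ Mz dv) (ae_and ffin (M2_finite hPc hT hB limit_M2))
  (ae_and fth (qv_theta_le hT iTh theta_sq_le (lexx 0) T0 (lexx T))) => w hw [fz fH] [ft qt] e e0.
have e1 : 0 < Num.min (e / 4) ((e / 4) ^+ 2 / (1 + kap)).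
  by rewrite lt_min !divr_gt0 ?exprn_gt0 ?divr_gt0//; exact: kap1.
have [n0 hn] := hw _ e1; exists n0 => n nn s t s0 st tT.
have [q1 i1] := hn n nn; have sT := le_trans st tT; have t0 := le_trans s0 st.
have := i1 s s0 sT; have := i1 t t0 tT; rewrite !le_min => /andP[a1 _] /andP[a2 _].
have fd := sq_subtr_finite hT pH (pz n) fH (fz n); have pd := predictable_mxB hT pH (pz n).
have td2 := time_dot_sq_le hT pd pth fd ft s0 tT.
have qd : qv (fun t w => H t w - z n t w) s t w <= (e / 4) ^+ 2 / (1 + kap).
  apply: (@le_trans _ _ (qv (fun t w => H t w - z n t w) 0 T w)).
    exact: (qv_le hT pd fd s0 st tT).
  rewrite (sq_qv fd) lee_fin le_min in q1; by case/andP: q1.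
have qs : qv theta s t w <= kap by apply: le_trans qt; exact: (qv_le hT pth ft s0 st tT).
have q0 := qv_ge0 theta s t w; have d0_ := qv_ge0 (fun t w => H t w - z n t w) s t w.
have td_le : `|time_dot (fun t w => H t w - z n t w) theta s t w| <= e / 4.
  apply: le_of_sqr_le; first by rewrite divr_ge0// ltW.
  rewrite real_normK ?num_real//; apply: (le_trans td2).
  apply: (@le_trans _ _ ((e / 4) ^+ 2 / (1 + kap) * kap)).
    by apply: ler_pM.
  rewrite mulrAC ler_pdivrMr; last exact: kap1.
  by rewrite ler_wpM2l ?sqr_ge0// lerDr.
have tdE : time_dot (fun t w => H t w - z n t w) theta s t w =
    time_dot H theta s t w - time_dot (z n) theta s t w.
  have := time_dot_lincomb 1 (-1) pH (pz n) pth fH (fz n) ft s0 tT.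
  rewrite (_ : (fun t w => 1 *: H t w + -1 *: z n t w) = (fun t w => H t w - z n t w)); last first.
    by apply/funext => x; apply/funext => w'; rewrite scale1r scaleN1r.
  by move=> ->; rewrite mul1r mulN1r.
rewrite tdE in td_le; rewrite !gincrE -/G.
move: td_le a1 a2; move: (time_dot _ _ _ _ _) (time_dot _ _ _ _ _) => p q.
rewrite /G /limit_integral; move: (ito_limsup _ _ _) (ito_limsup _ _ _) (J n t w) (J n s w) => x1 x2 x3 x4.
move=> /ler_normlP[b1 b2] /ler_normlP[b3 b4] /ler_normlP[b5 b6].
by rewrite ler_norml; apply/andP; split; lra.
Qed.

Let eps_small e : 0 < e -> exists n0, forall n, (n0 <= n)%N -> eps n <= e.
Proof.
move=> e0; have e1 : 0 < e / (1 + kap) by rewrite divr_gt0//; exact: kap1.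
have [n0 h] := exists_invS_lt e1; exists n0 => n nn.
apply: (@le_trans _ _ (kap * (e / (1 + kap)))).
  apply: ler_wpM2l => //; apply: le_trans (ltW h).
  by rewrite lef_pV2 ?posrE ?ltr0n// ler_nat ltnS.
by rewrite mulrA ler_pdivrMr; [rewrite mulrC ler_pM2l// lerDr|exact: kap1].
Qed.

Let u_ge n t : 0 <= t -> t <= T -> {ae P, forall w, - (k + kap) <= u n t w}.
Proof.
move=> t0 tT; have mu_ : meas_wrt (Fil t) (fun w => - u n t w) by exact: meas_wrtN (nsh_adapted (hv n) t0 tT).
have := superhedging_le hPc hT hB iTh theta_sq_le hZ (iJ n) (Mz n) t0 tT mu_.
move=> /(_ (k + kap)) h; apply: filterS (h _) => [w|]; first by rewrite lerNl.
apply: filterS3 (nsh_incr (hv n) t0 tT (lexx T)) (nsh_final (hv n)) hF_below => w.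
rewrite -/(u n) -/(z n) -/(J n) => + e; rewrite e => h1 h2.
have : eps n <= kap by rewrite ler_pdivrMr ?ltr0n// ler_peMr// ler1n.
by move: h1; move: (gincr _ _ _ _ _ _) (eps n) => g e'; lra.
Qed.

Lemma limit_incr s t : 0 <= s -> s <= t -> t <= T ->
  (forall r, 0 <= r -> r <= T -> {ae P, forall w, u n r w @[n --> \oo] --> sup_price r w}) ->
  {ae P, forall w, sup_price t w <= sup_price s w + gincr theta H G s t w}.
Proof.
move=> s0 st tT hu; have sT := le_trans st tT; have t0 := le_trans s0 st.
have hi := ae_foralln (fun n => nsh_incr (hv n) s0 st tT).
apply: filterS3 (ae_and (hu s s0 sT) (hu t t0 tT)) hi gincr_limit => w [us ut] iw gw.
apply/ler_addgt0Pr => e e0; have e4 : 0 < e / 4 by rewrite divr_gt0.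
have [n1 h1] := gw _ e4; have [n2 h2] := eps_small e4.
move: us ut => /cvgrPdist_le /(_ _ e4) [n3 _ h3] /cvgrPdist_le /(_ _ e4) [n4 _ h4].
pose n := maxn (maxn n1 n2) (maxn n3 n4).
have l12 : (maxn n1 n2 <= n)%N by exact: leq_maxl.
have l34 : (maxn n3 n4 <= n)%N by exact: leq_maxr.
have := h1 n (leq_trans (leq_maxl _ _) l12) s t s0 st tT.
have := h2 n (leq_trans (leq_maxr _ _) l12).
have := h3 n (leq_trans (leq_maxl _ _) l34); have := h4 n (leq_trans (leq_maxr _ _) l34).
have := iw n; rewrite -/(u n) -/(z n) -/(J n) /=.
move: (gincr _ _ _ _ _ _) (gincr _ _ _ _ _ _) (eps n) (u n t w) (u n s w) => g1 g2 ep x1 x2 h5.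
move=> /ler_normlP[a1 a2] /ler_normlP[b1 b2] c /ler_normlP[d1 d2]; lra.
Qed.

(** Let [cl] be the lower limit of the values [u n t]. The portfolio of [H] started from [cl]
    superhedges [F], so by comparison every [y n t], and hence [sup_price t], is at most [cl]. As
    each [u n t] is at most [sup_price t], the sequence converges to it. *)
Lemma approx_price_cvg t : 0 <= t -> t <= T -> {ae P, forall w, u n t w @[n --> \oo] --> sup_price t w}.
Proof.
move=> t0 tT.
pose cl w := - real_limsup (fun n => - u n t w).
have ule := ae_foralln (fun n => nsh_le (hv n) t0 tT).
have uge := ae_foralln (fun n => u_ge n t0 tT).
have hcl : {ae P, forall w, (forall c N, (forall n, (N <= n)%N -> c <= u n t w) -> c <= cl w) /\
    (forall e, 0 < e -> exists N, forall n, (N <= n)%N -> cl w - e <= u n t w)}.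
  apply: filterS2 ule uge => w h1 h2.
  have l1 n : - sup_price t w <= - u n t w by rewrite lerN2; exact: h1.
  have l2 n : - u n t w <= k + kap by rewrite lerNl; exact: h2.
  have [p1 p2] := real_limsupP l1 l2; split=> [c N hc|e e0].
    by rewrite /cl lerNr; apply: (p1 _ N) => n Nn; rewrite lerN2; exact: hc.
  have [N hN] := p2 e e0; exists N => n Nn; have := hN n Nn; rewrite /cl; lra.
have mcl : meas_wrt (Fil t) cl.
  apply: meas_wrtN; apply/meas_wrtP; apply: measurable_real_limsup => n; apply/meas_wrtP.
  exact: meas_wrtN (nsh_adapted (hv n) t0 tT).
have sh : {ae P, forall w, F w <= cl w + gincr theta H G t T w}.
  have hi := ae_foralln (fun n => nsh_incr (hv n) t0 tT (lexx T)).
  have hf := ae_foralln (fun n => nsh_final (hv n)).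
  apply: filterS3 hcl (ae_and hi hf) gincr_limit => w [c1 _] [iw fw] gw.
  rewrite -lerBlDr; apply/ler_addgt0Pr => e e0; have e4 : 0 < e / 2 by rewrite divr_gt0.
  have [n1 h1] := gw _ e4; have [n2 h2] := eps_small e4.
  rewrite -lerBlDr; apply: (c1 _ (maxn n1 n2)) => n; rewrite geq_max => /andP[l1 l2].
  have := h1 n l1 t T t0 tT (lexx T); have := h2 n l2; have := iw n; rewrite fw -/(u n) -/(z n) -/(J n).
  move: (gincr _ _ _ _ _ _) (gincr _ _ _ _ _ _) (eps n) (u n t w) => g1 g2 ep x1 h5 h6.
  by move=> /ler_normlP[b1 b2]; lra.
have ycl : {ae P, forall w n, y n t w <= cl w}.
  apply: ae_foralln => n.
  exact: (exp_bsde_comparison (al0 n) (hy n) (iIz n) (hIz n) t0 tT mcl limit_ito limit_M2 limit_constraint sh).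
apply: filterS3 (ae_and hcl ule) ycl (sup_priceP t0 tT) => w [[_ c2] uw] yw [_ sw].
have sc : sup_price t w <= cl w by apply: sw.
apply/cvgrPdist_le => e e0; have [N hN] := c2 e e0; exists N => // n /= Nn.
have := hN n Nn; have := uw n; rewrite -/(u n) => h1 h2.
by rewrite ler_norml; apply/andP; split; lra.
Qed.

Lemma sup_price_superhedges s t : 0 <= s -> s <= t -> t <= T ->
  {ae P, forall w, sup_price t w <= sup_price s w + gincr theta H G s t w}.
Proof. by move=> s0 st tT; apply: limit_incr => // r r0 rT; exact: approx_price_cvg. Qed.

Local Notation Cs := sup_price.
Let fH : {ae P, forall w, (sq H w < +oo)%E}. Proof. by case: limit_ito. Qed.
Let pH : pred H. Proof. by case: limit_ito. Qed.
Let g t w := gincr theta H G 0 t w.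
Let gT_split : {ae P, forall w s t, 0 <= s -> s <= t -> t <= T -> g t w = g s w + gincr theta H G s t w}.
Proof.
apply: filterS2 fH fth => w f1 f2 s t s0 st tT.
by rewrite /g !gincrE (time_dot_split hT pH pth f1 f2 (lexx 0) s0 st tT); ring.
Qed.

(** What the portfolio of [H] started from [Cs 0] has gained over the value: increasing in time, but
    for each pair of times only almost surely. *)
Definition unregularized_increase t w : R := Cs 0 w - Cs t w + g t w.
Local Notation A0 := unregularized_increase.
Definition minimal_increase t w : R := right_regularize T (A0 ^~ w) t.
Definition minimal_price t w : R := Cs 0 w - minimal_increase t w + g t w.
Local Notation A := minimal_increase.
Local Notation C' := minimal_price.

Let g_cont : {ae P, forall w, {within `[0, T], continuous (g ^~ w)}}.
Proof.
have cG : {ae P, forall w, {within `[0, T], continuous (G ^~ w)}} by case: limit_ito.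
apply: filterS3 cG fH fth => w c1 f1 f2.
have -> : g ^~ w = fun t => (G t w - G 0 w) + time_dot H theta 0 t w.
  by apply/funext => t; rewrite /g gincrE.
have c2 := time_dot_continuous hT pH pth f1 f2.
move=> t; apply: cvgD; last exact: c2.
by apply: cvgB; [exact: c1|exact: cvg_cst].
Qed.

Let A0_incr s t : 0 <= s -> s <= t -> t <= T -> {ae P, forall w, A0 s w <= A0 t w}.
Proof.
move=> s0 st tT; apply: filterS2 (sup_price_superhedges s0 st tT) gT_split => w h /(_ s t s0 st tT) e.
by rewrite /A0 e; lra.
Qed.

Let A0_mono : {ae P, forall w i j, tq T i <= tq T j -> A0 (tq T i) w <= A0 (tq T j) w}.
Proof.
apply: ae_foralln => i; apply: ae_foralln => j.
have [ij|ij] := boolP (tq T i <= tq T j); last by apply: aeW => w /negP.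
by apply: filterS (A0_incr (tq_ge0 hT i) ij (tq_le hT j)).
Qed.

(** At a fixed time some [y n] nearly attains the supremum and, being continuous, keeps [sup_price]
    from dropping just afterwards. So the unregularized process has no jump to the right of that
    time. *)
Lemma minimal_increase_eq t : 0 <= t -> t <= T -> {ae P, forall w, A t w = A0 t w}.
Proof.
move=> t0; rewrite le_eqVlt => /orP[/eqP ->|tT].
  by apply: aeW => w; exact: right_regularizeT.
have hA : {ae P, forall w i, t < tq T i -> A0 t w <= A0 (tq T i) w}.
  apply: ae_foralln => i; have [ti|ti] := boolP (t < tq T i); last by apply: aeW => w /negP.
  by apply: filterS (A0_incr t0 (ltW ti) (tq_le hT i)).
have hs : {ae P, forall w i, (forall n, y n (tq T i) w <= Cs (tq T i) w)}.
  by apply: ae_foralln => i; apply: filterS (sup_priceP (tq_ge0 hT i) (tq_le hT i)) => w [].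
have cy : {ae P, forall w n, {within `[0, T], continuous (y n ^~ w)}}.
  by apply: ae_foralln => n; exact: exp_bsde_continuous (hy n).
apply: filterS3 (ae_and A0_mono hA) (ae_and hs (sup_priceP t0 (ltW tT))) (ae_and cy g_cont).
move=> w [mono ge_] [ys [yt st]] [cyw cg]; apply/le_anti/andP; split; last exact: right_regularize_ge.
apply/ler_addgt0Pr => e e0; have e3 : 0 < e / 3 by rewrite divr_gt0.
have [n hn] : exists n, Cs t w - e / 3 < y n t w.
  apply: contrapT => /forallNP h.
  have : Cs t w <= Cs t w - e / 3 by apply: st => n; rewrite leNgt; exact/negP.
  lra.
have rc := right_contB (continuous_right_cont hT cg) (continuous_right_cont hT (cyw n)).
have : \forall s \near t^'+, g s w - y n s w < g t w - y n t w + e / 3.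
  by apply: (cvgr_lt (g t w - y n t w)); [exact: rc|lra].
move=> [dl /= dl0 hdl]; have [i /andP[ti tid]] := tq_right t0 tT dl0.
have hi := hdl (tq T i); rewrite /= distrC gtr0_norm ?subr_gt0// ltrBlDl in hi.
have {}hi := hi tid ti.
apply: (le_trans (right_regularize_le hT (a := A0 ^~ w) mono ti)).
by have := ys i n; rewrite /A0; move: hi hn; lra.
Qed.

Lemma minimal_price_eq t : 0 <= t -> t <= T -> {ae P, forall w, C' t w = Cs t w}.
Proof.
by move=> t0 tT; apply: filterS (minimal_increase_eq t0 tT) => w; rewrite /C' /A0 => ->; ring.
Qed.

(** Minimality holds because every solution dominates each [y n], while at a fixed time the price is
    almost surely their supremum. The square-integrable bounds come from the domination of all [y n]
    by the given solution and by a constant. *)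
Lemma minimal_solution : minimal_constrained_bsde P T B b sigma C F C' H A.
Proof.
have eqA : {ae P, forall w i, A (tq T i) w = A0 (tq T i) w}.
  by apply: ae_foralln => i; exact: minimal_increase_eq (tq_ge0 hT i) (tq_le hT i).
have aC t : 0 <= t -> t <= T -> meas_wrt (Fil t) (C' t).
  move=> t0 tT; apply: (meas_wrt_ae (sup_price_adapted t0 tT)).
  by apply: filterS (minimal_price_eq t0 tT) => w ->.
have a0_ t : 0 <= t -> t <= T -> meas_wrt (Fil t) (Cs 0).
  by move=> t0 tT; apply: (meas_wrt_mono t0); exact: sup_price_adapted.
have ag t : 0 <= t -> t <= T -> meas_wrt (Fil t) (g t).
  move=> t0 tT.
  have : meas_wrt (Fil t) (fun w => (G t w - G 0 w) + \int[mu]_(u in `[0, t]) vdot (H u w) (theta u w)).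
    apply: meas_wrtD; last exact: (adapted_int_vdot hT).
    apply: meas_wrtB; first exact: (ito_adapted limit_ito).
    by apply: (meas_wrt_mono t0); exact: (ito_adapted limit_ito).
  by congr meas_wrt; apply/funext => w; rewrite /g gincrE time_dotE.
have aA t : 0 <= t -> t <= T -> meas_wrt (Fil t) (A t).
  move=> t0 tT.
  have := meas_wrtB (meas_wrtD (a0_ t t0 tT) (ag t t0 tT)) (aC t t0 tT).
  by congr meas_wrt; apply/funext => w; rewrite /C'; ring.
have cadA : {ae P, forall w, cadlag T (A ^~ w)}.
  apply: filterS A0_mono => w mono; split; first exact: (right_regularize_cont hT (a := A0 ^~ w) mono).
  exact: (right_regularize_left_lim hT (a := A0 ^~ w) mono).
have cadC : {ae P, forall w, cadlag T (C' ^~ w)}.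
  apply: filterS2 cadA g_cont => w [rA lA] cg; split.
    by apply: right_contD; [apply: right_contB => //; exact: right_cont_cst|exact: continuous_right_cont].
  move=> t t0 tT; apply: is_cvgD; last first.
    by apply/cvg_ex; eexists; exact: within_continuous_left_lim cg t0 tT.
  by apply: is_cvgB; [exact: is_cvg_cst|exact: lA].
have CsT : {ae P, forall w, Cs T w = F w}.
  apply: filterS2 (ae_foralln (fun n => exp_bsde_final (hIz n))) (sup_priceP T0 (lexx T)) => w yF [h1 h2].
  by apply/le_anti; rewrite h2/= => [|n]; rewrite ?yF// -(yF 0%N).
have Cs_norm t : 0 <= t -> t <= T -> {ae P, forall w, `|Cs t w| <= Xi w}.
  move=> t0 tT; apply: filterS3 (sup_priceP t0 tT) (ae_and (y_ge 0 t0 tT) hXb)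
    (ae_foralln (fun n => y_le n t0 tT)) => w [h1 h2] [h3 /(_ t t0 tT) /ler_normlP[h4 h5]] h6.
  have h7 := h1 0%N; have h8 := h2 _ h6.
  by have := Xb0 w; have := k'0; rewrite ler_norml /Xi => ? ?; apply/andP; split; lra.
have C_norm : {ae P, forall w t, 0 <= t -> t <= T -> `|C' t w| <= Xi w}.
  have h : {ae P, forall w i, `|Cs (tq T i) w| <= Xi w}.
    by apply: ae_foralln => i; exact: Cs_norm (tq_ge0 hT i) (tq_le hT i).
  apply: filterS3 h eqA cadC => w h e [rc _] t t0 tT.
  apply: (right_cont_le hT (right_cont_norm rc)) => // i.
  rewrite (_ : C' (tq T i) w = Cs (tq T i) w)//; by rewrite /C' e /A0; ring.
have g2 := gincr_L2 hPc hT hB iTh theta_sq_le limit_ito limit_M2 (lexx 0) T0.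
have mg : measurable_fun setT (g T) by exact: (meas_wrt_measurable hPc hB (lexx T) (ag T T0 (lexx T))).
have sX2 : summable_rv P (fun w => (2 * Xi w + `|g T w|) ^+ 2).
  apply: summable_sqD.
  - exact: measurable_funM.
  - exact: measurableT_comp.
  - exact: summable_sqZ.
  - by apply: eq_summable g2 => w; rewrite real_normK ?num_real.
have A_norm : {ae P, forall w t, 0 <= t -> t <= T -> `|A t w| <= 2 * Xi w + `|g T w|}.
  apply: filterS3 A0_mono (Cs_norm 0 (lexx 0) T0) (Cs_norm T T0 (lexx T)) => w mono h1 h2 t t0 tT.
  have lo := right_regularize_ge0 hT (a := A0 ^~ w) mono tT; have hi := right_regularize_mono hT (a := A0 ^~ w) mono tT (lexx T).
  rewrite right_regularizeT in hi.
  have e0 : A0 0 w = 0 by rewrite /A0 /g gincrE time_dot_self; ring.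
  rewrite e0 in lo; rewrite ger0_norm//; apply: (le_trans hi); rewrite /A0.
  by have := ler_norm (g T w); move: h1 h2 => /ler_normlP[? ?] /ler_normlP[? ?]; lra.
split; last first.
  move=> C2 H2 A2 sol2 t; rewrite in_itv/= => /andP[t0 tT].
  apply: filterS3 (minimal_price_eq t0 tT) (sup_priceP t0 tT)
    (ae_foralln (fun n => solution_dominates (al0 n) (hy n) sol2 t0 tT)) => w -> [_ h]; exact: h.
split.
- split; last 1 first.
  + apply: (S2_of_dominated hPc hT hB _ cadA sX2 A_norm) => t; rewrite in_itv/= => /andP[t0 tT]; exact: aA.
  + apply: (S2_of_dominated hPc hT hB _ cadC sXi2 C_norm) => t; rewrite in_itv/= => /andP[t0 tT]; exact: aC.
  + exact: limit_M2.
- apply: filterS A0_mono => w mono s t s0 st tT; exact: (right_regularize_mono hT (a := A0 ^~ w) mono st tT).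
- exists G; first exact: limit_ito.
  apply: filterS2 CsT gT_split => w e gs t; rewrite in_itv/= => /andP[t0 tT].
  have := gs t T t0 tT (lexx T); rewrite gincrE time_dotE /C' /A right_regularizeT /A0 e => ->.
  by move: (\int[_]_(_ in _) _) => x; ring.
- exact: limit_constraint.
Qed.

End selected.

End construction.

Lemma solution_norm_bound C' H' A' : constrained_bsde P T B b sigma C F C' H' A' ->
  exists2 c, {ae P, forall w, C' 0 w = c} & exists X : Om -> R, [/\ measurable_fun setT X,
    forall w, 0 <= X w, summable_rv P (fun w => X w ^+ 2) &
    {ae P, forall w t, 0 <= t -> t <= T -> `|C' t w| <= X w}].
Proof.
move=> [[SC _ _] _ _ _]; have aC : meas_wrt (Fil 0) (C' 0).
  by case: SC => aC _ _; apply: aC; rewrite in_itv/= lexx ltW.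
have [c hc] := Fil0_const hB aC; exists c => //.
exact: S2_dominated.
Qed.

(** The second conclusion bounds the initial value by every common bound of the [y n 0]. The final
    contradiction uses it with a sequence [al] chosen for the occasion. *)
Theorem minimal_solution_exists (al : nat -> R) (y : nat -> R -> Om -> R)
  (zz : nat -> R -> Om -> 'cV[R]_m) : (forall n, n.+1%:R <= al n) ->
  (forall n, exp_bsde P T B b sigma C (al n) F (y n) (zz n)) ->
  (exists C' H' A', constrained_bsde P T B b sigma C F C' H' A') ->
  exists C' H' A', minimal_constrained_bsde P T B b sigma C F C' H' A' /\
    forall c, (forall n, {ae P, forall w, y n 0 w <= c}) -> {ae P, forall w, C' 0 w <= c}.
Proof.
move=> hal hy [Cb [Hb [Ab hb_sol]]].
have /choice[Iz hIz] : forall n, exists I, ito (zz n) I /\ as_all P T (fun t w => y n t w =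
    F w + gen_int (al n) (zz n) t T w - (I T w - I t w)).
  by move=> n; have [I iI hI] := exp_bsde_ito (hy n); exists I.
have iIz n := (hIz n).1; have eIz n := (hIz n).2.
have [cb hcb [Xb [mXb Xb0 sXb2 hXb]]] := solution_norm_bound hb_sol.
have [Cq Cq0 hCq] := approximations_bounded hal hy iIz eIz hb_sol mXb Xb0 sXb2 hXb hcb.
have [v hv dv] := near_superhedge_select hal hy iIz eIz hb_sol Cq0 hCq.
exists (minimal_price y v), (limit_integrand v), (minimal_increase y v); split.
  exact: (minimal_solution hal hy iIz eIz hb_sol mXb Xb0 sXb2 hXb Cq0 hv dv).
move=> c hc.
have e0 := minimal_price_eq hal hy iIz eIz hb_sol Cq0 hv dv (lexx 0) T0.
apply: filterS3 e0 (sup_priceP hal hy hb_sol (lexx 0) T0) (ae_foralln hc) => w -> [_ h]; exact: h.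
Qed.

End market.

(** * Indifference prices *)

Section mean_density.
Context (R : realType) (d0 : measure_display) (Om : measurableType d0)
  (P Q : probability Om R).
Variables (g : Om -> R) (mg : measurable_fun setT g) (g0 : forall w, 0 <= g w)
  (QE : forall A, measurable A -> Q A = (\int[P]_(w in A) (g w)%:E)%E).

Lemma ge0_mean_density f : summable_rv Q f -> (forall w, 0 <= f w) ->
  summable_rv P (fun w => f w * g w) /\ \mean[P]_w (f w * g w) = \mean[Q]_w f w.
Proof.
move=> sf f0; have mf := summable_measurable sf.
have e := ge0_integral_density mg g0 QE (f := EFin \o f) ltac:(exact/measurable_EFinP)
  ltac:(by move=> w; rewrite lee_fin).
have s : summable_rv P (fun w => f w * g w).
  apply/summableP; apply: integrable_EFin_ge0.
  - exact: measurable_funM.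
  - by move=> w; rewrite mulr_ge0.
  - under eq_integral do rewrite EFinM.
    by rewrite -[X in (X < _)%E]e /= (integral_EFin sf) ltry.
split=> //; apply: EFin_inj; rewrite -(integral_EFin s) -(integral_EFin sf).
by rewrite [RHS]e; apply: eq_integral => w _; rewrite EFinM.
Qed.

(** [f] is the difference of the nonnegative functions [|f| + f] and [|f|]. *)
Lemma mean_density f : summable_rv Q f ->
  summable_rv P (fun w => f w * g w) /\ \mean[P]_w (f w * g w) = \mean[Q]_w f w.
Proof.
move=> sf; have sn := summable_norm sf.
have [s1 e1] := ge0_mean_density (summableD sn sf) (fun w => ltac:(have := ler_norm (- f w); rewrite normrN; lra)).
have [s2 e2] := ge0_mean_density sn (fun w => normr_ge0 (f w)).
have E w : (`|f w| + f w) * g w - `|f w| * g w = f w * g w by ring.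
split; first exact: (eq_summable E (summableB s1 s2)).
rewrite -(eq_mean P E) meanB// e1 e2 meanD//; ring.
Qed.

Lemma ae_density (S : Om -> Prop) : {ae P, forall w, S w} -> {ae Q, forall w, S w}.
Proof.
move=> [A [mA PA sub]]; exists A; split=> //.
by rewrite QE// null_set_integral//; apply/measurable_EFinP; exact: measurable_funTS.
Qed.

End mean_density.

Section prices.
Context (R : realType) (d0 : measure_display) (Om : measurableType d0)
  (P : probability Om R) (hPc : measure_is_complete P) (T : R) (hT : 0 < T)
  (d m : nat) (B : R -> Om -> 'cV[R]_m) (hB : brownian_motion P T B).
Local Notation Fil := (augmented_filtration P B).
Local Notation pred := (predictable_mx Fil T).
Local Notation sq := (sq_norm_integral T).
Local Notation ito := (ito_integral P T B).
Local Notation mu := (@lebesgue_measure R).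

Let T0 : 0 <= T. Proof. exact: ltW. Qed.

Lemma sq_ae_eq n (h h' : R -> Om -> 'cV[R]_n) w : pred h -> pred h' ->
  {ae mu, forall t, t \in `[0, T] -> h' t w = h t w} -> sq h' w = sq h w.
Proof.
move=> ph ph' e; rewrite !sq_norm_integralE; apply: ae_eq_integral => //.
- by apply/measurable_EFinP; exact: (vdot_section hT w ph' ph').
- by apply/measurable_EFinP; exact: (vdot_section hT w ph ph).
- by apply: ae_time_mono e => t h1 tT; rewrite h1.
Qed.

Lemma time_dot_ae_eq n (h h' g : R -> Om -> 'cV[R]_n) s t w : pred h -> pred h' -> pred g ->
  (sq h w < +oo)%E -> (sq g w < +oo)%E -> 0 <= s -> t <= T ->
  {ae mu, forall t, t \in `[0, T] -> h' t w = h t w} ->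
  time_dot h' g s t w = time_dot h g s t w.
Proof.
move=> ph ph' pg fh fg s0 tT e.
have fh' : (sq h' w < +oo)%E by rewrite (sq_ae_eq ph ph' e).
have i1 := sq_vdot_integrable hT ph pg fh fg.
have i2 := sq_vdot_integrable hT ph' pg fh' fg.
apply: le_anti; rewrite !time_dotE.
rewrite (le_Rintegral_ae s0 tT i2 i1); last by apply: ae_time_mono e => u h1 /h1 ->.
by rewrite (le_Rintegral_ae s0 tT i1 i2)//; apply: ae_time_mono e => u h1 /h1 ->.
Qed.

Lemma ito_ae_eq h h' I : ito h I -> pred h' -> as_ae P T (fun t w => h' t w = h t w) -> ito h' I.
Proof.
move=> iI ph' e; have [S wS hS] := ito_integral_approx hPc hT hB iI.
case: iI => ph fh aI cI _.
apply: (approx_ito_integral hPc hT hB ph' _ aI cI wS).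
  by apply: filterS2 fh e => w fw ew; rewrite (sq_ae_eq ph ph' ew).
apply: filterS2 hS e => w hw ew r r0; have [n0 hn] := hw r r0; exists n0 => n nn0.
have [h1 h2] := hn n nn0; split; last exact: h2.
have pS := predictable_simple hT (wS n).
apply: le_trans h1; rewrite le_eqVlt; apply/orP; left; apply/eqP.
apply: (sq_ae_eq (predictable_mxB hT pS ph) (predictable_mxB hT pS ph')).
by apply: ae_time_mono ew => t h1 /h1 ->.
Qed.

Variables (b : R -> Om -> 'cV[R]_d) (sigma : R -> Om -> 'M[R]_(d, m)) (C : set 'cV[R]_d).
Hypotheses (hb : pred b) (hsigma : pred sigma) (hC0 : C 0)
  (hsigma_inv : as_ae P T (fun t w => sigma t w *m (sigma t w)^T \in unitmx)).
Local Notation theta := (market_price_of_risk b sigma).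
Local Notation K := (constraint_image sigma C).
Let pth : pred theta. Proof. exact: (predictable_theta hT hb hsigma). Qed.

(** The constraint gives a portfolio at each time and path but no measurable choice of it. The left
    inverse of [sigma^T] is predictable and recovers that very portfolio, which lies in [C]. *)
Lemma strategy_of_integrand H : pred H -> as_ae P T (fun t w => K t w (H t w)) ->
  exists pi, [/\ pred pi, as_ae P T (fun t w => C (pi t w)) &
    as_ae P T (fun t w => (sigma t w)^T *m pi t w = H t w)].
Proof.
move=> pH hK.
pose pi t w := invmx (sigma t w *m (sigma t w)^T) *m (sigma t w *m H t w).
have piE : as_ae P T (fun t w => C (pi t w) /\ (sigma t w)^T *m pi t w = H t w).
  apply: filterS2 hK hsigma_inv => w; apply: ae_time_mono2 => t hK hs tT.
  have [p Cp pH'] := hK tT; have su := hs tT.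
  suff -> : pi t w = p by [].
  by rewrite /pi -pH' (mulmxA (sigma t w)) mulKmx.
exists pi; split.
- apply: (predictable_mxM hT); last exact: (predictable_mxM hT).
  apply: (predictable_mx_inv hT); apply: (predictable_mxM hT) => //.
  exact: (predictable_mx_tr hT).
- by apply: filterS piE => w; apply: ae_time_mono => t h /h[].
- by apply: filterS piE => w; apply: ae_time_mono => t h /h[].
Qed.

Lemma exp_utilityE alpha (V : Om -> R) :
  exp_utility P alpha V = (- \int[P]_w (expR (- alpha * V w))%:E)%E.
Proof.
by rewrite /exp_utility; under eq_integral do rewrite EFinN; rewrite integral_ge0N.
Qed.

Lemma exp_utility_cst alpha (c : R) : exp_utility P alpha (fun=> c) = (- expR (- alpha * c))%:E.
Proof. by rewrite exp_utilityE (integral_EFin (summable_cst P _)) expectation_cst EFinN. Qed.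

Lemma riskless_strategy (Q : probability Om R) x : exists pi,
  admissible_mart P Q T B b sigma C x pi (fun _ _ => x).
Proof.
have z : (fun t w => (sigma t w)^T *m (0 : 'cV[R]_d)) = (fun _ _ => 0).
  by apply/funext => t; apply/funext => w; rewrite mulmx0.
have iz := ito_zero hPc hT hB.
exists (fun _ _ => 0); split.
  split; rewrite ?z.
  - exact: predictable_mx0.
  - by case: iz.
  - by apply: aeW => w; apply: aeW => t _.
  exists (fun _ _ => 0); first exact: iz.
  apply: aeW => w t _; rewrite -[X in X + _]/(x + 0) addr0.
  by under eq_Rintegral do rewrite ?mulmx0 vdot0l; rewrite Rintegral_cst// mul0r addr0.
split=> //.
- by move=> t _; exact: meas_wrt_cst.
- by move=> t _; exact: finite_measure_integrable_cst.
Qed.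

Variables (Kth : R) (Kth0 : 0 <= Kth)
  (hth : as_ae P T (fun t w => enorm (theta t w) <= Kth)).
Let theta_sq := theta_sq_le hT hb hsigma Kth0 hth.
Local Notation kap := (Kth ^+ 2 * T).
Let fth : {ae P, forall w, (sq theta w < +oo)%E}.
Proof. by apply: filterS theta_sq => w /le_lt_trans; apply; rewrite ltry. Qed.

Variables (Th : R -> Om -> R) (iTh : ito theta Th).

Section martingale_wealth.
Variables (Q : probability Om R)
  (QE : forall A, measurable A -> Q A = (\int[P]_(w in A) (gdens theta Th 0 T w)%:E)%E).
Let mZ := measurable_gdens hPc hT hB iTh (lexx 0) T0 (lexx T).
Let Z0 w : 0 <= gdens theta Th 0 T w. Proof. exact/ltW/gdens_gt0. Qed.

(** Jensen's inequality relative to [Q], with the second moment of the density in place of its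
    relative entropy: [expR kap] bounds that moment, whence the loss [kap] in the exponent. The
    wealth has mean [x] under [Q] by the martingale property. *)
Lemma martingale_utility_le alpha x pi X : admissible_mart P Q T B b sigma C x pi X ->
  (exp_utility P alpha (X T) <= (- expR (- alpha * x - kap))%:E)%E.
Proof.
move=> [[ppi _ _ [I iI hX]] [aX iX mX]].
have sXT : summable_rv Q (X T) by apply/summableP; apply: iX; rewrite in_itv/= T0 lexx.
have X0 : {ae P, forall w, X 0 w = x}.
  apply: filterS2 (as_all_at hX (lexx 0) T0) (ito_at0 hPc hT hB iI) => w -> ->.
  by rewrite Rintegral_itv1 !addr0.
have EX : \mean[Q]_w X T w = x.
  have F0 : Fil 0 setT by exact: Fil_setT.
  have := mX 0 T setT (lexx 0) T0 (lexx T) F0.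
  have sX0 : summable_rv Q (X 0) by apply/summableP; apply: iX; rewrite in_itv/= T0 lexx.
  rewrite (integral_EFin sXT) (integral_EFin sX0) => -[->].
  rewrite -[RHS](expectation_cst Q); apply: expectation_as_eq => //; first exact: summable_cst.
  exact: (ae_density mZ QE).
have [sXZ eXZ] := mean_density mZ Z0 QE sXT.
have [sZ2 eZ2] := gdens_L2 hPc hT hB iTh theta_sq T0 (lexx T).
have [sZ eZ] : summable_rv P (gdens theta Th 0 T) /\ \mean[P]_w gdens theta Th 0 T w = 1.
  have [s e] := mean_density mZ Z0 QE (summable_cst Q 1).
  by split; [apply: eq_summable s|rewrite -[RHS](expectation_cst Q) -e; apply: eq_mean]; move=> w; rewrite mul1r.
rewrite exp_utilityE EFinN leeN2.
have mXT := summable_measurable sXZ.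
have mX' : measurable_fun setT (X T) by exact: (summable_measurable sXT).
have me : measurable_fun setT (fun w => expR (- alpha * X T w)).
  by apply: measurableT_comp => //; exact: measurable_funM.
have [->|] := eqVneq (\int[P]_w (expR (- alpha * X T w))%:E)%E +oo%E; first exact: leey.
rewrite -ltey => fin.
have se : summable_rv P (fun w => expR (- alpha * X T w)).
  by apply/summableP; apply: integrable_EFin_ge0 => // w; exact: expR_ge0.
rewrite (integral_EFin se) lee_fin.
pose M := expR kap; have M0 : 0 < M by exact: expR_gt0.
(* [v * (2 - r - v) <= expR (- r)] at [v = Z / M], [r = alpha * (X T - x)] *)
pose g w := expR (- alpha * x) * (M^-1 * ((2 + alpha * x) * gdens theta Th 0 T w
  - (alpha * (X T w * gdens theta Th 0 T w) + M^-1 * gdens theta Th 0 T w ^+ 2))).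
have s1 := summableZ (2 + alpha * x) sZ.
have s2 := summableZ alpha sXZ; have s3 := summableZ M^-1 sZ2.
have s4 := summableD s2 s3; have s5 := summableB s1 s4.
have sg : summable_rv P g by apply: summableZ; exact: summableZ.
have key w : g w <= expR (- alpha * X T w).
  rewrite /g; move: (gdens_gt0 theta Th 0 T w) (X T w); set z := gdens _ _ _ _ _ => z0 y.
  have -> : - alpha * y = - alpha * x + - (alpha * (y - x)) by ring.
  rewrite expRD ler_wpM2l ?expR_ge0//; set r := alpha * (y - x).
  pose v := z / M; have v0 : 0 < v by rewrite divr_gt0.
  have -> : M^-1 * ((2 + alpha * x) * z - (alpha * (y * z) + M^-1 * z ^+ 2)) = v * (2 - r - v).
    by rewrite /v /r; ring.
  have -> : expR (- r) = v * expR (- r - ln v).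
    by rewrite -{1}[v]lnK ?posrE// -expRD; congr expR; ring.
  rewrite ler_wpM2l ?(ltW v0)//; apply: le_trans (expR_ge1Dx _).
  have := @le_ln1Dx _ (v - 1); rewrite addrCA subrr addr0.
  by move=> h; have := h ltac:(lra); lra.
apply: le_trans (expectation_le sg se key); rewrite /g meanZ//; last exact: summableZ.
rewrite meanZ// meanB// meanD// !meanZ// eZ eXZ EX expRD ler_wpM2l ?expR_ge0//.
rewrite expRN -/M -[leLHS]mulr1 ler_wpM2l ?invr_ge0 ?(ltW M0)//.
have : M^-1 * \mean[P]_w (gdens theta Th 0 T w ^+ 2) <= 1.
  by rewrite mulrC ler_pdivrMr// mul1r.
lra.
Qed.

End martingale_wealth.

Variables (F : Om -> R) (k : R) (hk : 0 <= k) (hF_below : {ae P, forall w, - k <= F w})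
  (hZ : \mean[P]_w gdens theta Th 0 T w = 1).
Variables (alpha : R) (Y : R -> Om -> R) (Z : R -> Om -> 'cV[R]_m)
  (a0 : 0 < alpha) (hYZ : exp_bsde P T B b sigma C alpha F Y Z).

(** [D] is [alpha * (Y - X)] normalised to start at 0. By [gen_le] it dominates the exponent of the
    exponential martingale of [alpha *: (Z - H)], and admissibility supplies the uniform
    integrability demanded by [exp_lower_bound]. *)
Lemma hedged_utility_le y0 x pi X : {ae P, forall w, Y 0 w = y0} ->
  admissible_UI P T B b sigma C alpha Y x pi X ->
  (exp_utility P alpha (fun w => (X T w - F w)%R) <= (- expR (- alpha * (x - y0)))%:E)%E.
Proof.
move=> hy0 [[ppi fpi Cpi [J iJ hX]] UI].
have [I iI hI] := exp_bsde_ito hYZ.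
have YT := exp_bsde_final hT hI.
set H := (fun t w => (sigma t w)^T *m pi t w) in fpi iJ hX.
have pH : pred H by case: iJ.
have pZ := exp_bsde_predictable hYZ.
have fZ : {ae P, forall w, (sq Z w < +oo)%E} by case: iI.
have HK : as_ae P T (fun t w => K t w (H t w)).
  by apply: filterS Cpi => w; apply: ae_time_mono => t h /h Cp; exists (pi t w).
have aX t : 0 <= t -> t <= T -> meas_wrt (Fil t) (X t).
  move=> t0 tT; apply: (meas_wrt_ae (f := fun w => x + J t w +
    \int[mu]_(u in `[0, t]) vdot (H u w) (theta u w))).
    apply: meas_wrtD; last exact: (adapted_int_vdot hT).
    by apply: meas_wrtD; [exact: meas_wrt_cst|exact: (ito_adapted iJ)].
  by apply: filterS (as_all_at hX t0 tT) => w ->.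
pose D t w := - alpha * (X t w - Y t w) + alpha * (x - y0).
have aD t : 0 <= t -> t <= T -> meas_wrt (Fil t) (D t).
  move=> t0 tT; apply: meas_wrtD; last exact: meas_wrt_cst.
  by apply: meas_wrtZ; apply: meas_wrtB; [exact: aX|exact: (exp_bsde_adapted hT hYZ)].
have iN := ito_lincomb hPc hT hB alpha (- alpha) iI iJ.
have lb : (P setT <= \int[P]_w (\1_setT w * expR (D T w))%:E)%E.
  apply: (exp_lower_bound hPc hT hB (lexx 0) T0 iN (G := setT) (D := D)) => //.
  - exact: Fil_setT.
  - move=> s s0 sT.
    have h1 := ito_at0 hPc hT hB iJ.
    have h2 := as_all_at hX s0 sT.
    have h3 := exp_bsde_incr hT hb hsigma hC0 Kth0 hth a0 hYZ iI hI.
    apply: filterS3 (ae_and (ae_and (ae_and hy0 fpi) h1) (ae_and fZ fth))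
      (ae_and h2 HK) h3.
    move=> w [[[y0w fH] J0] [fw ft]] [Xs hKw] /(_ 0 s (lexx 0) s0 sT) Ys _.
    rewrite (_ : (fun t w => alpha *: Z t w + - alpha *: H t w) =
        (fun t w => alpha *: (Z t w - H t w))); last first.
      by apply/funext => t; apply/funext => v; rewrite scalerBr scaleNr.
    rewrite (qv_scale hT alpha (predictable_mxB hT pZ pH) (sq_subtr_finite hT pZ pH fw fH) (lexx 0) sT).
    have := gen_int_le hT hb hsigma hC0 a0 pZ pH fw fH ft (lexx 0) sT hKw.
    rewrite /D (_ : X s w = x + J s w + time_dot H theta 0 s w); last by rewrite Xs time_dotE.
    rewrite J0 -(@ler_pM2l _ alpha a0); move: y0w; rewrite Ys.
    move: (gen_int _ _ _ _ _) (qv _ _ _ _) (time_dot _ _ _ _ _) => g q td; nra.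
  move=> e e0; pose kp := expR (alpha * (x - y0)); have kp0 : 0 < kp by exact: expR_gt0.
  have [c hc] := UI _ (divr_gt0 e0 kp0).
  (* The level given by admissibility is rescaled by the normalising factor [kp] of [D], and cut at
     0 because the level asked for here is nonnegative. *)
  exists (kp * Num.max c 0); first by rewrite mulr_ge0 ?(ltW kp0)// le_max lexx orbT.
  move=> tau st _ _ mD.
  pose f w := expR (- alpha * (X (tau w) w - Y (tau w) w)).
  have Df w : expR (D (tau w) w) = kp * f w by rewrite mulrC -expRD.
  have mf : measurable_fun setT f.
    rewrite (_ : f = fun w => kp^-1 * expR (D (tau w) w)); first exact: measurable_funM.
    by apply/funext => w; rewrite Df mulKf// gt_eqF.
  have mA : measurable [set w | c <= `|f w|].
    have := (measurableT_comp (@normr_measurable R setT) mf) measurableT `[c, +oo[%classic (measurable_itv _).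
    by rewrite setTI; congr (measurable _); apply/seteqP; split=> w /=; rewrite in_itv/= andbT.
  have fE : (\int[P]_w (\1_[set w | setT w /\ (kp * Num.max c 0 <= expR (D (tau w) w))%R] w *
        expR (D (tau w) w))%:E = kp%:E * \int[P]_(w in [set w | (c <= `|f w|)%R]) (`|f w|)%:E)%E.
    rewrite [X in (_ = _ * X)%E]integral_mkcond -ge0_integralZl_EFin//; last 3 first.
    - by move=> w _; rewrite patchE; case: ifP => // _; rewrite lee_fin.
    - apply/measurable_restrict => //; rewrite setTI; apply/measurable_EFinP.
      by apply: measurable_funTS; exact: measurableT_comp.
    - exact: ltW.
    apply: eq_integral => w _; rewrite patchE Df.
    rewrite (_ : [set w | _] = [set w | c <= `|f w|]); last first.
      apply/seteqP; split=> v /=; rewrite Df ler_pM2l// ge_max ger0_norm ?expR_ge0//.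
        by case=> _ /andP[].
      by move=> ->; split=> //; exact: expR_ge0.
    rewrite indicE; case: (w \in _); last by rewrite mul0r mule0.
    by rewrite mul1r EFinM ger0_norm ?expR_ge0.
  rewrite fE; apply: (@le_trans _ _ (kp%:E * (e / kp)%:E)%E).
    by rewrite lee_pmul2l//; apply: hc; exists tau.
  by rewrite -EFinM mulrC divfK// gt_eqF.
have mYT := meas_wrt_measurable hPc hB (lexx T) (exp_bsde_adapted hT hYZ T0 (lexx T)).
have mXT := meas_wrt_measurable hPc hB (lexx T) (aX T T0 (lexx T)).
have mV : measurable_fun setT (fun w => expR (- alpha * (X T w - F w))).
  apply: measurableT_comp => //; apply: measurable_funM => //; apply: measurable_funB => //.
  exact: (measurable_ae_eq hPc mYT YT).
have E : (\int[P]_w (\1_setT w * expR (D T w))%:E = (expR (alpha * (x - y0)))%:E *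
    \int[P]_w (expR (- alpha * (X T w - F w)))%:E)%E.
  have mVE : measurable_fun setT (fun w => (expR (- alpha * (X T w - F w)))%:E) by exact/measurable_EFinP.
  have V0 (w : Om) : [set: Om] w -> (0 <= (expR (- alpha * (X T w - F w)))%:E)%E by rewrite lee_fin expR_ge0.
  rewrite -(ge0_integralZl_EFin P measurableT V0 mVE (expR_ge0 _)).
  apply: ae_eq_integral => //.
  - apply/measurable_EFinP; apply: measurable_funM => //; apply: measurableT_comp => //.
    exact: (meas_wrt_measurable hPc hB (lexx T) (aD T T0 (lexx T))).
  - by apply: emeasurable_funM => //; exact: measurable_cst.
  by apply: filterS YT => w yT _; rewrite indicT mul1r /D yT -EFinM addrC expRD.
rewrite exp_utilityE EFinN leeN2; move: lb; rewrite E probability_setT => lb.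
have e0 : (0 <= (expR (- alpha * (x - y0)))%:E)%E by rewrite lee_fin expR_ge0.
have := lee_wpmul2l e0 lb.
by rewrite mule1 muleA -EFinM -expRD mulNr addNr expR0 mul1e.
Qed.

(** The portfolio of the constrained solution keeps [X - Y] above [x - c0]: at the times of [tq]
    because [Y <= C'] there, then at all times by right continuity. The exponentials are therefore
    bounded, which gives both admissibility and the utility bound. *)
Lemma superhedging_utility_ge C' H' A' c0 x : constrained_bsde P T B b sigma C F C' H' A' ->
  {ae P, forall w, C' 0 w = c0} -> exists pi X,
  admissible_UI P T B b sigma C alpha Y x pi X /\
  ((- expR (- alpha * (x - c0)))%:E <= exp_utility P alpha (fun w => (X T w - F w)%R))%E.
Proof.
move=> sol hc0; have := sol; move=> [[[aC _ _] [pH' _] _] Amono [J iJ hC'] HK].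
have fH' : {ae P, forall w, (sq H' w < +oo)%E} by case: iJ.
have [pi [ppi Cpi piH]] := strategy_of_integrand pH' HK.
set H := fun t w => (sigma t w)^T *m pi t w in piH.
have pH : pred H by apply: (predictable_mxM hT) => //; exact: (predictable_mx_tr hT).
have iH : ito H J := ito_ae_eq iJ pH piH.
have fH : {ae P, forall w, (sq H w < +oo)%E} by case: iH.
pose X t w := x + J t w + \int[mu]_(u in `[0, t]) vdot (H u w) (theta u w).
have XE t w : X t w = x + J t w + time_dot H theta 0 t w by rewrite time_dotE.
have str : constrained_strategy P T B b sigma C x pi X.
  by split=> //; exists J => //; apply: aeW => w t _.
(* [Y <= C' <= C' 0 + J + int H theta] *)
have YX : {ae P, forall w t, 0 <= t -> t <= T -> x - c0 <= X t w - Y t w}.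
  have dense : {ae P, forall w n, Y (tq T n) w - X (tq T n) w <= - (x - c0)}.
    apply: ae_foralln => n; have t0 := tq_ge0 hT n; have tT := tq_le hT n.
    have dom := solution_dominates hPc hT hB hb hsigma hC0 Kth0 hth iTh hZ hF_below a0 hYZ sol t0 tT.
    apply: filterS3 (ae_and hc0 (ae_and dom (ae_and Amono (ito_at0 hPc hT hB iJ))))
      (ae_and (as_all_at hC' t0 tT) (as_all_at hC' (lexx 0) T0))
      (ae_and (ae_and fH' fth) piH).
    move=> w [c0w [hY [Aw J0]]] [Ct C0] [[fw ft] e].
    have := Aw 0 (tq T n) (lexx 0) t0 tT; move: hY; rewrite XE (time_dot_ae_eq pH' pH pth fw ft (lexx 0) tT e).
    move: c0w; rewrite C0 Ct J0 -!time_dotE.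
    rewrite (time_dot_split hT pH' pth fw ft (lexx 0) t0 tT (lexx T)).
    move: (time_dot _ _ _ _ _) (time_dot _ _ _ _ _) => u v; lra.
  apply: filterS3 dense (ae_and fH fth) (ae_and (exp_bsde_continuous hYZ) (ito_right_cont hT iH)).
  move=> w hd [fw ft] [cY cJ] t t0 tT; rewrite -lerN2 opprB.
  apply: (right_cont_le hT (f := fun t => Y t w - X t w)) => //.
  apply: right_contB; first exact: continuous_right_cont.
  rewrite (_ : X ^~ w = fun t => x + J t w + time_dot H theta 0 t w); last first.
    by apply/funext => u; exact: XE.
  apply: right_contD; first by apply: right_contD => //; exact: right_cont_cst.
  by apply: continuous_right_cont => //; exact: (time_dot_continuous hT pH pth fw ft).
exists pi, X; split; first split=> //.
  (* Adding 1 to the almost sure bound makes the tail event negligible for every stopping time. *)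
  move=> e e0; pose c := expR (- alpha * (x - c0)) + 1; exists c => _ [tau [st _] <-].
  set f := fun w => _; set S := [set w | _].
  have Sneg : P.-negligible S.
    apply: negligibleS YX => w /= + h; apply/negP; rewrite -ltNge ger0_norm ?expR_ge0//.
    have := st w; rewrite in_itv/= => /andP[t0 tT].
    apply: (@le_lt_trans _ _ (expR (- alpha * (x - c0)))); last by rewrite ltrDl.
    by rewrite ler_expR !mulNr lerN2 ler_pM2l//; exact: h.
  have mS : measurable S by exact: hPc.
  rewrite integral_mkcond (ae_eq_integral (cst 0%E))//.
  - by rewrite integral0 lee_fin ltW.
  - apply: (ae_measurable_fun hPc (f := cst 0%E)) => //.
    apply: negligibleS Sneg => w /= h; apply: contrapT => nS; apply: h.
    by rewrite patchE memNset.
  - apply: negligibleS Sneg => w /= h; apply: contrapT => nS; apply: h => _.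
    by rewrite patchE memNset.
have [I iI hI] := exp_bsde_ito hYZ.
have YT := exp_bsde_final hT hI.
rewrite exp_utilityE EFinN leeN2.
have mF : measurable_fun setT F.
  apply: (measurable_ae_eq hPc _ YT).
  exact: (meas_wrt_measurable hPc hB (lexx T) (exp_bsde_adapted hT hYZ T0 (lexx T))).
have mXT : measurable_fun setT (X T).
  rewrite (_ : X T = fun w => x + J T w + time_dot H theta 0 T w); last first.
    by apply/funext => w; exact: XE.
  apply: measurable_funD; last exact: (measurable_time_dot hPc hT hB).
  by apply: measurable_funD => //; exact: (measurable_ito hPc hB iH).
rewrite -[X in (_ <= X%:E)%E](expectation_cst P) -(integral_EFin (summable_cst P _)).
apply: ae_ge0_le_integral => //.
- apply/measurable_EFinP; apply: measurableT_comp => //; apply: measurable_funM => //.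
  exact: measurable_funB.
apply: filterS2 YX YT => w /(_ T T0 (lexx T)) h <- _.
by rewrite lee_fin ler_expR !mulNr lerN2 ler_pM2l.
Qed.

End prices.

Theorem theorem5p11 (R : realType) (d0 : measure_display)
    (Om : measurableType d0) (P : probability Om R)
    (hPcomplete : measure_is_complete P)
    (T : R) (hT : 0 < T) (d m : nat) (hd : (1 <= d)%N) (hdm : (d <= m)%N)
    (B : R -> Om -> 'cV[R]_m) (hB : brownian_motion P T B)
    (b : R -> Om -> 'cV[R]_d) (sigma : R -> Om -> 'M[R]_(d, m))
    (hb : predictable_mx (augmented_filtration P B) T b)
    (hsigma : predictable_mx (augmented_filtration P B) T sigma)
    (hb_bounded : exists K : R,
       as_ae P T (fun t w => forall i, `|b t w i ord0| <= K))
    (hsigma_bounded : exists K : R,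
       as_ae P T (fun t w => forall i j, `|sigma t w i j| <= K))
    (hsigma_inv : as_ae P T
       (fun t w => sigma t w *m (sigma t w)^T \in unitmx))
    (htheta_bounded : exists K : R,
       as_ae P T (fun t w => enorm (market_price_of_risk b sigma t w) <= K))
    (Q : probability Om R)
    (hQ : girsanov_measure P T B (market_price_of_risk b sigma) Q)
    (C : set 'cV[R]_d) (hC_closed : closed C)
    (hC_convex : convex_set (C : set (convex_lmodType 'cV[R]_d)))
    (hC_cone : cone C) (hC0 : C 0)
    (F : Om -> R) (hF_meas : meas_wrt (augmented_filtration P B T) F)
    (hF_exp : forall p : R, 1 <= p ->
       (\int[P]_w (expR (p * pos_part (F w)))%:E < +oo)%E)
    (k : R) (hk : 0 < k) (hF_below : {ae P, forall w, neg_part (F w) <= k})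
    (Y : R -> R -> Om -> R) (Z : R -> R -> Om -> 'cV[R]_m)
    (hYZ : forall alpha : R, 0 < alpha ->
       exp_bsde P T B b sigma C alpha F (Y alpha) (Z alpha))
    (x : R) (price : R -> R)
    (hprice : forall alpha : R, 0 < alpha ->
       indifference_price P Q T B b sigma C alpha F (Y alpha) x (price alpha))
    (hsol : exists Cbar Hbar Abar,
       constrained_bsde P T B b sigma C F Cbar Hbar Abar) :
  (exists Cinf Hinf Ainf,
     minimal_constrained_bsde P T B b sigma C F Cinf Hinf Ainf) /\
  (forall Cinf Hinf Ainf,
     minimal_constrained_bsde P T B b sigma C F Cinf Hinf Ainf ->
     {ae P, forall w, price alpha @[alpha --> +oo] --> Cinf 0 w}).

Proof.
have T0 := ltW hT.
set theta := market_price_of_risk b sigma in htheta_bounded hQ.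
have [K1 hK1] := htheta_bounded; pose Kth := Num.max K1 0.
have hK0 : 0 <= Kth by rewrite le_max lexx orbT.
have hth : as_ae P T (fun t w => enorm (theta t w) <= Kth).
  by apply: filterS hK1 => w; apply: ae_time_mono => t h /h e; rewrite le_max e.
pose kap := Kth ^+ 2 * T.
have kap0 : 0 <= kap by rewrite mulr_ge0// sqr_ge0.
have [Th iTh QE0] := hQ.
have mZ := measurable_gdens hPcomplete hT hB iTh (lexx 0) T0 (lexx T).
have Z0 w : 0 <= gdens theta Th 0 T w by exact/ltW/gdens_gt0.
(* [girsanov_measure] writes the density with the value of the integral at [T], [gdens] with its
   increment from 0; they agree because the integral starts almost surely at 0. *)
have QE A : measurable A -> Q A = (\int[P]_(w in A) (gdens theta Th 0 T w)%:E)%E.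
  move=> mA; rewrite QE0//.
  have pth : predictable_mx (augmented_filtration P B) T theta by exact: (predictable_theta hT hb hsigma).
  have E w : (\int[@lebesgue_measure R]_(t in `[0, T]) enorm (theta t w) ^+ 2)%R = qv theta 0 T w.
    by rewrite qvE; apply: eq_Rintegral => t _; rewrite sqr_enorm.
  under eq_integral do rewrite E.
  apply: ae_eq_integral => //.
  - apply/measurable_EFinP; apply: measurable_funTS; apply: measurableT_comp => //.
    apply: measurable_funB.
      by apply: measurableT_comp => //; exact: (measurable_ito hPcomplete hB iTh).
    by apply: measurable_funM => //; exact: (measurable_qv hPcomplete hT hB).
  - by apply/measurable_EFinP; exact: measurable_funTS.
  by apply: filterS (ito_at0 hPcomplete hT hB iTh) => w e _; rewrite gdensE e subr0.
have hZ : \mean[P]_w gdens theta Th 0 T w = 1.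
  have [_ e] := mean_density mZ Z0 QE (summable_cst Q 1).
  by rewrite -[RHS](expectation_cst Q) -e; apply: eq_mean => w; rewrite mul1r.
have hF : {ae P, forall w, - k <= F w}.
  by apply: filterS hF_below => w; rewrite /neg_part ge_max lerNl => /andP[].
have hmid u v : C u -> C v -> C (2^-1 *: (u + v)).
  move=> Cu Cv; have h0 : 0 <= (2^-1 : R) by []; have h1 : (2^-1 : R) <= 1 by lra.
  have := hC_convex u v (Itv01 h0 h1); rewrite !inE => /(_ Cu Cv).
  rewrite /conv/= /unstable.onem (_ : 1 - 2^-1 = 2^-1) ?scalerDr//; lra.
have exists_minimal al := minimal_solution_exists hPcomplete hT hB hb hsigma hC0 hK0 hth iTh hZ
  (ltW hk) hF hmid hC_closed hsigma_inv (al := al).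
(* Investing nothing bounds the supremum without the claim below by the utility of [x]; the supremum
   with the claim is at most the utility of [x + price alpha - y0]. *)
have price_ge alpha : 0 < alpha -> {ae P, forall w, Y alpha 0 w <= price alpha}.
  move=> a0; have hYa := hYZ _ a0.
  have [y0 hy0] := Fil0_const hB (exp_bsde_adapted hT hYa (lexx 0) T0).
  have [pi hpi] := riskless_strategy hPcomplete hT hB b sigma hC0 Q x.
  have := hprice _ a0; rewrite /indifference_price => hp.
  apply: filterS (hy0) => w ->.
  have : ((- expR (- alpha * x))%:E <= (- expR (- alpha * (x + price alpha - y0)))%:E)%E.
    rewrite -(exp_utility_cst P alpha x).
    apply: (@le_trans _ _ (ereal_sup [set u | exists pi X,
        admissible_mart P Q T B b sigma C x pi X /\ u = exp_utility P alpha (X T)])).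
      by apply: ereal_sup_ubound; exists pi, (fun _ _ => x); split; first exact: hpi.
    rewrite -hp; apply: ub_ereal_sup => _ [pi' [X [hX ->]]].
    exact: (hedged_utility_le hPcomplete hT hB hb hsigma hC0 hK0 hth a0 hYa hy0 hX).
  rewrite lee_fin lerN2 ler_expR; nra.
(* Now the other direction: a superhedging portfolio bounds the supremum with the claim from below,
   and Jensen's inequality bounds the one without it from above. The exponents differ by [kap], so
   the price exceeds [c0] by at most [kap / alpha]. *)
have price_le alpha C' H' A' c0 : 0 < alpha -> constrained_bsde P T B b sigma C F C' H' A' ->
    {ae P, forall w, C' 0 w = c0} -> alpha * (price alpha - c0) <= kap.
  move=> a0 sol hc0; have hYa := hYZ _ a0.
  have := hprice _ a0; rewrite /indifference_price => hp.
  have [pi [X [hX uX]]] := superhedging_utility_ge hPcomplete hT hB hb hsigma hC0 hsigma_inv hK0 hth iTh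
    hF hZ a0 hYa (x + price alpha) sol hc0.
  have : ((- expR (- alpha * (x + price alpha - c0)))%:E <= (- expR (- alpha * x - kap))%:E)%E.
    apply: (le_trans uX).
    apply: (@le_trans _ _ (ereal_sup [set u | exists pi X,
        admissible_mart P Q T B b sigma C x pi X /\ u = exp_utility P alpha (X T)])).
      by rewrite -hp; apply: ereal_sup_ubound; exists pi, X; split; first exact: hX.
    apply: ub_ereal_sup => _ [pi' [X' [hX' ->]]].
    exact: (martingale_utility_le hPcomplete hT hB hb hsigma hK0 hth iTh QE _ hX').
  rewrite lee_fin lerN2 ler_expR; nra.
split.
  have hYn (n : nat) := hYZ n.+1%:R (ltr0Sn R n).
  have [C' [H' [A' [h _]]]] := exists_minimal _ _ _ (fun n => lexx _) hYn hsol.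
  by exists C', H', A'.
move=> C' H' A' [sol min].
have [c0 hc0] : exists c, {ae P, forall w, C' 0 w = c}.
  apply: (Fil0_const hB); case: sol => -[[aC _ _] _ _] _ _ _.
  by apply: aC; rewrite in_itv/= lexx.
suff cv : price alpha @[alpha --> +oo] --> c0 by apply: filterS hc0 => w ->.
apply/cvgrPdist_le => e e0.
(* Otherwise there are [al n], tending to infinity, whose prices, and hence the values [Y (al n) 0],
   lie below [c0 - e]. The minimal solution built from this very sequence starts at or below
   [c0 - e], against the minimality of [C']. *)
have [M hM] : exists M, forall alpha, M <= alpha -> 0 < alpha -> c0 - e <= price alpha.
  apply: contrapT => /forallNP hN.
  have /choice[al hal] : forall n : nat, exists alpha,
      [/\ n.+1%:R <= alpha, 0 < alpha & price alpha < c0 - e].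
    move=> n; have /existsNP[alpha /not_implyP[h1 /not_implyP[h2 /negP]]] := hN n.+1%:R.
    by rewrite -ltNge => h3; exists alpha.
  have hal1 n : n.+1%:R <= al n by case: (hal n).
  have hal2 n : 0 < al n by case: (hal n).
  have hal3 n : price (al n) < c0 - e by case: (hal n).
  have [C2 [H2 [A2 [[sol2 _] le2]]]] := exists_minimal al _ _ hal1 (fun n => hYZ _ (hal2 n)) hsol.
  have : {ae P, forall w, C2 0 w <= c0 - e}.
    apply: le2 => n; apply: filterS (price_ge _ (hal2 n)) => w h.
    exact: le_trans h (ltW (hal3 n)).
  move=> h2; apply: (@ae_not_false _ _ _ P).
  have T00 : (0 : R) \in `[0, T] by rewrite in_itv/= lexx.
  apply: filterS3 h2 hc0 (min _ _ _ sol2 0 T00) => w h3 -> h4.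
  by have := le_trans h4 h3; lra.
near=> alpha.
have a0 : 0 < alpha by near: alpha; exact: nbhs_pinfty_gt.
have aM : M <= alpha by near: alpha; apply: nbhs_pinfty_ge; exact: num_real.
have ak : kap / e <= alpha by near: alpha; apply: nbhs_pinfty_ge; exact: num_real.
have h1 := hM _ aM a0; have h2 := price_le _ _ _ _ _ a0 sol hc0.
rewrite ler_pdivrMr// in ak.
have h3 : price alpha - c0 <= e.
  by rewrite -(@ler_pM2l _ alpha)//; exact: le_trans h2 ak.
by rewrite ler_norml; apply/andP; split; lra.
Unshelve. all: by end_near.
Qed.
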